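(* Let $d \ge 2$, $\theta>0$, and $q,r \in [1,\infty]$. Consider the set of initial data $u_{\mathrm{in}} \in \mathbb{P}B^{-\theta}_{q,r}(\mathbb{T}^d)$ for which there exist $T>0$ and two distinct mild solutions $$u,v \in C([0,T];B^{-\theta}_{q,r}(\mathbb{T}^d))$$ to the Navier-Stokes equations $$\partial_t u + \mathrm{div}(u \otimes u) - \Delta u + \nabla p = 0,\qquad \mathrm{div}\, u = 0,$$ on $\mathbb{T}^d$, both with initial data $u_{\mathrm{in}}$. This set is dense in $\mathbb{P}B^{-\theta}_{q,r}(\mathbb{T}^d)$ if $r<\infty$, and weak*-dense in $\mathbb{P}B^{-\theta}_{q,r}(\mathbb{T}^d)$ if $r=\infty$.
   Context: $\mathbb{T}^d=\mathbb{R}^d/\mathbb{Z}^d$; $\hat f(m)=\langle f,e^{-2\pi i m\cdot x}\rangle$ for $f\in\mathscr{D}'(\mathbb{T}^d)$, $m\in\mathbb{Z}^d$. For vectors, $(a\otimes b)_{ij}=a_ib_j$; for matrix fields, $(\mathrm{div} A)_i=\partial_jA_{ij}$. Dyadic integers are integer powers of $2$ that are $\ge 1$. Littlewood-Paley and Besov spaces. Fix a radial bump function $\chi\in C_c^\infty(\mathbb{R}^d)$ supported in $B(0,1)$ and equal to $1$ on $B(0,9/10)$. For dyadic $N\ge1$, $P_{\le N}f(x)=\sum_{m}\chi(m/N)\hat f(m)e^{2\pi i m\cdot x}$, $P_1=P_{\le 1}$, $P_N=P_{\le N}-P_{\le N/2}$ for $N\ge2$. For $s\in\mathbb{R}$,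 $q,r\in[1,\infty]$, $B^s_{q,r}(\mathbb{T}^d)$ is the space of distributions with $\|f\|_{B^s_{q,r}}=(\sum_N N^{sr}\|P_Nf\|_{L^q}^r)^{1/r}<\infty$ (supremum if $r=\infty$). $\mathbb{P}B^s_{q,r}=\{f\in B^s_{q,r}(\mathbb{T}^d;\mathbb{R}^d):\mathrm{div} f=0,\ \hat f(0)=0\}$. The weak*-topology on $B^{-\theta}_{q,\infty}$ is the one induced by $B^{\theta}_{q',1}$, $\frac1q+\frac1{q'}=1$. Products. $\dot H^{s}$ is the space of distributions modulo constants with $\|f\|_{\dot H^s}=(\sum_{m\neq0}|m|^{2s}|\hat f(m)|^2)^{1/2}<\infty$. For a vector-valued distribution $f$ on $\mathbb{T}^d$ and $\sigma>0$, $f\otimes f$ is well-defined as a paraproduct in $\dot H^{-\sigma}$ if $\sum_{N,M}\|P_Nf\otimes P_Mf\|_{\dot H^{-\sigma}}<\infty$ ($N,M$ over all dyadic integers); then $f\otimes f:=\sum_{N,M}P_Nf\otimes P_Mf$ in $\dot H^{-\sigma}$ (an object defined modulo constants, identified with its mean-zero representative). For time-dependent $u$, $(u\otimes u)(s)$ denotes the paraproduct of $u(s)$ with itself. Mild solutions. For a divergence-free $u_{\mathrm{in}}\in\mathscr{D}'(\mathbb{T}^d)$, $u$ is a mild solution on $[0,T)$ with initial data $u_{\mathrm{in}}$ if $u(t)=e^{t\Delta}u_{\mathrm{in}}-B(u,u)(t)$ in $\mathscr{D}'((0,T)\times\mathbb{T}^d)$, where $B(u,u)(t)=\int_0^te^{(t-s)\Delta}\mathbb{P}\,\mathrm{div}(u\otimes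 u)(s)\,ds$ and $\mathbb{P}$ is the Leray projection onto divergence-free vector fields; it is part of the notion that these expressions make sense as distributions. No requirement $u\in L^2_{\mathrm{loc}}$ is imposed. *)

(* Defs.v *)
From HB Require Import structures.
From mathcomp Require Import all_boot all_order all_algebra.
From mathcomp Require Import all_classical all_reals all_analysis.
From mathcomp Require Import complex.
Set Implicit Arguments.
Unset Strict Implicit.
Unset Printing Implicit Defensive.
Import Order.TTheory GRing.Theory Num.Theory.
Import numFieldNormedType.Exports.
Local Open Scope classical_set_scope.
Local Open Scope ring_scope.

Section Smooth.
Context {R : realType} {V : normedModType R}.

Definition derives (vs : seq V) (f : V -> R) : V -> R :=
  foldr (fun v g => 'D_v g) f vs.

(* On a finite-dimensional V this is C^oo: the iterated directional derivatives
   in all directions exist and are continuous. *)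
Definition smooth (f : V -> R) : Prop :=
  forall vs : seq V, continuous (derives vs f) /\
    forall x v, derivable (derives vs f) x v.

(* B bounds the C^n norm of f. *)
Definition Cn_bound (n : nat) (f : V -> R) (B : R) : Prop :=
  forall vs : seq V, (size vs <= n)%N -> all (fun v => `|v| <= 1) vs ->
    forall x, `|derives vs f x| <= B.

Lemma smooth_derive (f : V -> R) v : smooth f -> smooth ('D_v f).
Proof.
move=> sf vs; rewrite (_ : derives vs _ = derives (rcons vs v) f).
  exact: sf.
by rewrite /derives foldr_rcons.
Qed.

End Smooth.

Section Torus.
Context {R : realType} {d : nat}.

(* The norm `|_| of the library on 'rV[R]_d is the sup norm. *)
Definition enorm (x : 'rV[R]_d) : R := Num.sqrt (\sum_i x 0 i ^+ 2).

Definition freq (m : 'rV[int]_d) : 'rV[R]_d := map_mx intr m.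

Definition phase (m : 'rV[int]_d) (x : 'rV[R]_d) : R :=
  2 * pi * \sum_i freq m 0 i * x 0 i.

Definition Zperiodic (f : 'rV[R]_d -> R) : Prop :=
  forall (m : 'rV[int]_d) x, f (x + freq m) = f x.

Record test_fun := TestFun {
  tf_val :> 'rV[R]_d -> R ;
  tf_smooth : smooth tf_val ;
  tf_periodic : Zperiodic tf_val }.

Definition trig (a b : R) (m : 'rV[int]_d) (x : 'rV[R]_d) : R :=
  a * cos (phase m x) + b * sin (phase m x).

Lemma phaseDZ m x v (h : R) : phase m (h *: v + x) = h * phase m v + phase m x.
Proof.
rewrite /phase mulrCA -mulrDr; congr (_ * _).
rewrite mulr_sumr -big_split/=.
by apply: eq_bigr => i _; rewrite !mxE mulrDr mulrCA.
Qed.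

Lemma continuous_trig a b m : continuous (trig a b m).
Proof.
have cp : continuous (phase m).
  move=> x; apply: (@cvgMl_tmp R 'rV[R]_d (nbhs x)).
  apply: (@cvg_big _ _ _ _ _ add_continuous _ (nbhs x)) => i _.
  by apply: (@cvgMl_tmp R 'rV[R]_d (nbhs x)); exact: (@coord_continuous R).
move=> x; apply: (@cvgD _ _ 'rV[R]_d (nbhs x)).
  apply: (@cvgMl_tmp R 'rV[R]_d (nbhs x)).
  by apply: continuous_comp; [exact: cp|exact: continuous_cos].
apply: (@cvgMl_tmp R 'rV[R]_d (nbhs x)).
by apply: continuous_comp; [exact: cp|exact: continuous_sin].
Qed.

Lemma is_derive_trig a b m x v :
  is_derive x v (trig a b m) (trig (b * phase m v) (- (a * phase m v)) m x).
Proof.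
pose p (h : R) := h * phase m v + phase m x.
pose g (h : R) := a * cos (p h) + b * sin (p h).
have E : (fun h : R => trig a b m (h *: v + x)) = g.
  by apply/funext => h; rewrite /trig phaseDZ.
have Dp : is_derive (0 : R) 1 p (phase m v).
  rewrite (_ : p = phase m v *: id + cst (phase m x)); last first.
    by apply/funext => h; rewrite /p mulrC.
  apply: is_derive_eq.
  by rewrite addr0 /GRing.scale/= mulr1.
have p0 : p 0 = phase m x by rewrite /p mul0r add0r.
have Dg : is_derive (0 : R) 1 g (trig (b * phase m v) (- (a * phase m v)) m x).
  rewrite (_ : g = a *: (cos \o p) + b *: (sin \o p)) //.
  apply: is_derive_eq.
  rewrite /GRing.scale/= p0 /trig addrC !mulNr mulrN.
  by congr (_ - _); rewrite [X in _ * X]mulrC mulrA.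
have {E Dg} [De Dv] : is_derive (0 : R) 1 (fun h : R => trig a b m (h *: v + x))
  (trig (b * phase m v) (- (a * phase m v)) m x) by rewrite E.
split; first exact: (iffRL (@derivable1P R _ R (trig a b m) x v) De).
rewrite -Dv /derive; set g1 := fun h => h^-1 *: _; set g2 := fun h => h^-1 *: _.
suff -> : g1 = g2 by [].
by rewrite funeqE /g1 /g2 => h /=; rewrite addr0 scale0r add0r [_%:A]mulr1.
Qed.

Lemma smooth_trig a b m : smooth (trig a b m).
Proof.
move=> vs; have [a' [b' ->]] : exists a' b', derives vs (trig a b m) = trig a' b' m.
  elim: vs => [|v vs [a' [b' IH]]]; first by exists a, b.
  exists (b' * phase m v), (- (a' * phase m v)).
  by apply/funext => x; rewrite /= IH (@derive_val _ _ _ _ _ _ _ (is_derive_trig _ _ _ _ _)).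
split; first exact: continuous_trig.
by move=> x v; apply: (@ex_derive _ _ _ _ _ _ _ (is_derive_trig _ _ _ _ _)).
Qed.

Lemma periodic_trig a b m : Zperiodic (trig a b m).
Proof.
move=> n x.
have [k E] : exists k : int, phase m (x + freq n) = phase m x + k%:~R * (2 * pi).
  exists (\sum_i m 0 i * n 0 i).
  rewrite -[x + _]addrC -[freq n]scale1r phaseDZ mul1r addrC; congr (_ + _).
  rewrite mulrC /phase; congr (_ * _).
  rewrite raddf_sum; apply: eq_bigr => i _.
  by rewrite !mxE -intrM.
have P (f : R -> R) y : (forall z, f (z + 2 * pi) = f z) ->
    f (y + k%:~R * (2 * pi)) = f y.
  move=> pf; have Pn (n0 : nat) z : f (z + n0%:R * (2 * pi)) = f z.
    elim: n0 z => [|n0 IH] z; first by rewrite mul0r addr0.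
    by rewrite -natr1 mulrDl mul1r addrA pf IH.
  case: {E} k => n0; first exact: Pn.
  by rewrite NegzE mulrNz mulNr -(Pn n0.+1 (y - _)) subrK.
rewrite /trig E !P // => z; rewrite mulrC mulr_natr.
  exact: sinD2pi.
exact: cosD2pi.
Qed.

Definition tcos m := TestFun (smooth_trig 1 0 m) (periodic_trig 1 0 m).
Definition tsin m := TestFun (smooth_trig 0 1 m) (periodic_trig 0 1 m).

Lemma periodic_derive (f : 'rV[R]_d -> R) v : Zperiodic f -> Zperiodic ('D_v f).
Proof.
move=> pf m x; rewrite /derive; set g1 := fun h => h^-1 *: _; set g2 := fun h => h^-1 *: _.
suff -> : g1 = g2 by [].
by rewrite funeqE /g1 /g2 => h /=; rewrite addrA !pf.
Qed.

Definition tderive (i : 'I_d) (phi : test_fun) : test_fun :=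
  TestFun (smooth_derive (delta_mx 0 i) (tf_smooth phi))
          (periodic_derive (delta_mx 0 i) (tf_periodic phi)).

End Torus.
Arguments test_fun : clear implicits.

Section Measure.
Context {R : realType}.

Definition cons_tuple n (x : measurableTypeR R * n.-tuple (measurableTypeR R)) :
    n.+1.-tuple (measurableTypeR R) :=
  [tuple of x.1 :: x.2].

Lemma measurable_cons_tuple n :
  measurable_fun [set: measurableTypeR R * n.-tuple (measurableTypeR R)] (@cons_tuple n).
Proof. exact: measurable_cons. Qed.

HB.instance Definition _ n := isMeasurableFun.Build _ _ _ _ (@cons_tuple n)
  (@measurable_cons_tuple n).

(* The uniform law on the cube [0,1]^n, i.e. Haar measure on T^n. *)
Fixpoint cube_prob n : probability (n.-tuple (measurableTypeR R)) R :=
  match n with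
  | 0 => dirac [tuple]
  | n'.+1 => distribution (uniform_prob (@ltr01 R) \x cube_prob n')%E (@cons_tuple n')
  end.

End Measure.

Section Distributions.
Context {R : realType} {d : nat}.

(* Integration over T^d, identified with the cube [0,1]^d. *)
Definition torus_int (g : 'rV[R]_d -> R) : R :=
  (\int[cube_prob d]_x g (\row_i tnth x i))%R.

Definition torus_Lnorm (q : \bar R) (g : 'rV[R]_d -> R) : \bar R :=
  Lnorm (cube_prob d) q (fun x => (g (\row_i tnth x i))%:E).

Definition dist : Type := test_fun R d -> R.
Definition vdist : Type := 'I_d -> dist.
Definition mdist : Type := 'I_d -> 'I_d -> dist.

(* f is in D'(T^d): linear, and bounded by a C^n norm for some n. *)
Definition is_dist (f : dist) : Prop :=
  (forall (a : R) (phi psi rho : test_fun R d),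
    (forall x, rho x = a * phi x + psi x) -> f rho = a * f phi + f psi) /\
  exists (n : nat) (C : R), forall (phi : test_fun R d) (B : R),
    Cn_bound n phi B -> `|f phi| <= C * B.

Definition dist_of_fun (g : 'rV[R]_d -> R) : dist :=
  fun phi => torus_int (fun x => g x * phi x).

(* Test functions are real-valued, so <f, e^{-2 pi i m.x}> is taken by
   complex linearity. *)
Definition fcoef (f : dist) (m : 'rV[int]_d) : R[i] :=
  Complex (f (tcos m)) (- f (tsin m)).

Definition expi (m : 'rV[int]_d) (x : 'rV[R]_d) : R[i] :=
  Complex (cos (phase m x)) (sin (phase m x)).

(* The real distribution with Fourier coefficients c (which must satisfy
   c (- m) = conjugate of c m and grow at most polynomially), by Parseval. *)
Definition synth (c : 'rV[int]_d -> R[i]) : dist := fun phi =>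
  lim ((fun K : nat => complex.Re
    (\sum_(m \in [set m : 'rV[int]_d | forall i, (`|m ord0 i| <= K)%N])
        c m * conjc (fcoef (dist_of_fun phi) m))) @ \oo).

Definition real_mul (a : R) (z : R[i]) : R[i] := (a%:C)%C * z.

Definition pderive (j : 'I_d) (f : dist) : dist := fun phi => - f (tderive j phi).
Definition div (f : vdist) : dist := fun phi => \sum_i pderive i (f i) phi.
Definition mdiv (A : mdist) : vdist := fun i phi => \sum_j pderive j (A i j) phi.

Definition heat (t : R) (f : dist) : dist := synth (fun m =>
  real_mul (expR (- (4 * pi ^+ 2 * enorm (freq m) ^+ 2 * t))) (fcoef f m)).

(* At m = 0 the division by zero gives the symbol (i == j), as it should. *)
Definition leray (f : vdist) : vdist := fun i => synth (fun m =>
  \sum_j real_mul ((i == j)%:R -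
      freq m ord0 i * freq m ord0 j / enorm (freq m) ^+ 2) (fcoef (f j) m)).

Section LittlewoodPaley.
Variable chi : 'rV[R]_d -> R.

Definition lp_bump : Prop :=
  [/\ smooth chi,
      forall x y, enorm x = enorm y -> chi x = chi y,
      closure [set x | chi x != 0] `<=` [set x | enorm x < 1] &
      forall x, enorm x < 9 / 10 -> chi x = 1].

(* The dyadic integers are N = 2 ^ k with k : nat. The sum below has finite
   support and is real, since f is real and chi is even. *)
Definition lp_le (k : nat) (f : dist) (x : 'rV[R]_d) : R := complex.Re
  (\sum_(m \in [set: 'rV[int]_d])
      real_mul (chi ((2 ^- k) *: freq m)) (fcoef f m * expi m x)).

Definition lp (k : nat) (f : dist) (x : 'rV[R]_d) : R :=
  if k is k'.+1 then lp_le k f x - lp_le k' f x else lp_le 0 f x.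

Definition lp_Lnorm (q : \bar R) (k : nat) (f : vdist) : \bar R :=
  torus_Lnorm q (fun x => enorm (\row_i lp k (f i) x)).

Definition besov_norm (s : R) (q r : \bar R) (f : vdist) : \bar R :=
  if r is r'%:E then
    ((\sum_(0 <= k <oo)
       (((2 ^+ k) `^ (s * r'))%:E * lp_Lnorm q k f `^ r')) `^ r'^-1)%E
  else ereal_sup (range (fun k : nat => ((2 ^+ k) `^ s)%:E * lp_Lnorm q k f)%E).

Definition besov (s : R) (q r : \bar R) : set vdist :=
  [set f | (forall i, is_dist (f i)) /\ (besov_norm s q r f < +oo)%E].

Definition pbesov (s : R) (q r : \bar R) : set vdist :=
  [set f | besov s q r f /\ div f = cst 0 /\ forall i, fcoef (f i) 0 = 0].

(* The duality pairing of B^s_{q,oo} with B^{-s}_{q',1}, as the limit over N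
   of the integrals of P_{<= N} f . P_{<= N} g. *)
Definition besov_pairing (f g : vdist) : R :=
  lim ((fun k : nat => \sum_i torus_int (fun x => lp_le k (f i) x * lp_le k (g i) x))
    @ \oo).

Definition besov_dense (s : R) (q r : \bar R) (S : set vdist) : Prop :=
  forall f, pbesov s q r f -> forall e : R, 0 < e ->
    exists2 g, S g & (besov_norm s q r (g - f)%R < e%:E)%E.

Definition besov_weakstar_dense (s : R) (q : \bar R) (S : set vdist) : Prop :=
  forall f, pbesov s q +oo%E f ->
  forall (n : nat) (h : 'I_n -> vdist),
    (forall j, besov (- s) (hoelder_conjugate q) 1%E (h j)) ->
  forall e : R, 0 < e ->
    exists2 g, S g & forall j, `|besov_pairing (g - f) (h j)| < e.

(* u is in C([0,T]; B^s_{q,r}). *)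
Definition besov_curve (s : R) (q r : \bar R) (T : R) (u : R -> vdist) : Prop :=
  (forall t, 0 <= t <= T -> besov s q r (u t)) /\
  forall t, 0 <= t <= T -> forall e : R, 0 < e -> exists2 dl : R, 0 < dl &
    forall t', 0 <= t' <= T -> `|t' - t| < dl ->
      (besov_norm s q r (u t' - u t)%R < e%:E)%E.

Definition mdist_fcoef_sq (A : mdist) (m : 'rV[int]_d) : R :=
  \sum_i \sum_j (complex.Re (fcoef (A i j) m) ^+ 2 +
                 complex.Im (fcoef (A i j) m) ^+ 2).

Definition sobolev_norm (s : R) (A : mdist) : \bar R :=
  ((\esum_(m in [set~ (0 : 'rV[int]_d)%R])
     (enorm (freq m) `^ (2 * s) * mdist_fcoef_sq A m)%:E) `^ 2^-1)%E.

Definition lp_tensor (k l : nat) (f : vdist) : mdist :=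
  fun i j => dist_of_fun (fun x => lp k (f i) x * lp l (f j) x).

(* f (x) f is well-defined as a paraproduct in the homogeneous Sobolev space
   of order - sigma, and F is its mean-zero representative. *)
Definition is_paraproduct (sigma : R) (f : vdist) (F : mdist) : Prop :=
  [/\ (\esum_(kl in [set: nat * nat])
         sobolev_norm (- sigma) (lp_tensor kl.1 kl.2 f) < +oo)%E,
      forall i j, is_dist (F i j) /\ fcoef (F i j) 0 = 0 &
      (fun K : nat => sobolev_norm (- sigma)
         (F - \sum_(k < K) \sum_(l < K) lp_tensor k l f)%R) @ \oo --> 0%E].

Local Notation mu := (@lebesgue_measure R).

(* Phi is smooth on R x T^d and vanishes for times outside [a, b]. *)
Definition st_test (a b : R) (Phi : R -> test_fun R d) : Prop :=
  smooth (fun p : R * 'rV[R]_d => Phi p.1 p.2) /\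
  forall t x, ~~ (a <= t <= b) -> Phi t x = 0.

Definition st_pairing (T : R) (w : R -> dist) (Phi : R -> test_fun R d) : R :=
  (\int[mu]_(t in `]0, T[) w t (Phi t))%R.

(* The curve w defines an element of D'((0,T) x T^d) by integration in time. *)
Definition st_dist (T : R) (w : R -> dist) : Prop :=
  forall a b, 0 < a -> b < T ->
    (forall Phi, st_test a b Phi ->
       mu.-integrable `]0, T[ (fun t => (w t (Phi t))%:E)) /\
    exists (n : nat) (C : R), forall Phi B, st_test a b Phi ->
      Cn_bound n (fun p : R * 'rV[R]_d => Phi p.1 p.2) B ->
      `|st_pairing T w Phi| <= C * B.

Definition duhamel_integrand (F : R -> mdist) (t s : R) : vdist :=
  fun i => heat (t - s) (leray (mdiv (F s)) i).

Definition duhamel (F : R -> mdist) (t : R) : vdist := fun i phi =>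
  (\int[mu]_(s in `]0, t[) duhamel_integrand F t s i phi)%R.

(* F is the curve of paraproducts s |-> (u (x) u)(s), so that duhamel F is
   B(u,u); the time integral defining it is taken weakly in D'(T^d). *)
Definition mild_solution (T : R) (u_in : vdist) (u : R -> vdist) : Prop :=
  exists (sigma : R) (F : R -> mdist),
  [/\ 0 < sigma,
      {ae mu, forall s, 0 < s < T -> is_paraproduct sigma (u s) (F s)},
      forall t i, 0 < t < T ->
        (forall phi, mu.-integrable `]0, t[
           (fun s => (duhamel_integrand F t s i phi)%:E)) /\
        is_dist (duhamel F t i),
      forall i, [/\ st_dist T (fun t => u t i),
                    st_dist T (fun t => heat t (u_in i)) &
                    st_dist T (fun t => duhamel F t i)] &
      forall i a b Phi, 0 < a -> b < T -> st_test a b Phi ->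
        st_pairing T (fun t => u t i) Phi =
        st_pairing T (fun t => heat t (u_in i)) Phi -
        st_pairing T (fun t => duhamel F t i) Phi].

Definition nonunique_data (s : R) (q r : \bar R) : set vdist :=
  [set u_in | pbesov s q r u_in /\
    exists (T : R) (u v : R -> vdist),
      [/\ 0 < T,
          besov_curve s q r T u /\ besov_curve s q r T v,
          mild_solution T u_in u /\ mild_solution T u_in v &
          exists2 t, 0 <= t <= T & u t <> v t]].

End LittlewoodPaley.
End Distributions.

(* Main.v *)
From HB Require Import structures.
Require Import Defs.
From mathcomp Require Import all_boot all_order all_algebra.
From mathcomp Require Import all_classical all_reals all_analysis.
From mathcomp Require Import measurable_realfun ess_sup_inf.
From mathcomp Require Import complex ring lra zify.
Set Implicit Arguments.
Unset Strict Implicit.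
Unset Printing Implicit Defensive.
Import Order.TTheory GRing.Theory Num.Theory.
Import numFieldNormedType.Exports.
Local Open Scope classical_set_scope.
Local Open Scope ring_scope.

(** A field u(t) with Fourier coefficients c_a(t) solves the projected Navier-Stokes
   equations when, at each frequency m, the error

     err m = c_m' + 4 pi^2 |m|^2 c_m
             + P_m (2 pi i sum_l m_l sum_a (c_a)_l c_(m-a))

   vanishes. As solutions are not required to be square integrable, an error at m
   can be removed by a pair of very high frequencies p and m - p (together with
   their opposites), whose interaction lands on m. In dimension at least two one can
   take p = L (m + e) with e orthogonal to m, and amplitudes that are divergence
   free and that depend on the error but not on the size of p
   ([pair_interaction], [cab_ampB]). Hence, as L grows, the pair costs nothing in the
   weighted l^1 norm of weight |a|^(-theta), which dominates the norm of
   B^(-theta)_(q,r) for all q and r ([besov_norm_l1]); and if p is far enough, the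
   errors at the frequencies of the field built so far do not change, except at m
   and - m ([step_err_off], [step_err_m]). Treating all frequencies of the lattice one after the other,
   with summable costs, one obtains in the limit an exact solution with prescribed low
   frequencies and an arbitrarily small remainder ([flow_exists]).

   At each frequency m the interactions either come from frequencies comparable to m
   or from the pair that was created for m. So the convolution at m is a finite sum,
   bounded by a power of m uniformly in the stage of the construction. The same bound
   controls the errors that the later steps have to remove ([err_bound]); in
   the limit it shows that the tensor product is defined as a paraproduct
   ([flow_tensor_summable], [flow_tensor_cvg]), and the equations of all modes integrate
   to the Duhamel formula ([flow_mild]).

   The construction is local in time: all the coefficients are obtained from the initial
   field by algebraic operations and differentiation in time. Let this initial field be
   a Fejer mean of a given f, plus a shear wave with the factor exp(-1/t) for t > 0
   and 0 for t <= 0. The solution is then constant for t <= 0, and the low frequency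
   of the shear wave shows that it moves afterwards. Starting it at time -1 or at time 0
   gives two solutions on [0, 1] with the same datum, the first one of which does not
   move on this interval ([flow_nonunique]).

   This datum is as close as wanted to the Fejer mean of f ([nonunique_near]). Fejer
   means are averages of translates, bounded in every Besov norm, and converge on each
   Littlewood-Paley block. Therefore they converge to f in norm when r is finite
   ([besov_near]), and when r = oo they converge against the fields of
   B^theta_(q',1), whose block norms are summable ([besov_near_weakstar]). *)

(** * Complex numbers and finite sums *)

Section ComplexAbs.
Context {R : realType}.
Implicit Types z w : R[i].

(** Submultiplicative and subadditive like the Euclidean modulus, and free of square
   roots. *)
Definition cab z : R := `|complex.Re z| + `|complex.Im z|.

Lemma cab_ge0 z : 0 <= cab z.
Proof. by rewrite addr_ge0. Qed.

Lemma cab0 : cab 0 = 0.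
Proof. by rewrite /cab/= normr0 addr0. Qed.

Lemma ReD z w : complex.Re (z + w) = complex.Re z + complex.Re w.
Proof. by case: z; case: w. Qed.

Lemma ImD z w : complex.Im (z + w) = complex.Im z + complex.Im w.
Proof. by case: z; case: w. Qed.

Lemma ReN z : complex.Re (- z) = - complex.Re z.
Proof. by case: z. Qed.

Lemma ImN z : complex.Im (- z) = - complex.Im z.
Proof. by case: z. Qed.

Lemma ReB z w : complex.Re (z - w) = complex.Re z - complex.Re w.
Proof. by rewrite ReD ReN. Qed.

Lemma ImB z w : complex.Im (z - w) = complex.Im z - complex.Im w.
Proof. by rewrite ImD ImN. Qed.

Lemma ReM z w : complex.Re (z * w) = complex.Re z * complex.Re w - complex.Im z * complex.Im w.
Proof. by case: z; case: w. Qed.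

Lemma ImM z w : complex.Im (z * w) = complex.Re z * complex.Im w + complex.Im z * complex.Re w.
Proof. by case: z; case: w. Qed.

Lemma Re_sum (I : Type) (s : seq I) (P : pred I) (f : I -> R[i]) :
  complex.Re (\sum_(i <- s | P i) f i) = \sum_(i <- s | P i) complex.Re (f i).
Proof. by elim/big_rec2: _ => // i y z _ <-; rewrite ReD. Qed.

Lemma Im_sum (I : Type) (s : seq I) (P : pred I) (f : I -> R[i]) :
  complex.Im (\sum_(i <- s | P i) f i) = \sum_(i <- s | P i) complex.Im (f i).
Proof. by elim/big_rec2: _ => // i y z _ <-; rewrite ImD. Qed.

Lemma complex_ext z w :
  complex.Re z = complex.Re w -> complex.Im z = complex.Im w -> z = w.
Proof. by case: z => a b; case: w => c e /= -> ->. Qed.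

Lemma Re_le_cab z : `|complex.Re z| <= cab z.
Proof. by rewrite lerDl. Qed.

Lemma Im_le_cab z : `|complex.Im z| <= cab z.
Proof. by rewrite lerDr. Qed.

Lemma cabD z w : cab (z + w) <= cab z + cab w.
Proof.
by rewrite /cab ReD ImD addrACA lerD // ler_normD.
Qed.

Lemma cabN z : cab (- z) = cab z.
Proof. by rewrite /cab ReN ImN !normrN. Qed.

Lemma cabM z w : cab (z * w) <= cab z * cab w.
Proof.
rewrite /cab ReM ImM mulrDl !mulrDr -!normrM.
rewrite (le_trans (lerD (ler_normB _ _) (ler_normD _ _)))//.
lra.
Qed.

Lemma cabJ z : cab (conjc z) = cab z.
Proof. by case: z => a b; rewrite /cab/= normrN. Qed.

Lemma cab_sum (I : Type) (s : seq I) (P : pred I) (f : I -> R[i]) :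
  cab (\sum_(i <- s | P i) f i) <= \sum_(i <- s | P i) cab (f i).
Proof.
elim/big_rec2: _ => [|i y z _ h]; first by rewrite cab0.
by rewrite (le_trans (cabD _ _))// lerD2l.
Qed.

Lemma cjD z w : conjc (z + w) = conjc z + conjc w.
Proof. exact: rmorphD. Qed.

Lemma cjN z : conjc (- z) = - conjc z.
Proof. exact: rmorphN. Qed.

Lemma cjB z w : conjc (z - w) = conjc z - conjc w.
Proof. exact: rmorphB. Qed.

Lemma cjM z w : conjc (z * w) = conjc z * conjc w.
Proof. exact: rmorphM. Qed.

Lemma cj_nat (n : nat) : conjc (n%:R : R[i]) = n%:R.
Proof. exact: rmorph_nat. Qed.

Lemma cj_int (n : int) : conjc (n%:~R : R[i]) = n%:~R.
Proof. exact: rmorph_int. Qed.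

Lemma cj_i : conjc ('i%C : R[i]) = - 'i%C.
Proof. by apply: complex_ext => /=; rewrite ?oppr0. Qed.

Lemma cj_sum (I : Type) (s : seq I) (P : pred I) (f : I -> R[i]) :
  conjc (\sum_(i <- s | P i) f i) = \sum_(i <- s | P i) conjc (f i).
Proof. exact: rmorph_sum. Qed.

Lemma real_mulE (a : R) z : real_mul a z = Complex (a * complex.Re z) (a * complex.Im z).
Proof. by rewrite /real_mul; case: z => b c /=; simpc. Qed.

Lemma cab_real_mul (a : R) z : cab (real_mul a z) = `|a| * cab z.
Proof. by rewrite real_mulE /cab/= !normrM mulrDr. Qed.

Lemma conjc_real_mul (a : R) z : conjc (real_mul a z) = real_mul a (conjc z).
Proof. by rewrite !real_mulE; case: z => b c /=; rewrite mulrN. Qed.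

Lemma real_mul1 z : real_mul 1 z = z.
Proof. by rewrite real_mulE !mul1r; case: z. Qed.

Lemma real_mulA (a b : R) z : real_mul a (real_mul b z) = real_mul (a * b) z.
Proof. by rewrite !real_mulE/= !mulrA. Qed.

Lemma cabr (a : R) : cab (a%:C)%C = `|a|.
Proof. by rewrite /cab/= normr0 addr0. Qed.

Lemma cab_nat (n : nat) : cab (n%:R) = n%:R.
Proof. by rewrite (_ : n%:R = ((n%:R : R)%:C)%C) ?cabr ?normr_nat// rmorph_nat. Qed.

Lemma cab_conj_sqr z : complex.Re z ^+ 2 + complex.Im z ^+ 2 <= cab z ^+ 2.
Proof.
rewrite /cab -(real_normK (num_real (complex.Re z))) -(real_normK (num_real (complex.Im z))).
rewrite sqrrD -addrA lerD2l lerDr mulrn_wge0// mulr_ge0//.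
Qed.

End ComplexAbs.

Lemma cvg_fsum {R : realType} (T : Type) (F : set_system T) {FF : Filter F}
    (I : Type) (s : seq I) (u : I -> T -> R) (l : I -> R) :
  (forall i, u i x @[x --> F] --> l i) ->
  \sum_(i <- s) u i x @[x --> F] --> \sum_(i <- s) l i.
Proof.
move=> h; elim: s => [|i s IH].
  by under eq_fun do rewrite big_nil; rewrite big_nil; exact: cvg_cst.
by under eq_fun do rewrite big_cons; rewrite big_cons; apply: cvgD.
Qed.

Section FiniteSums.
Context {R : realType} {T : eqType}.

Lemma big_uniq_sub (V : nmodType) (s t : seq T) (f : T -> V) : uniq s -> uniq t ->
  {subset s <= t} -> \sum_(x <- t | x \in s) f x = \sum_(x <- s) f x.
Proof.
move=> us ut st; rewrite -big_filter; apply: perm_big; apply: uniq_perm => //.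
  exact: filter_uniq.
move=> x; rewrite mem_filter; case xs: (x \in s) => //=; exact: st.
Qed.

Lemma sum_widen (V : nmodType) (s t : seq T) (f : T -> V) : uniq s -> uniq t ->
  {subset s <= t} -> (forall x, x \in t -> x \notin s -> f x = 0) ->
  \sum_(x <- t) f x = \sum_(x <- s) f x.
Proof.
move=> us ut st f0; rewrite -(big_uniq_sub f us ut st) [LHS](bigID (fun x => x \in s))/=.
rewrite [X in _ + X]big_seq_cond [X in _ + X]big1 ?addr0// => x /andP[xt xs].
exact: f0.
Qed.

Lemma ler_sum_sub (s t : seq T) (f : T -> R) : uniq s -> uniq t ->
  {subset s <= t} -> (forall x, 0 <= f x) -> \sum_(x <- s) f x <= \sum_(x <- t) f x.
Proof.
move=> us ut st f0; rewrite -(big_uniq_sub f us ut st) [leRHS](bigID (fun x => x \in s))/=.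
by rewrite lerDl sumr_ge0.
Qed.

End FiniteSums.

(** * The lattice of frequencies *)

Section Lattice.
Context {R : realType} {d : nat}.
Local Notation mode := 'rV[int]_d.

Definition nrm (m : mode) : nat := \sum_i `|m 0%R i|%N.
Definition jap (m : mode) : R := (1 + nrm m)%:R.

Definition box (K : nat) : seq mode :=
  [seq (\row_i ((f i : nat)%:Z - K%:Z)) | f : {ffun 'I_d -> 'I_(K.*2.+1)}].

Lemma box_uniq K : uniq (box K).
Proof.
rewrite map_inj_uniq ?enum_uniq// => f g /rowP fg; apply/ffunP => i.
by have := fg i; rewrite !mxE => /addIr [] /val_inj.
Qed.

Lemma mem_box K m : (m \in box K) = [forall i, (`|m ord0 i| <= K)%N].
Proof.
apply/mapP/forallP => [[f _ ->] i|h].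
  have aux (k : nat) : (k < K.*2.+1)%N -> (`|k%:Z - K%:Z| <= K)%N by lia.
  by rewrite mxE; exact: aux (ltn_ord (f i)).
have aux (z : int) : (`|z| <= K)%N -> (`|(z + K%:Z)%R| < K.*2.+1)%N by lia.
have aux2 (z : int) : (`|z| <= K)%N -> z = `|(z + K%:Z)%R|%N%:Z - K%:Z by lia.
have hi i := aux _ (h i).
exists [ffun i => Ordinal (hi i)]; first by rewrite mem_enum.
by apply/rowP => i; rewrite !mxE ffunE/= -aux2.
Qed.

Lemma fsum_box (V : nmodType) K (F : mode -> V) :
  \sum_(m \in [set m : mode | forall i, (`|m ord0 i| <= K)%N]) F m =
  \sum_(m <- box K) F m.
Proof.
rewrite (fsbig_seq _ _ (box_uniq K)); apply: eq_fsbigl.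
apply/seteqP; split => m /=; first by move=> h; rewrite mem_box; apply/forallP.
by rewrite mem_box => /forallP.
Qed.

Lemma box_mono K L : (K <= L)%N -> {subset box K <= box L}.
Proof.
move=> KL m; rewrite !mem_box => /forallP h; apply/forallP => i.
exact: leq_trans (h i) KL.
Qed.

Lemma coord_nrm (m : mode) i : (`|m ord0 i| <= nrm m)%N.
Proof. by rewrite /nrm (bigD1 i)//= leq_addr. Qed.

Lemma nrm_box m K : (nrm m <= K)%N -> m \in box K.
Proof.
move=> h; rewrite mem_box; apply/forallP => i; exact: leq_trans (coord_nrm _ _) h.
Qed.

Lemma box_nrm m K : m \in box K -> (nrm m <= d * K)%N.
Proof.
rewrite mem_box => /forallP h; rewrite /nrm.
have <- : (\sum_(i < d) K = d * K)%N by rewrite sum_nat_const card_ord.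
exact: leq_sum.
Qed.

Lemma seq_sub_box (s : seq mode) : exists K, {subset s <= box K}.
Proof.
exists (\max_(m <- s) nrm m)%N => m ms; apply: nrm_box.
by rewrite (big_rem m)//= leq_maxl.
Qed.

Lemma nrmN m : nrm (- m) = nrm m.
Proof. by apply: eq_bigr => i _; rewrite mxE abszN. Qed.

Lemma nrmD a b : (nrm (a + b) <= nrm a + nrm b)%N.
Proof. rewrite /nrm -big_split/=; apply: leq_sum => i _; rewrite mxE.
have aux (x y : int) : (`|(x + y)%R| <= `|x| + `|y|)%N by lia.
exact: aux. Qed.

Lemma nrmB_ge a b : (nrm a <= nrm (a - b) + nrm b)%N.
Proof. by rewrite -[X in (nrm X <= _)%N](subrK b) nrmD. Qed.

Lemma nrmD_ge a b : (nrm a <= nrm (a + b) + nrm b)%N.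
Proof. by rewrite -(nrmN b) -{1}(addrK b a) nrmD. Qed.

Lemma nrm_eq0 m : (nrm m == 0%N) = (m == 0).
Proof.
rewrite /nrm sum_nat_eq0; apply/forallP/eqP => [h|-> i]; last by rewrite mxE.
by apply/rowP => i; rewrite mxE; have := h i; rewrite absz_eq0 => /eqP.
Qed.

Lemma nrm0 : nrm 0 = 0%N.
Proof. by apply/eqP; rewrite nrm_eq0. Qed.

Lemma nrm_gt0 m : m != 0 -> (0 < nrm m)%N.
Proof. by rewrite -nrm_eq0 lt0n. Qed.

Lemma jap_gt0 m : 0 < jap m.
Proof. by rewrite ltr0n. Qed.

Lemma jap_ge0 m : 0 <= jap m.
Proof. by rewrite ler0n. Qed.

Lemma jap_ge1 m : 1 <= jap m.
Proof. by rewrite ler1n. Qed.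

Lemma japN m : jap (- m) = jap m.
Proof. by rewrite /jap nrmN. Qed.

(** The weight through which absolute summability over the lattice is always
   checked: it is dominated by a product of one-dimensional weights. *)
Definition wt (m : mode) : R := (jap m ^+ d.*2)^-1.

Lemma wt_gt0 m : 0 < wt m.
Proof. by rewrite invr_gt0 exprn_gt0 // jap_gt0. Qed.

Lemma wt_ge0 m : 0 <= wt m.
Proof. exact: ltW (wt_gt0 m). Qed.

Lemma sum_inv_sqr_le (n : nat) : \sum_(k < n) ((1 + k)%:R ^+ 2 : R)^-1 <= 2.
Proof.
(* comparison with the telescoping sum of 1/k - 1/(k+1) *)
suff h : forall n, \sum_(k < n.+1) ((1 + k)%:R ^+ 2 : R)^-1 <= 2 - (n.+1%:R)^-1.
  case: n => [|n]; first by rewrite big_ord0.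
  by rewrite (le_trans (h n))// gerBl invr_ge0.
elim => [|k IH]; first by rewrite big_ord_recr big_ord0 /= expr1n invr1; lra.
rewrite big_ord_recr/= (le_trans (lerD IH (lexx _)))//.
have k0 : 0 <= k%:R :> R by [].
have -> : (1 + k.+1)%:R = k%:R + 2 :> R by rewrite natrD -natr1; ring.

have -> : k.+1%:R = k%:R + 1 :> R by rewrite -natr1; ring.
rewrite -subr_ge0.
have -> : 2 - (k%:R + 2)^-1 - (2 - (k%:R + 1)^-1 + ((k%:R + 2) ^+ 2)^-1) =
  ((k%:R + 1) * (k%:R + 2) ^+ 2)^-1 :> R.
  by field; apply/andP; split; lra.
by rewrite invr_ge0 mulr_ge0 ?exprn_ge0//; lra.
Qed.

Lemma wt_le_prod m : wt m <= \prod_i ((1 + `|m 0%R i|)%:R ^+ 2)^-1.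
Proof.
rewrite /wt -muln2 exprM (_ : \prod_i _ = (\prod_i ((1 + `|m ord0 i|)%:R ^+ 2))^-1); last first.
  by rewrite -prodfV.
rewrite lef_pV2 ?posrE ?exprn_gt0 ?jap_gt0//; last first.
  by apply: prodr_gt0 => i _; rewrite exprn_gt0// ltr0n.
have -> : jap m ^+ d = \prod_(i < d) jap m by rewrite prodr_const card_ord.
rewrite -prodrXl; apply: ler_prod => i _.
by rewrite exprn_ge0//= lerXn2r ?nnegrE// ler_nat leq_add2l coord_nrm.
Qed.

(** The exponent 2d leaves the square of 1 + |m_i| for each coordinate, hence in
   each coordinate two convergent series of sum at most 2. *)
Lemma wt_sum5 (s : seq mode) : uniq s -> \sum_(m <- s) wt m <= 5 ^+ d.
Proof.
move=> us; have [K sK] := seq_sub_box s.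
rewrite (le_trans (ler_sum_sub us (box_uniq K) sK wt_ge0))//.
rewrite /box big_image/=.
pose g (j : 'I_K.*2.+1) : R := ((1 + `|(j : nat)%:Z - K%:Z|)%:R ^+ 2)^-1.
apply: (@le_trans _ _ (\sum_(f : {ffun 'I_d -> 'I_(K.*2.+1)}) \prod_i g (f i))).
  apply: ler_sum => f _; rewrite (le_trans (wt_le_prod _))// le_eqVlt; apply/orP; left.
  by apply/eqP/eq_bigr => i _; rewrite mxE.
(* over a box the product weight sums to the power of a one-dimensional sum *)
rewrite -(bigA_distr_bigA (fun _ => g)) prodr_const card_ord lerXn2r ?nnegrE//.
  by apply: sumr_ge0 => j _; rewrite invr_ge0 exprn_ge0.
have -> : \sum_j g j = \sum_(0 <= j < K.*2.+1) (((1 + `|j%:Z - K%:Z|)%:R ^+ 2)^-1 : R).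
  by rewrite big_mkord.
rewrite (@big_cat_nat _ _ _ K) //=; last by lia.
apply: (@le_trans _ _ (2 + 2 : R)); last by lra.
apply: lerD; last first.
  rewrite -{1}(add0n K) big_addn big_mkord.
  apply: le_trans (sum_inv_sqr_le (K.*2.+1 - K)); apply: ler_sum => j _.
  by rewrite (_ : `|(j + K)%:Z - K%:Z|%N = j)//; lia.
rewrite big_nat_rev/= big_mkord.
apply: le_trans (sum_inv_sqr_le K); apply: ler_sum => j _.
rewrite lef_pV2 ?posrE ?exprn_gt0 ?ltr0n// lerXn2r ?nnegrE// ler_nat.
by have := ltn_ord j; lia.
Qed.

Definition summable (f : mode -> R) :=
  exists C : R, forall K, \sum_(m <- box K) `|f m| <= C.

(** Boxes exhaust the lattice, so that this is the convergence of absolutely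
   convergent series: the positive and negative parts are monotone. *)
Lemma summable_cvg (f : mode -> R) : summable f ->
  cvgn (fun K => \sum_(m <- box K) f m).
Proof.
move=> [C fC].
have H (g : mode -> R) (B : R) : (forall m, 0 <= g m) ->
    (forall K, \sum_(m <- box K) g m <= B) -> cvgn (fun K => \sum_(m <- box K) g m).
  move=> g0 gB; apply: nondecreasing_is_cvgn.
    apply/nondecreasing_seqP => K; apply: ler_sum_sub => //; [exact: box_uniq..|].
    exact: box_mono.
  by exists B => _ [K _ <-].
have -> : (fun K => \sum_(m <- box K) f m) =
    (fun K => \sum_(m <- box K) (`|f m| + f m)) - (fun K => \sum_(m <- box K) `|f m|).
  apply/funext => K; rewrite fctE big_split/= addrAC subrr add0r//.
apply: is_cvgB; last exact: H fC.
apply: (H _ (C + C)) => [m|K].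
  by rewrite -lerBlDl sub0r lerNnormlW// ler_norm.
apply: (@le_trans _ _ (\sum_(m <- box K) (`|f m| + `|f m|))).
  by apply: ler_sum => m _; rewrite lerD2l ler_norm.
by rewrite big_split/= lerD.
Qed.

Lemma summable_wt (f : mode -> R) (A : R) :
  (forall m, `|f m| <= A * wt m) -> summable f.
Proof.
move=> h; exists (`|A| * 5 ^+ d) => K.
apply: (@le_trans _ _ (\sum_(m <- box K) `|A| * wt m)).
  apply: ler_sum => m _; rewrite (le_trans (h m))// ler_wpM2r ?wt_ge0//.
  exact: ler_norm.
by rewrite -mulr_sumr ler_wpM2l// wt_sum5// box_uniq.
Qed.

End Lattice.
Arguments jap {R d} m.
Arguments wt {R d} m.

(** * Integration over the torus *)

Section CubeShift.
Context {R : realType}.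
Local Notation mu := (@lebesgue_measure R).
Local Notation TR := (measurableTypeR R).
Local Open Scope ereal_scope.

Lemma lebesgue_measure_shift (s : R) (A : set R) : measurable A ->
  pushforward mu (fun x : TR => (x + s)%R : TR) A = mu A.
Proof.
move=> mA.
have ms : measurable_fun [set: TR] (fun x : TR => (x + s)%R : TR).
  by apply: measurable_funD.
apply/esym/(lebesgue_measure_unique (mu := pushforward mu _)) => //= _ [[a b]] _ <-.
rewrite /pushforward (_ : _ @^-1` _ = `](a - s)%R, (b - s)%R]%classic); last first.
  by apply/seteqP; split => x /=; rewrite !in_itv/= => /andP[] ? ?; apply/andP; split; lra.
rewrite !lebesgue_measure_itv/= !lte_fin ltrD2r.
by case: ifP => // _; congr (_%:E); lra.
Qed.

Lemma ge0_integral_shift_itv (f : TR -> \bar R) (a b s : R) :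
  measurable_fun [set: TR] f -> (forall x, 0 <= f x) ->
  \int[mu]_(x in `[a, b[) f (x + s)%R = \int[mu]_(x in `[(a + s)%R, (b + s)%R[) f x.
Proof.
move=> mf f0.
have ms : measurable_fun [set: TR] (fun x : TR => (x + s)%R : TR).
  by apply: measurable_funD.
have -> : `[a, b[%classic = (fun x : TR => (x + s)%R : TR) @^-1` `[(a + s)%R, (b + s)%R[.
  by apply/seteqP; split => x /=; rewrite !in_itv/= => /andP[] ? ?; apply/andP; split; lra.
rewrite -(@ge0_integral_pushforward _ _ _ _ _ _ ms mu _ f)//; last exact: measurable_funTS.
by apply: eq_measure_integral => //= A mA AS; exact: lebesgue_measure_shift.
Qed.

(** Cut [s, s + 1[ at the integer that it contains; the two pieces are translates
   of pieces of a unit interval that starts at an integer. *)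
Lemma ge0_integral_shift_period (f : TR -> \bar R) (s : R) :
  measurable_fun [set: TR] f -> (forall x, 0 <= f x) ->
  (forall (x : R) (n : int), f (x + n%:~R)%R = f x) ->
  \int[uniform_prob (@ltr01 R)]_x f (x + s)%R = \int[uniform_prob (@ltr01 R)]_x f x.
Proof.
move=> mf f0 fp.
have mfs (u : R) : measurable_fun [set: TR] (fun x : TR => f (x + u)%R).
  by apply: (measurableT_comp mf); exact: measurable_funD.
rewrite !integral_uniform//.
congr (_ * _).
rewrite -(integral_itv_bndo_bndc (measurable_funTS (mfs s))).
rewrite -(integral_itv_bndo_bndc (measurable_funTS mf)).
rewrite ge0_integral_shift_itv// add0r.
have [n [ns sn]] : exists n : int, (n%:~R <= s)%R /\ (s < n%:~R + 1)%R.
  exists (Num.floor s); split; first exact: floor_le_tmp.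
  by have := lt_succ_floor s; rewrite intrD.
have E1 (x y z : R) : (x <= y)%R -> (y <= z)%R ->
    \int[mu]_(x in `[x, z[) f x = \int[mu]_(x in `[x, y[) f x + \int[mu]_(x in `[y, z[) f x.
  move=> xy yz; rewrite (@itv_bndbnd_setU _ _ _ (BLeft y)) ?bnd_simp//.
  rewrite ge0_integral_setU//.
    exact: measurable_funTS.
  apply/disj_setPS => t /= []; rewrite !in_itv/= => /andP[_ ty] /andP[yt _].
  by move: (lt_le_trans ty yt); rewrite ltxx.
have E2 (x y : R) (k : int) : \int[mu]_(t in `[x, y[) f t =
    \int[mu]_(t in `[(x + k%:~R)%R, (y + k%:~R)%R[) f t.
  rewrite -ge0_integral_shift_itv//; apply: eq_integral => t _; by rewrite fp.
rewrite (E1 s (n%:~R + 1)%R (1 + s)%R (ltW sn)); last by rewrite addrC lerD2l.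
rewrite (E2 (n%:~R + 1)%R (1 + s)%R (- 1%:Z)%R).
rewrite (E2 0%R 1%R n) add0r (E1 n%:~R s (1 + n%:~R)%R ns); last by rewrite addrC ltW.
rewrite addeC; congr (_ + _).
  have -> : (n%:~R + 1 + (- 1%:Z)%:~R = n%:~R :> R)%R by rewrite intrN addrK.
  by have -> : (1 + s + (- 1%:Z)%:~R = s :> R)%R by rewrite intrN addrAC subrr add0r.
by rewrite [(1 + _)%R]addrC.
Qed.

Definition tshift n (x : n.-tuple TR) (v : 'I_n -> R) : n.-tuple TR :=
  [tuple (tnth x i + v i)%R | i < n].

Lemma measurable_tshift n (v : 'I_n -> R) :
  measurable_fun setT (fun x : n.-tuple TR => tshift x v).
Proof.
apply/measurable_fun_tnthP => i.
rewrite (_ : _ \o _ = fun x : n.-tuple TR => (tnth x i + v i)%R : TR); last first.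
  by apply/funext => x /=; rewrite tnth_mktuple.
by apply: measurable_funD => //; exact: measurable_tnth.
Qed.

Lemma tshift_cons n (x : TR * n.-tuple TR) (v : 'I_n.+1 -> R) :
  tshift (Defs.cons_tuple x) v =
  Defs.cons_tuple ((x.1 + v ord0)%R, tshift x.2 (fun i => v (lift ord0 i))).
Proof.
apply: eq_from_tnth => i; rewrite tnth_mktuple.
case: (unliftP ord0 i) => [j ->|->]; first by rewrite !tnthS tnth_mktuple.
by rewrite !tnth0.
Qed.

Lemma measurable_cons2 n (v : R) :
  measurable_fun setT (fun x : TR * n.-tuple TR => Defs.cons_tuple ((x.1 + v)%R, x.2)).
Proof.
apply: (@measurableT_comp _ _ _ _ _ _ (@Defs.cons_tuple R n)); first exact: measurable_cons_tuple.
by apply: measurable_fun_pair => //; exact: measurable_funD.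
Qed.

(** By Tonelli and periodicity in each coordinate this reduces to one variable. *)
Lemma ge0_integral_tshift n (F : n.-tuple TR -> \bar R) (v : 'I_n -> R) :
  measurable_fun setT F -> (forall x, 0 <= F x) ->
  (forall x (z : 'I_n -> int), F (tshift x (fun i => (z i)%:~R%R)) = F x) ->
  \int[cube_prob n]_x F (tshift x v) = \int[cube_prob n]_x F x.
Proof.
elim: n F v => [|n IH] F v mF F0 Fp.
  by apply: eq_integral => x _; congr F; apply: eq_from_tnth; case.
rewrite /= !ge0_integral_distribution//; last first.
  by apply: (measurableT_comp mF); exact: measurable_tshift.
set m2 := cube_prob n.
pose w := v ord0.
pose G (x : TR * n.-tuple TR) := F (Defs.cons_tuple ((x.1 + w)%R, x.2)).
have mG : measurable_fun setT G by apply: (measurableT_comp mF); exact: measurable_cons2.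
have mH : measurable_fun setT (F \o @Defs.cons_tuple R n).
  by apply: (measurableT_comp mF); exact: measurable_cons_tuple.
have G0 x : 0 <= G x by exact: F0.
have H0 x : 0 <= (F \o @Defs.cons_tuple R n) x by exact: F0.
transitivity (\int[uniform_prob (@ltr01 R) \x m2]_x G x).
  rewrite fubini_tonelli1; last (by move=> x; exact: F0); last first.
    apply: (measurableT_comp (measurableT_comp mF (measurable_tshift v))).
    exact: measurable_cons_tuple.
  rewrite (fubini_tonelli1 G mG G0).
  apply: eq_integral => x _; rewrite /fubini_F/=.
  under eq_integral => y _ do rewrite tshift_cons/=.
  apply: (IH (fun y => F (Defs.cons_tuple ((x + w)%R, y)))) => //.
    apply: (measurableT_comp mF); apply: (measurableT_comp (@measurable_cons_tuple R n)).
    exact: measurable_fun_pair.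
  move=> y z; rewrite -[in RHS](Fp _ (fun i => if unlift ord0 i is Some j then z j else 0%R)).
  rewrite tshift_cons/= unlift_none addr0; congr (F (Defs.cons_tuple (_, tshift _ _))).
  by apply/funext => j; rewrite liftK.
rewrite (fubini_tonelli2 G mG G0) (fubini_tonelli2 _ mH H0).
apply: eq_integral => y _; rewrite /fubini_G/=.
apply: (@ge0_integral_shift_period (fun x => F (Defs.cons_tuple (x, y)))) => //.
  apply: (measurableT_comp mF); apply: (measurableT_comp (@measurable_cons_tuple R n)).
  exact: measurable_fun_pair.
move=> x k.
rewrite -[in RHS](Fp _ (fun i => if unlift ord0 i is Some j then 0%R else k)).
rewrite tshift_cons/= unlift_none; congr (F (Defs.cons_tuple (_, _))).
by apply: eq_from_tnth => j; rewrite tnth_mktuple liftK addr0.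
Qed.

End CubeShift.

Section TorusIntegral.
Context {R : realType} {n : nat}.
Local Notation TR := (measurableTypeR R).
Local Notation "'V'" := 'rV[R]_n.

Definition rowt (x : n.-tuple TR) : V := \row_i tnth x i.

Implicit Types (A B : R).

Lemma rowt_tshift x (v : 'I_n -> R) : rowt (tshift x v) = rowt x + \row_i v i.
Proof. by apply/rowP => i; rewrite !mxE tnth_mktuple. Qed.

Lemma measurable_cont (g : V -> R) : continuous g ->
  measurable_fun [set: n.-tuple TR] (fun x => g (rowt x)).
Proof.
move=> cg.
pose fl (k : nat) (a : R) : int := Num.floor (k.+1%:R * a).
pose ap k (x : n.-tuple TR) : V := \row_i ((fl k (tnth x i))%:~R / k.+1%:R).
(* a continuous function is the limit of step functions on finer and finer grids *)
apply: (@measurable_fun_cvg _ _ _ _ (fun k x => g (ap k x))) => [k|x _].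
- move=> _ Y mY; rewrite setTI.
  pose cell (z : V) := [set x : n.-tuple TR | ap k x = z].
  have -> : (fun x => g (ap k x)) @^-1` Y =
     \bigcup_(z in [set z : 'rV[int]_n | Y (g (\row_i ((z 0 i)%:~R / k.+1%:R)))])
       \bigcap_(i in [set: 'I_n]) ((fun x : n.-tuple TR => tnth x i) @^-1`
           `[((z 0 i)%:~R / k.+1%:R), ((z 0 i)%:~R + 1) / k.+1%:R[).
    have k0 : 0 < k.+1%:R :> R by rewrite ltr0n.
    apply/seteqP; split => x /=.
      move=> Yx; exists (\row_i fl k (tnth x i)) => /=.
        by congr (Y (g _)): Yx; apply/rowP => i; rewrite !mxE.
      move=> i _ /=; rewrite in_itv/= mxE ler_pdivrMr// ltr_pdivlMr// mulrC.
      rewrite floor_le_tmp/=; have := lt_succ_floor (k.+1%:R * tnth x i).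
      by rewrite intrD.
    move=> [z /= Yz zx]; congr (Y (g _)): Yz; apply/rowP => i; rewrite !mxE.
    congr (_%:~R / _); apply/esym/eqP.
    have := zx i Logic.I; rewrite /= in_itv/= ler_pdivrMr// ltr_pdivlMr// mulrC => /andP[h1 h2].
    by apply/eqP/floor_def; rewrite h1 intrD.
  rewrite bigcup_mkcond; apply: countable_bigcupT_measurable => [|z].
    exact: countableP.
  case: ifPn => // _; apply: fin_bigcap_measurable => // i _.
  rewrite -[X in measurable X]setTI.
  by apply: (@measurable_tnth _ TR n i) => //; exact: measurable_itv.
- apply: continuous_cvg => //; first exact: cg.
  apply/cvgrPdist_le => e e0.
  near=> k.
  rewrite [leLHS]mx_normrE; apply/bigmax_leP; split; first exact: ltW.
  move=> [i0 i] _ /=; rewrite ord1 !mxE.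
  have k0 : 0 < k.+1%:R :> R by rewrite ltr0n.
  set a := tnth x i.
  have h1 : (fl k a)%:~R <= k.+1%:R * a by exact: floor_le_tmp.
  have h2 : k.+1%:R * a < (fl k a)%:~R + 1 by have := lt_succ_floor (k.+1%:R * a); rewrite intrD.
  have ke : (k.+1%:R)^-1 <= e by near: k; near do apply: ltW; exact: (near_infty_natSinv_lt (PosNum e0)).
  rewrite ger0_norm; last by rewrite subr_ge0 ler_pdivrMr// mulrC.
  apply: le_trans ke; rewrite lerBlDr -[X in X + _]mul1r -mulrDl ler_pdivlMr//.
  by rewrite mulrC ltW// addrC.
Unshelve. all: by end_near. Qed.

(** The functions that are integrated over the torus are all continuous and
   periodic, so that they are bounded and integrability is never an issue. *)
Definition cper (g : V -> R) := continuous g /\ Zperiodic g.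

Lemma cper_cst a : cper (fun=> a).
Proof. by split => //; exact: cst_continuous. Qed.

Lemma cperD f g : cper f -> cper g -> cper (fun x => f x + g x).
Proof.
move=> [cf pf] [cg pg]; split => [x|m x]; last by rewrite pf pg.
exact: continuousD (cf x) (cg x).
Qed.

Lemma cperM f g : cper f -> cper g -> cper (fun x => f x * g x).
Proof.
move=> [cf pf] [cg pg]; split => [x|m x]; last by rewrite pf pg.
exact: continuousM (cf x) (cg x).
Qed.

Lemma cperZ a f : cper f -> cper (fun x => a * f x).
Proof. by move=> cf; apply: cperM => //; exact: cper_cst. Qed.

Lemma cperN f : cper f -> cper (fun x => - f x).
Proof.
by move=> cf; rewrite (_ : (fun x => _) = (fun x => -1 * f x)); [exact: cperZ|apply/funext => x; rewrite mulN1r].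
Qed.

Lemma cperB f g : cper f -> cper g -> cper (fun x => f x - g x).
Proof. by move=> cf cg; apply: cperD => //; exact: cperN. Qed.

Lemma cper_sum (I : Type) (s : seq I) (P : pred I) (f : I -> V -> R) :
  (forall i, cper (f i)) -> cper (fun x => \sum_(i <- s | P i) f i x).
Proof.
move=> h; elim: s => [|i s IH].
  by under eq_fun do rewrite big_nil; exact: cper_cst.
under eq_fun do rewrite big_cons; case: (P i) => //.
exact: cperD.
Qed.

Lemma cper_norm f : cper f -> cper (fun x => `|f x|).
Proof.
move=> [cf pf]; split => [x|m x]; last by rewrite pf.
by apply: (@continuous_comp _ _ _ f (fun y => `|y|)); [exact: cf|exact: norm_continuous].
Qed.

Lemma cper_trig a b m : cper (trig a b m).
Proof. by split; [exact: continuous_trig|exact: periodic_trig]. Qed.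

Lemma cper_test (phi : test_fun R n) : cper phi.
Proof. by split; [have [] := tf_smooth phi [::]|exact: tf_periodic]. Qed.

Lemma cper_shift f v : cper f -> cper (fun x => f (x + v)).
Proof.
move=> [cf pf]; split => [x|m x]; last by rewrite addrAC pf.
have cs : (x' + v) @[x' --> x] --> x + v.
  by apply: (@continuousD _ _ _ id (cst v) x) => //; exact: cst_continuous.
exact: (@continuous_comp V V R (fun y => y + v) f x cs (cf _)).
Qed.

Lemma cper_bounded f : cper f -> exists2 B, 0 <= B & forall x, `|f x| <= B.
Proof.
move=> [cf pf].
pose A := [set v : V | forall i, `[0, 1]%classic (v ord0 i)].
have cA : compact A.
  by apply: (@rV_compact R n (fun=> `[0, 1]%classic)) => i; exact: segment_compact.
have A0 : A !=set0 by exists 0 => i; rewrite /= mxE in_itv/= lexx ler01.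
have [c _ hc] := @compact_EVT_max _ R (fun x => `|f x|) A A0 cA
  (continuous_subspaceT (proj1 (cper_norm (conj cf pf)))).
exists `|f c| => // x.
pose z : 'rV[int]_n := - \row_i Num.floor (x ord0 i).
rewrite -(pf z x); apply: hc; rewrite inE => i /=.
rewrite !mxE in_itv/= intrN.
have := floor_le_tmp (x ord0 i); have := lt_succ_floor (x ord0 i); rewrite intrD => h1 h2.
by rewrite subr_ge0 h2 lerBlDr addrC ltW.
Qed.

Lemma cper_integrable f : cper f ->
  (cube_prob n).-integrable setT (EFin \o (fun x : n.-tuple TR => f (rowt x))).
Proof.
move=> cf; have [B B0 hB] := cper_bounded cf; have [cf1 _] := cf.
apply: measurable_bounded_integrable => //.
- by rewrite (le_lt_trans (probability_le1 _ _))// ltry.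
- exact: measurable_cont.
- by exists B; split; [exact: num_real|move=> y By x _ /=; rewrite (le_trans (hB _))// ltW].
Qed.

Lemma torus_intD f g : cper f -> cper g ->
  torus_int (fun x => f x + g x) = torus_int f + torus_int g.
Proof.
by move=> cf cg; rewrite /torus_int RintegralD//; exact: cper_integrable.
Qed.

Lemma torus_intZ a f : cper f -> torus_int (fun x => a * f x) = a * torus_int f.
Proof.
by move=> cf; rewrite /torus_int RintegralZl//; exact: cper_integrable.
Qed.

Lemma torus_int_cst (a : R) : torus_int (fun _ : V => a) = a.
Proof.
rewrite /torus_int Rintegral_cst//.
transitivity (a * fine (1%E : \bar R)); last by rewrite mulr1.
by congr (_ * fine _); exact: (@probability_setT _ _ R (@cube_prob R n)).
Qed.

Lemma torus_intN f : cper f -> torus_int (fun x => - f x) = - torus_int f.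
Proof.
move=> cf; rewrite -mulN1r -torus_intZ//; congr torus_int; apply/funext => x.
by rewrite mulN1r.
Qed.

Lemma torus_intB f g : cper f -> cper g ->
  torus_int (fun x => f x - g x) = torus_int f - torus_int g.
Proof. by move=> cf cg; rewrite torus_intD ?torus_intN//; exact: cperN. Qed.

Lemma torus_int_sum (I : Type) (s : seq I) (P : pred I) (f : I -> V -> R) :
  (forall i, cper (f i)) ->
  torus_int (fun x => \sum_(i <- s | P i) f i x) = \sum_(i <- s | P i) torus_int (f i).
Proof.
move=> h; elim: s => [|i s IH].
  under [X in torus_int X]eq_fun do rewrite big_nil.
  by rewrite torus_int_cst big_nil.
under [X in torus_int X]eq_fun do rewrite big_cons.
rewrite big_cons; case: (P i) => //.
by rewrite torus_intD ?IH//; exact: cper_sum.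
Qed.

Lemma torus_int_le f B : cper f -> (forall x, `|f x| <= B) -> `|torus_int f| <= B.
Proof.
move=> cf hB; rewrite /torus_int.
apply: le_trans (le_normr_Rintegral _ _) _ => //; first exact: cper_integrable.
rewrite -[leRHS]torus_int_cst; apply: le_Rintegral => //.
- exact: cper_integrable (cper_norm cf).
- exact: cper_integrable (cper_cst B).
Qed.

Lemma ge0_integral_shift_row (F : V -> \bar R) (v : V) :
  measurable_fun [set: n.-tuple TR] (fun x => F (rowt x)) -> (forall x, 0 <= F x)%E ->
  (forall m x, F (x + freq m) = F x) ->
  (\int[cube_prob n]_x F (rowt x + v)%R = \int[cube_prob n]_x F (rowt x))%E.
Proof.
move=> mF F0 pF.
rewrite -(@ge0_integral_tshift R n (fun x => F (rowt x)) (fun i => v ord0 i))//.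
  by apply: eq_integral => x _; rewrite rowt_tshift; congr (F (_ + _)); apply/rowP => i; rewrite mxE.
move=> x z; rewrite rowt_tshift -[in RHS](pF (\row_i z i)); congr (F (_ + _)).
by apply/rowP => i; rewrite !mxE.
Qed.

Lemma torus_int_shift f v : cper f -> torus_int (fun x => f (x + v)) = torus_int f.
Proof.
move=> cf; have [B B0 hB] := cper_bounded cf.
suff : torus_int (fun x => f (x + v) + B) = torus_int (fun x => f x + B).
  rewrite !torus_intD//; first exact: addIr.
  - exact: cper_cst.
  - exact: cper_shift.
  - exact: cper_cst.
rewrite /torus_int /Rintegral; congr fine.
apply: (@ge0_integral_shift_row (fun x => (f x + B)%:E)) => [|x|m x].
- by apply/measurable_EFinP; apply: (measurable_cont (proj1 (cperD cf (cper_cst B)))).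
- by rewrite lee_fin -lerBlDr sub0r; have := hB x; rewrite ler_norml => /andP[].
- by case: cf => _ ->.
Qed.

(** A derivative has mean zero, being a limit of difference quotients, each of
   which has mean zero by translation invariance. *)
Lemma torus_int_derive f v : cper f -> (forall x, derivable f x v) ->
  continuous ('D_v f) -> torus_int ('D_v f) = 0.
Proof.
move=> cf df cdf.
have [cf1 pf] := cf.
have cD : cper ('D_v f) by split => //; exact: periodic_derive.
have [B B0 hB] := cper_bounded cD.
pose h (k : nat) x := k.+1%:R * (f (x + k.+1%:R^-1 *: v) - f x).
have ch k : cper (h k).
  by apply: cperZ; apply: cperB => //; exact: cper_shift.
have h0 k : torus_int (h k) = 0.
  rewrite /h torus_intZ ?torus_intB ?torus_int_shift ?subrr ?mulr0//.
  - exact: cper_shift.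
  - by apply: cperB => //; exact: cper_shift.
have hx x : h k x @[k --> \oo] --> 'D_v f x.
  have Dx : (fun t : R => t^-1 *: ((f \o shift x) (t *: v) - f x)) @ 0^' --> 'D_v f x.
    exact: df.
  have u0 : (fun k : nat => k.+1%:R^-1 : R) @ \oo --> (0 : R)^'.
    move=> P /= hP.
    have H : \forall k \near \oo, k.+1%:R^-1 != 0 :> R -> P (k.+1%:R^-1).
      exact: (@cvg_harmonic R _ hP).
    by apply: filterS H => k /=; apply; rewrite invr_eq0 pnatr_eq0.
  have := cvg_comp _ _ u0 Dx; apply: cvg_trans; apply: near_eq_cvg.
  by apply: nearW => k; rewrite /h/= invrK [_ + x]addrC.
(* the mean value theorem dominates the difference quotients *)
have hb k x : `|h k x| <= B.
  pose ph (t : R) := f (x + t *: v).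
  have dph (t : R) : is_derive t 1 ph ('D_v f (x + t *: v)).
    have E : (fun s : R => s^-1 *: ((ph \o shift t) (s *: (1 : R)) - ph t)) =
        (fun s : R => s^-1 *: ((f \o shift (x + t *: v)) (s *: v) - f (x + t *: v))).
      apply/funext => s; rewrite /ph/=; congr (_ *: (f _ - _)).
      by rewrite [s *: 1]mulr1 scalerDl addrCA addrA.
    by split; [rewrite /derivable E; exact: df|rewrite /derive E].
  have k0 : 0 < k.+1%:R^-1 :> R by rewrite invr_gt0.
  have [c _ Ec] := MVT_segment (ltW k0) (fun t _ => dph t)
    (derivable_within_continuous (fun t _ => @ex_derive _ _ _ _ _ _ _ (dph t))).
  rewrite /h (_ : f (x + _) - f x = ph k.+1%:R^-1 - ph 0); last first.
    by rewrite /ph scale0r addr0.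
  by rewrite Ec subr0 mulrC mulfVK ?pnatr_eq0.
have : (\int[cube_prob n]_x (h k (rowt x))%:E @[k --> \oo] -->
        \int[cube_prob n]_x ('D_v f (rowt x))%:E)%E.
  apply: (@dominated_cvg _ _ _ _ _ _ _ _ (cst B%:E)) => //.
  - by move=> k; apply/measurable_EFinP; apply: measurable_cont; case: (ch k).
  - by move=> x _; apply/fine_cvgP; split; [exact: nearW|exact: hx].
  - exact: (cper_integrable (cper_cst B)).
  - by move=> k x _; rewrite abse_EFin lee_fin.
rewrite (_ : (fun k => _) = cst 0%E); last first.
  apply/funext => k; rewrite /= -[LHS]fineK; first by rewrite -[fine _]/(torus_int (h k)) h0.
  exact: integrable_fin_num (cper_integrable (ch k)).
move/(cvg_unique _ (cvg_cst _)) => /(_ (@ereal_hausdorff R)) E.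
by rewrite /torus_int /Rintegral -E.
Qed.

(** ** Fourier coefficients of continuous functions *)

Implicit Types (a b m : 'rV[int]_n).

Lemma phaseD a b (x : V) : phase (a + b) x = phase a x + phase b x.
Proof.
rewrite /phase -mulrDr -big_split/=; congr (_ * _); apply: eq_bigr => i _.
by rewrite !mxE intrD mulrDl.
Qed.

Lemma phaseN a (x : V) : phase (- a) x = - phase a x.
Proof.
rewrite /phase -mulrN -sumrN; congr (_ * _); apply: eq_bigr => i _.
by rewrite !mxE intrN mulNr.
Qed.

Lemma phase0 (x : V) : phase 0 x = 0.
Proof. by rewrite /phase big1 ?mulr0// => i _; rewrite !mxE mul0r. Qed.

Lemma phase_delta a i : phase a (delta_mx 0 i : V) = 2 * pi * (a 0 i)%:~R.
Proof.
rewrite /phase (bigD1 i)//= !mxE !eqxx mulr1 big1 ?addr0// => j ji.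
by rewrite !mxE eqxx/= (negPf ji) mulr0.
Qed.

Lemma expiD a b (x : V) : expi (a + b) x = expi a x * expi b x.
Proof.
by rewrite /expi phaseD cosD sinD; apply: complex_ext; rewrite ?ReM ?ImM//= addrC.
Qed.

Lemma conjc_expi a (x : V) : conjc (expi a x) = expi (- a) x.
Proof. by rewrite /expi /= phaseN cosN sinN. Qed.

Lemma expi0 (x : V) : expi 0 x = 1.
Proof. by rewrite /expi phase0 cos0 sin0. Qed.

Lemma cab_expi a (x : V) : cab (expi a x) <= 2.
Proof. by rewrite /cab/= (le_trans (lerD (cos_max _) (sin_max _)))//; lra. Qed.

Lemma cper_cos m : cper (fun x : V => cos (phase m x)).
Proof.
rewrite (_ : (fun x => _) = trig 1 0 m); first exact: cper_trig.
by apply/funext => x; rewrite /trig mul1r mul0r addr0.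
Qed.

Lemma cper_sin m : cper (fun x : V => sin (phase m x)).
Proof.
rewrite (_ : (fun x => _) = trig 0 1 m); first exact: cper_trig.
by apply/funext => x; rewrite /trig mul1r mul0r add0r.
Qed.

(** Orthogonality of characters, from translation invariance alone. *)
Lemma torus_int_trig m : m != 0 ->
  torus_int (fun x : V => cos (phase m x)) = 0 /\ torus_int (fun x : V => sin (phase m x)) = 0.
Proof.
move=> m0.
have [i mi] : exists i, m ord0 i != 0.
  apply/existsP; apply: contraNT m0; rewrite negb_exists => /forallP h.
  by apply/eqP/rowP => i; rewrite mxE; apply/eqP/negPn/h.
(* translating by half a period changes the sign *)
pose v : V := (2 * (m ord0 i)%:~R)^-1 *: delta_mx 0 i.
have pv x : phase m (x + v) = phase m x + pi.
  rewrite addrC phaseDZ addrC phase_delta; congr (_ + _).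
  by rewrite [2 * pi * _]mulrAC mulKf// mulf_neq0// intr_eq0.
have half (g : V -> R) : cper g -> (forall x, g (x + v) = - g x) -> torus_int g = 0.
  move=> cg gv; have := torus_int_shift v cg.
  under [X in torus_int X]eq_fun do rewrite gv.
  by rewrite torus_intN//; lra.
by split; apply: half => [|x]; rewrite ?pv ?cosDpi ?sinDpi//; [exact: cper_cos|exact: cper_sin].
Qed.

(** Integration of complex-valued functions, and Fourier coefficients, are handled
   through real and imaginary parts, as the integral of the torus is real. *)
Definition cint (G : V -> R[i]) : R[i] :=
  Complex (torus_int (fun x => complex.Re (G x))) (torus_int (fun x => complex.Im (G x))).

Definition ccper (G : V -> R[i]) :=
  cper (fun x => complex.Re (G x)) /\ cper (fun x => complex.Im (G x)).

Lemma ccperD F G : ccper F -> ccper G -> ccper (fun x => F x + G x).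
Proof.
move=> [rF iF] [rG iG]; split.
  by under eq_fun do rewrite ReD; exact: cperD.
by under eq_fun do rewrite ImD; exact: cperD.
Qed.

Lemma ccperM F G : ccper F -> ccper G -> ccper (fun x => F x * G x).
Proof.
move=> [rF iF] [rG iG]; split.
  by under eq_fun do rewrite ReM; apply: cperB; exact: cperM.
by under eq_fun do rewrite ImM; apply: cperD; exact: cperM.
Qed.

Lemma ccper_cst c : ccper (fun=> c).
Proof. by split; exact: cper_cst. Qed.

Lemma ccper_sum (I : Type) (s : seq I) (F : I -> V -> R[i]) :
  (forall i, ccper (F i)) -> ccper (fun x => \sum_(i <- s) F i x).
Proof.
move=> h; elim: s => [|i s IH].
  by under eq_fun do rewrite big_nil; exact: ccper_cst.
by under eq_fun do rewrite big_cons; exact: ccperD.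
Qed.

Lemma ccper_expi m : ccper (expi m).
Proof. by split; [exact: cper_cos|exact: cper_sin]. Qed.

Lemma ccper_real f : cper f -> ccper (fun x => (f x)%:C%C).
Proof. by move=> cf; split => //=; exact: cper_cst. Qed.

Lemma cintD F G : ccper F -> ccper G -> cint (fun x => F x + G x) = cint F + cint G.
Proof.
move=> [rF iF] [rG iG]; apply: complex_ext; rewrite ?ReD ?ImD/= -torus_intD//; congr torus_int; apply/funext => x.
  exact: ReD.
exact: ImD.
Qed.

Lemma cintZ c F : ccper F -> cint (fun x => c * F x) = c * cint F.
Proof.
move=> [rF iF]; apply: complex_ext; rewrite ?ReM ?ImM/=.
  rewrite -!torus_intZ// -torus_intB//; try exact: cperZ.
  by congr torus_int; apply/funext => x; rewrite ReM.
rewrite -!torus_intZ// -torus_intD//; try exact: cperZ.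
by congr torus_int; apply/funext => x; rewrite ImM.
Qed.

Lemma cint_sum (I : Type) (s : seq I) (F : I -> V -> R[i]) :
  (forall i, ccper (F i)) -> cint (fun x => \sum_(i <- s) F i x) = \sum_(i <- s) cint (F i).
Proof.
move=> h; elim: s => [|i s IH].
  rewrite big_nil; under [X in cint X]eq_fun do rewrite big_nil.
  by rewrite /cint/= torus_int_cst.
rewrite big_cons -IH -cintD//; last exact: ccper_sum.
by congr cint; apply/funext => x; rewrite big_cons.
Qed.

Lemma cint_expi m : cint (expi m) = (m == 0)%:R.
Proof.
rewrite /cint/=; have [->|m0] := eqVneq m 0.
  under [X in Complex (torus_int X) _]eq_fun do rewrite phase0 cos0.
  under [X in Complex _ (torus_int X)]eq_fun do rewrite phase0 sin0.
  by rewrite !torus_int_cst.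
by have [-> ->] := torus_int_trig m0.
Qed.

Definition ft (g : V -> R) m : R[i] := cint (fun x => (g x)%:C%C * expi (- m) x).

Lemma fcoef_fun g m : cper g -> fcoef (dist_of_fun g) m = ft g m.
Proof.
move=> cg; rewrite /fcoef /ft /dist_of_fun /cint; congr Complex.
  by congr torus_int; apply/funext => x; rewrite ReM/= /trig phaseN cosN mul1r !mul0r addr0 subr0.
rewrite -torus_intN; last by apply: cperM => //; exact: cper_trig.
by congr torus_int; apply/funext => x; rewrite ImM/= /trig phaseN sinN mul1r !mul0r add0r addr0 mulrN.
Qed.

Lemma ft_le g B m : cper g -> (forall x, `|g x| <= B) -> cab (ft g m) <= 2 * B.
Proof.
move=> cg gB; rewrite /ft.
have [rG iG] := ccperM (ccper_real cg) (ccper_expi (- m)).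
have B0 : 0 <= B by exact: le_trans (gB 0).
rewrite /cab/= mulr_natl mulr2n; apply: lerD; apply: torus_int_le => // x.
  by rewrite /= mul0r subr0 normrM (le_trans _ (gB x))// ler_piMr ?cos_max.
by rewrite /= mul0r addr0 normrM (le_trans _ (gB x))// ler_piMr ?sin_max.
Qed.

Lemma ftD f g m : cper f -> cper g -> ft (fun x => f x + g x) m = ft f m + ft g m.
Proof.
move=> cf cg; rewrite /ft -cintD; try by apply: ccperM; [exact: ccper_real|exact: ccper_expi].
by congr cint; apply/funext => x; rewrite -mulrDl rmorphD.
Qed.

Lemma ftZ (a : R) f m : cper f -> ft (fun x => a * f x) m = real_mul a (ft f m).
Proof.
move=> cf; rewrite /ft /real_mul -cintZ; last by apply: ccperM; [exact: ccper_real|exact: ccper_expi].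
by congr cint; apply/funext => x; rewrite mulrA rmorphM.
Qed.

(** Integration by parts: the derivative of the product of the function with a
   character has mean zero. *)
Lemma ft_tderive (phi : test_fun R n) j m :
  ft (tderive j phi) m = (2 * pi * (m 0 j)%:~R)%:C%C * 'i%C * ft phi m.
Proof.
have cphi := cper_test phi; have cd := cper_test (tderive j phi).
(* both components at once: differentiation rotates the pair (cos, sin) *)
have key (a b : R) : torus_int (fun x => tderive j phi x * trig a b m x) =
    2 * pi * (m 0 j)%:~R * torus_int (fun x => phi x * trig (- b) a m x).
  have ct := cper_trig a b m.
  set c := 2 * pi * _.
  have ct' : cper (fun x => phi x * trig (- b) a m x) by apply: cperM => //; exact: cper_trig.
  have Dprod x : is_derive x (delta_mx 0 j : V) (tf_val phi * trig a b m)
      (tderive j phi x * trig a b m x - c * (phi x * trig (- b) a m x)).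
    have D1 : is_derive x (delta_mx 0 j : V) phi (tderive j phi x).
      by have [_ /(_ x (delta_mx 0 j)) h] := tf_smooth phi [::]; exact: DeriveDef.
    apply: is_derive_eq; first exact: (is_deriveM D1 (is_derive_trig a b m x (delta_mx 0 j))).
    by rewrite phase_delta -/c /trig /GRing.scale/=; ring.
  have cD : cper (fun x => tderive j phi x * trig a b m x - c * (phi x * trig (- b) a m x)).
    by apply: cperB; [exact: cperM|exact: cperZ].
  have E : 'D_(delta_mx 0 j) (tf_val phi * trig a b m) =
      fun x => tderive j phi x * trig a b m x - c * (phi x * trig (- b) a m x).
    by apply/funext => x; exact: (@derive_val _ _ _ _ _ _ _ (Dprod x)).
  have := @torus_int_derive (tf_val phi * trig a b m) (delta_mx 0 j) (cperM cphi ct)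
    (fun x => @ex_derive _ _ _ _ _ _ _ (Dprod x)).
  rewrite E => /(_ (proj1 cD)); rewrite torus_intB; [|exact: cperM|exact: cperZ].
  by rewrite torus_intZ// => /eqP; rewrite subr_eq0 => /eqP.
rewrite /ft /cint; apply: complex_ext; rewrite ?ReM ?ImM/=.
  transitivity (torus_int (fun x => tderive j phi x * trig 1 0 m x)).
    by congr torus_int; apply/funext => x; rewrite phaseN cosN /trig/=; ring.
  rewrite key !mulr0 mul0r subr0 mul0r sub0r addr0 mulr1 -mulrN -torus_intN; last first.
    by have [_ h] := ccperM (ccper_real cphi) (ccper_expi (- m)).
  congr (_ * _); congr torus_int; apply/funext => x.
  by rewrite phaseN sinN /trig; ring.
transitivity (torus_int (fun x => tderive j phi x * trig 0 (-1) m x)).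
  by congr torus_int; apply/funext => x; rewrite phaseN sinN /trig/=; ring.
rewrite key !mulr0 mul0r subr0 mul0r add0r addr0 mulr1.
congr (_ * _); congr torus_int; apply/funext => x.
by rewrite phaseN cosN /trig; ring.
Qed.

Lemma iter_tderive (phi : test_fun R n) i k :
  tf_val (iter k (tderive i) phi) = derives (nseq k (delta_mx 0 i)) phi.
Proof. by elim: k => //= k ->. Qed.

Lemma ft_iter_tderive (phi : test_fun R n) i N m :
  ft (iter N.*2 (tderive i) phi) m =
  real_mul ((-1) ^+ N * (2 * pi * (m 0 i)%:~R) ^+ N.*2) (ft phi m).
Proof.
elim: N => [|N IH]; first by rewrite /= expr0 mul1r expr0 real_mul1.
rewrite doubleS !iterS !ft_tderive IH /real_mul.
set c := 2 * pi * _; rewrite !exprS !rmorphM rmorphN1.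
set z := ft phi m.
transitivity ('i%C * 'i%C * (c%:C%C * c%:C%C * (((-1) ^+ N)%:C%C * (c ^+ N.*2)%:C%C * z))).
  by rewrite rmorphM; ring.
have -> : 'i%C * 'i%C = -1 :> R[i] by rewrite -expr2 sqr_i.
by rewrite rmorphM; ring.
Qed.

(** The largest coordinate controls the bracket. *)
Lemma jap_pow_le m N :
  (jap m : R) ^+ N.*2 <= (1 + n%:R) ^+ N.*2 * (1 + \sum_i (`|m 0 i|%:R) ^+ N.*2).
Proof.
have S0 : 0 <= \sum_i (`|m 0 i|%:R : R) ^+ N.*2.
  by apply: sumr_ge0 => i _; rewrite exprn_ge0.
have [/existsP[i0 hi0]|] := boolP [exists i, (0 < `|m 0%R i|)%N]; last first.
  rewrite negb_exists => /forallP h.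
  have -> : jap m = 1 :> R.
    rewrite /jap (_ : nrm m = 0%N)//; apply/eqP; rewrite sum_nat_eq0; apply/forallP => i.
    by rewrite -leqn0 leqNgt; exact: h.
  rewrite expr1n mulr_ege1// ?exprn_ege1// ?lerDl//.
pose i := [arg max_(i > i0) `|m ord0 i|%N].
have hi j : (`|m ord0 j| <= `|m ord0 i|)%N.
  by rewrite /i; case: arg_maxnP => // k _; apply.
have i1 : (0 < `|m ord0 i|)%N by exact: leq_trans hi0 (hi i0).
apply: (@le_trans _ _ (((1 + n%:R) * `|m ord0 i|%:R) ^+ N.*2)).
  rewrite lerXn2r ?nnegrE ?jap_ge0 ?mulr_ge0 ?addr_ge0//.
  rewrite /jap -[1 in leRHS]/(1%:R) -natrD -natrM ler_nat mulnDl leq_add ?mul1n//.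
  have <- : (\sum_(j < n) `|m ord0 i| = n * `|m ord0 i|)%N by rewrite sum_nat_const card_ord.
  exact: leq_sum.
rewrite exprMn ler_wpM2l ?exprn_ge0 ?addr_ge0// (bigD1 i)//=.
by rewrite addrCA lerDl addr_ge0// sumr_ge0// => j _; rewrite exprn_ge0.
Qed.

Definition decay_const N : R := (1 + n%:R) ^+ N.*2 * (2 * (1 + n%:R)).

Lemma decay_const_ge0 N : 0 <= decay_const N.
Proof. by rewrite mulr_ge0 ?exprn_ge0 ?mulr_ge0 ?addr_ge0. Qed.

(** The coefficients of the derivatives are bounded too, which pays for any power of the
   frequency. *)
Lemma ft_decay (phi : test_fun R n) N B m :
  (forall x, `|phi x| <= B) ->
  (forall i x, `|iter N.*2 (tderive i) phi x| <= B) ->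
  cab (ft phi m) * jap m ^+ N.*2 <= decay_const N * B.
Proof.
move=> b0 b1.
have h1 : cab (ft phi m) <= 2 * B by apply: ft_le => //; exact: cper_test.
have h2 i : cab (ft phi m) * `|m 0 i|%:R ^+ N.*2 <= 2 * B.
  have h : cab (ft (iter N.*2 (tderive i) phi) m) <= 2 * B.
    by apply: ft_le => //; exact: cper_test.
  apply: le_trans h; rewrite ft_iter_tderive cab_real_mul mulrC ler_wpM2r ?cab_ge0//.
  rewrite normrM normrX normrN1 expr1n mul1r normrX lerXn2r ?nnegrE//.
  rewrite normrM natr_absz intr_norm ler_peMl// ger0_norm ?mulr_ge0 ?pi_ge0//.
  by have := @pi_ge2 R; lra.
apply: le_trans (ler_wpM2l (cab_ge0 _) (jap_pow_le m N)) _.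
rewrite mulrCA /decay_const -mulrA ler_wpM2l ?exprn_ge0 ?addr_ge0//.
rewrite mulrDr mulr1 mulr_sumr.
apply: (@le_trans _ _ (2 * B + \sum_(i < n) 2 * B)).
  by apply: lerD => //; apply: ler_sum => i _; exact: h2.
by rewrite sumr_const card_ord -mulr_natl; lra.
Qed.

Lemma delta_norm_le1 (i : 'I_n) : `|delta_mx 0 i : V| <= 1.
Proof.
rewrite [leLHS]mx_normrE; apply/bigmax_leP; split => // -[a b] _ /=; rewrite mxE.
by case: (_ && _); rewrite ?normr1 ?normr0.
Qed.

Lemma Cn_bound_decay (phi : test_fun R n) N B : Cn_bound N.*2 phi B ->
  (forall x, `|phi x| <= B) /\ (forall i x, `|iter N.*2 (tderive i) phi x| <= B).
Proof.
move=> h; split => [x|i x]; first exact: (h [::]).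
rewrite iter_tderive; apply: h; first by rewrite size_nseq.
by rewrite all_nseq delta_norm_le1 orbT.
Qed.

Lemma test_bounds (phi : test_fun R n) N : exists B,
  (forall x, `|phi x| <= B) /\ (forall i x, `|iter N.*2 (tderive i) phi x| <= B).
Proof.
have [B0 B00 h0] := cper_bounded (cper_test phi).
have /choice [b hb] (i : 'I_n) : exists B, 0 <= B /\ forall x, `|iter N.*2 (tderive i) phi x| <= B.
  by have [B ? h] := cper_bounded (cper_test (iter N.*2 (tderive i) phi)); exists B.
exists (B0 + \sum_i b i); split => [x|i x].
  by rewrite (le_trans (h0 x))// lerDl sumr_ge0// => i _; case: (hb i).
have [_ /(_ x) h] := hb i; rewrite (le_trans h)// (bigD1 i)//= addrCA lerDl addr_ge0//.
by rewrite sumr_ge0// => j _; case: (hb j).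
Qed.

End TorusIntegral.

(** * Distributions with prescribed Fourier coefficients *)

Section Synth.
Context {R : realType} {d : nat}.
Local Notation mode := 'rV[int]_d.
Implicit Types (m : mode) (B : R).
Implicit Types (c : mode -> R[i]) (phi psi rho : test_fun R d) (f g : @dist R d).

Definition herm c := forall m, c (- m) = conjc (c m).
(** Polynomial growth with explicit constants: distributions over space-time need
   bounds that are uniform in time. *)
Definition pbd (A : R) N c := forall m, cab (c m) <= A * jap m ^+ N.

Lemma pbd_ge0 A N c : pbd A N c -> 0 <= A.
Proof.
move=> /(_ 0); rewrite /jap nrm0 addn0 expr1n mulr1; apply: le_trans; exact: cab_ge0.
Qed.

Lemma pbd_widen A N c A' N' : pbd A N c -> A <= A' -> (N <= N')%N -> pbd A' N' c.
Proof.
move=> h AA NN m; rewrite (le_trans (h m))// ler_pM ?exprn_ge0 ?jap_ge0 ?(pbd_ge0 h)//.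
by rewrite ler_weXn2l// jap_ge1.
Qed.

Lemma pbdD A N c A' N' c' : pbd A N c -> pbd A' N' c' ->
  pbd (A + A') (N + N') (fun m => c m + c' m).
Proof.
move=> h h' m; rewrite (le_trans (cabD _ _))// mulrDl; apply: lerD.
  exact: (pbd_widen h (lexx _) (leq_addr _ _)).
exact: (pbd_widen h' (lexx _) (leq_addl _ _)).
Qed.

Lemma pbd_real_mul A N c (s : mode -> R) : pbd A N c -> (forall m, `|s m| <= 1) ->
  pbd A N (fun m => real_mul (s m) (c m)).
Proof.
by move=> h s1 m; rewrite cab_real_mul (le_trans _ (h m))// ler_piMl ?cab_ge0.
Qed.

(** The terms of the Parseval series that defines synth. *)
Definition sterm c phi m : R := complex.Re (c m * conjc (ft phi m)).

Lemma synthE c phi : synth c phi = limn (fun K => \sum_(m <- box K) sterm c phi m).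
Proof.
rewrite /synth; congr (lim (_ @ \oo)); apply/funext => K.
rewrite (@fsum_box d R[i]) Re_sum; apply: eq_bigr => m _.
by rewrite /sterm fcoef_fun//; exact: cper_test.
Qed.

(** N + d pairs of derivatives absorb the growth of the coefficients and leave the
   summable weight. *)
Lemma sterm_bound A N c phi B : pbd A N c ->
  (forall x, `|phi x| <= B) ->
  (forall i x, `|iter (N + d).*2 (tderive i) phi x| <= B) ->
  forall m, `|sterm c phi m| <= A * (@decay_const R d (N + d) * B) * wt m.
Proof.
move=> hc b0 b1 m; have hd := ft_decay m b0 b1.
have j0 := jap_gt0 (R := R) m.
apply: le_trans (Re_le_cab _) _; apply: le_trans (cabM _ _) _; rewrite cabJ.
apply: (@le_trans _ _ (A * jap m ^+ N * cab (ft phi m))); first by rewrite ler_wpM2r ?cab_ge0.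
rewrite /wt ler_pdivlMr ?exprn_gt0//.
apply: (@le_trans _ _ (A * (cab (ft phi m) * jap m ^+ (N + d).*2))); last first.
  by rewrite ler_wpM2l// (pbd_ge0 hc).
rewrite -!mulrA ler_wpM2l ?(pbd_ge0 hc)// mulrCA ler_wpM2l ?cab_ge0// -exprD.
by rewrite ler_weXn2l ?jap_ge1// -!addnn; lia.
Qed.

Lemma sterm_summable A N c phi : pbd A N c -> summable (sterm c phi).
Proof.
move=> hc; have [B [b0 b1]] := test_bounds phi (N + d).
exact: summable_wt (sterm_bound hc b0 b1).
Qed.

Lemma synth_cvg A N c phi : pbd A N c ->
  \sum_(m <- box K) sterm c phi m @[K --> \oo] --> synth c phi.
Proof. by move=> hc; rewrite synthE; apply/summable_cvg/sterm_summable. Qed.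

Definition synth_const N : R := @decay_const R d (N + d) * (5 ^+ d).

Lemma synth_bound A N c phi B : pbd A N c ->
  (forall x, `|phi x| <= B) ->
  (forall i x, `|iter (N + d).*2 (tderive i) phi x| <= B) ->
  forall K, `|\sum_(m <- box K) sterm c phi m| <= A * synth_const N * B.
Proof.
move=> hc b0 b1 K; apply: le_trans (ler_norm_sum _ _ _) _.
apply: le_trans (ler_sum _ (fun m _ => sterm_bound hc b0 b1 m)) _.
rewrite -mulr_sumr /synth_const.
have B0 : 0 <= B by exact: le_trans (b0 0).
rewrite [leRHS](_ : _ = A * (@decay_const R d (N + d) * B) * 5 ^+ d); last by ring.
apply: ler_wpM2l; first by rewrite !mulr_ge0 ?decay_const_ge0 ?(pbd_ge0 hc).
by apply: wt_sum5; exact: box_uniq.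
Qed.

Lemma synth_le A N c phi B : pbd A N c ->
  (forall x, `|phi x| <= B) ->
  (forall i x, `|iter (N + d).*2 (tderive i) phi x| <= B) ->
  `|synth c phi| <= A * synth_const N * B.
Proof.
move=> hc b0 b1.
have h : `|\sum_(m <- box K) sterm c phi m| @[K --> \oo] --> `|synth c phi|.
  by apply: cvg_norm; exact: synth_cvg hc.
rewrite -(cvg_lim (@Rhausdorff R) h); apply: limr_le; first by apply/cvg_ex; eexists; exact: h.
by apply: nearW => K; exact: synth_bound.
Qed.

Lemma synthB A N c A' N' c' phi : pbd A N c -> pbd A' N' c' ->
  synth (fun m => c m - c' m) phi = synth c phi - synth c' phi.
Proof.
move=> h h'; rewrite synthE; apply/cvg_lim => //.
rewrite (_ : (fun K => _) = (fun K => \sum_(m <- box K) sterm c phi m) -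
   (fun K => \sum_(m <- box K) sterm c' phi m)); last first.
  apply/funext => K; rewrite !fctE -sumrB; apply: eq_bigr => m _.
  by rewrite /sterm mulrBl ReB.
by apply: cvgB; [exact: synth_cvg h|exact: synth_cvg h'].
Qed.

Lemma ft_lin (a : R) phi psi rho m : (forall x, rho x = a * phi x + psi x) ->
  ft rho m = real_mul a (ft phi m) + ft psi m.
Proof.
move=> h; rewrite -ftZ; last exact: cper_test.
rewrite -ftD; [|exact/cperZ/cper_test|exact: cper_test].
by congr ft; apply/funext => x; rewrite h.
Qed.

Lemma synth_is_dist A N c : pbd A N c -> is_dist (synth c).
Proof.
move=> hc; split.
  move=> a phi psi rho h; rewrite [LHS]synthE; apply/cvg_lim => //.
  rewrite (_ : (fun K => _) = a *: (fun K => \sum_(m <- box K) sterm c phi m) +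
     (fun K => \sum_(m <- box K) sterm c psi m)); last first.
    apply/funext => K; rewrite !fctE scaler_sumr -big_split; apply: eq_bigr => m _ /=.
    rewrite /sterm (ft_lin m h) cjD conjc_real_mul mulrDr ReD; congr (_ + _).
    by rewrite real_mulE !ReM/= /GRing.scale/=; ring.
  apply: cvgD; last exact: synth_cvg hc.
  apply: cvgZr; exact: synth_cvg hc.
exists (N + d).*2, (A * synth_const N) => phi B /Cn_bound_decay [b0 b1].
exact: synth_le.
Qed.

Lemma sum_delta (V : pzRingType) (s : seq mode) x (f : mode -> V) : uniq s -> x \in s ->
  \sum_(m <- s) f m * (m == x)%:R = f x.
Proof.
move=> us xs; rewrite (bigD1_seq x)//= eqxx mulr1 big1_seq ?addr0// => m /andP[mx _].
by rewrite (negPf mx) mulr0.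
Qed.

Lemma ft_tcos (a : mode) m : ft (tcos a) m = (2^-1)%:C%C * ((m == a)%:R + (m == - a)%:R) :> R[i].
Proof.
rewrite /ft; have -> : (fun x : 'rV[R]_d => (tcos a x)%:C%C * expi (- m) x) =
    (fun x => (2^-1)%:C%C * (expi (a - m) x + expi (- a - m) x)).
  apply: funext => x; rewrite !expiD -mulrDl mulrA; congr (_ * _).
  rewrite /= /trig mul1r mul0r addr0 /expi phaseN cosN sinN.
  by apply: complex_ext; rewrite ?ReM ?ImM/=; field.
rewrite cintZ; last by apply: ccperD; exact: ccper_expi.
rewrite cintD; try exact: ccper_expi.
rewrite !cint_expi !subr_eq0; congr (_ * (_ + _)); first by rewrite eq_sym.
by rewrite eq_sym.
Qed.

Lemma ft_tsin a m : ft (tsin a) m = - 'i%C * (2^-1)%:C%C * ((m == a)%:R - (m == - a)%:R) :> R[i].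
Proof.
rewrite /ft; have -> : (fun x : 'rV[R]_d => (tsin a x)%:C%C * expi (- m) x) =
    (fun x => (- 'i%C * (2^-1)%:C%C) * (expi (a - m) x + (-1) * expi (- a - m) x)).
  apply: funext => x; rewrite !expiD mulrA -mulrDl mulrA; congr (_ * _).
  rewrite /= /trig mul1r mul0r add0r /expi phaseN cosN sinN.
  by apply: complex_ext; rewrite ?ReM ?ImM ?ReD ?ImD ?ReM ?ImM/=; field.
have cm : ccper (fun x : 'rV[R]_d => -1 * expi (- a - m) x).
  by apply: ccperM; [exact: ccper_cst|exact: ccper_expi].
rewrite cintZ; last by apply: ccperD => //; exact: ccper_expi.
rewrite cintD//; last exact: ccper_expi.
rewrite cintZ; last exact: ccper_expi.
by rewrite !cint_expi !subr_eq0 mulN1r; congr (_ * (_ - _)); rewrite eq_sym.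
Qed.

(** Tested against a cosine or a sine the Parseval series has at most two terms,
   which Hermitian symmetry recombines. *)
Lemma fcoef_synth A N c : pbd A N c -> herm c -> fcoef (synth c) = c.
Proof.
move=> hc ch; apply/funext => a.
(* the partial sums are eventually constant *)
have lim_ev phi (l : R) :
    (forall K, (nrm a <= K)%N -> \sum_(m <- box K) sterm c phi m = l) -> synth c phi = l.
  move=> h; rewrite synthE; apply/cvg_lim => //; apply: cvg_near_cst.
  by near=> K; apply: h; near: K; exact: nbhs_infty_ge.
have inK (K : nat) : (nrm a <= K)%N -> (a \in box K) && (- a \in box K).
  by move=> h; rewrite !nrm_box// nrmN.
rewrite /fcoef (lim_ev (tcos a) (complex.Re (c a))); last first.
  move=> K /inK /andP[h1 h2]; rewrite -Re_sum.
  under eq_bigr => m _ do rewrite ft_tcos cjM cjD !cj_nat conjc_real mulrCA mulrDr.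
  rewrite -mulr_sumr big_split/= !sum_delta ?box_uniq// ch ReM ReD ImD.
  by case: (c a) => x y /=; field.
rewrite (lim_ev (tsin a) (- complex.Im (c a))); last first.
  move=> K /inK /andP[h1 h2]; rewrite -Re_sum.
  under eq_bigr => m _ do rewrite ft_tsin !cjM cjB cjN !cj_nat conjc_real mulrCA mulrBr.
  rewrite -mulr_sumr sumrB !sum_delta ?box_uniq// ch.
  by case: (c a) => x y /=; simpc => /=; field.
by rewrite opprK; case: (c a).
Unshelve. all: by end_near. Qed.

(** ** Linear operations on coefficients *)

Lemma dist_scale f (a : R) phi rho : is_dist f -> (forall x, rho x = a * phi x) ->
  f rho = a * f phi.
Proof.
move=> [lf _] h; rewrite (lf (a - 1) phi phi rho) => [|x]; first by rewrite mulrBl mul1r subrK.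
by rewrite h mulrBl mul1r subrK.
Qed.

Lemma fcoefN f m : is_dist f -> fcoef f (- m) = conjc (fcoef f m).
Proof.
move=> df; rewrite /fcoef/=; congr Complex.
  rewrite (dist_scale (a := 1) (phi := tcos m) df) ?mul1r// => x.
  by rewrite /= /trig phaseN cosN sinN; ring.
rewrite (dist_scale (a := -1) (phi := tsin m) df) ?mulN1r// => x.
by rewrite /= /trig phaseN cosN sinN; ring.
Qed.

Lemma fcoefB f g m : fcoef (f - g) m = fcoef f m - fcoef g m.
Proof. by apply: complex_ext; rewrite ?ReB ?ImB /fcoef/= !fctE ?opprB ?opprK// addrC. Qed.

(** The symbol of the derivative in the direction j. *)
Definition dsym (j : 'I_d) (m : mode) : R[i] := (2 * pi * (m ord0 j)%:~R)%:C%C * 'i%C.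

Lemma fcoef_pderive j f m : is_dist f -> fcoef (pderive j f) m = dsym j m * fcoef f m.
Proof.
move=> df; rewrite /fcoef /pderive.
have D a b := derive_val (is_derive := is_derive_trig a b m _ (delta_mx 0 j : 'rV[R]_d)).
rewrite (dist_scale (a := - (2 * pi * (m ord0 j)%:~R)) (phi := tsin m) (rho := tderive j (tcos m)) df); last first.
  by move=> x; rewrite /= D phase_delta /trig; ring.
rewrite (dist_scale (a := 2 * pi * (m ord0 j)%:~R) (phi := tcos m) (rho := tderive j (tsin m)) df); last first.
  by move=> x; rewrite /= D phase_delta /trig; ring.
by rewrite /dsym; simpc; congr Complex; ring.
Qed.

Lemma fcoef_mdiv (A : @Defs.mdist R d) i m : (forall j, is_dist (A i j)) ->
  fcoef (mdiv A i) m = \sum_j dsym j m * fcoef (A i j) m.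
Proof.
move=> dA; under eq_bigr => j _ do rewrite -fcoef_pderive//.
by apply: complex_ext; rewrite ?Re_sum ?Im_sum /fcoef/= /mdiv ?sumrN.
Qed.

Lemma div_fcoef (u : @vdist R d) m : (forall i, is_dist (u i)) -> div u = cst 0 ->
  \sum_i (m ord0 i)%:~R * fcoef (u i) m = 0.
Proof.
move=> du d0; have h : fcoef (div u) m = 0 by rewrite d0 /fcoef oppr0.
have E : fcoef (div u) m = (2 * pi)%:C%C * 'i%C * \sum_i (m ord0 i)%:~R * fcoef (u i) m.
  rewrite mulr_sumr; transitivity (\sum_i dsym i m * fcoef (u i) m).
    under eq_bigr => i _ do rewrite -fcoef_pderive//.
    by apply: complex_ext; rewrite ?Re_sum ?Im_sum /fcoef/= /div ?sumrN.
  apply: eq_bigr => i _; rewrite /dsym rmorphM rmorph_int; ring.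
move: E; rewrite h => /esym/eqP; rewrite !mulf_eq0 => /orP[/orP[]|/eqP//].
  by rewrite eq_complex/= eqxx andbT mulf_eq0 pnatr_eq0/= gt_eqF// pi_gt0.
by rewrite eq_complex/= oner_eq0 andbF.
Qed.

Lemma div_synth A N (c : 'I_d -> mode -> R[i]) : (forall i, pbd A N (c i)) ->
  (forall m, \sum_i (m ord0 i)%:~R * c i m = 0) -> div (fun i => synth (c i)) = cst 0.
Proof.
move=> hc c0; apply/funext => phi; rewrite /div /pderive/= sumrN.
have : \sum_i (\sum_(m <- box K) sterm (c i) (tderive i phi) m) @[K --> \oo]
    --> \sum_i synth (c i) (tderive i phi).
  by apply: cvg_fsum => i; exact: synth_cvg (hc i).
rewrite (_ : (fun K => _) = cst 0); last first.
  apply/funext => K; rewrite exchange_big big1//= => m _.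
  rewrite -Re_sum; suff -> : \sum_i c i m * conjc (ft (tderive i phi) m) =
      (\sum_i (m ord0 i)%:~R * c i m) * ((2 * pi)%:C%C * - 'i%C * conjc (ft phi m)).
    by rewrite c0 mul0r.
  rewrite mulr_suml; apply: eq_bigr => i _; rewrite ft_tderive !cjM.
  by rewrite conjc_real cj_i rmorphM rmorph_int; ring.
by move/(cvg_unique _ (cvg_cst _)) => <- //; rewrite oppr0.
Qed.

End Synth.

(** * Littlewood-Paley blocks and Besov norms *)

Section Enorm.
Context {R : realType} {d : nat}.
Implicit Types (x y : 'rV[R]_d) (m : 'rV[int]_d).

Lemma sumsq_ge0 x : 0 <= \sum_i x 0 i ^+ 2.
Proof. by apply: sumr_ge0 => i _; rewrite sqr_ge0. Qed.

Lemma enorm_ge0 x : 0 <= enorm x.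
Proof. exact: sqrtr_ge0. Qed.

Lemma sqr_enorm x : enorm x ^+ 2 = \sum_i x 0 i ^+ 2.
Proof. by rewrite sqr_sqrtr// sumsq_ge0. Qed.

Lemma coord_enorm x i : `|x 0 i| <= enorm x.
Proof.
rewrite -(ler_pXn2r (n := 2)) ?nnegrE ?enorm_ge0// sqr_enorm real_normK ?num_real//.
by rewrite (bigD1 i)//= lerDl sumr_ge0// => j _; rewrite sqr_ge0.
Qed.

Lemma enorm_le_sum x : enorm x <= \sum_i `|x 0 i|.
Proof.
have s0 : 0 <= \sum_i `|x 0 i| by apply: sumr_ge0.
rewrite -(ler_pXn2r (n := 2)) ?nnegrE ?enorm_ge0// sqr_enorm expr2 mulr_suml.
apply: ler_sum => i _; rewrite -real_normK ?num_real// expr2 ler_wpM2l//.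
by rewrite (bigD1 i)//= lerDl sumr_ge0.
Qed.

Lemma enormZ a x : enorm (a *: x) = `|a| * enorm x.
Proof.
rewrite /enorm; under eq_bigr => i _ do rewrite mxE exprMn.
by rewrite -mulr_sumr sqrtrM ?sqr_ge0// sqrtr_sqr.
Qed.

Lemma cauchy_schwarz x y : \sum_i x 0 i * y 0 i <= enorm x * enorm y.
Proof.
set P := \sum_i _.
have [P0|P0] := leP P 0; first by rewrite (le_trans P0)// mulr_ge0 ?enorm_ge0.
rewrite -(ler_pXn2r (n := 2)) ?nnegrE ?mulr_ge0 ?enorm_ge0 ?(ltW P0)//.
rewrite exprMn !sqr_enorm.
set X := \sum_i x 0 i ^+ 2; set Y := \sum_i y 0 i ^+ 2.
have [Y0|Y0] := eqVneq Y 0.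
  have y0 i : y 0 i = 0.
    have := Y0; rewrite /Y => /eqP; rewrite psumr_eq0 => [|j _]; last exact: sqr_ge0.
    by move=> /allP /(_ i); rewrite mem_index_enum sqrf_eq0 => /(_ isT)/eqP.
  by move: P0; rewrite /P big1 ?ltxx// => i _; rewrite y0 mulr0.
have Yp : 0 < Y by rewrite lt_def Y0 sumsq_ge0.
(* the discriminant argument, without division *)
have : 0 <= \sum_i (Y * x 0 i - P * y 0 i) ^+ 2 by apply: sumr_ge0 => i _; rewrite sqr_ge0.
have -> : \sum_i (Y * x 0 i - P * y 0 i) ^+ 2 = Y * (X * Y - P ^+ 2).
  under eq_bigr => i _ do rewrite sqrrB !exprMn.
  rewrite big_split sumrB/= -!mulr_sumr -/X -/Y.
  have -> : \sum_i (Y * x 0 i * (P * y 0 i)) *+ 2 = Y * P * P *+ 2.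
    rewrite sumrMnl [in RHS]/P mulr_sumr; congr (_ *+ 2); apply: eq_bigr => i _.
    by rewrite -!mulrA; congr (_ * _); rewrite mulrCA.
  by rewrite mulr2n; ring.
by rewrite pmulr_rge0// subr_ge0.
Qed.

Lemma enormD x y : enorm (x + y) <= enorm x + enorm y.
Proof.
rewrite -(ler_pXn2r (n := 2)) ?nnegrE ?addr_ge0 ?enorm_ge0//.
rewrite sqrrD !sqr_enorm.
have -> : \sum_i (x + y) 0 i ^+ 2 =
    \sum_i x 0 i ^+ 2 + (\sum_i x 0 i * y 0 i) *+ 2 + \sum_i y 0 i ^+ 2.
  by rewrite -sumrMnl -!big_split; apply: eq_bigr => i _; rewrite mxE sqrrD.
by rewrite lerD2r lerD2l lerMn2r cauchy_schwarz orbT.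
Qed.

Lemma enorm0 : enorm (0 : 'rV[R]_d) = 0.
Proof. by rewrite /enorm big1 ?sqrtr0// => i _; rewrite mxE expr0n. Qed.

Lemma enorm_freq_le m : enorm (freq m : 'rV[R]_d) <= (nrm m)%:R.
Proof.
rewrite (le_trans (enorm_le_sum _))// /nrm natr_sum; apply: ler_sum => i _.
by rewrite mxE natr_absz intr_norm.
Qed.

Lemma nrm_le_enorm m : (nrm m)%:R <= d%:R * enorm (freq m : 'rV[R]_d).
Proof.
rewrite /nrm natr_sum; have -> : d%:R * enorm (freq m) = \sum_(i < d) enorm (freq m : 'rV[R]_d).
  by rewrite sumr_const card_ord mulr_natl.
by apply: ler_sum => i _; have := coord_enorm (freq m) i; rewrite mxE natr_absz intr_norm.
Qed.

Lemma enorm_freqN m : enorm (freq (- m) : 'rV[R]_d) = enorm (freq m).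
Proof. by congr Num.sqrt; apply: eq_bigr => i _; rewrite !mxE intrN sqrrN. Qed.

Lemma enorm_freq_ge1 m : m != 0 -> 1 <= enorm (freq m : 'rV[R]_d).
Proof.
move=> m0; rewrite -(ler_pXn2r (n := 2)) ?nnegrE ?enorm_ge0// expr1n sqr_enorm.
have [i mi] : exists i, m ord0 i != 0.
  apply/existsP; apply: contraNT m0; rewrite negb_exists => /forallP h.
  by apply/eqP/rowP => i; rewrite mxE; apply/eqP/negPn/h.
rewrite (bigD1 i)//= mxE -[leLHS]addr0 lerD//; last by apply: sumr_ge0 => j _; rewrite sqr_ge0.
rewrite -rmorphXn/= -[1]/(1%:~R) ler_int.
have aux (z : int) : z != 0 -> 1 <= z ^+ 2 by move=> z0; nia.
exact: aux.
Qed.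

Lemma cper_enorm (h : 'I_d -> 'rV[R]_d -> R) : (forall i, cper (h i)) ->
  cper (fun x => enorm (\row_i h i x)).
Proof.
move=> ch; have cs : cper (fun x => \sum_i (h i x) ^+ 2).
  by apply: cper_sum => i; under eq_fun do rewrite expr2; exact: cperM.
have -> : (fun x => enorm (\row_i h i x)) = (fun x => Num.sqrt (\sum_i (h i x) ^+ 2)).
  by apply: funext => x; rewrite /enorm; congr Num.sqrt; apply: eq_bigr => i _; rewrite mxE.
case: cs => cs ps; split => [x|m x]; last by rewrite ps.
exact: (@continuous_comp _ _ _ _ Num.sqrt x (cs x) (@sqrt_continuous R _)).
Qed.

End Enorm.

Section TorusNorm.
Context {R : realType} {d : nat}.
Implicit Types (q : \bar R) (g : 'rV[R]_d -> R).

Lemma torus_Lnorm_le q g (B : R) : (1 <= q)%E -> 0 <= B -> cper g ->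
  (forall x, `|g x| <= B) -> (torus_Lnorm q g <= B%:E)%E.
Proof.
move=> q1 B0 cg gB; rewrite /torus_Lnorm unlock.
have mg := measurable_cont (proj1 cg).
case: q q1 => [p p1| _|//].
- have p0 : p != 0 by rewrite gt_eqF// (lt_le_trans ltr01)// -lee_fin.
  have p1' : (1 <= p)%R by rewrite -lee_fin.
  have pp : (0 < p)%R by rewrite (lt_le_trans ltr01).
  apply: (@le_trans _ _ ((B `^ p)%:E `^ p^-1)%E); last first.
    by rewrite poweR_EFin -powRrM mulfV// powRr1.
  have pV : 0 <= p^-1 by rewrite invr_ge0 ltW.
  apply: (gt0_ler_poweR pV); rewrite ?in_itv/= ?leey ?andbT.
  + by apply: integral_ge0 => x _; rewrite lee_fin powR_ge0.
  + by rewrite lee_fin powR_ge0.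
  have -> : (B `^ p)%:E = (\int[cube_prob d]_x cst (B `^ p)%:E x)%E :> \bar R.
    by rewrite integral_cst//= probability_setT mule1.
  apply: ge0_le_integral => //.

  + apply/measurable_EFinP; apply: (@measurableT_comp _ _ _ _ _ _ (fun y : R => y `^ p)).
      exact: measurable_powR.
    exact: (measurable_cont (proj1 (cper_norm cg))).
  + by move=> x _; rewrite lee_fin; apply: ge0_ler_powR; rewrite ?nnegrE// ltW.
- case: ifPn => // _.
  by apply/ess_supP; apply: nearW => x; rewrite /= lee_fin.
Qed.

End TorusNorm.

Section TrigPoly.
Context {R : realType} {d : nat}.
Local Notation mode := 'rV[int]_d.
Implicit Types (s : seq mode) (c : mode -> R[i]).

Definition tpoly s c (x : 'rV[R]_d) : R := complex.Re (\sum_(m <- s) c m * expi m x).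

Lemma cper_tpoly s c : cper (tpoly s c).
Proof.
suff [] : ccper (fun x : 'rV[R]_d => \sum_(m <- s) c m * expi m x) by [].
apply: (@ccper_sum R d _ s (fun m x => c m * expi m x)) => m.
by apply: ccperM; [exact: ccper_cst|exact: ccper_expi].
Qed.

Lemma tpoly_le s c x : `|tpoly s c x| <= 2 * \sum_(m <- s) cab (c m).
Proof.
rewrite (le_trans (Re_le_cab _))// (le_trans (cab_sum _ _ _))// mulr_sumr.
apply: ler_sum => m _; rewrite (le_trans (cabM _ _))// mulrC ler_wpM2r ?cab_ge0//.
exact: cab_expi.
Qed.

Lemma tpolyB s c c' x : tpoly s (fun m => c m - c' m) x = tpoly s c x - tpoly s c' x.
Proof. by rewrite /tpoly -ReB -sumrB; congr complex.Re; apply: eq_bigr => m _; rewrite mulrBl. Qed.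

Lemma tpoly_widen s s' c : uniq s -> uniq s' -> {subset s <= s'} ->
  (forall m, m \in s' -> m \notin s -> c m = 0) -> tpoly s' c = tpoly s c.
Proof.
move=> us us' ss h; apply: funext => x; rewrite /tpoly; congr complex.Re.
by apply: sum_widen => // m ms' ms; rewrite h ?mul0r.
Qed.

End TrigPoly.

Section Blocks.
Context {R : realType} {d : nat}.
Local Notation mode := 'rV[int]_d.
Variable chi : 'rV[R]_d -> R.
Hypothesis hchi : lp_bump chi.
Implicit Types (f : @dist R d) (u : @Defs.vdist R d) (m : mode) (k : nat).

Lemma chi_supp x : chi x != 0 -> enorm x < 1.
Proof. by case: hchi => _ _ h _ x0; apply: h; exact: subset_closure. Qed.

Lemma chi_bounded : exists2 X : R, 0 < X & forall x, `|chi x| <= X.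
Proof.
pose A := [set v : 'rV[R]_d | forall i, `[-1, 1]%classic (v ord0 i)].
have cA : compact A.
  by apply: (@rV_compact R d (fun=> `[-1, 1]%classic)) => i; exact: segment_compact.
have A0 : A !=set0 by exists 0 => i; rewrite /= mxE in_itv/=; apply/andP; split; lra.
have cc : continuous (fun x => `|chi x|).
  have [sc _ _ _] := hchi; have [c0 _] := sc [::] => x.
  exact: (@continuous_comp _ _ _ chi (fun y => `|y|) x (c0 x) (@norm_continuous _ _ _)).
have [c _ hc] := @compact_EVT_max _ R (fun x => `|chi x|) A A0 cA (continuous_subspaceT cc).
exists (`|chi c| + 1) => [|x]; first by rewrite ltr_pwDr.
have [->|x0] := eqVneq (chi x) 0; first by rewrite normr0 addr_ge0.
rewrite (@le_trans _ _ `|chi c|) ?lerDl//; apply: hc; rewrite inE => i /=.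
by rewrite in_itv/= -ler_norml (le_trans (coord_enorm _ _))// ltW// chi_supp.
Qed.

Definition chik k m : R := chi (2 ^- k *: freq m).

Definition psi k m : R := if k is k'.+1 then chik k m - chik k' m else chik 0 m.

Lemma pow2_gt0 k : 0 < 2 ^+ k :> R.
Proof. by rewrite exprn_gt0. Qed.

Lemma chikN k m : chik k (- m) = chik k m.
Proof.
by case: hchi => _ h _ _; apply: h; rewrite !enormZ enorm_freqN.
Qed.

Lemma psiN k m : psi k (- m) = psi k m.
Proof. by case: k => [|k] /=; rewrite !chikN. Qed.

Lemma chik_eq0 k m : 2 ^+ k <= enorm (freq m : 'rV[R]_d) -> chik k m = 0.
Proof.
move=> h; apply/eqP/negPn/negP => /chi_supp; rewrite enormZ ger0_norm ?invr_ge0 ?exprn_ge0//.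
by rewrite mulrC ltr_pdivrMr ?pow2_gt0// mul1r ltNge h.
Qed.

Lemma chik_out k m : m \notin box (2 ^ k) -> chik k m = 0.
Proof.
rewrite mem_box => /forallPn[j]; rewrite -ltnNge => hi.
rewrite chik_eq0// (le_trans _ (coord_enorm _ j))// mxE -intr_norm -natr_absz -natrX ler_nat.
exact: ltnW.
Qed.

Lemma chik_eq1 k m : enorm (freq m : 'rV[R]_d) < 9 / 10 * 2 ^+ k -> chik k m = 1.
Proof.
move=> h; case: hchi => _ _ _; apply; rewrite enormZ ger0_norm ?invr_ge0 ?exprn_ge0//.
by rewrite mulrC ltr_pdivrMr ?pow2_gt0.
Qed.

(** The two cutoffs that define the multiplier are both 1 when 4 |m| < 2^k and both 0
   when |m| >= 2^k; the maximum with 1 accounts for the block 0. *)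
Lemma psi_neq0 k m : psi k m != 0 ->
  enorm (freq m : 'rV[R]_d) < 2 ^+ k /\ 2 ^+ k <= 4 * Num.max 1 (enorm (freq m : 'rV[R]_d)).
Proof.
move=> h; split.
  rewrite ltNge; apply: contraNN h => le; case: k le => [|k] /= le; first by rewrite chik_eq0.
  by rewrite !chik_eq0 ?subrr// (le_trans _ le)// ler_weXn2l// ler1n.
rewrite leNgt; apply: contraNN h; rewrite -ltr_pdivlMl// gt_max => /andP[h1 h2].
case: k h1 h2 => [|[|k]] h1 h2 /=.
- by exfalso; move: h1; rewrite expr0; lra.
- by exfalso; move: h1; rewrite expr1; lra.
by rewrite !chik_eq1 ?subrr//; move: h2; rewrite !exprS; have := pow2_gt0 k; lra.
Qed.

Lemma psi_bounded : exists2 X : R, 0 < X & forall k m, `|psi k m| <= X.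
Proof.
have [X X0 hX] := chi_bounded; exists (2 * X) => [|k m]; first by rewrite mulr_gt0.
have h j m' : `|chik j m'| <= X by exact: hX.
case: k => [|k] /=; first by rewrite (le_trans (h _ _))//; lra.
by rewrite (le_trans (ler_normB _ _))//; have := h k.+1 m; have := h k m; lra.
Qed.

(** A frequency meets at most three consecutive blocks, those around the first
   k0 with max(1, |m|) < 2^k0. *)
Lemma sum_psi_bounded : exists2 X : R, 0 < X & forall n m, \sum_(k < n) `|psi k m| <= X.
Proof.
have [X X0 hX] := psi_bounded; exists (3 * X) => [|n m]; first by rewrite mulr_gt0.
set E := Num.max 1 (enorm (freq m : 'rV[R]_d)).
have [k0 Ek0 k0min] : exists2 k0, E < 2 ^+ k0 & forall k, E < 2 ^+ k -> (k0 <= k)%N.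
  have ex : exists k, E < 2 ^+ k.
    exists (Num.truncn E).+1; apply: lt_trans (truncnS_gt E) _.
    by rewrite -natrX ltr_nat ltn_expl.
  by exists (ex_minn ex); case: ex_minnP.
have one c : \sum_(k < n) ((k == c :> nat)%:R : R) <= 1.
  have [cn|cn] := ltnP c n; last first.
    by rewrite big1 ?ler01// => k _; rewrite (ltn_eqF (leq_trans (ltn_ord k) cn)).
  rewrite (bigD1 (Ordinal cn))//= eqxx big1 ?addr0// => k kc.
  by rewrite (_ : (k == c :> nat) = false)//; apply: contraNF kc => /eqP e; apply/eqP/val_inj.
have step (k : 'I_n) : `|psi k m| <= X * ((k == k0.-1 :> nat)%:R + (k == k0 :> nat)%:R + (k == k0.+1 :> nat)%:R).
  have [->|/psi_neq0 [h1 h2]] := eqVneq (psi k m) 0.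
    by rewrite normr0 mulr_ge0 ?(ltW X0)// !addr_ge0.
  rewrite -/E in h2.
  have kk : (k < k0.+2)%N.
    rewrite -(ltr_eXn2l (x := 2 : R)) ?ltr1n// !exprS.
    by move: h2 Ek0; rewrite -/E; set a := 2 ^+ k0; set b := 2 ^+ k; lra.
  have kk' : (k0 <= k.+1)%N.
    by apply: k0min; rewrite gt_max exprS; have := @exprn_ege1 R k 2 _; rewrite ler1n => /(_ isT); lra.
  have /orP[/orP[]|] : (k == k0.-1 :> nat) || (k == k0 :> nat) || (k == k0.+1 :> nat) by lia.
  - move=> ->; rewrite (le_trans (hX k m))// ler_peMr ?(ltW X0)//.
    by rewrite -addrA lerDl addr_ge0.
  - move=> ->; rewrite (le_trans (hX k m))// ler_peMr ?(ltW X0)//.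
    by rewrite addrAC lerDr addr_ge0.
  - move=> ->; rewrite (le_trans (hX k m))// ler_peMr ?(ltW X0)//.
    by rewrite lerDr addr_ge0.
apply: (@le_trans _ _ (\sum_(k < n) X * ((k == k0.-1 :> nat)%:R +
    (k == k0 :> nat)%:R + (k == k0.+1 :> nat)%:R))); first exact: ler_sum.
rewrite -mulr_sumr mulrC ler_pM2r// !big_split/=.
have := one k0.-1; have := one k0; have := one k0.+1; lra.
Qed.

Lemma lp_leE k f x : lp_le chi k f x =
  tpoly (box (2 ^ k)) (fun m => real_mul (chik k m) (fcoef f m)) x.
Proof.
rewrite /lp_le /tpoly; congr complex.Re.
rewrite -(@fsbig_widen _ _ _ _ [set m : mode | forall i, (`|m ord0 i| <= 2 ^ k)%N])//; last first.
  move=> m /= [_ hm]; rewrite -/(chik k m) chik_out ?real_mulE ?mul0r//.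
  by apply/negP; rewrite mem_box => /forallP.
by rewrite (fsum_box (V := R[i])); apply: eq_bigr => m _; rewrite /real_mul mulrA.
Qed.

Lemma lpE k f x : lp chi k f x =
  tpoly (box (2 ^ k)) (fun m => real_mul (psi k m) (fcoef f m)) x.
Proof.
case: k => [|k] /=; rewrite lp_leE// lp_leE.
rewrite -(@tpoly_widen _ _ (box (2 ^ k)) (box (2 ^ k.+1))) ?box_uniq//.
- rewrite -tpolyB; congr tpoly; apply: funext => m.
  by rewrite /real_mul rmorphB mulrBl.
- by apply: box_mono; rewrite leq_exp2l.
by move=> m _ mk; rewrite chik_out ?real_mulE ?mul0r.
Qed.

Lemma cper_lp k f : cper (lp chi k f).
Proof. by rewrite (funext (lpE k f)); exact: cper_tpoly. Qed.

Lemma cper_lp_enorm k u : cper (fun x => enorm (\row_i lp chi k (u i) x)).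
Proof. by apply: cper_enorm => i; exact: cper_lp. Qed.

Lemma lp_abs_le k f x (M : mode -> R) : (forall m, cab (fcoef f m) <= M m) ->
  `|lp chi k f x| <= 2 * \sum_(m <- box (2 ^ k)) `|psi k m| * M m.
Proof.
move=> h; rewrite lpE (le_trans (tpoly_le _ _ _))// ler_pM2l//.
by apply: ler_sum => m _; rewrite cab_real_mul ler_wpM2l.
Qed.

(** The l^1 norm over the blocks dominates every l^r norm, r in [1, oo]. *)
Lemma besov_norm_le (s : R) q r u (l : nat -> R) (S : R) : (1 <= r)%E ->
  (forall k, 0 <= l k) -> (forall k, (lp_Lnorm chi q k u <= (l k)%:E)%E) ->
  (forall n, \sum_(k < n) (2 ^+ k) `^ s * l k <= S) ->
  (besov_norm chi s q r u <= S%:E)%E.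
Proof.
move=> r1 l0 hl hS.
have S0 : 0 <= S by have := hS 0%N; rewrite big_ord0.
have lS k : (2 ^+ k) `^ s * l k <= S.
  rewrite (le_trans _ (hS k.+1))// big_ord_recr/= lerDr sumr_ge0// => i _.
  by rewrite mulr_ge0 ?powR_ge0.
case: r r1 => [r r1|_|//]; last first.
  apply: ge_ereal_sup => _ [k _ <-]; apply: (@le_trans _ _ (((2 ^+ k) `^ s)%:E * (l k)%:E)%E).
    by rewrite lee_wpmul2l ?lee_fin ?powR_ge0.
  by rewrite -EFinM lee_fin.
have r0 : (0 < r)%R by rewrite (lt_le_trans ltr01)// -lee_fin.
have r1' : (1 <= r)%R by rewrite -lee_fin.
have rV : 0 <= r^-1 by rewrite invr_ge0 ltW.
rewrite /besov_norm.
have -> : S%:E = ((S `^ r)%:E `^ r^-1)%E by rewrite poweR_EFin -powRrM mulfV ?gt_eqF// powRr1.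
have t0 k : (0 <= ((2 ^+ k) `^ (s * r))%:E * lp_Lnorm chi q k u `^ r)%E.
  by rewrite mule_ge0 ?lee_fin ?powR_ge0 ?poweR_ge0.
apply: (gt0_ler_poweR rV); rewrite ?in_itv/= ?leey ?andbT.
- exact: nneseries_ge0.
- by rewrite lee_fin powR_ge0.
apply: lime_le; first exact: is_cvg_nneseries.
apply: nearW => n; rewrite big_mkord.
apply: (@le_trans _ _ (\sum_(k < n) (((2 ^+ k) `^ s * l k) `^ r)%:E)%E).
  apply: lee_sum => k _.
  rewrite powRM ?powR_ge0// -powRrM EFinM lee_wpmul2l ?lee_fin ?powR_ge0// -poweR_EFin.
  apply: (gt0_ler_poweR (ltW r0)); rewrite ?in_itv/= ?leey ?andbT ?lee_fin//.
  exact: Lnorm_ge0.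
rewrite sumEFin lee_fin.
have a0 k : 0 <= (2 ^+ k) `^ s * l k by rewrite mulr_ge0 ?powR_ge0.
(* a^r <= a S^(r-1) when 0 <= a <= S: this is how l^1 dominates l^r *)
have ar k : ((2 ^+ k) `^ s * l k) `^ r <= (2 ^+ k) `^ s * l k * S `^ (r - 1).
  move: (a0 k) (lS k); set a := _ * l k => a0k aS.
  have [->|an0] := eqVneq a 0; first by rewrite mul0r powR0// gt_eqF.
  have -> : a `^ r = a * a `^ (r - 1).
    by rewrite -{2}[a]powRr1// -powRD ?subrKC// an0 implybT.
  by rewrite ler_wpM2l// ge0_ler_powR ?nnegrE// subr_ge0.
apply: (@le_trans _ _ (\sum_(k < n) (2 ^+ k) `^ s * l k * S `^ (r - 1))); first exact: ler_sum.
rewrite -mulr_suml.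
have [S00|Sn0] := eqVneq S 0.
  rewrite [X in _ <= X `^ _]S00 [leRHS]powR0 ?gt_eqF//.
  by apply: mulr_le0_ge0; [rewrite (le_trans (hS n))// S00|exact: powR_ge0].
have -> : S `^ r = S * S `^ (r - 1).
  by rewrite -{2}[S]powRr1// -powRD ?subrKC// Sn0 implybT.
by rewrite ler_wpM2r ?powR_ge0.
Qed.

(** A block is bounded pointwise by the l^1 norm of its coefficients, and a frequency
   meets boundedly many blocks. *)
Lemma besov_norm_l1 : exists2 C : R, 0 < C & forall (theta : R) q r u (M : mode -> R) (S : R),
  0 <= theta -> (1 <= q)%E -> (1 <= r)%E -> (forall m, 0 <= M m) ->
  (forall i m, cab (fcoef (u i) m) <= M m) ->
  (forall K, \sum_(m <- box K) jap m `^ (- theta) * M m <= S) ->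
  (besov_norm chi (- theta) q r u <= (C * (1 + d%:R) `^ theta * S)%:E)%E.
Proof.
have [X X0 hX] := sum_psi_bounded.
exists ((1 + d%:R) * 2 * X) => [|theta q r u M S t0 q1 r1 M0 hM hS]; first by rewrite !mulr_gt0// ltr_wpDr.
have d0 : 0 <= d%:R :> R by [].
have d1 : 0 < 1 + d%:R :> R by lra.
pose l k : R := d%:R * (2 * \sum_(m <- box (2 ^ k)) `|psi k m| * M m).
have s0 k : 0 <= \sum_(m <- box (2 ^ k)) `|psi k m| * M m by apply: sumr_ge0 => m _; rewrite mulr_ge0.
have l0 k : 0 <= l k by rewrite !mulr_ge0.
apply: (@besov_norm_le _ _ _ _ l) => //.
  move=> k; apply: torus_Lnorm_le => //; first exact: cper_lp_enorm.
  move=> x; rewrite ger0_norm ?enorm_ge0// (le_trans (enorm_le_sum _))//.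
  have -> : l k = \sum_(i < d) (2 * \sum_(m <- box (2 ^ k)) `|psi k m| * M m).
    by rewrite sumr_const card_ord /l mulr_natl.
  by apply: ler_sum => i _; rewrite mxE lp_abs_le.
move=> n.
have step (k : 'I_n) : (2 ^+ k) `^ (- theta) * l k <= d%:R * 2 * (1 + d%:R) `^ theta *
    \sum_(m <- box (2 ^ n)) `|psi k m| * (jap m `^ (- theta) * M m).
  have -> : (2 ^+ k) `^ (- theta) * l k = d%:R * 2 *
      \sum_(m <- box (2 ^ k)) `|psi k m| * ((2 ^+ k) `^ (- theta) * M m).
    rewrite /l mulrCA -[RHS]mulrA; congr (_ * _); rewrite mulrCA; congr (_ * _).
    by rewrite mulr_sumr; apply: eq_bigr => m _; ring.
  rewrite -!mulrA ler_wpM2l// ler_wpM2l// mulr_sumr.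
  apply: (@le_trans _ _ (\sum_(m <- box (2 ^ k)) (1 + d%:R) `^ theta *
      (`|psi k m| * (jap m `^ (- theta) * M m)))); last first.
    apply: ler_sum_sub; [exact: box_uniq..| |].
      by apply: box_mono; rewrite leq_exp2l// ltnW.
    by move=> m; rewrite !mulr_ge0 ?powR_ge0.
  apply: ler_sum => m _; have [->|/psi_neq0 [h1 _]] := eqVneq (psi k m) 0.
    by rewrite normr0 !mul0r mulr0.
  rewrite [leRHS]mulrCA ler_wpM2l// mulrA ler_wpM2r// !powRN.
  (* on the support of the multiplier the weights (2^k)^(-theta) and jap^(-theta) compare *)
  have jk : jap m <= (1 + d%:R) * 2 ^+ k :> R.
    rewrite /jap natrD; apply: (@le_trans _ _ (2 ^+ k + d%:R * 2 ^+ k)); last by rewrite mulrDl mul1r.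
    rewrite lerD ?exprn_ege1 ?ler1n// (le_trans (nrm_le_enorm m))//.
    by rewrite ler_wpM2l// ltW.
  rewrite -[leLHS]mul1r ler_pdivrMr ?powR_gt0 ?exprn_gt0//.
  rewrite -mulrA mulrCA -powRM ?exprn_ge0 ?(ltW d1)// mulrC ler_pdivlMr ?powR_gt0 ?jap_gt0// mul1r.
  by rewrite ge0_ler_powR ?nnegrE ?jap_ge0 ?mulr_ge0 ?exprn_ge0// ltW.
apply: (@le_trans _ _ (\sum_(k < n) (d%:R * 2 * (1 + d%:R) `^ theta *
    \sum_(m <- box (2 ^ n)) `|psi k m| * (jap m `^ (- theta) * M m)))).
  by apply: ler_sum => k _; exact: step.
rewrite -mulr_sumr exchange_big/=.
apply: (@le_trans _ _ (d%:R * 2 * (1 + d%:R) `^ theta * (X * S))).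
  rewrite ler_wpM2l ?mulr_ge0 ?powR_ge0//.
  apply: (@le_trans _ _ (X * \sum_(m <- box (2 ^ n)) jap m `^ (- theta) * M m)); last first.
    by rewrite ler_pM2l.
  rewrite mulr_sumr; apply: ler_sum => m _.
  by rewrite -mulr_suml ler_wpM2r ?mulr_ge0 ?powR_ge0// hX.
have S0 : 0 <= S.
  by rewrite (le_trans _ (hS 0%N))// sumr_ge0// => m _; rewrite mulr_ge0 ?powR_ge0.
rewrite [leRHS](_ : _ = (1 + d%:R) * 2 * (1 + d%:R) `^ theta * (X * S)); last by ring.
by rewrite ler_wpM2r ?mulr_ge0 ?(ltW X0)// ler_wpM2r ?powR_ge0// ler_wpM2r//; lra.
Qed.

End Blocks.

(** * Smooth functions of time that are constant before time zero *)

Section TimeFunctions.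
Context {R : realType}.
Implicit Types (f g : R -> R) (t : R) (n k : nat).

Fixpoint Cn n f : Prop :=
  if n is n'.+1 then (forall t, derivable f t 1) /\ Cn n' (derive1 f) else continuous f.

Lemma Cn_continuous n f : Cn n f -> continuous f.
Proof.
case: n => [//|n] [df _] t; apply: differentiable_continuous.
by apply/derivable1_diffP; exact: df.
Qed.

Lemma Cn_pred n f : Cn n.+1 f -> Cn n f.
Proof.
elim: n f => [|n IH] f; first exact: (@Cn_continuous 1).
by move=> [df cf]; split => //; exact: IH.
Qed.

Lemma derive1_ext f (df : R -> R) : (forall t, is_derive t (1 : R) f (df t)) -> derive1 f = df.
Proof. by move=> h; apply/funext => t; rewrite derive1E; exact: derive_val. Qed.

Lemma derivable_is f : (forall t, derivable f t 1) -> forall t, is_derive t (1 : R) f (derive1 f t).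
Proof. by move=> h t; rewrite derive1E; exact: DeriveDef. Qed.

Lemma Cn_cst n (a : R) : Cn n (fun=> a).
Proof.
elim: n a => [|n IH] a; first exact: cst_continuous.
split => [t|]; first exact: derivable_cst.
by rewrite (@derive1_ext _ (fun=> 0))// => t; exact: is_derive_cst.
Qed.

Lemma CnD n f g : Cn n f -> Cn n g -> Cn n (fun t => f t + g t).
Proof.
elim: n f g => [|n IH] f g; first by move=> cf cg t; exact: continuousD (cf t) (cg t).
move=> [df cf] [dg cg]; split=> [t|]; first exact: derivableD (df t) (dg t).
rewrite (derive1_ext (fun t => is_deriveD (derivable_is df t) (derivable_is dg t))).
exact: IH.
Qed.

Lemma CnM n f g : Cn n f -> Cn n g -> Cn n (fun t => f t * g t).
Proof.
elim: n f g => [|n IH] f g; first by move=> cf cg t; exact: continuousM (cf t) (cg t).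
move=> cf' cg'; have [cf0 cg0] := (Cn_pred cf', Cn_pred cg').
have [[df cf] [dg cg]] := (cf', cg').
split=> [t|]; first exact: derivableM (df t) (dg t).
rewrite (derive1_ext (fun t => is_deriveM (derivable_is df t) (derivable_is dg t))).
by apply: CnD; apply: IH.
Qed.

(** Smooth functions of time that are constant on t <= 0. They form an algebra
   closed under differentiation, so that whatever the cascade computes from such
   functions is again constant before time 0. *)
Definition tfun f := (forall n, Cn n f) /\ forall t, t <= 0 -> f t = f 0.

Lemma tfun_continuous f : tfun f -> continuous f.
Proof. by case=> /(_ 0%N). Qed.

Lemma tfun_derivable f : tfun f -> forall t, derivable f t 1.
Proof. by case=> /(_ 1%N) []. Qed.

Lemma tfun_is_derive f : tfun f -> forall t, is_derive t (1 : R) f (derive1 f t).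
Proof. by move=> /tfun_derivable; exact: derivable_is. Qed.

Lemma tfun_cst (a : R) : tfun (fun=> a).
Proof. by split => // n; exact: Cn_cst. Qed.

Lemma tfunD f g : tfun f -> tfun g -> tfun (fun t => f t + g t).
Proof.
by move=> [cf f0] [cg g0]; split=> [n|t t0]; [exact: CnD|rewrite f0 ?g0].
Qed.

Lemma tfunM f g : tfun f -> tfun g -> tfun (fun t => f t * g t).
Proof.
by move=> [cf f0] [cg g0]; split=> [n|t t0]; [exact: CnM|rewrite f0 ?g0].
Qed.

Lemma tfunN f : tfun f -> tfun (fun t => - f t).
Proof.
move=> tf; rewrite (_ : (fun t => _) = fun t => -1 * f t); first by apply: tfunM => //; exact: tfun_cst.
by apply/funext => t; rewrite mulN1r.
Qed.

(** At t = 0 by continuity of the derivative from the left. *)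
Lemma tfun_derive_eq0 f t : tfun f -> t <= 0 -> derive1 f t = 0.
Proof.
move=> tf; have [cf f0] := tf; have cdf : continuous (derive1 f) by case: (cf 1%N).
have neg (s : R) : s < 0 -> derive1 f s = 0.
  move=> s0; rewrite derive1E; apply: derive_val.
  apply: (@near_eq_is_derive _ _ _ (cst (f 0))).
  by near=> z; rewrite /cst f0//; apply: ltW; near: z; exact: lt_nbhsl.
rewrite le_eqVlt => /orP[/eqP ->|]; last exact: neg.
have h1 : derive1 f (- k.+1%:R^-1) @[k --> \oo] --> derive1 f 0.
  apply: continuous_cvg; first exact: cdf.
  by rewrite -[X in _ --> X]oppr0; apply: cvgN; exact: cvg_harmonic.
have h2 : derive1 f (- k.+1%:R^-1) @[k --> \oo] --> (0 : R).
  rewrite (_ : (fun k => _) = cst 0); first exact: cvg_cst.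
  by apply/funext => k; rewrite neg// oppr_lt0 invr_gt0.
exact: cvg_unique h1 h2.
Unshelve. all: by end_near. Qed.

Lemma tfun_derive f : tfun f -> tfun (derive1 f).
Proof.
move=> tf; split=> [n|t t0]; first by case: tf => /(_ n.+1) [].
by rewrite !tfun_derive_eq0.
Qed.

Lemma tfun_bounded f : tfun f -> exists B : R, forall t, -1 <= t <= 1 -> `|f t| <= B.
Proof.
move=> /tfun_continuous cf.
have cn : continuous (fun t => `|f t|).
  by move=> t; apply: continuous_comp; [exact: cf|exact: norm_continuous].
have [c _ hc] := @EVT_max R (fun t => `|f t|) (-1) 1 (ltac:(lra)) (continuous_subspaceT cn).
by exists `|f c| => t ht; apply: hc; rewrite in_itv.
Qed.

(** ** A smooth function vanishing exactly on the negative half-line *)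

(** The family t^(-k) exp(-1/t), extended by 0: it is closed under
   differentiation up to linear combinations, hence consists of smooth functions. *)
Definition flatk (k : nat) (t : R) : R := if t <= 0 then 0 else t^-1 ^+ k * expR (- t^-1).

(** The linear bound gives continuity and, applied to k + 1, differentiability at 0. *)
Lemma flatk_le k t : 0 < t -> `|flatk k t| <= (k.+1%:R) ^+ k.+1 * t.
Proof.
move=> t0; have tV : 0 <= t^-1 by rewrite invr_ge0 ltW.
rewrite /flatk [t <= 0]leNgt t0/= ger0_norm ?mulr_ge0 ?expR_ge0 ?exprn_ge0//.
rewrite expRN; have k0 : 0 < k.+1%:R :> R by rewrite ltr0n.
(* exp(x) = exp(x/(k+1))^(k+1) >= (x/(k+1))^(k+1) *)
have h : (t^-1 / k.+1%:R) ^+ k.+1 <= expR t^-1.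
  have -> : expR t^-1 = expR (t^-1 / k.+1%:R) ^+ k.+1.
    by rewrite -expRM_natl mulrC divfK// gt_eqF.
  rewrite lerXn2r ?nnegrE ?expR_ge0 ?divr_ge0//.
  by rewrite (le_trans _ (expR_ge1Dx _))// lerDr.
have x0 : 0 < (t^-1 / k.+1%:R) ^+ k.+1 by rewrite exprn_gt0// divr_gt0// invr_gt0.
apply: (@le_trans _ _ (t^-1 ^+ k * ((t^-1 / k.+1%:R) ^+ k.+1)^-1)).
  by rewrite ler_wpM2l ?exprn_ge0// lef_pV2 ?posrE ?expR_gt0.
rewrite expr_div_n invf_div !exprVn invrK [t ^+ k.+1]exprSr.
by rewrite mulrCA mulKf// expf_neq0// gt_eqF.
Qed.

Lemma is_derive_flatk k t : is_derive t (1 : R) (flatk k) (flatk k.+2 t - k%:R * flatk k.+1 t).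
Proof.
have [t0|t0|->] := ltgtP t 0.
- rewrite /flatk (ltW t0) mulr0 subr0.
  apply: (@near_eq_is_derive _ _ _ (cst 0)).
  by near=> z; rewrite /flatk/= ifT//; apply: ltW; near: z; exact: lt_nbhsl.
- have tn0 : t != 0 by rewrite gt_eqF.
  apply: (@near_eq_is_derive _ _ _ (fun s : R => s^-1 ^+ k * expR (- s^-1))).
    by near=> z; rewrite /flatk ifF//; apply/negbTE; rewrite -ltNge; near: z; exact: lt_nbhsr.
  rewrite /flatk [t <= 0]leNgt t0/=.
  have Di := @is_deriveV R id t 1 1 tn0 (is_derive_id _ _).
  have DX := is_deriveX k Di.
  have De := @is_derive1_comp R expR (fun s : R => - s^-1) t _ _ (is_derive_expR (- t^-1)) (is_deriveN Di).
  rewrite (_ : (fun s : R => _) = ([eta GRing.inv] ^+ k) * (expR \o (fun s : R => - s^-1))); last first.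
    by apply/funext => s; rewrite !fctE.
  apply: (is_derive_eq (is_deriveM DX De)).
  rewrite /GRing.scale/= !fctE mulr1 opprK -exprVn; case: k {DX} => [|k].
    by rewrite mul0r !mul0r mulr0 addr0 subr0 !expr0 !mul1r mulrC.
  by rewrite -pred_Sn !exprS; ring.
- rewrite /flatk lexx mulr0 subr0 -/(flatk k).
  have cv : (fun h : R => h^-1 *: ((flatk k \o shift 0) (h *: (1 : R)) - flatk k 0)) @ 0^' --> (0 : R).
    apply/cvgrPdist_le => e e0; near=> h.
    have hn0 : h != 0 by near: h; exact: nbhs_dnbhs_neq.
    rewrite sub0r normrN /= addr0 [h *: 1]mulr1 [flatk k 0]/flatk lexx subr0.
    have [h0|h0] := leP h 0.
      by rewrite /flatk h0 scaler0 normr0 ltW.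
    have -> : h^-1 *: flatk k h = flatk k.+1 h.
      by rewrite /flatk leNgt h0/= /GRing.scale/= exprS mulrA.
    rewrite (le_trans (flatk_le _ h0))// -ler_pdivlMl ?exprn_gt0//.
    apply: ltW; apply: le_lt_trans (ler_norm h) _; near: h; apply: dnbhs0_lt.
    by rewrite mulr_gt0// invr_gt0 exprn_gt0.
  by apply: DeriveDef; [apply/cvg_ex; exists 0|exact: cvg_lim].
Unshelve. all: by end_near. Qed.

Lemma flatk_continuous k : continuous (flatk k).
Proof.
move=> t; apply: differentiable_continuous; apply/derivable1_diffP.
by have [] := is_derive_flatk k t.
Qed.

Lemma flatk_Cn n k : Cn n (flatk k).
Proof.
elim: n k => [|n IH] k; first exact: flatk_continuous.
split => [t|]; first by have [] := is_derive_flatk k t.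
rewrite (derive1_ext (is_derive_flatk k)).
have h := CnM (Cn_cst n (- k%:R)) (IH k.+1).
have := CnD (IH k.+2) h; congr (Cn n _).
by apply/funext => t; rewrite mulNr.
Qed.

Lemma tfun_flat : tfun (flatk 0).
Proof.
split => [n|t t0]; first exact: flatk_Cn.
by rewrite /flatk t0 lexx.
Qed.

Lemma flat1_neq0 : flatk 0 1 != 0.
Proof. by rewrite /flatk ler10 mulf_neq0// ?gt_eqF ?expR_gt0// expr0 invr1 ltr01. Qed.

(** ** Complex-valued functions of time *)

Implicit Types (u v : R -> R[i]).

Definition ctf u := tfun (fun t => complex.Re (u t)) /\ tfun (fun t => complex.Im (u t)).

Definition cder u t : R[i] :=
  Complex (derive1 (fun t => complex.Re (u t)) t) (derive1 (fun t => complex.Im (u t)) t).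

Lemma ctf_cst (a : R[i]) : ctf (fun=> a).
Proof. by split; exact: tfun_cst. Qed.

Lemma ctfD u v : ctf u -> ctf v -> ctf (fun t => u t + v t).
Proof.
move=> [ru iu] [rv iv]; split.
  by under eq_fun do rewrite ReD; exact: tfunD.
by under eq_fun do rewrite ImD; exact: tfunD.
Qed.

Lemma ctfM u v : ctf u -> ctf v -> ctf (fun t => u t * v t).
Proof.
move=> [ru iu] [rv iv]; split.
  by under eq_fun do rewrite ReM; apply: tfunD; [exact: tfunM|apply: tfunN; exact: tfunM].
by under eq_fun do rewrite ImM; apply: tfunD; exact: tfunM.
Qed.

Lemma ctfZ (a : R[i]) u : ctf u -> ctf (fun t => a * u t).
Proof. by move=> cu; apply: ctfM => //; exact: ctf_cst. Qed.

Lemma ctf_sum (I : Type) (s : seq I) (u : I -> R -> R[i]) :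
  (forall i, ctf (u i)) -> ctf (fun t => \sum_(i <- s) u i t).
Proof.
move=> h; elim: s => [|i s IH].
  by under eq_fun do rewrite big_nil; exact: ctf_cst.
by under eq_fun do rewrite big_cons; exact: ctfD.
Qed.

Lemma ctf_conj u : ctf u -> ctf (fun t => conjc (u t)).
Proof.
move=> [ru iu]; split.
  by rewrite (_ : (fun t => _) = fun t => complex.Re (u t))//; apply/funext => t; case: (u t).
by rewrite (_ : (fun t => _) = fun t => - complex.Im (u t)); [exact: tfunN|apply/funext => t; case: (u t)].
Qed.

Lemma ctf_cder u : ctf u -> ctf (cder u).
Proof. by move=> [ru iu]; split => /=; exact: tfun_derive. Qed.

Lemma ctf_const u t : ctf u -> t <= 0 -> u t = u 0.
Proof. by move=> [[_ ru] [_ iu]] t0; apply: complex_ext; [exact: ru|exact: iu]. Qed.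

Lemma ctf_bounded u : ctf u -> exists2 B, 0 <= B & forall t, -1 <= t <= 1 -> cab (u t) <= B.
Proof.
move=> [/tfun_bounded [B1 h1] /tfun_bounded [B2 h2]]; exists (B1 + B2) => [|t ht].
  have t0 : -1 <= (0 : R) <= 1 by rewrite oppr_le0 ler01.
  by rewrite addr_ge0// ?(le_trans (normr_ge0 _) (h1 _ t0)) ?(le_trans (normr_ge0 _) (h2 _ t0)).
by rewrite lerD ?h1 ?h2.
Qed.

Lemma cder_cst (a : R[i]) : cder (fun=> a) = fun=> 0.
Proof.
by apply/funext => t; rewrite /cder !(derive1_ext (fun t => is_derive_cst _ t (1 : R))).
Qed.

Lemma cderD u v t : ctf u -> ctf v -> cder (fun t => u t + v t) t = cder u t + cder v t.
Proof.
move=> [ru iu] [rv iv]; apply: complex_ext; rewrite ?ReD ?ImD/=.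
  under eq_fun do rewrite ReD.
  by rewrite (derive1_ext (fun t => is_deriveD (tfun_is_derive ru t) (tfun_is_derive rv t))).
under eq_fun do rewrite ImD.
by rewrite (derive1_ext (fun t => is_deriveD (tfun_is_derive iu t) (tfun_is_derive iv t))).
Qed.

Lemma is_derive_lin f g (a b : R) t : tfun f -> tfun g ->
  derive1 (fun t => a * f t + b * g t) t = a * derive1 f t + b * derive1 g t.
Proof.
move=> tf tg.
have h s : is_derive s (1 : R) (fun t => a * f t + b * g t) (a * derive1 f s + b * derive1 g s).
  exact: is_deriveD (is_deriveZ a (tfun_is_derive tf s)) (is_deriveZ b (tfun_is_derive tg s)).
by rewrite (derive1_ext h).
Qed.

Lemma cderZ (a : R[i]) u t : ctf u -> cder (fun t => a * u t) t = a * cder u t.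
Proof.
move=> [ru iu]; apply: complex_ext; rewrite ?ReM ?ImM/=.
  by under eq_fun do rewrite ReM -mulNr; rewrite is_derive_lin// mulNr.
by under eq_fun do rewrite ImM; rewrite is_derive_lin.
Qed.

Lemma cder_sum (I : Type) (s : seq I) (u : I -> R -> R[i]) t : (forall i, ctf (u i)) ->
  cder (fun t => \sum_(i <- s) u i t) t = \sum_(i <- s) cder (u i) t.
Proof.
move=> h; elim: s => [|i s IH].
  by under eq_fun do rewrite big_nil; rewrite big_nil cder_cst.
under eq_fun do rewrite big_cons; rewrite big_cons cderD ?IH//; exact: ctf_sum.
Qed.

Lemma cder_conj u t : ctf u -> cder (fun t => conjc (u t)) t = conjc (cder u t).
Proof.
move=> [ru iu]; rewrite /cder; congr Complex.
  by congr (derive1 _ t); apply/funext => s; case: (u s).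
have -> : (fun t => complex.Im (conjc (u t))) = (fun t => - complex.Im (u t)).
  by apply/funext => s; case: (u s).
by rewrite (derive1_ext (fun t => is_deriveN (tfun_is_derive iu t))).
Qed.

End TimeFunctions.

(** * Cancelling one Fourier mode of the error *)

Section ResonantPair.
Context {R : realType} {d : nat}.
Local Notation mode := 'rV[int]_d.
Local Notation C := R[i].
Implicit Types (m a e : mode).

Definition zc m (i : 'I_d) : C := (m ord0 i)%:~R.

Definition dotz m e : int := \sum_i m ord0 i * e ord0 i.

Lemma dotzC m e : dotz m e = dotz e m.
Proof. by apply: eq_bigr => i _; rewrite mulrC. Qed.

Lemma dotzE m e : \sum_i zc m i * zc e i = (dotz m e)%:~R.
Proof. by rewrite /dotz rmorph_sum; apply: eq_bigr => i _; rewrite rmorphM. Qed.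

Lemma dotz_gt0 m : m != 0 -> 0 < dotz m m.
Proof.
move=> m0; have [i mi] : exists i, m ord0 i != 0.
  apply/existsP; apply: contraNT m0; rewrite negb_exists => /forallP h.
  by apply/eqP/rowP => i; rewrite mxE; apply/eqP/negPn/h.
rewrite /dotz (bigD1 i)//= ltr_wpDr// ?sumr_ge0// => [j _|]; first by rewrite -expr2 sqr_ge0.
by rewrite -expr2 exprn_even_gt0.
Qed.

Lemma dotzDr m a e : dotz m (a + e) = dotz m a + dotz m e.
Proof. by rewrite /dotz -big_split; apply: eq_bigr => i _; rewrite mxE mulrDr. Qed.

(** Rotate by a right angle in the plane of two coordinates, one of them nonzero. *)
Lemma ortho_exists m : (2 <= d)%N -> m != 0 ->
  exists e, [/\ e != 0, dotz m e = 0 & (nrm e <= nrm m)%N].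
Proof.
move=> d2 m0; have [i mi] : exists i, m ord0 i != 0.
  apply/existsP; apply: contraNT m0; rewrite negb_exists => /forallP h.
  by apply/eqP/rowP => i; rewrite mxE; apply/eqP/negPn/h.
have [j ji] : exists j, j != i.
  have d0 : (0 < d)%N by exact: leq_trans d2.
  have [i0|i0] := eqVneq i (Ordinal d0); last by exists (Ordinal d0); rewrite eq_sym.
  by exists (Ordinal d2); rewrite i0.
pose e : mode := \row_k (if k == j then m ord0 i else if k == i then - m ord0 j else 0).
have ei k : e ord0 k = if k == j then m ord0 i else if k == i then - m ord0 j else 0.
  by rewrite mxE.
exists e; split.
- by apply: contra_neq mi => e0; have := ei j; rewrite eqxx e0 mxE.
- rewrite /dotz (bigD1 i)//= (bigD1 j)//= big1 => [|k /andP[ki kj]].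
    by rewrite !ei eqxx eq_sym (negPf ji) eqxx addr0; ring.
  by rewrite ei (negPf ki) (negPf kj) mulr0.
rewrite /nrm (bigD1 i)//= (bigD1 j)//= big1 => [|k /andP[ki kj]].
  rewrite !ei eqxx eq_sym (negPf ji) eqxx addn0.
  rewrite [leqRHS](bigD1 i)//= [X in (_ <= _ + X)%N](bigD1 j)//= abszN addnC addnA leq_addr//.
by rewrite ei (negPf ki) (negPf kj).
Qed.

(** The amplitudes carried by the frequencies p = L (m + e) and m - p, where e is
   orthogonal to m. The first one, ampA, is orthogonal to p and satisfies
   m . ampA = 1. The second one, ampB, is linear in the error E: the
   multiple of m, which the projection removes from the interaction, makes
   m . ampB = kap, and the value of kap makes ampB orthogonal to m - p. Both are
   bounded independently of L. *)
Definition ampA m e i : C := zc m i / (dotz m m)%:~R - zc e i / (dotz e e)%:~R.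

Definition kap (L : nat) e (E : 'I_d -> C) : C := L%:R / (1 - L.*2%:R) * \sum_j E j * zc e j.

Definition ampB L m e (E : 'I_d -> C) i : C :=
  E i - kap L e E * ampA m e i + 2 * kap L e E / (dotz m m)%:~R * zc m i.

Definition pair_freq L m e : mode := (m + e) *+ L.

Lemma zc_pair L m e i : zc (pair_freq L m e) i = L%:R * (zc m i + zc e i).
Proof. by rewrite /zc /pair_freq mulmxnE mxE rmorphMn -mulr_natl rmorphD. Qed.

Lemma zcB m a i : zc (m - a) i = zc m i - zc a i.
Proof. by rewrite /zc !mxE rmorphB. Qed.

Lemma zcN m i : zc (- m) i = - zc m i.
Proof. by rewrite /zc !mxE rmorphN. Qed.

Section Algebra.
Variables (L : nat) (m e : mode) (E : 'I_d -> C).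
Hypotheses (m0 : m != 0) (e0 : e != 0) (me : dotz m e = 0).
Hypothesis mE : \sum_i zc m i * E i = 0.

Let mm0 : ((dotz m m)%:~R : C) != 0.
Proof. by rewrite intr_eq0 gt_eqF// dotz_gt0. Qed.

Let ee0 : ((dotz e e)%:~R : C) != 0.
Proof. by rewrite intr_eq0 gt_eqF// dotz_gt0. Qed.

Lemma m_ampA : \sum_i zc m i * ampA m e i = 1.
Proof.
under eq_bigr => i _ do rewrite /ampA mulrBr !mulrA.
by rewrite sumrB -!mulr_suml !dotzE me mul0r subr0 divff.
Qed.

Lemma e_ampA : \sum_i zc e i * ampA m e i = -1.
Proof.
under eq_bigr => i _ do rewrite /ampA mulrBr !mulrA.
by rewrite sumrB -!mulr_suml !dotzE dotzC me mul0r sub0r divff.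
Qed.

Lemma p_ampA : \sum_i zc (pair_freq L m e) i * ampA m e i = 0.
Proof.
under eq_bigr => i _ do rewrite zc_pair -mulrA mulrDl.
by rewrite -mulr_sumr big_split/= m_ampA e_ampA subrr mulr0.
Qed.

Lemma m_ampB : \sum_i zc m i * ampB L m e E i = kap L e E.
Proof.
under eq_bigr => i _ do rewrite /ampB mulrDr mulrBr ![zc m i * (_ * _)]mulrCA.
by rewrite big_split sumrB/= -!mulr_sumr mE m_ampA dotzE sub0r mulr1 divfK//; ring.
Qed.

Lemma e_ampB : \sum_i zc e i * ampB L m e E i = \sum_j E j * zc e j + kap L e E.
Proof.
under eq_bigr => i _ do rewrite /ampB mulrDr mulrBr ![zc e i * (_ * _)]mulrCA.
rewrite big_split sumrB/= -!mulr_sumr e_ampA dotzE dotzC me mulr0 addr0 mulrN1 opprK.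
by congr (_ + _); apply: eq_bigr => i _; rewrite mulrC.
Qed.

Let Lne : (1 - L.*2%:R : C) != 0.
Proof.
rewrite subr_eq0 -[X in X != _]/(1%:R) eqr_nat.
by apply/eqP => h; have := odd_double L; rewrite -h.
Qed.

Lemma q_ampB : \sum_i zc (m - pair_freq L m e) i * ampB L m e E i = 0.
Proof.
under eq_bigr => i _ do rewrite zcB zc_pair mulrBl -mulrA mulrDl.
rewrite sumrB -mulr_sumr big_split/= m_ampB e_ampB /kap.
move: Lne; rewrite -muln2 natrM => Ln.
by set S := \sum_j _; field.
Qed.

(** As m . ampA = 1 and m . ampB = kap, the interaction is kap * ampA + ampB, in
   which the multiples of ampA cancel: only the error and a gradient remain. *)
Lemma pair_interaction k :
  (\sum_l zc m l * ampB L m e E l) * ampA m e k +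
  (\sum_l zc m l * ampA m e l) * ampB L m e E k =
  E k + 2 * kap L e E / (dotz m m)%:~R * zc m k.
Proof. by rewrite m_ampB m_ampA mul1r /ampB; ring. Qed.

End Algebra.

Lemma intc (z : int) : (z%:~R : C) = ((z%:~R : R)%:C)%C.
Proof. by rewrite rmorph_int. Qed.

Lemma cab_int (z : int) : cab (z%:~R : C) = (`|z|%N)%:R.
Proof. by rewrite intc cabr natr_absz intr_norm. Qed.

Lemma cab_zc_div m i : m != 0 -> cab (zc m i / (dotz m m)%:~R) <= 1.
Proof.
move=> m0; have dm := dotz_gt0 m0.
rewrite (_ : _ / _ = (((m ord0 i)%:~R / (dotz m m)%:~R : R)%:C)%C); last first.
  by rewrite fmorph_div/= !rmorph_int.
rewrite cabr normrM normfV -!intr_norm (gtr0_norm dm).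
rewrite ler_pdivrMr ?ltr0z// mul1r ler_int /dotz (bigD1 i)//=.
apply: (@le_trans _ _ (m ord0 i * m ord0 i)).
  have aux (z : int) : `|z| <= z * z by nia.
  exact: aux.
by rewrite lerDl sumr_ge0// => j _; rewrite -expr2 sqr_ge0.
Qed.

Lemma cab_ampA m e i : m != 0 -> e != 0 -> cab (ampA m e i) <= 2.
Proof.
move=> m0 e0; rewrite (le_trans (cabD _ _))// cabN.
by have := cab_zc_div i m0; have := cab_zc_div i e0; lra.
Qed.

(** The factor L / (1 - 2 L) is bounded by 1: this is what makes the amplitudes
   independent of the size of the pair. *)
Lemma cab_kap L e E B : (forall j, cab (E j) <= B) -> cab (kap L e E) <= (nrm e)%:R * B.
Proof.
move=> hE; rewrite /kap; have B0 (j : 'I_d) : 0 <= B by exact: le_trans (cab_ge0 _) (hE j).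
rewrite (le_trans (cabM _ _))//.
have h1 : cab (L%:R / (1 - L.*2%:R) : C) <= 1.
  rewrite (_ : _ / _ = (((L%:R / (1 - L.*2%:R)) : R)%:C)%C); last first.
    by rewrite fmorph_div/= rmorphB/= rmorph1 !rmorph_nat.
  rewrite cabr normrM normfV; case: L => [|L]; first by rewrite normr0 mul0r.
  have l0 : 0 <= L%:R :> R by [].
  have -> : 1 - L.+1.*2%:R = - (2 * L%:R + 1) :> R by rewrite -muln2 natrM -natr1; ring.
  clear B0; have x0 : 0 < 2 * L%:R + 1 :> R by rewrite ltr_wpDl// mulr_ge0.
  by rewrite normrN (gtr0_norm x0) normr_nat ler_pdivrMr// mul1r -natr1 lerD2r ler_peMl// ler1n.
apply: (@le_trans _ _ (1 * cab (\sum_j E j * zc e j))); first by rewrite ler_wpM2r ?cab_ge0.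
rewrite mul1r (le_trans (cab_sum _ _ _))// /nrm natr_sum mulr_suml.
apply: ler_sum => j _; rewrite (le_trans (cabM _ _))// mulrC cab_int ler_wpM2l//.
Qed.

Lemma cab_ampB L m e E B i : m != 0 -> e != 0 -> (nrm e <= nrm m)%N ->
  (forall j, cab (E j) <= B) -> cab (ampB L m e E i) <= 5 * jap m * B.
Proof.
move=> m0 e0 em hE; have B0 : 0 <= B by exact: le_trans (cab_ge0 _) (hE i).
have hk : cab (kap L e E) <= (nrm m)%:R * B.
  by rewrite (le_trans (cab_kap L e hE))// ler_wpM2r// ler_nat.
have h1 : cab (kap L e E * ampA m e i) <= (nrm m)%:R * B * 2.
  by rewrite (le_trans (cabM _ _))// ler_pM ?cab_ge0// cab_ampA.
have h2 : cab (2 * kap L e E / (dotz m m)%:~R * zc m i) <= 2 * ((nrm m)%:R * B) * 1.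
  rewrite [X in cab X](_ : _ = 2 * kap L e E * (zc m i / (dotz m m)%:~R)); last by rewrite mulrAC mulrA.
  rewrite (le_trans (cabM _ _))// ler_pM ?cab_ge0// ?cab_zc_div//.
  by rewrite (le_trans (cabM _ _))// ler_pM ?cab_ge0// cab_nat.
rewrite /ampB (le_trans (cabD _ _))// (le_trans (lerD (cabD _ _) (lexx _)))// cabN.
have -> : 5 * jap m * B = 5 * B + 5 * ((nrm m)%:R * B) by rewrite /jap natrD; ring.
by have := hE i; have := mulr_ge0 (ler0n R (nrm m)) B0; lra.
Qed.

End ResonantPair.

Section ErrorCoefficient.
Context {R : realType} {d : nat}.
Local Notation mode := 'rV[int]_d.
Local Notation C := R[i].
Implicit Types (m a b e : mode) (c : mode -> 'I_d -> R -> C) (t : R) (K : nat).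

Definition boxconv K c k l m t : C := \sum_(a <- box K) c a k t * c (m - a) l t.

(** The coefficient at m of the divergence of the tensor product. *)
Definition dconv K c k m t : C := \sum_l dsym l m * boxconv K c k l m t.

(** The symbol of the Leray projection. *)
Definition proj m (i k : 'I_d) : R :=
  (i == k)%:R - freq m ord0 i * freq m ord0 k / enorm (freq m) ^+ 2.

Definition lap m : R := 4 * pi ^+ 2 * enorm (freq m : 'rV[R]_d) ^+ 2.

(** The Fourier coefficient at m of the left-hand side of the projected
   Navier-Stokes equations, where the convolution only runs over a box. *)
Definition err K c m i t : C :=
  cder (c m i) t + (lap m)%:C%C * c m i t + \sum_k (proj m i k)%:C%C * dconv K c k m t.

Lemma dsymE l m : dsym l m = (2 * pi)%:C%C * 'i%C * zc m l :> C.
Proof. by rewrite /dsym /zc intc rmorphM; ring. Qed.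

Lemma enorm_dotz m : enorm (freq m : 'rV[R]_d) ^+ 2 = (dotz m m)%:~R.
Proof.
by rewrite sqr_enorm /dotz rmorph_sum; apply: eq_bigr => i _; rewrite !mxE rmorphM expr2.
Qed.

Lemma projE m i k : (proj m i k)%:C%C = (i == k)%:R - zc m i * zc m k / (dotz m m)%:~R :> C.
Proof.
by rewrite /proj enorm_dotz !mxE rmorphB rmorph_nat fmorph_div rmorphM !rmorph_int.
Qed.

Lemma proj_apply m i (v : 'I_d -> C) :
  \sum_k (proj m i k)%:C%C * v k = v i - zc m i / (dotz m m)%:~R * \sum_k zc m k * v k.
Proof.
under eq_bigr => k _ do rewrite projE mulrBl.
rewrite sumrB (bigD1 i)//= eqxx mul1r big1 ?addr0 => [|k ki]; last first.
  by rewrite eq_sym (negPf ki) mul0r.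
by rewrite mulr_sumr; congr (_ - _); apply: eq_bigr => k _; ring.
Qed.

Lemma dot_proj m (v : 'I_d -> C) : m != 0 -> \sum_i zc m i * (\sum_k (proj m i k)%:C%C * v k) = 0.
Proof.
move=> m0; under eq_bigr => i _ do rewrite proj_apply mulrBr !mulrA.
rewrite sumrB -!mulr_suml dotzE divff ?mul1r ?subrr//.
by rewrite intr_eq0 gt_eqF// dotz_gt0.
Qed.

Lemma projN m i k : proj (- m) i k = proj m i k.
Proof. by rewrite /proj enorm_freqN !mxE !intrN mulrNN. Qed.

Lemma proj_le m i k : `|proj m i k| <= 2.
Proof.
have [->|m0] := eqVneq m 0.
  rewrite /proj !mxE !mul0r subr0; case: (i == k); rewrite ?normr0 ?normr1; lra.
rewrite (le_trans (ler_normB _ _))//.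
have -> : 2 = 1 + 1 :> R by [].
apply: lerD; first by case: (i == k); rewrite ?normr0 ?normr1.
have e1 := enorm_freq_ge1 (R := R) m0.
have e0 : 0 < enorm (freq m : 'rV[R]_d) by rewrite (lt_le_trans ltr01).
rewrite normrM normfV [`|_ ^+ 2|]ger0_norm ?exprn_ge0 ?enorm_ge0//.
by rewrite ler_pdivrMr ?exprn_gt0// mul1r expr2 normrM ler_pM// coord_enorm.
Qed.

Lemma box_sumN (V : nmodType) K (f : mode -> V) :
  \sum_(a <- box K) f (- a) = \sum_(a <- box K) f a.
Proof.
rewrite -(big_map (@GRing.opp _) xpredT f); apply: perm_big; apply: uniq_perm.
- by rewrite map_inj_uniq ?box_uniq//; exact: oppr_inj.
- exact: box_uniq.
move=> a; rewrite -[a in LHS]opprK mem_map; last exact: oppr_inj.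
by rewrite !mem_box; apply: eq_forallb => i; rewrite mxE abszN.
Qed.

(** A real, divergence-free, mean-zero trigonometric field of degree rho whose
   coefficients are constant before time 0. *)
Record admissible (rho : nat) c : Prop := Admissible {
  adm_supp : forall a i t, (rho < nrm a)%N -> c a i t = 0;
  adm_zero : forall i t, c 0 i t = 0;
  adm_herm : forall a i t, c (- a) i t = conjc (c a i t);
  adm_div : forall a t, \sum_i zc a i * c a i t = 0;
  adm_ctf : forall a i, ctf (c a i) }.

Section Admissible.
Variables (rho : nat) (c : mode -> 'I_d -> R -> C).
Hypothesis hc : admissible rho c.

Lemma adm_widen rho' : (rho <= rho')%N -> admissible rho' c.
Proof.
move=> rr; case: hc => h1 h2 h3 h4 h5; split => // a i t ra.
by apply: h1; exact: leq_ltn_trans ra.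
Qed.

Lemma boxconv_widen K k l m t : (rho <= K)%N -> boxconv K c k l m t = boxconv rho c k l m t.
Proof.
move=> rK; apply: sum_widen; rewrite ?box_uniq//; first exact: box_mono.
move=> a _ na; rewrite (adm_supp hc) ?mul0r// ltnNge; apply: contra na; exact: nrm_box.
Qed.

Lemma err_widen K m i t : (rho <= K)%N -> err K c m i t = err rho c m i t.
Proof.
move=> rK; rewrite /err; congr (_ + _); apply: eq_bigr => k _; congr (_ * _).
by apply: eq_bigr => l _; rewrite boxconv_widen.
Qed.

Lemma err_herm m i t : err rho c (- m) i t = conjc (err rho c m i t).
Proof.
rewrite /err !cjD cj_sum; congr (_ + _ + _).
- rewrite -cder_conj; last exact: adm_ctf hc _ _.
  by congr (cder _ t); apply: funext => s; rewrite (adm_herm hc).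
- by rewrite (adm_herm hc) cjM conjc_real /lap enorm_freqN.
apply: eq_bigr => k _; rewrite cjM conjc_real projN cj_sum; congr (_ * _).
apply: eq_bigr => l _; rewrite cjM cj_sum !dsymE zcN; congr (_ * _).
  by rewrite !cjM conjc_real cj_i /zc cj_int; ring.
rewrite /boxconv -box_sumN; apply: eq_bigr => a _.
by rewrite cjM -!(adm_herm hc) opprB opprK addrC.
Qed.

(** Both the linear part and the projected quadratic part are orthogonal to m; the
   second amplitude of a resonant pair relies on it. *)
Lemma err_div m t : m != 0 -> \sum_i zc m i * err rho c m i t = 0.
Proof.
move=> m0; rewrite /err; under eq_bigr => i _ do rewrite !mulrDr.
rewrite !big_split/= dot_proj// addr0.
have -> : \sum_i zc m i * cder (c m i) t = 0.
  have h i : ctf (fun s => zc m i * c m i s) by apply: ctfZ; exact: adm_ctf hc _ _.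
  transitivity (cder (fun s => \sum_i zc m i * c m i s) t).
    by rewrite cder_sum//; apply: eq_bigr => i _; rewrite cderZ//; exact: adm_ctf hc _ _.
  by rewrite (_ : (fun s => _) = fun=> 0) ?cder_cst//; apply: funext => s; exact: adm_div hc _ _.
rewrite add0r; under eq_bigr => i _ do rewrite mulrCA.
by rewrite -mulr_sumr (adm_div hc) mulr0.
Qed.

Lemma err_ctf m i : ctf (err rho c m i).
Proof.
have hcc a j := adm_ctf hc a j.
apply: ctfD.
  by apply: ctfD; [exact: ctf_cder|exact: ctfZ].
apply: (@ctf_sum R _ _ (fun k t => (proj m i k)%:C%C * dconv rho c k m t)) => k; apply: ctfZ.
apply: (@ctf_sum R _ _ (fun l t => dsym l m * boxconv rho c k l m t)) => l; apply: ctfZ.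
apply: (@ctf_sum R _ _ (fun a t => c a k t * c (m - a) l t)) => a.
exact: ctfM.
Qed.

End Admissible.
End ErrorCoefficient.

(** * One step of the cascade *)

Ltac nonneg := repeat first
  [ done | exact: pi_ge0 | apply: exprn_ge0 | apply: mulr_ge0 | apply: addr_ge0
  | exact: wt_ge0 | exact: jap_ge0 | exact: powR_ge0 | exact: cab_ge0
  | exact: enorm_ge0 | rewrite invr_ge0 ].

Section PairGeometry.
Context {R : realType} {d : nat}.
Local Notation mode := 'rV[int]_d.
Implicit Types (m a b e p : mode).

(** The four frequencies added in one step, for the pair p + (m - p) = m. *)
Definition newfreqs m p : seq mode := [:: p; - p; m - p; - (m - p)].

(** The pairs of new frequencies whose sum is one of the two treated frequencies. *)
Definition resonant m p a b :=
  (a + b = m /\ (a = p /\ b = m - p \/ a = m - p /\ b = p)) \/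
  (a + b = - m /\ (a = - p /\ b = - (m - p) \/ a = - (m - p) /\ b = - p)).

Lemma nrm_dbl a : nrm (a + a) = (2 * nrm a)%N.
Proof.
rewrite /nrm big_distrr/=; apply: eq_bigr => i _; rewrite mxE.
have aux (z : int) : (`|(z + z)%R| = 2 * `|z|)%N by lia.
exact: aux.
Qed.

Variables (m p : mode) (rho : nat).
Hypotheses (mrho : (nrm m <= rho)%N) (prho : (20 * rho.+1 <= nrm p)%N).

Lemma newfreq_size a : a \in newfreqs m p -> (nrm p - rho <= nrm a <= nrm p + rho)%N.
Proof.
have h2 : (nrm (m - p) <= nrm m + nrm p)%N by rewrite -(nrmN p); exact: nrmD.
have h1 : (nrm p <= nrm (m - p) + nrm m)%N by rewrite -(nrmN (m - p)) opprB; exact: nrmB_ge.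
rewrite !inE => /or4P[] /eqP ->; rewrite ?nrmN; lia.
Qed.

(** Signed sums of two new frequencies either cancel the large frequency p, which
   gives 0, m or - m, or double it. *)
Lemma newfreq_pair a b : a \in newfreqs m p -> b \in newfreqs m p ->
  [\/ a + b = 0, resonant m p a b | (2 * nrm p - 2 * rho <= nrm (a + b))%N].
Proof.
(* the remaining sums are 2 p or - 2 p up to a shift of size at most 2 rho *)
have big (x y : mode) : (nrm x <= 2 * rho)%N -> y = p + p + x -> (2 * nrm p - 2 * rho <= nrm y)%N.
  by move=> hx ->; have := nrmD_ge (p + p) x; rewrite nrm_dbl; lia.
have big' (x y : mode) : (nrm x <= 2 * rho)%N -> y = - (p + p) + x -> (2 * nrm p - 2 * rho <= nrm y)%N.
  move=> hx ->; have : (nrm (p + p) <= nrm (- (p + p) + x) + nrm x)%N.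
    by rewrite -(nrmN (p + p)); exact: nrmD_ge.
  by rewrite nrm_dbl; lia.
have n0 : (nrm (0 : mode) <= 2 * rho)%N by rewrite nrm0.
have nm : (nrm m <= 2 * rho)%N by lia.
have nnm : (nrm (- m) <= 2 * rho)%N by rewrite nrmN.
have nmm : (nrm (m + m) <= 2 * rho)%N by rewrite nrm_dbl; lia.
have nnmm : (nrm (- (m + m)) <= 2 * rho)%N by rewrite nrmN nrm_dbl; lia.
rewrite !inE => /or4P[] /eqP -> /or4P[] /eqP ->.
- by apply: Or33; apply: (big _ _ n0); rewrite addr0.
- by apply: Or31; rewrite subrr.
- by apply: Or32; left; rewrite addrC subrK; split => //; left.
- by apply: Or33; apply: (big _ _ nnm); rewrite opprB addrA.
- by apply: Or31; rewrite addNr.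
- by apply: Or33; apply: (big' _ _ n0); rewrite addr0 opprD.
- by apply: Or33; apply: (big' _ _ nm); rewrite opprD addrCA addrC.
- by apply: Or32; right; rewrite opprB addrA addNr add0r; split => //; left.
- by apply: Or32; left; rewrite subrK; split => //; right.
- by apply: Or33; apply: (big' _ _ nm); rewrite -addrA -opprD addrC.
- by apply: Or33; apply: (big' _ _ nmm); rewrite opprD addrACA addrC.
- by apply: Or31; rewrite subrr.
- by apply: Or33; apply: (big _ _ nnm); rewrite opprB addrAC.
- by apply: Or32; right; rewrite opprB addrAC subrr add0r; split => //; right.
- by apply: Or31; rewrite addNr.
- by apply: Or33; apply: (big _ _ nnmm); rewrite opprB opprD addrACA.
Qed.

Hypothesis m0 : m != 0.

Lemma newfreq_uniq : uniq (newfreqs m p).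
Proof.
have mp : (0 < nrm m)%N by rewrite nrm_gt0.
have neq (x y : mode) : (rho < nrm (x - y))%N -> x != y.
  by apply: contraTneq => ->; rewrite subrr nrm0.
have d2 := nrm_dbl p.
have h1 : p != - p by apply: neq; rewrite opprK d2; lia.
have h2 : p != m - p.
  have h : (rho < nrm (p + p - m))%N.
    have : (nrm (p + p) <= nrm (p + p - m) + nrm m)%N by exact: nrmB_ge.
    by rewrite d2; lia.
  by apply: neq; rewrite opprB addrA.
have h3 : p != - (m - p).
  by apply: contra_neq m0 => h; have /eqP := h; rewrite opprB -subr_eq0 opprB addrC subrK => /eqP.
have h4 : m - p != - (m - p).
  have : (nrm p <= nrm (m - p) + nrm m)%N by rewrite -(nrmN (m - p)) opprB; exact: nrmB_ge.
  by move=> h; apply: neq; rewrite opprK nrm_dbl; lia.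
rewrite /= !inE !negb_or h1 h2 h3 h4 /= andbT.
by rewrite -(inj_eq oppr_inj) opprK h3 eqr_opp h2.
Qed.

End PairGeometry.

Section CascadeInvariant.
Context {R : realType} {d : nat}.
Local Notation mode := 'rV[int]_d.
Local Notation C := R[i].
Implicit Types (m a b e p : mode) (t : R).

(** The data produced so far: coefficients c, a radius rho containing their
   support, for each treated frequency m one half P m of its resonant pair
   (P m = 0 when m has not been treated), and a bound M of c, uniform in time. *)
Record state := State {
  st_c : mode -> 'I_d -> R -> C;
  st_rho : nat;
  st_P : mode -> mode;
  st_M : mode -> R }.

Variables (theta : R) (C0 C1 : R) (rho0 : nat).
Hypotheses (theta0 : 0 < theta) (C01 : 2 <= C0) (C11 : 1 <= C1).

(** The error at a frequency m without resonant interactions is at most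
   errC * jap m ^+ errN, whatever the number of steps already made; the
   amplitudes that cancel it obey a similar bound. *)
Definition errC : R :=
  C1 + 4 * pi ^+ 2 * C1 + d%:R * (2 * (d%:R * (2 * pi * (C1 ^+ 2 * C0 ^+ (2 + d.*2) * 5 ^+ d)))).
Definition errN : nat := (3 + d.*2)%N.
Definition ampC : R := 5 * errC.
Definition ampN : nat := errN.+1.

(** The interaction (a, b) is one of the two orderings of the pair that was created
   for a + b, or the opposite of such a pair for - (a + b). *)
Definition partner (P : mode -> mode) a b : Prop :=
  let m := a + b in [\/ a = P m, a = m - P m, a = - P (- m) | a = m + P (- m)].

(** The heart of the invariant is inv_res: two active frequencies that interact
   are comparable to their sum, unless they are the pair created for that sum.
   It bounds, independently of the stage, the error found at a frequency when its
   turn comes, and it makes the convolution at each frequency a finite sum. The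
   field inv_kill says that treated frequencies stay free of error. *)
Record invariant (S : R) (s : state) : Prop := Invariant {
  inv_adm : admissible (st_rho s) (st_c s);
  inv_M0 : forall a, 0 <= st_M s a;
  inv_Msupp : forall a, (st_rho s < nrm a)%N -> st_M s a = 0;
  inv_M : forall a i t, -1 <= t <= 1 -> cab (st_c s a i t) <= st_M s a;
  inv_M1 : forall a, st_M s a <= C1 * jap a;
  inv_der : forall a i t, -1 <= t <= 1 -> cab (cder (st_c s a i) t) <= C1 * jap a;
  inv_res : forall a b i j t t', st_c s a i t != 0 -> st_c s b j t' != 0 -> a + b != 0 ->
    (nrm a + nrm b)%:R <= C0 * (nrm (a + b))%:R :> R \/ partner (st_P s) a b;
  inv_P0 : st_P s 0 = 0;
  inv_Pball : forall m, st_P s m != 0 ->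
    [/\ (nrm m <= st_rho s)%N, (nrm (st_P s m) <= st_rho s)%N & (nrm (m - st_P s m) <= st_rho s)%N];
  inv_amp : forall m i t, st_P s m != 0 -> -1 <= t <= 1 ->
    cab (st_c s (st_P s m) i t) <= 2 /\ cab (st_c s (m - st_P s m) i t) <= ampC * jap m ^+ ampN;
  inv_kill : forall m i t, st_P s m != 0 -> err (st_rho s) (st_c s) m i t = 0;
  inv_sum : forall K, \sum_(a <- box K | (rho0 < nrm a)%N) jap a `^ (- theta) * st_M s a <= S }.

Lemma partner_free (P : mode -> mode) a b : P (a + b) = 0 -> P (- (a + b)) = 0 ->
  partner P a b -> a = 0 \/ b = 0.
Proof.
rewrite /partner => h1 h2; rewrite /= h1 h2 oppr0 !addr0.
have ab (x y : mode) : x = x + y -> y = 0 by rewrite -{1}[x]addr0 => /addrI ->.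
by case=> h; [left|right; exact: ab h|left|right; exact: ab h].
Qed.

Lemma errC_ge0 : 0 <= errC.
Proof.
have c1 : 0 <= C1 by exact: le_trans C11.
have c0 : 0 <= C0 by exact: le_trans C01.
by rewrite /errC; nonneg.
Qed.

(** A frequency that has not been treated only sees interactions of frequencies
   comparable to it, on which the coefficients grow at most linearly. *)
Lemma err_bound S s m i t : invariant S s -> m != 0 -> st_P s m = 0 -> st_P s (- m) = 0 ->
  -1 <= t <= 1 -> cab (err (st_rho s) (st_c s) m i t) <= errC * jap m ^+ errN.
Proof.
move=> hs m0 Pm PNm ht.
have ad := inv_adm hs.
have c1 : 0 <= C1 by exact: le_trans C11.
have c0 : 0 <= C0 by exact: le_trans C01.
have j1 : 1 <= jap m :> R := jap_ge1 m.
have j0 : 0 <= jap m :> R := jap_ge0 m.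
set J := jap m : R in j1 j0 *.
have Jle k n : (k <= n)%N -> J ^+ k <= J ^+ n by move=> kn; rewrite ler_weXn2l.
have conv k l : cab (boxconv (st_rho s) (st_c s) k l m t) <=
    C1 ^+ 2 * C0 ^+ (2 + d.*2) * 5 ^+ d * J ^+ (2 + d.*2).
  rewrite (le_trans (cab_sum _ _ _))//.
  (* 2 powers for the two coefficients, and 2 d more to pay for the summable weight *)
  apply: (@le_trans _ _ (\sum_(a <- box (st_rho s)) C1 ^+ 2 * (C0 * J) ^+ (2 + d.*2) * wt a)).
    apply: ler_sum => a _; rewrite (le_trans (cabM _ _))//.
    have rhs0 : 0 <= C1 ^+ 2 * (C0 * J) ^+ (2 + d.*2) * wt a.
      by nonneg.
    have [->|ca] := eqVneq (st_c s a k t) 0; first by rewrite cab0 mul0r.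
    have [->|cb] := eqVneq (st_c s (m - a) l t) 0; first by rewrite cab0 mulr0.
    have ab : a + (m - a) = m by rewrite addrC subrK.
    have nz b i' t' : st_c s b i' t' != 0 -> b != 0.
      by apply: contra_neq => ->; exact: adm_zero ad _ _.
    have dis : (nrm a + nrm (m - a))%:R <= C0 * (nrm m)%:R :> R \/ partner (st_P s) a (m - a).
      by rewrite -[in (nrm m)%:R]ab; apply: (inv_res hs ca cb); rewrite ab.
    case: dis => [nres|pa]; last first.
      have := @partner_free (st_P s) a (m - a); rewrite ab => /(_ Pm PNm pa) [] h.
        by move: (nz _ _ _ ca); rewrite h eqxx.
      by move: (nz _ _ _ cb); rewrite h eqxx.
    have ja : jap a <= C0 * J.
      rewrite /J /jap natrD [in leRHS]natrD mulrDr mulr1; apply: lerD; first by rewrite (le_trans _ C01)// ler1n.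
      by rewrite (le_trans _ nres)// ler_nat leq_addr.
    have jb : jap (m - a) <= C0 * J.
      rewrite /J /jap natrD [in leRHS]natrD mulrDr mulr1; apply: lerD; first by rewrite (le_trans _ C01)// ler1n.
      by rewrite (le_trans _ nres)// ler_nat leq_addl.
    have cj0 : 0 <= C0 * J by rewrite mulr_ge0.
    have b1 x k' : jap x <= C0 * J -> cab (st_c s x k' t) <= C1 * (C0 * J).
      move=> hx; rewrite (le_trans (inv_M hs _ _ ht))// (le_trans (inv_M1 hs _))//.
      by rewrite ler_wpM2l.
    apply: (@le_trans _ _ ((C1 * (C0 * J)) * (C1 * (C0 * J)))).
      by rewrite ler_pM ?cab_ge0 ?b1.
    rewrite exprD [leRHS](_ : _ = (C1 * (C0 * J)) * (C1 * (C0 * J)) * ((C0 * J) ^+ d.*2 * wt a)); last by ring.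
    rewrite ler_peMr ?mulr_ge0// /wt ler_pdivlMr ?exprn_gt0 ?jap_gt0// mul1r.
    by rewrite lerXn2r ?nnegrE ?jap_ge0.
  rewrite -mulr_sumr exprMn [leRHS](_ : _ = C1 ^+ 2 * (C0 ^+ (2 + d.*2) * J ^+ (2 + d.*2)) * 5 ^+ d); last by ring.
  by rewrite ler_wpM2l ?wt_sum5 ?box_uniq//; nonneg.
have cs (x : R) : \sum_(l < d) x = d%:R * x by rewrite sumr_const card_ord mulr_natl.
have zm l : cab (zc m l : C) <= J.
  by rewrite /zc cab_int /J /jap ler_nat (leq_trans (coord_nrm m l))// leq_addl.
have dc k : cab (dconv (st_rho s) (st_c s) k m t) <=
    d%:R * (2 * pi * (C1 ^+ 2 * C0 ^+ (2 + d.*2) * 5 ^+ d)) * J ^+ errN.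
  rewrite (le_trans (cab_sum _ _ _))//.
  rewrite -mulrA -cs; apply: ler_sum => l _.
  rewrite dsymE (le_trans (cabM _ _))//.
  apply: (@le_trans _ _ ((2 * pi * J) * (C1 ^+ 2 * C0 ^+ (2 + d.*2) * 5 ^+ d * J ^+ (2 + d.*2)))).
    rewrite ler_pM ?cab_ge0// (le_trans (cabM _ _))// ler_pM ?cab_ge0//.
    rewrite (le_trans (cabM _ _))// cabr ger0_norm ?mulr_ge0 ?pi_ge0//.
    by rewrite /cab/= normr0 normr1 add0r mulr1.
  by rewrite /errN -[(3 + _)%N]/((2 + d.*2).+1)%N [J ^+ _.+1]exprS mulrACA.
rewrite /err (le_trans (cabD _ _))// (le_trans (lerD (cabD _ _) (lexx _)))//.
rewrite /errC mulrDl; apply: lerD; last first.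
  rewrite (le_trans (cab_sum _ _ _))// -mulrA -cs.
  apply: ler_sum => k _; rewrite (le_trans (cabM _ _))// -[leRHS]mulrA ler_pM ?cab_ge0//.
  by rewrite cabr proj_le.
have J1N : J <= J ^+ errN by rewrite -[leLHS]expr1; apply: Jle.
rewrite mulrDl; apply: lerD.
  by rewrite (le_trans (inv_der hs _ _ ht))// ler_wpM2l.
rewrite (le_trans (cabM _ _))// cabr ger0_norm; last first.
  by rewrite /lap; nonneg.
apply: (@le_trans _ _ (4 * pi ^+ 2 * J ^+ 2 * (C1 * J))).
  rewrite ler_pM ?cab_ge0//.
  - by rewrite /lap; nonneg.
  - rewrite /lap; apply: ler_wpM2l; first by nonneg.
    rewrite lerXn2r ?nnegrE ?enorm_ge0//.
    by rewrite (le_trans (enorm_freq_le _))// /J /jap ler_nat; lia.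
  - by rewrite (le_trans (inv_M hs _ _ ht))// (inv_M1 hs).
rewrite [leLHS](_ : _ = 4 * pi ^+ 2 * C1 * J ^+ 3); last by ring.
by rewrite ler_wpM2l//; [nonneg|exact: Jle].
Qed.

End CascadeInvariant.

Section CascadeStep.
Context {R : realType} {d : nat}.
Local Notation mode := 'rV[int]_d.
Local Notation C := R[i].
Implicit Types (a b x : mode) (t : R).

Variables (theta : R) (C0 C1 : R) (rho0 : nat).
Hypotheses (theta0 : 0 < theta) (C02 : 2 <= C0) (C11 : 1 <= C1).
Variables (S delta : R) (s : @state R d) (m e : mode) (L : nat).
Hypothesis hs : invariant theta C0 C1 rho0 S s.
Hypotheses (m0 : m != 0) (Pm : st_P s m = 0) (PNm : st_P s (- m) = 0).
Hypotheses (e0 : e != 0) (me : dotz m e = 0) (em : (nrm e <= nrm m)%N).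
Hypotheses (delta0 : 0 < delta).

Local Notation rho := (st_rho s).
Local Notation c := (st_c s).
Hypothesis mrho : (nrm m <= rho)%N.

Let p := pair_freq L m e.
Local Notation q := (m - p).
Hypothesis prho : (20 * rho.+1 <= nrm p)%N.

Let E t i := err rho c m i t.
(** i / (2 pi), the inverse up to sign of the factor 2 pi i of the divergence. *)
Definition halfi : C := ((2 * pi)^-1)%:C%C * 'i%C.
Definition amp_q i t : C := halfi * ampB L m e (E t) i.

Definition pair_wave a i t : C :=
  if (a == p) || (a == - p) then ampA m e i
  else if a == q then amp_q i t
  else if a == - q then conjc (amp_q i t) else 0.

Local Notation w := pair_wave.
Local Notation new := (newfreqs m p).

Let ad := inv_adm hs.

Hypothesis hbig : forall a i t, a \in new -> -1 <= t <= 1 ->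
  [/\ cab (w a i t) <= jap a, cab (w a i t) <= delta * jap a `^ theta &
      cab (cder (w a i) t) <= jap a].

Let mE t : \sum_i zc m i * E t i = 0. Proof. exact: (err_div ad t m0). Qed.

Lemma wave_out a i t : a \notin new -> w a i t = 0.
Proof.
rewrite !inE !negb_or => /and4P[h1 h2 h3 h4].
by rewrite /pair_wave (negPf h1) (negPf h2) (negPf h3) (negPf h4).
Qed.

Lemma wave_ball a i t : (nrm a <= 2 * rho)%N -> w a i t = 0.
Proof.
move=> h; apply: wave_out; apply/negP => /(newfreq_size mrho prho).
by move: prho h; lia.
Qed.

Let uq := newfreq_uniq mrho prho m0.

Let neqs : [/\ p != - p, p != q, p != - q & [/\ - p != q, - p != - q & q != - q]].
Proof.
by have := uq; rewrite /= !inE !negb_or andbT => /and3P[/and3P[h1 h2 h3] /andP[h4 h5] h6].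
Qed.

Lemma wave_p i t : w p i t = ampA m e i.
Proof. by rewrite /pair_wave eqxx. Qed.

Lemma wave_q i t : w q i t = amp_q i t.
Proof.
case: neqs => [h1 h2 h3 [h4 h5 h6]].
by rewrite /pair_wave eq_sym (negPf h2) eq_sym (negPf h4) eqxx.
Qed.

Lemma conj_ampA i : conjc (ampA m e i : C) = ampA m e i.
Proof.
rewrite /ampA cjB !cjM /zc !cj_int.
by rewrite !conjc_inv !cj_int.
Qed.

Lemma wave_herm a i t : w (- a) i t = conjc (w a i t).
Proof.
case: neqs => [h1 h2 h3 [h4 h5 h6]].
have [an|an] := boolP (a \in new); last first.
  rewrite !wave_out ?conjc0//; apply: contra an.
  rewrite !inE => /or4P[] /eqP h; rewrite -[a]opprK h.
  - by rewrite eqxx !orbT.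
  - by rewrite opprK eqxx.
  - by rewrite eqxx !orbT.
  by rewrite opprK eqxx !orbT.
move: an; rewrite !inE => /or4P[] /eqP ->.
- by rewrite /pair_wave !eqxx orbT conj_ampA.
- by rewrite opprK /pair_wave !eqxx orbT conj_ampA.
- rewrite wave_q /pair_wave eq_sym (negPf h3) eq_sym (negPf h5).
  by rewrite eq_sym (negPf h6) eqxx.
rewrite opprK wave_q /pair_wave ![- q == _]eq_sym (negPf h3) (negPf h5) (negPf h6) eqxx.
by rewrite conjcK.
Qed.

Lemma wave_div a t : \sum_i zc a i * w a i t = 0.
Proof.
case: neqs => [h1 h2 h3 [h4 h5 h6]].
have dq : \sum_i zc q i * w q i t = 0.
  under eq_bigr => i _ do rewrite wave_q /amp_q mulrCA.
  by rewrite -mulr_sumr q_ampB ?mulr0.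
have dp : \sum_i zc p i * w p i t = 0.
  under eq_bigr => i _ do rewrite wave_p.
  exact: p_ampA.
have neg x : \sum_i zc x i * w x i t = 0 -> \sum_i zc (- x) i * w (- x) i t = 0.
  move=> h; have := congr1 conjc h; rewrite conjc0 cj_sum => h'.
  apply: oppr_inj; rewrite oppr0 -[RHS]h' -sumrN; apply: eq_bigr => i _ /=.
  by rewrite wave_herm cjM zcN /zc cj_int mulNr opprK.
have [|an] := boolP (a \in new); last by rewrite big1// => i _; rewrite wave_out ?mulr0.
by rewrite !inE => /or4P[] /eqP -> //; exact: neg.
Qed.

Lemma amp_q_ctf i : ctf (amp_q i).
Proof.
have cE j : ctf (E^~ j) by exact: (err_ctf ad).
have ck : ctf (fun t => kap L e (E t)).
  by apply: ctfZ; apply: (@ctf_sum _ _ _ (fun j t => E t j * zc e j)) => j; apply: ctfM => //; exact: ctf_cst.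
rewrite /amp_q /ampB; apply: ctfZ; apply: ctfD; first apply: ctfD => //.
  rewrite (_ : (fun t => _) = fun t => - ampA m e i * kap L e (E t)); first exact: ctfZ.
  by apply: funext => t; rewrite mulNr mulrC.
rewrite (_ : (fun t => _) = fun t => (2 / (dotz m m)%:~R * zc m i) * kap L e (E t)); first exact: ctfZ.
by apply: funext => t; ring.
Qed.

Lemma wave_ctf a i : ctf (w a i).
Proof.
have -> : w a i = fun t => if (a == p) || (a == - p) then ampA m e i
    else if a == q then amp_q i t else if a == - q then conjc (amp_q i t) else 0.
  by apply: funext.
case: ((a == p) || (a == - p)); first exact: ctf_cst.
case: (a == q); first exact: amp_q_ctf.
case: (a == - q); last exact: ctf_cst.
by apply: ctf_conj; exact: amp_q_ctf.
Qed.

Definition step_c a i t : C := c a i t + w a i t.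
Definition step_rho : nat := (nrm p + rho)%N.
Definition step_P x : mode := if x == m then p else st_P s x.
(** The first bound keeps the linear growth of the coefficients, the second one makes
   each new frequency cost delta in the weighted l^1 norm. *)
Definition step_M a : R :=
  st_M s a + if a \in new then Num.min (jap a) (delta * jap a `^ theta) else 0.
Definition step_state := State step_c step_rho step_P step_M.

Lemma step_adm : admissible step_rho step_c.
Proof.
split=> [a i t ra|i t|a i t|a t|a i].
- rewrite /step_c (adm_supp ad) ?wave_out ?addr0//; last by rewrite /step_rho in ra; lia.
  by apply/negP => /(newfreq_size mrho prho) /andP[_]; rewrite leqNgt ra.
- by rewrite /step_c (adm_zero ad) wave_ball ?addr0// nrm0.
- by rewrite /step_c (adm_herm ad) wave_herm cjD.
- under eq_bigr => i _ do rewrite /step_c mulrDr.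
  by rewrite big_split/= (adm_div ad) wave_div addr0.
- by apply: ctfD; [exact: adm_ctf ad _ _|exact: wave_ctf].
Qed.

Lemma step_ball a i t : (nrm a <= 2 * rho)%N -> step_c a i t = c a i t.
Proof. by move=> h; rewrite /step_c wave_ball ?addr0. Qed.

Lemma step_new a i t : a \in new -> step_c a i t = w a i t.
Proof.
move=> h; rewrite /step_c (adm_supp ad) ?add0r//.
by move: (newfreq_size mrho prho h) prho; lia.
Qed.

Lemma step_nz a i t : step_c a i t != 0 -> (c a i t != 0 /\ (nrm a <= rho)%N) \/ a \in new.
Proof.
have [an|an] := boolP (a \in new); first by right.
rewrite /step_c wave_out ?addr0// => ca; left; split => //.
by rewrite leqNgt; apply: contra ca => h; rewrite (adm_supp ad).
Qed.

(** Old and new frequencies do not interact into the old ball, since the new ones are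
   far outside of it. *)
Lemma step_conv x k l t : (nrm x <= rho)%N -> boxconv step_rho step_c k l x t =
  boxconv rho c k l x t + \sum_(a <- new) w a k t * w (x - a) l t.
Proof.
move=> xr; rewrite -(boxconv_widen ad k l x t (leq_addl (nrm p) rho)).
have -> : \sum_(a <- new) w a k t * w (x - a) l t =
    \sum_(a <- box step_rho) w a k t * w (x - a) l t.
  apply/esym/sum_widen => //; rewrite ?box_uniq//.
    by move=> a /(newfreq_size mrho prho) /andP[_ h]; exact: nrm_box.
  by move=> a _ an; rewrite wave_out ?mul0r.
rewrite /boxconv -big_split; apply: eq_bigr => a _ /=; rewrite /step_c mulrDl !mulrDr.
have small b : (nrm b <= rho)%N -> (nrm (x - b) <= 2 * rho)%N.
  by move=> h; have : (nrm (x - b) <= nrm x + nrm b)%N by [rewrite -(nrmN b); exact: nrmD]; lia.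
have h1 : c a k t * w (x - a) l t = 0.
  have [ar|ar] := leqP (nrm a) rho; first by rewrite (wave_ball _ _ (small _ ar)) mulr0.
  by rewrite (adm_supp ad) ?mul0r.
have h2 : w a k t * c (x - a) l t = 0.
  have [ar|ar] := leqP (nrm (x - a)) rho; last by rewrite (adm_supp ad _ _ ar) mulr0.
  by rewrite wave_ball ?mul0r//; have := small _ ar; rewrite opprB addrC subrK.
by rewrite h1 h2 addr0 add0r.
Qed.

(** A sum that falls into the old ball is neither zero nor large: it is resonant. *)
Lemma pair_off x a : (nrm x <= rho)%N -> x != 0 -> a \in new -> x - a \in new ->
  resonant m p a (x - a).
Proof.
move=> xr x0 an bn; case: (newfreq_pair mrho prho an bn) => //; rewrite addrC subrK.
  by move=> h; rewrite h eqxx in x0.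
by move: prho xr; lia.
Qed.

Lemma step_conv_off x k l t : (nrm x <= rho)%N -> x != 0 -> x != m -> x != - m ->
  boxconv step_rho step_c k l x t = boxconv rho c k l x t.
Proof.
move=> xr x0 xm xNm; rewrite step_conv// big_seq big1 ?addr0// => a an.
have [bn|bn] := boolP (x - a \in new); last by rewrite [X in _ * X]wave_out ?mulr0.
have [] := pair_off xr x0 an bn; rewrite addrC subrK => -[h _].
  by rewrite h eqxx in xm.
by rewrite h eqxx in xNm.
Qed.

Lemma step_conv_m k l t : boxconv step_rho step_c k l m t =
  boxconv rho c k l m t + (ampA m e k * amp_q l t + amp_q k t * ampA m e l).
Proof.
case: neqs => [h1 h2 h3 [h4 h5 h6]].
rewrite step_conv//; congr (_ + _); rewrite !big_cons big_nil addr0.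
have mNm : m != - m.
  rewrite -subr_eq0 opprK -nrm_eq0 nrm_dbl muln_eq0/= nrm_eq0//.
have z1 : w (m - - p) l t = 0.
  apply: wave_out; apply/negP => bn.
  have [] := @pair_off m (- p) mrho m0 _ bn; first by rewrite !inE eqxx orbT.
    by move=> [_ [[/eqP h _]|[/eqP h _]]]; [rewrite eq_sym (negPf h1) in h|rewrite (negPf h4) in h].
  by move=> [/eqP h _]; rewrite addrC subrK (negPf mNm) in h.
have z2 : w (m - - q) l t = 0.
  apply: wave_out; apply/negP => bn.
  have [] := @pair_off m (- q) mrho m0 _ bn; first by rewrite !inE eqxx !orbT.
    by move=> [_ [[/eqP h _]|[/eqP h _]]]; [rewrite eq_sym (negPf h3) in h|rewrite eq_sym (negPf h6) in h].
  by move=> [/eqP h _]; rewrite addrC subrK (negPf mNm) in h.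
rewrite z1 z2 !mulr0 add0r addr0 wave_p wave_q.
by rewrite subKr wave_p wave_q.
Qed.

Lemma wave_fun_ball a i : (nrm a <= rho)%N -> step_c a i = c a i.
Proof. by move=> h; apply: funext => t; rewrite step_ball//; lia. Qed.

(** The errors at the other frequencies of the old ball, in particular the vanishing
   ones, are left untouched. *)
Lemma step_err_off x i t : (nrm x <= rho)%N -> x != 0 -> x != m -> x != - m ->
  err step_rho step_c x i t = err rho c x i t.
Proof.
move=> xr x0 xm xNm; rewrite /err wave_fun_ball//; congr (_ + _).
apply: eq_bigr => k _; congr (_ * _); apply: eq_bigr => l _.
by rewrite step_conv_off.
Qed.

Lemma halfiE : (2 * pi)%:C%C * 'i%C * halfi = -1 :> C.
Proof.
rewrite /halfi [LHS](_ : _ = ((2 * pi)%:C%C * ((2 * pi)^-1)%:C%C) * ('i%C * 'i%C)); last by ring.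
rewrite -rmorphM/= mulfV ?mulf_neq0 ?gt_eqF ?pi_gt0// rmorph1 mul1r -expr2 sqr_i//.
Qed.

(** The factor halfi turns the interaction of the pair into minus the error plus a
   gradient, which the projection removes. *)
Lemma step_err_m i t : err step_rho step_c m i t = 0.
Proof.
have dE k : dconv step_rho step_c k m t =
    dconv rho c k m t - (E t k + 2 * kap L e (E t) / (dotz m m)%:~R * zc m k).
  rewrite -(pair_interaction L m0 me (mE t)) /dconv.
  under eq_bigr => l _ do rewrite step_conv_m mulrDr.
  rewrite big_split/=; congr (_ + _).
  transitivity ((2 * pi)%:C%C * 'i%C * halfi *
     ((\sum_l zc m l * ampB L m e (E t) l) * ampA m e k +
      (\sum_l zc m l * ampA m e l) * ampB L m e (E t) k) : C); last by rewrite halfiE mulN1r.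
  rewrite !mulr_suml -big_split mulr_sumr; apply: eq_bigr => l _ /=.
  by rewrite dsymE /amp_q; ring.
rewrite /err wave_fun_ball//.
under eq_bigr => k _ do rewrite dE mulrBr.
rewrite sumrB addrA -/(err rho c m i t) proj_apply.
have dm0 : (dotz m m)%:~R != 0 :> C by rewrite intr_eq0 gt_eqF// dotz_gt0.
under [X in _ - (_ - _ * X)]eq_bigr => k _ do rewrite mulrDr.
rewrite big_split/= mE add0r.
under eq_bigr => k _ do rewrite mulrCA.
by rewrite -mulr_sumr dotzE -/(E t i); field.
Qed.

Let min0 a : 0 <= Num.min (jap a) (delta * jap a `^ theta).
Proof. by rewrite le_min jap_ge0 mulr_ge0 ?powR_ge0// ltW. Qed.

Let new_big a : a \in new -> (rho < nrm a)%N.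
Proof. by move=> h; have := newfreq_size mrho prho h; move: prho; lia. Qed.

Lemma step_M_ball a : (nrm a <= rho)%N -> step_M a = st_M s a.
Proof.
move=> h; rewrite /step_M ifN ?addr0//.
by apply/negP => /new_big; rewrite ltnNge h.
Qed.

Lemma step_M_new a : a \in new -> step_M a = Num.min (jap a) (delta * jap a `^ theta).
Proof. by move=> h; rewrite /step_M h (inv_Msupp hs) ?add0r//; exact: new_big. Qed.

Lemma step_old a i t : a \notin new -> step_c a i t = c a i t.
Proof. by move=> h; rewrite /step_c wave_out ?addr0. Qed.

Lemma step_P_eq x : x != m -> step_P x = st_P s x.
Proof. by move=> h; rewrite /step_P (negPf h). Qed.

Lemma step_P_m : step_P m = p.
Proof. by rewrite /step_P eqxx. Qed.

Let p0 : p != 0.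
Proof. by rewrite -nrm_eq0 -lt0n; move: prho; lia. Qed.

Lemma amp_q_bound i t : -1 <= t <= 1 -> cab (amp_q i t) <= @ampC R d C0 C1 * jap m ^+ @ampN d.
Proof.
move=> ht; rewrite /amp_q (le_trans (cabM _ _))//.
have h1 : cab (halfi : C) <= 1.
  rewrite /halfi (le_trans (cabM _ _))// cabr /cab/= normr0 normr1 add0r mulr1.
  have pi2 : 2 <= pi :> R by exact: pi_ge2.
  rewrite ger0_norm ?invr_ge0 ?mulr_ge0 ?pi_ge0// invf_le1 ?mulr_gt0 ?pi_gt0//.
  by rewrite -[leLHS]mulr1 ler_pM ?ler1n// (le_trans _ pi2)// ler1n.
have h2 : cab (ampB L m e (fun j => err rho c m j t) i) <= 5 * jap m * (@errC R d C0 C1 * jap m ^+ @errN d).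
  by apply: cab_ampB => // j; exact: (err_bound theta0 C02 C11 _ hs).
rewrite (le_trans (ler_pM (cab_ge0 _) (cab_ge0 _) h1 h2))// /ampC /ampN exprS.
by rewrite le_eqVlt; apply/orP; left; apply/eqP; ring.
Qed.

(** A mixed interaction has a sum of the size of its new member; two new frequencies
   are resonant, opposite or add up to a large frequency; and an old pair that was a
   partner pair had a treated sum, which m is not. *)
Lemma step_res a b i j t t' : step_c a i t != 0 -> step_c b j t' != 0 -> a + b != 0 ->
  (nrm a + nrm b)%:R <= C0 * (nrm (a + b))%:R :> R \/ partner step_P a b.
Proof.
move=> ca cb ab.
have two (n k : nat) : (n <= 2 * k)%N -> n%:R <= C0 * k%:R :> R.
  move=> h; apply: (@le_trans _ _ (2 * k%:R)); last by rewrite ler_wpM2r.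
  by rewrite -natrM ler_nat.
have tri1 : (nrm a <= nrm (a + b) + nrm b)%N by exact: nrmD_ge.
have tri2 : (nrm b <= nrm (a + b) + nrm a)%N by rewrite addrC; exact: nrmD_ge.
have [[ca' ra]|an] := step_nz ca; have [[cb' rb]|bn] := step_nz cb.
- have [h|h] := inv_res hs ca' cb' ab; [by left|right].
  have nz x k u : c x k u != 0 -> x != 0 by apply: contra_neq => ->; exact: adm_zero ad _ _.
  have free : st_P s (a + b) = 0 -> st_P s (- (a + b)) = 0 -> False.
    move=> P1 P2; have [z|z] := partner_free P1 P2 h.
      by move: (nz _ _ _ ca'); rewrite z eqxx.
    by move: (nz _ _ _ cb'); rewrite z eqxx.
  have abm : a + b != m by apply/eqP => z; apply: free; rewrite z.
  have abNm : a + b != - m by apply/eqP => z; apply: free; rewrite z ?opprK.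
  move: h; rewrite /partner /= !step_P_eq//.
  by rewrite -[X in _ != X]opprK (inj_eq oppr_inj).
- left; apply: two; have := newfreq_size mrho prho bn; move: ra prho tri2; clear; lia.
- left; apply: two; have := newfreq_size mrho prho an; move: rb prho tri1; clear; lia.
have sa := newfreq_size mrho prho an; have sb := newfreq_size mrho prho bn.
case: (newfreq_pair mrho prho an bn) => [z|res|big].
- by rewrite z eqxx in ab.
- right; rewrite /partner /=; case: res => [[z]|[z]].
    rewrite z step_P_m => -[[-> _]|[-> _]]; first exact: Or41.
    exact: Or42.
  rewrite z opprK step_P_m => -[[-> _]|[-> _]]; first exact: Or43.
  by apply: Or44; rewrite opprB addrC.
by left; apply: two; move: sa sb big prho; clear; lia.
Qed.

Lemma step_sum K :
  \sum_(a <- box K | (rho0 < nrm a)%N) jap a `^ (- theta) * step_M a <= S + 4 * delta.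
Proof.
under eq_bigr => a _ do rewrite /step_M mulrDr.
rewrite big_split/=; apply: lerD; first exact: inv_sum hs K.
pose f a : R := if a \in new then delta else 0.
have f0 a : 0 <= f a by rewrite /f; case: ifP => // _; exact: ltW.
apply: (@le_trans _ _ (\sum_(a <- box K) f a)).
  rewrite big_mkcond; apply: ler_sum => a _; case: ifP => // _; rewrite /f.
  case: ifP => _; last by rewrite mulr0.
  rewrite powRN mulrC ler_pdivrMr ?powR_gt0 ?jap_gt0//.
  by rewrite ge_min lexx orbT.
have u := newfreq_uniq mrho prho m0.
rewrite /f -big_mkcond big_const_seq iter_addr addr0.
have -> : delta *+ count (fun a => a \in new) (box K) = delta * (count (mem new) (box K))%:R.
  by rewrite mulr_natr.
rewrite mulrC ler_wpM2r ?(ltW delta0)// ler_nat.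
rewrite -size_filter -[4%N]/(size new); apply: uniq_leq_size.
  by apply: filter_uniq; exact: box_uniq.
by move=> a; rewrite mem_filter => /andP[].
Qed.

Lemma step_invariant : invariant theta C0 C1 rho0 (S + 4 * delta) (step_state).
Proof.
have old_fun a i : a \notin new -> step_c a i = c a i.
  by move=> h; apply: funext => t; rewrite step_old.
split => /=.
- exact: step_adm.
- move=> a; rewrite /step_M addr_ge0 ?(inv_M0 hs)//; case: ifP => // _; exact: min0.
- move=> a h; rewrite /step_M ifF; last first.
    apply/negbTE/negP => /(newfreq_size mrho prho) /andP[_ h'].
    by move: h h'; rewrite /step_rho; clear; lia.
  by rewrite (inv_Msupp hs) ?addr0//; move: h; rewrite /step_rho; clear; lia.
- move=> a i t ht; have [an|an] := boolP (a \in new).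
    rewrite step_new// step_M_new// le_min.
    by have [h1 h2 _] := hbig i an ht; rewrite h1 h2.
  rewrite step_old// /step_M (negPf an) addr0; exact: (inv_M hs a i ht).
- move=> a; have [an|an] := boolP (a \in new).
    rewrite step_M_new// ge_min ler_peMl ?jap_ge0//.
  by rewrite /step_M (negPf an) addr0; exact: (inv_M1 hs).
- move=> a i t ht; have [an|an] := boolP (a \in new).
    have -> : step_c a i = w a i by apply: funext => u; rewrite step_new.
    by have [_ _ h] := hbig i an ht; rewrite (le_trans h)// ler_peMl ?jap_ge0.
  rewrite old_fun//; exact: (inv_der hs a i ht).
- exact: step_res.
- by rewrite step_P_eq ?(inv_P0 hs)// eq_sym.
- move=> x; have [->|xm] := eqVneq x m => [_|].
    have u y : y \in new -> (nrm y <= step_rho)%N by move=> /(newfreq_size mrho prho) /andP[_].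
    rewrite step_P_m; split; [|apply: u|apply: u]; rewrite ?inE ?eqxx ?orbT//.
    by rewrite /step_rho (leq_trans mrho)// leq_addl.
  rewrite step_P_eq// => /(inv_Pball hs)[h1 h2 h3].
  by rewrite /step_rho; split; move: h1 h2 h3; clear; lia.
- move=> x i t; have [->|xm] := eqVneq x m => [_|] ht.
    rewrite step_P_m step_new ?inE ?eqxx// wave_p; split; first exact: cab_ampA.
    by rewrite step_new ?inE ?eqxx ?orbT// wave_q//; exact: amp_q_bound.
  rewrite step_P_eq in ht *; last by [].
  move=> ht'; have [h1 h2 h3] := inv_Pball hs ht.
  rewrite !wave_fun_ball//; exact: (inv_amp hs i ht ht').
- move=> x i t; have [->|xm] := eqVneq x m => [_|].
    exact: step_err_m.
  rewrite step_P_eq// => Px; have [h1 h2 h3] := inv_Pball hs Px.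
  rewrite step_err_off//.
  - exact: (inv_kill hs i t Px).
  - by apply: contra_neq Px => ->; exact: inv_P0 hs.
  - by apply: contra_neq Px => ->.
- exact: step_sum.
Qed.

End CascadeStep.

(** * Iterating the cascade *)

Section Iteration.
Context {R : realType} {d : nat}.
Local Notation mode := 'rV[int]_d.
Local Notation C := R[i].
Implicit Types (a b m x e : mode) (t : R).

Lemma powR_large (theta delta Y : R) : 0 < theta -> 0 < delta ->
  exists n : nat, forall x : R, n%:R <= x -> Y <= x /\ Y <= delta * x `^ theta.
Proof.
move=> th0 de0; pose Z := Num.max 1 Y; pose x0 := (Z / delta) `^ theta^-1.
have Z1 : 1 <= Z by rewrite le_max lexx.
have YZ : Y <= Z by rewrite le_max lexx orbT.
have Zd : 0 <= Z / delta by rewrite divr_ge0 ?(ltW de0)// (le_trans _ Z1).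
have x00 : 0 <= x0 by exact: powR_ge0.
exists (Num.trunc (x0 + Z)).+1 => x hx.
have xx : x0 + Z <= x by rewrite (le_trans _ hx)// ltW// truncnS_gt.
have Z0 : 0 <= Z by exact: le_trans Z1.
split; first by rewrite (le_trans YZ)// (le_trans _ xx)// lerDr.
rewrite (le_trans YZ)// mulrC -ler_pdivrMr//.
have <- : x0 `^ theta = Z / delta by rewrite -powRrM mulVf ?gt_eqF// powRr1.
have x0x : x0 <= x by rewrite (le_trans _ xx)// lerDl.
by rewrite ge0_ler_powR ?nnegrE// ?(ltW th0)//; exact: le_trans x0x.
Qed.

Section Amplitudes.
Variables (theta C0 C1 : R) (rho0 : nat) (S : R) (s : @state R d) (m e : mode).
Hypothesis hs : invariant theta C0 C1 rho0 S s.
Hypotheses (m0 : m != 0) (e0 : e != 0) (em : (nrm e <= nrm m)%N).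

Let E t i := err (st_rho s) (st_c s) m i t.

Let cE i : ctf (E^~ i). Proof. exact: (err_ctf (inv_adm hs)). Qed.

Let z i : C := 2 / (dotz m m)%:~R * zc m i - ampA m e i.

Let ampBE L i (F : 'I_d -> C) : ampB L m e F i = F i + z i * kap L e F.
Proof. by rewrite /ampB /z; ring. Qed.

Let cs : ctf (fun t => \sum_j E t j * zc e j).
Proof.
by apply: (@ctf_sum _ _ _ (fun j t => E t j * zc e j)) => j; apply: ctfM => //; exact: ctf_cst.
Qed.

Let ck L : ctf (fun t => kap L e (E t)). Proof. exact: ctfZ. Qed.

Lemma ctf_ampB L i : ctf (fun t => ampB L m e (E t) i).
Proof. by under eq_fun do rewrite ampBE; apply: ctfD => //; exact: ctfZ. Qed.

Lemma cder_ampB L i t :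
  cder (fun t => ampB L m e (E t) i) t = ampB L m e (fun j => cder (E^~ j) t) i.
Proof.
have dk : cder (fun t => kap L e (E t)) t = kap L e (fun j => cder (E^~ j) t).
  rewrite cderZ// (@cder_sum _ _ _ (fun j t => E t j * zc e j)) => [|j]; last first.
    by apply: ctfM => //; exact: ctf_cst.
  congr (_ * _); apply: eq_bigr => j _.
  by under eq_fun do rewrite mulrC; rewrite cderZ// mulrC.
under eq_fun do rewrite ampBE.
by rewrite ampBE (@cderD _ (E^~ i) (fun t => z i * kap L e (E t)) t (cE i) (ctfZ _ (ck L))) (cderZ _ _ (ck L)) dk.
Qed.

Lemma cab_halfi : cab (halfi : C) <= 1.
Proof.
rewrite /halfi (le_trans (cabM _ _))// cabr /cab/= normr0 normr1 add0r mulr1.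
rewrite ger0_norm ?invr_ge0 ?mulr_ge0 ?pi_ge0// invf_le1 ?mulr_gt0 ?pi_gt0//.
by rewrite -[leLHS]mulr1 ler_pM ?ler1n// (le_trans _ (pi_ge2 _))// ler1n.
Qed.

(** The amplitudes depend on L through the bounded factor of kap only, so that one
   bound serves all L, and L is chosen after it. *)
Lemma wave_bounded : exists Y : R, forall L a i t, -1 <= t <= 1 ->
  cab (pair_wave s m e L a i t) <= Y /\ cab (cder (pair_wave s m e L a i) t) <= Y.
Proof.
have [B1 hB1] : exists B : R, forall j t, -1 <= t <= 1 -> cab (E t j) <= B /\ cab (cder (E^~ j) t) <= B.
  have /choice[f hf] : forall j, exists B : R, 0 <= B /\
      forall t, -1 <= t <= 1 -> cab (E t j) <= B /\ cab (cder (E^~ j) t) <= B.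
    move=> j; have [B b0 hB] := ctf_bounded (cE j).
    have [B' b0' hB'] := ctf_bounded (ctf_cder (cE j)).
    exists (B + B'); split; first exact: addr_ge0.
    by move=> t ht; split; [rewrite (le_trans (hB t ht))// lerDl|rewrite (le_trans (hB' t ht))// lerDr].
  exists (\sum_j f j) => j t ht; have [fj0 fj] := hf j; have [h1 h2] := fj t ht.
  have le : f j <= \sum_j f j.
    by rewrite (bigD1 j)//= lerDl sumr_ge0// => k _; have [] := hf k.
  by split; [exact: le_trans le|exact: le_trans le].
pose Y := 2 + `|5 * jap m * B1|.
have Y2 : 2 <= Y by rewrite lerDl.
have Y0 : 0 <= Y by exact: le_trans Y2.
have YB : 5 * jap m * B1 <= Y by rewrite (le_trans (ler_norm _))// lerDr.
have cq L i t : -1 <= t <= 1 -> cab (amp_q s m e L i t) <= Y /\ cab (cder (amp_q s m e L i) t) <= Y.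
  move=> ht; have hF (F : 'I_d -> C) : (forall j, cab (F j) <= B1) -> cab (halfi * ampB L m e F i) <= Y.
    move=> hF; rewrite (le_trans (cabM _ _))// -[leRHS]mul1r ler_pM ?cab_ge0 ?cab_halfi//.
    by rewrite (le_trans _ YB)// cab_ampB.
  split; first by apply: hF => j; have [] := hB1 j t ht.
  rewrite /amp_q cderZ ?cder_ampB; last exact: ctf_ampB.
  by apply: hF => j; have [] := hB1 j t ht.
exists Y => L a i t ht.
have -> : pair_wave s m e L a i = fun t => pair_wave s m e L a i t by apply: funext.
rewrite /pair_wave.
case: (_ || _); first by rewrite cder_cst cab0 (le_trans (cab_ampA _ _ _)).
case: (_ == _); first exact: cq.
case: (_ == _); last by rewrite cder_cst !cab0.
have [h1 h2] := cq L i t ht.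
by rewrite cder_conj ?cabJ//; exact: (amp_q_ctf m e L hs).
Qed.

End Amplitudes.

Section Steps.
Variables (theta C0 C1 : R) (rho0 : nat).
Hypotheses (theta0 : 0 < theta) (C02 : 2 <= C0) (C11 : 1 <= C1) (d2 : (2 <= d)%N).
Local Notation inv := (invariant theta C0 C1 rho0).

(** What later stages of the cascade leave unchanged. *)
Record extends (s s' : @state R d) : Prop := Extends {
  ext_rho : (st_rho s <= st_rho s')%N;
  ext_c : forall a, (nrm a <= st_rho s)%N -> st_c s' a = st_c s a /\ st_M s' a = st_M s a;
  ext_P : forall x, st_P s x != 0 \/ st_P s (- x) != 0 -> st_P s' x = st_P s x }.

Lemma extends_refl s : extends s s.
Proof. by split. Qed.

Lemma extends_trans s1 s2 s3 : extends s1 s2 -> extends s2 s3 -> extends s1 s3.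
Proof.
move=> [r1 c1 P1] [r2 c2 P2]; split; first exact: leq_trans r2.
  by move=> a h; have [-> ->] := c2 a (leq_trans h r1); exact: c1.
move=> x h; rewrite P2; first exact: P1.
case: h => h; [left|right]; rewrite P1 ?opprK//; first by left.
by left.
Qed.

Definition enlarge (r : nat) (s : @state R d) : state :=
  State (st_c s) (maxn r (st_rho s)) (st_P s) (st_M s).

Lemma enlarge_invariant r S s : inv S s -> inv S (enlarge r s).
Proof.
move=> hs; have ad := inv_adm hs.
have le : (st_rho s <= maxn r (st_rho s))%N by exact: leq_maxr.
case: (hs) => h1 h2 h3 h4 h5 h6 h7 h8 h9 h10 h11 h12; split => //=.
- exact: (adm_widen ad).
- by move=> a h; apply: h3; exact: leq_ltn_trans h.
- by move=> m /h9[k1 k2 k3]; split; exact: leq_trans le.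
- by move=> m i t Pm; rewrite (err_widen ad)// h11.
Qed.

Lemma enlarge_extends r s : extends s (enlarge r s).
Proof. by split => //=; exact: leq_maxr. Qed.

(** The pair is placed so far away that bounded amplitudes are negligible with respect
   to both delta * jap ^ theta and jap. *)
Lemma step_exists S s m delta : inv S s -> 0 < delta -> m != 0 -> st_P s m = 0 ->
  st_P s (- m) = 0 -> (nrm m <= st_rho s)%N ->
  exists s', [/\ inv (S + 4 * delta) s', extends s s' & st_P s' m != 0].
Proof.
move=> hs de0 m0 Pm PNm mr.
have [e [e0 me em]] := ortho_exists d2 m0.
have [Y hY] := wave_bounded hs m0 e0 em.
have [n hn] := powR_large Y theta0 de0.
pose L := (20 * (st_rho s).+1 + n)%N.
have pL : (L <= nrm (pair_freq L m e))%N.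
  (* the orthogonal frequency e differs from - m, hence L (m + e) has size at least L *)
  have me0 : m + e != 0.
    apply/eqP => h; have := dotz_gt0 m0.
    have -> : dotz m m = 0.
      by rewrite -[LHS]addr0 -me -dotzDr h /dotz big1// => i _; rewrite mxE mulr0.
    by rewrite ltxx.
  rewrite /pair_freq; have -> : nrm ((m + e) *+ L) = (L * nrm (m + e))%N.
    by rewrite /nrm big_distrr; apply: eq_bigr => i _ /=; rewrite mulmxnE -mulr_natl abszM natz absz_nat.
  by rewrite leq_pmulr// lt0n nrm_eq0.
have prho : (20 * (st_rho s).+1 <= nrm (pair_freq L m e))%N by exact: leq_trans (leq_addr _ _) pL.
have hbig a i t : a \in newfreqs m (pair_freq L m e) -> -1 <= t <= 1 ->
    [/\ cab (pair_wave s m e L a i t) <= jap a,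
       cab (pair_wave s m e L a i t) <= delta * jap a `^ theta &
      cab (cder (pair_wave s m e L a i) t) <= jap a].
  move=> an ht; have [h1 h2] := hY L a i t ht.
  have na : (n <= 1 + nrm a)%N.
    by have := newfreq_size mr prho an; move: pL; rewrite /L; clear; lia.
  have [k1 k2] := hn (jap a) (etrans (ler_nat _ _ _) na).
  by split; [exact: le_trans k1|exact: le_trans k2|exact: le_trans k1].
exists (step_state theta delta s m e L); split.
- by apply: step_invariant.
- split => /=; first by rewrite /step_rho leq_addl.
    move=> a h; split; last exact: step_M_ball.
    apply: funext => i; exact: (wave_fun_ball theta0 C02 C11 m0 e0 me em de0 mr prho).
  move=> x hx; rewrite /step_P; case: eqP => // xm; move: hx.
  by rewrite xm Pm PNm eqxx => -[].
by rewrite /= /step_P eqxx -nrm_eq0 -lt0n; move: prho; clear; lia.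
Qed.

(** Stage n treats the frequency number n of an enumeration of the lattice, unless
   it or its opposite was treated; Hermitian symmetry makes the error vanish at
   both. The radius is enlarged first, as a step needs m in the current ball. *)
Lemma stage_exists S s n delta : inv S s -> 0 < delta ->
  exists s', [/\ inv (S + 4 * delta) s', extends s s', (n <= st_rho s')%N &
    forall m : mode, unpickle n = Some m -> m != 0 -> st_P s' m != 0 \/ st_P s' (- m) != 0].
Proof.
move=> hs de0.
have weak s' : inv S s' -> inv (S + 4 * delta) s'.
  case=> h1 h2 h3 h4 h5 h6 h7 h8 h9 h10 h11 h12; split => // K.
  by rewrite (le_trans (h12 K))// lerDl mulr_ge0// ltW.
pose s1 := enlarge n s.
have hs1 : inv S s1 by exact: enlarge_invariant.
have e1 : extends s s1 by exact: enlarge_extends.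
have r1 : (n <= st_rho s1)%N by exact: leq_maxl.
case En : (unpickle n) => [m|]; last by exists s1; split => //; exact: weak.
have [->|m0] := eqVneq m 0.
  by exists s1; split => //; [exact: weak|move=> _ [<-]; rewrite eqxx].
pose s2 := enlarge (nrm m) s1.
have hs2 : inv S s2 by exact: enlarge_invariant.
have e2 : extends s s2 by apply: extends_trans e1 _; exact: enlarge_extends.
have r2 : (n <= st_rho s2)%N by exact: leq_trans (leq_maxr _ _).
have [Pm|Pm] := eqVneq (st_P s2 m) 0; last first.
  by exists s2; split => //; [exact: weak|move=> _ [<-] _; left].
have [PNm|PNm] := eqVneq (st_P s2 (- m)) 0; last first.
  by exists s2; split => //; [exact: weak|move=> _ [<-] _; right].
have [s' [i' e' P']] := step_exists hs2 de0 m0 Pm PNm (leq_maxl _ _).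
exists s'; split => //; first exact: extends_trans e'.
  by rewrite (leq_trans r2)//; exact: ext_rho e'.
by move=> _ [<-] _; left.
Qed.

(** Stage n spends 4 de n = eps / 2^(n+1), a total of eps. *)
Lemma stages_exist S0 s0 eps : inv S0 s0 -> 0 < eps -> exists s_ : nat -> @state R d,
  [/\ s_ 0%N = s0, forall n, inv (S0 + eps) (s_ n), forall n k, (n <= k)%N -> extends (s_ n) (s_ k),
      forall n, (n <= st_rho (s_ n.+1))%N &
      forall n m, unpickle n = Some m -> m != 0 -> st_P (s_ n.+1) m != 0 \/ st_P (s_ n.+1) (- m) != 0].
Proof.
move=> h0 eps0; pose de n : R := eps / 8 * 2^-1 ^+ n.
have de0 n : 0 < de n by rewrite /de mulr_gt0 ?divr_gt0// exprn_gt0// invr_gt0.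
pose S n : R := S0 + eps * (1 - 2^-1 ^+ n).
have Sn n : S n.+1 = S n + 4 * de n.
  by rewrite /S /de exprS; field.
(* the next state is chosen as a total function of the stage and of the current state *)
have /choice[f hf] : forall p : nat * @state R d, exists s', inv (S p.1) p.2 ->
    [/\ inv (S p.1.+1) s', extends p.2 s', (p.1 <= st_rho s')%N &
    forall m : mode, unpickle p.1 = Some m -> m != 0 -> st_P s' m != 0 \/ st_P s' (- m) != 0].
  move=> [n s] /=; have [hs|hs] := pselect (inv (S n) s); last by exists s.
  by have [s' h] := stage_exists n hs (de0 n); exists s'; rewrite Sn.
pose fix g n := if n is n'.+1 then f (n', g n') else s0.
have hg n : inv (S n) (g n).
  elim: n => [|n IH] /=; first by rewrite /S expr0 subrr mulr0 addr0.
  by have [] := hf (n, g n) IH.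
exists g; split => //.
- move=> n; case: (hg n) => h1 h2 h3 h4 h5 h6 h7 h8 h9 h10 h11 h12; split => // K.
  rewrite (le_trans (h12 K))// /S lerD2l ler_piMr ?(ltW eps0)// gerBl exprn_ge0// invr_ge0//.
- move=> n k nk; rewrite -(subnK nk); elim: (k - n)%N => [|j IH]; first exact: extends_refl.
  by rewrite addSn; apply: extends_trans IH _; have [] := hf (_, _) (hg (j + n)%N).
- by move=> n; have [] := hf (n, g n) (hg n).
by move=> n m; have [_ _ _ h] := hf (n, g n) (hg n); exact: h.
Qed.

End Steps.

Lemma admissible_nz rho c a i t : @admissible R d rho c -> c a i t != 0 -> a != 0 /\ (nrm a <= rho)%N.
Proof.
move=> ad ca; split; first by apply: contra_neq ca => ->; exact: adm_zero ad _ _.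
by rewrite leqNgt; apply: contra ca => h; rewrite (adm_supp ad).
Qed.

(** What is retained of the limit of the cascade. The error vanishes (fl_conv), the
   part above rho0 is small in a weighted l^1 space (fl_sum), and, at each
   frequency m, the convolution is a finite sum (fl_conv) whose absolute values
   add up to at most a power of m (fl_weight). The last two facts are a substitute
   for square integrability, which fails in general. *)
Record flow (theta eps : R) (rho0 : nat) (c : mode -> 'I_d -> R -> C) (M : mode -> R) : Prop := Flow {
  fl_herm : forall a i t, c (- a) i t = conjc (c a i t);
  fl_zero : forall i t, c 0 i t = 0;
  fl_div : forall a t, \sum_i zc a i * c a i t = 0;
  fl_ctf : forall a i, ctf (c a i);
  fl_M0 : forall a, 0 <= M a;
  fl_M : forall a i t, -1 <= t <= 1 -> cab (c a i t) <= M a;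
  fl_poly : exists C1 : R, forall a, M a <= C1 * jap a;
  fl_sum : forall K, \sum_(a <- box K | (rho0 < nrm a)%N) jap a `^ (- theta) * M a <= eps;
  fl_conv : forall m, m != 0 -> exists k : nat,
    (forall a i j t t', c a i t != 0 -> c (m - a) j t' != 0 -> (nrm a <= k)%N) /\
    forall K i t, (k <= K)%N -> err K c m i t = 0;
  fl_weight : exists (C4 : R) (N : nat), 0 <= C4 /\
    forall m, m != 0 -> forall K, exists om : mode -> R,
    [/\ forall a, 0 <= om a, \sum_(a <- box K) om a <= C4 &
     forall a i j t, a \in box K -> -1 <= t <= 1 ->
       cab (c a i t * c (m - a) j t) <= jap m ^+ N * om a] }.

Section Limit.
Variables (theta C0 C1 eps : R) (rho0 : nat) (s_ : nat -> @state R d).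
Hypotheses (C02 : 2 <= C0) (C11 : 1 <= C1).
Hypothesis hinv : forall n, invariant theta C0 C1 rho0 eps (s_ n).
Hypothesis hext : forall n k, (n <= k)%N -> extends (s_ n) (s_ k).
Hypothesis hrho : forall n, (n <= st_rho (s_ n.+1))%N.
Hypothesis htreat : forall n m, unpickle n = Some m -> m != 0 ->
  st_P (s_ n.+1) m != 0 \/ st_P (s_ n.+1) (- m) != 0.

(** The coefficient at a does not change once the radius has reached |a|, which
   happens at stage |a| + 1. *)
Definition limit_c a := st_c (s_ (nrm a).+1) a.
Definition limit_M a := st_M (s_ (nrm a).+1) a.

Lemma limit_eq n a : (nrm a < n)%N -> st_c (s_ n) a = limit_c a /\ st_M (s_ n) a = limit_M a.
Proof. by move=> h; apply: ext_c (hext h) _ (hrho _). Qed.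

Lemma limit_c_eq n a i t : (nrm a < n)%N -> limit_c a i t = st_c (s_ n) a i t.
Proof. by move=> /limit_eq[->]. Qed.

Let ad n := inv_adm (hinv n).

Lemma treated m n : m != 0 -> (pickle m < n)%N ->
  [/\ st_P (s_ n) m != 0 \/ st_P (s_ n) (- m) != 0,
      st_P (s_ n) m = st_P (s_ (pickle m).+1) m &
      st_P (s_ n) (- m) = st_P (s_ (pickle m).+1) (- m)].
Proof.
move=> m0 mn; have tr := htreat (pickleK m) m0; have e := hext mn.
have h1 : st_P (s_ n) m = st_P (s_ (pickle m).+1) m by exact: ext_P e _ tr.
have h2 : st_P (s_ n) (- m) = st_P (s_ (pickle m).+1) (- m).
  by apply: (ext_P e); rewrite opprK; case: tr; [right|left].
by rewrite h1 h2.
Qed.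

(** After its treatment, a frequency m only sees interactions of frequencies of size
   at most C0 |m| and those of its own pair, which later stages leave in place. *)
Lemma interaction_bound m : m != 0 -> exists k : nat, forall n, (pickle m < n)%N ->
  forall a i j t t', st_c (s_ n) a i t != 0 -> st_c (s_ n) (m - a) j t' != 0 -> (nrm a <= k)%N.
Proof.
move=> m0; pose n1 := (pickle m).+1; pose r1 := st_rho (s_ n1).
pose k0 := (Num.trunc (C0 * (nrm m)%:R)).+1.
exists (maxn k0 r1) => n mn a i j t t' ca cb; have ab : a + (m - a) = m by rewrite addrC subrK.
have := inv_res (hinv n) ca cb; rewrite ab => /(_ m0)[h|].
  rewrite (leq_trans _ (leq_maxl _ _))// -(ler_nat R) (le_trans _ (ltW (truncnS_gt _)))//.
  by rewrite (le_trans _ h)// ler_nat leq_addr.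
have [_ P1 P2] := treated m0 mn.
rewrite /partner ab /= P1 P2 => h; rewrite (leq_trans _ (leq_maxr _ _))//.
have ball x : (nrm (st_P (s_ n1) x) <= r1)%N /\ (nrm x <= r1 -> nrm (x - st_P (s_ n1) x) <= r1)%N.
  have [->|Px] := eqVneq (st_P (s_ n1) x) 0; first by rewrite nrm0 subr0.
  by have [_ h1 h2] := inv_Pball (hinv n1) Px.
have mr : (nrm m <= r1)%N.
  have [tr _ _] := @treated m n1 m0 (leqnn _).
  by case: tr => /(inv_Pball (hinv n1))[]; rewrite ?nrmN.
case: h => ->; rewrite ?nrmN.
- by have [] := ball m.
- by have [_ ->] := ball m.
- by have [] := ball (- m).
by have [_] := ball (- m); rewrite nrmN => /(_ mr); rewrite -nrmN opprD !opprK.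
Qed.

Lemma limit_err m K n i t : (d * K + nrm m < n)%N ->
  err K limit_c m i t = err K (fun a => st_c (s_ n) a) m i t.
Proof.
move=> hn; have mn : (nrm m < n)%N by apply: leq_ltn_trans hn; exact: leq_addl.
have E : limit_c m = st_c (s_ n) m by have [->] := limit_eq mn.
rewrite /err E; congr (_ + _); apply: eq_bigr => k _; congr (_ * _).
apply: eq_bigr => l _; congr (_ * _); rewrite /boxconv big_seq [RHS]big_seq.
apply: eq_bigr => a /box_nrm ha; rewrite !(@limit_c_eq n)//.
  by apply: leq_ltn_trans hn; rewrite addnC (leq_trans _ (leq_add (leqnn _) ha))// -(nrmN a) nrmD.
by apply: leq_ltn_trans hn; rewrite (leq_trans ha)// leq_addr.
Qed.

(** At m the limit coincides with a late stage, where either m or - m has been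
   treated. *)
Lemma limit_conv m : m != 0 -> exists k : nat,
    (forall a i j t t', limit_c a i t != 0 -> limit_c (m - a) j t' != 0 -> (nrm a <= k)%N) /\
    forall K i t, (k <= K)%N -> err K limit_c m i t = 0.
Proof.
move=> m0; have [k hk] := interaction_bound m0; exists k; split.
  move=> a i j t t'; pose n := (pickle m + nrm a + nrm (m - a)).+1.
  rewrite !(@limit_c_eq n); first by apply: hk; rewrite /n ltnS -addnA leq_addr.
    by rewrite /n ltnS leq_addl.
  by rewrite /n ltnS addnAC leq_addl.
move=> K i t kK; pose n := (pickle m + d * K + nrm m).+1.
rewrite (@limit_err _ _ n); last by rewrite /n ltnS -addnA leq_addl.
have mn : (pickle m < n)%N by rewrite /n ltnS -addnA leq_addr.
have -> : err K (fun a => st_c (s_ n) a) m i t = err (st_rho (s_ n)) (st_c (s_ n)) m i t.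
  rewrite -(err_widen (ad n) (K := (K + st_rho (s_ n))%N)) ?leq_addl//.
  rewrite /err; congr (_ + _); apply: eq_bigr => u _; congr (_ * _).
  apply: eq_bigr => l _; congr (_ * _); apply/esym/sum_widen; rewrite ?box_uniq//.
    by apply: box_mono; exact: leq_addr.
  move=> a _ na; apply/eqP; apply: contraNT na; rewrite mulf_eq0 negb_or => /andP[ca cb].
  by apply: nrm_box; rewrite (leq_trans _ kK)//; exact: hk ca cb.
have [[Pm|PNm] _ _] := treated m0 mn; first exact: (inv_kill (hinv n) i t Pm).
by rewrite -[m]opprK (err_herm (ad n)) (inv_kill (hinv n) i t PNm) conjc0.
Qed.

Let pos0 : 0 <= C1. Proof. exact: le_trans C11. Qed.
Let C00 : 0 <= C0. Proof. exact: le_trans C02. Qed.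
Let ampC0 : 0 <= @ampC R d C0 C1.
Proof. by rewrite /ampC mulr_ge0// errC_ge0. Qed.

(** Bounds the two kinds of interactions: those between frequencies comparable to m,
   and those of the resonant pair of m, whose amplitudes are 2 and ampC * jap m ^+ ampN. *)
Definition weightC : R := C1 ^+ 2 * C0 ^+ (2 + d.*2) + 2 * @ampC R d C0 C1.

(** The comparable interactions are paid for by the summable weight, the four resonant
   ones by a counting weight. *)
Lemma weight_stage n m K : m != 0 -> exists om : mode -> R,
    [/\ forall a, 0 <= om a, \sum_(a <- box K) om a <= weightC * (5 ^+ d + 4) &
     forall a i j t, -1 <= t <= 1 ->
       cab (st_c (s_ n) a i t * st_c (s_ n) (m - a) j t) <= jap m ^+ (2 + d.*2 + @ampN d) * om a].
Proof.
move=> m0; pose P := st_P (s_ n).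
pose ps := [:: P m; m - P m; - P (- m); m + P (- m)].
pose om a := weightC * (wt a + (count_mem a ps)%:R).
have w0 : 0 <= weightC by rewrite /weightC; apply: addr_ge0; apply: mulr_ge0 => //; exact: exprn_ge0.
exists om; split => [a||a i j t ht].
- by rewrite /om mulr_ge0// addr_ge0 ?wt_ge0.
- rewrite /om -mulr_sumr ler_wpM2l// big_split/= lerD ?wt_sum5 ?box_uniq//.
  rewrite -natr_sum ler_nat.
  have aux (l : seq mode) : (\sum_(a <- box K) count_mem a l <= size l)%N.
    elim: l => [|x l IH] /=; first by rewrite big1.
    rewrite big_split/= -[X in (_ <= X)%N]add1n leq_add//.
    under eq_bigr do rewrite eq_sym.
    rewrite -(big_map (fun i => (i == x) : nat) xpredT id) -sumnE sumn_count count_uniq_mem ?box_uniq//; exact: leq_b1.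
  exact: (aux ps).
have jm1 : 1 <= jap m :> R := jap_ge1 m.
have jm0 : 0 <= jap m :> R := jap_ge0 m.
have [->|ca] := eqVneq (st_c (s_ n) a i t) 0.
  by rewrite mul0r cab0 mulr_ge0 ?exprn_ge0// mulr_ge0// addr_ge0 ?wt_ge0.
have [->|cb] := eqVneq (st_c (s_ n) (m - a) j t) 0.
  by rewrite mulr0 cab0 mulr_ge0 ?exprn_ge0// mulr_ge0// addr_ge0 ?wt_ge0.
have w1 : C1 ^+ 2 * C0 ^+ (2 + d.*2) <= weightC by rewrite lerDl mulr_ge0.
have w2 : 2 * @ampC R d C0 C1 <= weightC.
  by rewrite lerDr mulr_ge0// exprn_ge0.
have ab : a + (m - a) = m by rewrite addrC subrK.
have [a0 _] := admissible_nz (ad n) ca; have [b0 _] := admissible_nz (ad n) cb.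
rewrite (le_trans (cabM _ _))//.
have := inv_res (hinv n) ca cb; rewrite ab => /(_ m0)[h|].
  have ja : jap a <= C0 * jap m.
    rewrite /jap natrD [in leRHS]natrD mulrDr mulr1; apply: lerD; first by rewrite (le_trans _ C02)// ler1n.
    by rewrite (le_trans _ h)// ler_nat leq_addr.
  have jb : jap (m - a) <= C0 * jap m.
    rewrite /jap natrD [in leRHS]natrD mulrDr mulr1; apply: lerD; first by rewrite (le_trans _ C02)// ler1n.
    by rewrite (le_trans _ h)// ler_nat leq_addl.
  have b1 x k' : jap x <= C0 * jap m -> cab (st_c (s_ n) x k' t) <= C1 * (C0 * jap m).
    move=> hx; rewrite (le_trans (inv_M (hinv n) _ _ ht))// (le_trans (inv_M1 (hinv n) _))//.
    by rewrite ler_wpM2l.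
  apply: (@le_trans _ _ ((C1 * (C0 * jap m)) * (C1 * (C0 * jap m)))).
    by rewrite ler_pM ?cab_ge0 ?b1.
  have h1 : 1 <= (C0 * jap m) ^+ d.*2 * wt a.
    rewrite /wt ler_pdivlMr ?exprn_gt0 ?jap_gt0// mul1r.
    by rewrite lerXn2r ?nnegrE ?jap_ge0// mulr_ge0.
  have h2 : 0 <= C1 * (C0 * jap m) * (C1 * (C0 * jap m)) by rewrite !mulr_ge0.
  apply: (le_trans (ler_peMr h2 h1)).
  rewrite [leLHS](_ : _ = jap m ^+ (2 + d.*2) * (C1 ^+ 2 * C0 ^+ (2 + d.*2) * wt a)); last first.
    by rewrite !exprMn !exprD; ring.
  apply: ler_pM; rewrite ?exprn_ge0//; first by nonneg.
    by rewrite ler_weXn2l// leq_addr.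
  apply: ler_pM; rewrite ?wt_ge0//; first by rewrite mulr_ge0// exprn_ge0.
  by rewrite lerDl.
have cl x i' j' : P x != 0 -> cab (st_c (s_ n) (P x) i' t) * cab (st_c (s_ n) (x - P x) j' t) <=
    weightC * jap x ^+ @ampN d.
  move=> Px; have [k1 _] := inv_amp (hinv n) i' Px ht; have [_ k2] := inv_amp (hinv n) j' Px ht.
  rewrite (le_trans (ler_pM (cab_ge0 _) (cab_ge0 _) k1 k2))// mulrA ler_wpM2r//.
  by rewrite exprn_ge0// jap_ge0.
move=> pa; have aps : a \in ps.
  by move: pa; rewrite /partner /= ab -/P !inE => -[] <-; rewrite eqxx ?orbT.
suff h : cab (st_c (s_ n) a i t) * cab (st_c (s_ n) (m - a) j t) <= weightC * jap m ^+ @ampN d.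
  rewrite (le_trans h)// mulrC ler_pM ?exprn_ge0//; first by rewrite ler_weXn2l// leq_addl.
  rewrite ler_peMr// (le_trans (_ : 1 <= (count_mem a ps)%:R))//.
    by rewrite ler1n -has_count has_pred1.
  by rewrite lerDr wt_ge0.
have nP x y : x = P y -> x != 0 -> P y != 0 by move=> <-.
have cNN x i' : cab (st_c (s_ n) (- x) i' t) = cab (st_c (s_ n) x i' t).
  by rewrite (adm_herm (ad n)) cabJ.
move: pa; rewrite /partner /= ab -/P => -[] e.
- by have := nP _ _ e a0; rewrite e => Px; exact: cl.
- have e' : m - a = P m by rewrite e subKr.
  by have := nP _ _ e' b0; rewrite e' e => Px; rewrite mulrC; exact: cl.
- have e' : - a = P (- m) by rewrite e opprK.
  have Px : P (- m) != 0 by rewrite -e' oppr_eq0.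
  rewrite -[X in X * _]cNN -[X in _ * X]cNN (_ : - (m - a) = - m - P (- m)) ?e'; last by rewrite -e' opprB addrC opprK.
  by rewrite -(japN m); exact: cl.
have e' : - (m - a) = P (- m) by rewrite opprB e addrAC subrr add0r.
have Px : P (- m) != 0 by rewrite -e' oppr_eq0.
rewrite -cNN -[X in _ * X]cNN e' (_ : - a = - m - P (- m)); last by rewrite e opprD.
by rewrite mulrC -(japN m); exact: cl.
Qed.

Lemma limit_flow : flow theta eps rho0 limit_c limit_M.
Proof.
split.
- move=> a i t; pose n := (nrm a).+1.
  by rewrite !(@limit_c_eq n) ?nrmN//; exact: adm_herm (ad n) _ _ _.
- by move=> i t; rewrite (@limit_c_eq 1) ?nrm0//; exact: adm_zero (ad 1) _ _.
- by move=> a t; exact: adm_div (ad _) _ _.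
- by move=> a i; exact: adm_ctf (ad _) _ _.
- by move=> a; exact: inv_M0 (hinv _) _.
- by move=> a i t ht; exact: (inv_M (hinv _)).
- by exists C1 => a; exact: (inv_M1 (hinv _)).
- move=> K; rewrite (le_trans _ (inv_sum (hinv (d * K).+1) K))//.
  rewrite big_seq_cond [leRHS]big_seq_cond; apply: ler_sum => a /andP[aK _].
  by case: (@limit_eq (d * K).+1 a) => [|_ ->]; rewrite ?ltnS ?box_nrm.
- exact: limit_conv.
exists (weightC * (5 ^+ d + 4)), (2 + d.*2 + @ampN d)%N; split.
  rewrite mulr_ge0//; first by rewrite /weightC; apply: addr_ge0; apply: mulr_ge0 => //; exact: exprn_ge0.
move=> m m0 K; pose n := (d * K + nrm m).+1.
have [om [h1 h2 h3]] := weight_stage n K m0; exists om; split => // a i j t /box_nrm aK ht.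
rewrite !(@limit_c_eq n); first exact: h3.
  by rewrite /n ltnS addnC (leq_trans _ (leq_add (leqnn _) aK))// -(nrmN a) nrmD.
by rewrite /n ltnS (leq_trans aK)// leq_addr.
Qed.

End Limit.

(** The constant C0 is large enough for all interactions of the initial field to
   count as comparable with their sum, which is possible as the field is finite. *)
Lemma flow_exists theta eps rho0 c0 : (2 <= d)%N -> 0 < theta -> 0 < eps -> admissible rho0 c0 ->
  exists c M, flow theta eps rho0 c M /\ forall a, (nrm a <= rho0)%N -> c a = c0 a.
Proof.
move=> d2 th0 eps0 ad0.
have [B B0 hB] : exists2 B : R, 0 <= B & forall a i t, -1 <= t <= 1 ->
    cab (c0 a i t) <= B /\ cab (cder (c0 a i) t) <= B.
  have /choice[f hf] : forall ai : mode * 'I_d, exists B : R, 0 <= B /\ forall t, -1 <= t <= 1 ->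
      cab (c0 ai.1 ai.2 t) <= B /\ cab (cder (c0 ai.1 ai.2) t) <= B.
    move=> [a i] /=; have [B b0 hB] := ctf_bounded (adm_ctf ad0 a i).
    have [B' b0' hB'] := ctf_bounded (ctf_cder (adm_ctf ad0 a i)).
    exists (B + B'); split; first exact: addr_ge0.
    by move=> t ht; split; [rewrite (le_trans (hB t ht))// lerDl|rewrite (le_trans (hB' t ht))// lerDr].
  have f0 ai : 0 <= f ai by have [] := hf ai.
  exists (\sum_(a <- box rho0) \sum_i f (a, i)); first by apply: sumr_ge0 => a _; apply: sumr_ge0.
  move=> a i t ht.
  have [ar|ar] := leqP (nrm a) rho0; last first.
    have -> : c0 a i = fun=> 0 by apply: funext => u; exact: adm_supp ad0 _ _ _ ar.
    rewrite cder_cst cab0; split; by apply: sumr_ge0 => b _; apply: sumr_ge0.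
  have le : f (a, i) <= \sum_(a <- box rho0) \sum_i f (a, i).
    rewrite (bigD1_seq a) ?box_uniq//=; last exact: nrm_box.
    rewrite (bigD1 i)//= -addrA lerDl addr_ge0//; first by apply: sumr_ge0.
    by apply: sumr_ge0 => b _; apply: sumr_ge0.
  by have [_ /(_ t ht)[/= h1 h2]] := hf (a, i); split; [exact: le_trans le|exact: le_trans le].
pose C1 := Num.max 1 B.
have C11 : 1 <= C1 by rewrite le_max lexx.
have BC1 : B <= C1 by rewrite le_max lexx orbT.
pose C0 : R := (2 + 2 * rho0)%:R.
have C02 : 2 <= C0 by rewrite ler_nat leq_addr.
have C1j a : B <= C1 * jap a.
  by rewrite (le_trans BC1)// ler_peMr ?jap_ge1// (le_trans _ C11).
pose s0 := State c0 rho0 (fun=> 0) (fun a : mode => if (nrm a <= rho0)%N then B else 0).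
have hs0 : invariant theta C0 C1 rho0 0 s0.
  split => //=.
  - by move=> a; case: ifP.
  - by move=> a; rewrite ltnNge => /negPf ->.
  - move=> a i t ht; case: leqP => ar; first by have [] := hB a i t ht.
    by rewrite (adm_supp ad0)// cab0.
  - move=> a; case: ifP => // _; rewrite mulr_ge0 ?jap_ge0// (le_trans _ C11)//.
  - by move=> a i t ht; have [_ h] := hB a i t ht; exact: le_trans (C1j a).
  - move=> a b i j t t' ca cb ab; left.
    have [_ ra] := admissible_nz ad0 ca; have [_ rb] := admissible_nz ad0 cb.
    have nab := nrm_gt0 ab.
    apply: (@le_trans _ _ (2 * rho0)%:R); first by rewrite ler_nat mul2n -addnn leq_add.
    by rewrite /C0 -natrM ler_nat (leq_trans _ (leq_pmulr _ nab))// leq_addl.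
  - by move=> m; rewrite eqxx.
  - by move=> m i t; rewrite eqxx.
  - by move=> m i t; rewrite eqxx.
  by move=> K; rewrite big1// => a; rewrite ltnNge => /negPf ->; rewrite mulr0.
have [s_ [e0 hinv hext hrho htreat]] := stages_exist th0 C02 C11 d2 hs0 eps0.
have hinv' n : invariant theta C0 C1 rho0 eps (s_ n) by rewrite -[eps]add0r.
exists (limit_c s_), (limit_M s_); split; first exact: (limit_flow C02 C11 hinv' hext hrho htreat).
move=> a ar; rewrite /limit_c; have := ext_c (hext 0%N (nrm a).+1 isT) (a := a).
by rewrite e0 => /(_ ar)[->].
Qed.

End Iteration.

(** * The tensor product as a paraproduct *)

Section Paraproduct.
Context {R : realType} {d : nat}.
Local Notation mode := 'rV[int]_d.
Local Notation C := R[i].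
Implicit Types (m a b : mode) (t : R).

Lemma real_mul0l (z : C) : real_mul 0 z = 0.
Proof. by rewrite real_mulE !mul0r. Qed.

(** Sums over a set are suprema over its finite subsets. *)
Lemma esum_le_fin (T : choiceType) (A : set T) (f : T -> R) (B : R) :
  (forall x, 0 <= f x) ->
  (forall s : seq T, uniq s -> (forall x, x \in s -> A x) -> \sum_(x <- s) f x <= B) ->
  (\esum_(x in A) (f x)%:E <= B%:E)%E.
Proof.
move=> f0 h; apply: ge_ereal_sup => _ [X [fX XA] <-].
rewrite fsbig_finite//= sumEFin lee_fin; apply: h; first exact: finmap.fset_uniq.
by move=> x; rewrite in_fset_set// inE => /XA.
Qed.

Lemma enorm_powR_le m (n : nat) : m != 0 ->
  enorm (freq m : 'rV[R]_d) `^ (- n%:R) <= (1 + d%:R) ^+ n / jap m ^+ n.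
Proof.
move=> m0; have e1 := enorm_freq_ge1 (R := R) m0.
have e0 : 0 < enorm (freq m : 'rV[R]_d) by exact: lt_le_trans ltr01 e1.
rewrite powRN powR_mulrn ?(ltW e0)// -invf_div -expr_div_n lef_pV2 ?posrE ?exprn_gt0//; last first.
  by rewrite divr_gt0 ?jap_gt0// ltr_wpDr.
rewrite lerXn2r ?nnegrE ?(ltW e0)//; first by rewrite divr_ge0 ?jap_ge0// addr_ge0.
rewrite ler_pdivrMr ?ltr_wpDr// mulrDr mulr1 /jap natrD lerD//.
by rewrite mulrC nrm_le_enorm.
Qed.

(** In a Sobolev space of sufficiently negative order, a weighted l^1 bound on the
   coefficients suffices: the l^2 norm is dominated by the l^1 norm. *)
Lemma sobolev_norm_le (A : @Defs.mdist R d) (n : nat) (D : mode -> R) (B : R) :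
  (forall m i j, m != 0 -> cab (fcoef (A i j) m) <= D m * jap m ^+ n) ->
  (forall m, 0 <= D m) ->
  (forall K, \sum_(m <- box K) D m * wt m <= B) ->
  (sobolev_norm (- (n + d.*2)%:R) A <= (d%:R ^+ 2 * (1 + d%:R) ^+ (n + d.*2) * B)%:E)%E.
Proof.
move=> hA D0 hB; pose k := (n + d.*2)%N.
have B0 : 0 <= B by rewrite (le_trans _ (hB 0%N))// sumr_ge0// => m _; rewrite mulr_ge0 ?wt_ge0.
pose Q : R := d%:R ^+ 2 * (1 + d%:R) ^+ k.
have d1 : 0 <= 1 + d%:R :> R by rewrite addr_ge0.
have Q0 : 0 <= Q by rewrite mulr_ge0 ?exprn_ge0.
have QB : 0 <= Q * B by rewrite mulr_ge0.
rewrite /sobolev_norm -/k -/Q.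
have -> : (Q * B)%:E = (((Q * B) ^+ 2)%:E `^ 2^-1)%E.
  by rewrite poweR_EFin -powR_mulrn// -powRrM mulfV ?powRr1.
have sq0 m : 0 <= mdist_fcoef_sq A m.
  by rewrite sumr_ge0// => i _; rewrite sumr_ge0// => j _; rewrite addr_ge0 ?sqr_ge0.
have f0 m : 0 <= enorm (freq m : 'rV[R]_d) `^ (2 * - k%:R) * mdist_fcoef_sq A m.
  by rewrite mulr_ge0 ?powR_ge0.
apply: gt0_ler_poweR; rewrite ?in_itv/= ?leey ?andbT ?invr_ge0//.
- by apply: esum_ge0 => m _; rewrite lee_fin.
- by rewrite lee_fin exprn_ge0.
apply: esum_le_fin => // s us sA.
have term m : m \in s -> enorm (freq m : 'rV[R]_d) `^ (2 * - k%:R) * mdist_fcoef_sq A m <=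
    (Q * (D m * wt m)) ^+ 2.
  move=> ms; have m0 : m != 0 by apply/eqP; exact: sA.
  have h1 : mdist_fcoef_sq A m <= (d%:R ^+ 2 * (D m * jap m ^+ n)) ^+ 2.
    set Y := D m * jap m ^+ n; have Y0 : 0 <= Y by rewrite mulr_ge0 ?exprn_ge0 ?jap_ge0.
    apply: (@le_trans _ _ (\sum_(i < d) \sum_(j < d) Y ^+ 2)).
      apply: ler_sum => i _; apply: ler_sum => j _; rewrite (le_trans (cab_conj_sqr _))//.
      by rewrite lerXn2r ?nnegrE ?cab_ge0// hA.
    have cs (x : R) : \sum_(l < d) x = d%:R * x by rewrite sumr_const card_ord mulr_natl.
    under eq_bigr do rewrite cs; rewrite cs mulrA -expr2 [leRHS]exprMn.
    apply: ler_wpM2r; first exact: sqr_ge0.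
    by rewrite -exprM -!natrX ler_nat; case: (d) => // d'; rewrite leq_pexp2l.
  have h2 : enorm (freq m : 'rV[R]_d) `^ (2 * - k%:R) <= ((1 + d%:R) ^+ k / jap m ^+ k) ^+ 2.
    rewrite mulrC powRrM powR_mulrn ?powR_ge0// lerXn2r ?nnegrE ?powR_ge0//.
      by rewrite divr_ge0 ?exprn_ge0 ?jap_ge0.
    exact: enorm_powR_le.
  apply: (le_trans (ler_pM (powR_ge0 _ _) (sq0 m) h2 h1)).
  rewrite -exprMn le_eqVlt; apply/orP; left; apply/eqP; congr (_ ^+ 2).
  have jn : jap m ^+ n != 0 :> R by rewrite expf_neq0// gt_eqF ?jap_gt0.
  have jd : jap m ^+ d.*2 != 0 :> R by rewrite expf_neq0// gt_eqF ?jap_gt0.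
  by rewrite /Q /wt /k [jap m ^+ (n + _)]exprD; field; rewrite jn jd.
have [K sK] := seq_sub_box s.
have t0 m : 0 <= Q * (D m * wt m) by rewrite !mulr_ge0 ?wt_ge0.
apply: (@le_trans _ _ (\sum_(m <- s) (Q * (D m * wt m)) * (Q * B))).
  rewrite big_seq [leRHS]big_seq; apply: ler_sum => m ms; rewrite (le_trans (term m ms))//.
  rewrite expr2 ler_wpM2l// ler_wpM2l// (le_trans _ (hB K))//.
  by rewrite (bigD1_seq m) ?box_uniq ?sK//= lerDl sumr_ge0// => x _; rewrite mulr_ge0 ?wt_ge0.
rewrite -mulr_suml expr2 ler_wpM2r// -mulr_sumr ler_wpM2l// (le_trans _ (hB K))//.
by apply: ler_sum_sub; rewrite ?box_uniq// => m; rewrite mulr_ge0 ?wt_ge0.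
Qed.

Lemma tpoly_real K (p : mode -> C) x : herm p ->
  (tpoly (box K) p x)%:C%C = \sum_(m <- box K) p m * expi m x.
Proof.
move=> hp; apply: complex_ext => //=; set S := \sum_(m <- _) _.
have h : conjc S = S.
  rewrite /S cj_sum -[RHS]box_sumN.
  by apply: eq_bigr => m _; rewrite cjM hp conjc_expi.
by move/(congr1 (@complex.Im R)): h; case: S => a b /=; lra.
Qed.

Lemma ft_tpoly_mul K (p q : mode -> C) m : herm p -> herm q ->
  (forall a, a \notin box K -> q a = 0) ->
  ft (fun x => tpoly (box K) p x * tpoly (box K) q x) m =
  \sum_(a <- box K) p a * q (m - a).
Proof.
move=> hp hq q0; rewrite /ft.
have -> : (fun x => (tpoly (box K) p x * tpoly (box K) q x)%:C%C * expi (- m) x : C) =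
    (fun x => \sum_(a <- box K) (fun x => \sum_(b <- box K) (p a * q b) * expi (a + b - m) x) x).
  apply: funext => x; rewrite rmorphM/= !tpoly_real// !mulr_suml; apply: eq_bigr => a _.
  rewrite mulr_sumr mulr_suml; apply: eq_bigr => b _; rewrite !expiD; ring.
have cc a : ccper (fun x : 'rV[R]_d => \sum_(b <- box K) (p a * q b) * expi (a + b - m) x).
  apply: (@ccper_sum R d _ _ (fun b x => (p a * q b) * expi (a + b - m) x)) => b.
  by apply: ccperM; [exact: ccper_cst|exact: ccper_expi].
rewrite (@cint_sum R d _ _ (fun a x => \sum_(b <- box K) (p a * q b) * expi (a + b - m) x))//.
apply: eq_bigr => a _.
rewrite (@cint_sum R d _ _ (fun b x => (p a * q b) * expi (a + b - m) x)); last first.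
  by move=> b; apply: ccperM; [exact: ccper_cst|exact: ccper_expi].
have e b : (a + b - m == 0) = (b == m - a) by rewrite subr_eq0 [a + b]addrC eq_sym -subr_eq eq_sym.
under eq_bigr => b _.
  rewrite cintZ; last exact: ccper_expi.
  rewrite cint_expi e.
  over.
have [h|h] := boolP (m - a \in box K); first by rewrite (sum_delta (fun b => p a * q b)) ?box_uniq.
rewrite q0// mulr0 big1_seq// => b /andP[_ hb].
by rewrite (_ : (b == m - a) = false) ?mulr0//; apply: contraNF h => /eqP <-.
Qed.

Lemma fcoef_sum (I : Type) (s : seq I) (A : I -> @Defs.mdist R d) i j m :
  fcoef ((\sum_(k <- s) A k) i j) m = \sum_(k <- s) fcoef (A k i j) m.
Proof.
elim: s => [|k s IH]; first by rewrite !big_nil /fcoef oppr0.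
by rewrite !big_cons -IH /fcoef; apply: complex_ext => //=; rewrite opprD.
Qed.

Section Multipliers.
Variable chi : 'rV[R]_d -> R.
Hypothesis hchi : lp_bump chi.
Local Notation psi := (psi chi).

Lemma psi_out k m : m \notin box (2 ^ k) -> psi k m = 0.
Proof.
case: k => [|k] h /=; first exact: chik_out hchi _ _ h.
rewrite !(chik_out hchi) ?subrr//; apply: contra h; apply: box_mono.
by rewrite leq_exp2l.
Qed.

Lemma psi_sum k m : \sum_(l < k.+1) psi l m = chik chi k m.
Proof.
elim: k => [|k IH]; first by rewrite big_ord_recr/= big_ord0 add0r.
by rewrite big_ord_recr IH /= addrC subrK.
Qed.

Lemma psi_sum_eq1 n K m : (nrm m <= n)%N -> (n + 3 <= K)%N -> \sum_(l < K) psi l m = 1.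
Proof.
case: K => [|K] mn nK; first by rewrite addnS in nK.
rewrite psi_sum; apply: (chik_eq1 hchi); rewrite (le_lt_trans (enorm_freq_le _))//.
apply: (@le_lt_trans _ _ n%:R); first by rewrite ler_nat.
have h : (2 * n.+2 <= 2 ^ K)%N.
  have h1 : (n.+1 < 2 ^ n.+1)%N by exact: ltn_expl.
  apply: (@leq_trans (2 ^ n.+2)); first by rewrite [(2 ^ n.+2)%N]expnS leq_mul2l.
  by rewrite leq_exp2l//; move: nK; clear; lia.
rewrite -natrX; apply: (@lt_le_trans _ _ (9 / 10 * (2 * n.+2)%:R)); last by rewrite ler_wpM2l// ler_nat.
have n0 : 0 <= n%:R :> R by [].
by rewrite natrM -[n.+2]addn2 natrD; lra.
Qed.

End Multipliers.

Section FlowTensor.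
Variables (theta eps : R) (rho0 : nat) (c : mode -> 'I_d -> R -> C) (M : mode -> R).
Hypothesis hfl : flow theta eps rho0 c M.
Variable kap : mode -> nat.
Hypothesis hkap : forall m, m != 0 ->
    (forall a i j t t', c a i t != 0 -> c (m - a) j t' != 0 -> (nrm a <= kap m)%N) /\
    forall K i t, (kap m <= K)%N -> err K c m i t = 0.
Variables (C1 C4 : R) (N : nat).
Hypothesis hC1 : forall a, M a <= C1 * jap a.
Hypothesis C40 : 0 <= C4.
Hypothesis hC4 : forall m, m != 0 -> forall K, exists om : mode -> R,
    [/\ forall a, 0 <= om a, \sum_(a <- box K) om a <= C4 &
     forall a i j t, a \in box K -> -1 <= t <= 1 ->
       cab (c a i t * c (m - a) j t) <= jap m ^+ N * om a].

(** The coefficients of the tensor product: a finite sum, over any box that contains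
   the interacting frequencies. The mean is put to 0, as the product is only
   defined modulo constants. *)
Definition conv i j m t : C := if m == 0 then 0 else boxconv (kap m) c i j m t.

Lemma conv_boxE i j m t K : m != 0 -> (kap m <= K)%N -> boxconv K c i j m t = conv i j m t.
Proof.
move=> m0 kK; rewrite /conv (negPf m0); apply: sum_widen; rewrite ?box_uniq//.
  exact: box_mono.
move=> a _ na; apply/eqP; apply: contraNT na; rewrite mulf_eq0 negb_or => /andP[ca cb].
by apply: nrm_box; have [h _] := hkap m0; exact: h ca cb.
Qed.

Lemma cc_sum_le m K i j t : m != 0 -> -1 <= t <= 1 ->
  \sum_(a <- box K) cab (c a i t * c (m - a) j t) <= C4 * jap m ^+ N.
Proof.
move=> m0 ht; have [om [h1 h2 h3]] := hC4 m0 K.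
apply: (@le_trans _ _ (\sum_(a <- box K) jap m ^+ N * om a)).
  by rewrite big_seq [leRHS]big_seq; apply: ler_sum => a ha; exact: h3.
by rewrite -mulr_sumr mulrC ler_wpM2r// exprn_ge0 ?jap_ge0.
Qed.

Lemma conv_le i j m t : -1 <= t <= 1 -> cab (conv i j m t) <= C4 * jap m ^+ N.
Proof.
move=> ht; rewrite /conv; case: eqVneq => [->|m0].
  by rewrite cab0 mulr_ge0// exprn_ge0// jap_ge0.
by rewrite (le_trans (cab_sum _ _ _))// cc_sum_le.
Qed.

Lemma conv_herm i j m t : conv i j (- m) t = conjc (conv i j m t).
Proof.
have [->|m0] := eqVneq m 0; first by rewrite /conv oppr0 eqxx conjc0.
rewrite -(@conv_boxE i j (- m) t (kap m + kap (- m))) ?oppr_eq0 ?leq_addl//.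
rewrite -(@conv_boxE i j m t (kap m + kap (- m))) ?leq_addr// cj_sum /boxconv.
rewrite -[RHS]box_sumN; apply: eq_bigr => a _.
by rewrite cjM -!(fl_herm hfl) opprK opprD.
Qed.

Lemma conv_pbd i j t : -1 <= t <= 1 -> pbd C4 N (fun m => conv i j m t).
Proof. by move=> ht m; exact: conv_le. Qed.

Lemma flow_pbd i t : -1 <= t <= 1 -> pbd C1 1 (fun m => c m i t).
Proof. by move=> ht m; rewrite expr1 (le_trans (fl_M hfl _ _ ht))// hC1. Qed.

Lemma flow_hermt i t : herm (fun m => c m i t).
Proof. by move=> m; exact: fl_herm hfl _ _ _. Qed.

Definition flow_u t : @Defs.vdist R d := fun i => synth (fun m => c m i t).
Definition flow_F t : @Defs.mdist R d := fun i j => synth (fun m => conv i j m t).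

Variable t : R.
Hypothesis ht : -1 <= t <= 1.

Lemma fcoef_flow_u i : fcoef (flow_u t i) = fun m => c m i t.
Proof. exact: fcoef_synth (flow_pbd i ht) (flow_hermt i t). Qed.

Lemma fcoef_flow_F i j : fcoef (flow_F t i j) = fun m => conv i j m t.
Proof. by apply: fcoef_synth (conv_pbd i j ht) _ => m; exact: conv_herm. Qed.

Variable chi : 'rV[R]_d -> R.
Hypothesis hchi : lp_bump chi.
Local Notation psi := (psi chi).

Lemma lp_flow k n i : (k <= n)%N ->
  lp chi k (flow_u t i) = tpoly (box (2 ^ n)) (fun m => real_mul (psi k m) (c m i t)).
Proof.
move=> kn; apply: funext => x; rewrite (lpE hchi) fcoef_flow_u; congr (_ x); apply/esym.
apply: tpoly_widen; rewrite ?box_uniq//; first by apply: box_mono; rewrite leq_exp2l.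
by move=> m _ h; rewrite (psi_out hchi)// real_mul0l.
Qed.

Lemma fcoef_lp_tensor k l n i j m : (k <= n)%N -> (l <= n)%N ->
  fcoef (lp_tensor chi k l (flow_u t) i j) m =
  \sum_(a <- box (2 ^ n)) real_mul (psi k a * psi l (m - a)) (c a i t * c (m - a) j t).
Proof.
move=> kn ln; rewrite /lp_tensor fcoef_fun; last by apply: cperM; exact: cper_lp.
rewrite (lp_flow i kn) (lp_flow j ln) ft_tpoly_mul.
- by apply: eq_bigr => a _; rewrite !real_mulE; apply: complex_ext; rewrite ?ReM ?ImM/= ?ReM ?ImM; ring.
- by move=> a; rewrite (psiN hchi) (fl_herm hfl) conjc_real_mul.
- by move=> a; rewrite (psiN hchi) (fl_herm hfl) conjc_real_mul.
move=> a ha; rewrite (psi_out hchi) ?real_mul0l//.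
by apply: contra ha; apply: box_mono; rewrite leq_exp2l.
Qed.

(** Summing over all pairs of blocks costs a bounded factor at each pair of
   frequencies; the absolute convolution sums are polynomially bounded. *)
Lemma flow_tensor_summable :
  (\esum_(kl in [set: nat * nat])
     sobolev_norm (- (N + d.*2)%:R) (lp_tensor chi kl.1 kl.2 (flow_u t)) < +oo)%E.
Proof.
have [X X0 hX] := sum_psi_bounded hchi.
pose D k l m : R := if m == 0 then 0 else
  (jap m ^+ N)^-1 * \sum_i \sum_j \sum_(a <- box (2 ^ k))
    `|psi k a| * `|psi l (m - a)| * cab (c a i t * c (m - a) j t).
have D0 k l m : 0 <= D k l m.
  rewrite /D; case: eqP => // _; rewrite mulr_ge0 ?invr_ge0 ?exprn_ge0 ?jap_ge0//.
  by do 3!(apply: sumr_ge0 => ? _); rewrite !mulr_ge0 ?cab_ge0.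
pose B k l : R := \sum_(m <- box (d * 2 ^ k + d * 2 ^ l)) D k l m * wt m.
have Dw0 k l m : 0 <= D k l m * wt m by rewrite mulr_ge0 ?wt_ge0.
have Dout k l m : m \notin box (d * 2 ^ k + d * 2 ^ l) -> D k l m = 0.
  move=> h; rewrite /D; case: eqP => // _; rewrite big1 ?mulr0// => i _; rewrite big1// => j _.
  rewrite big_seq big1// => a ha; rewrite [psi l _](psi_out hchi) ?normr0 ?mulr0 ?mul0r//.
  apply: contra h => hb; apply: nrm_box; have -> : m = a + (m - a) by rewrite addrC subrK.
  by rewrite (leq_trans (nrmD _ _))// leq_add// box_nrm.
have BK k l K : \sum_(m <- box K) D k l m * wt m <= B k l.
  pose K' := (K + (d * 2 ^ k + d * 2 ^ l))%N.
  apply: (@le_trans _ _ (\sum_(m <- box K') D k l m * wt m)).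
    by apply: ler_sum_sub; rewrite ?box_uniq//; apply: box_mono; exact: leq_addr.
  rewrite /B (@sum_widen _ _ (box (d * 2 ^ k + d * 2 ^ l)) (box K')) ?box_uniq//.
    by apply: box_mono; exact: leq_addl.
  by move=> m _ h; rewrite Dout ?mul0r.
pose Q : R := d%:R ^+ 2 * (1 + d%:R) ^+ (N + d.*2).
have Q0 : 0 <= Q by rewrite mulr_ge0 ?exprn_ge0// addr_ge0.
have step kl : [set: nat * nat] kl ->
   (sobolev_norm (- (N + d.*2)%:R) (lp_tensor chi kl.1 kl.2 (flow_u t)) <= (Q * B kl.1 kl.2)%:E)%E.
  move=> _; case: kl => k l /=; apply: sobolev_norm_le (BK k l) => // m i j m0.
  rewrite /D (negPf m0) mulrAC mulVf ?mul1r; last by rewrite expf_neq0// gt_eqF ?jap_gt0.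
  rewrite (@fcoef_lp_tensor k l (maxn k l)) ?leq_maxl ?leq_maxr//.
  rewrite (@sum_widen _ _ (box (2 ^ k))) ?box_uniq//; last 2 first.
  - by apply: box_mono; rewrite leq_exp2l ?leq_maxl.
  - by move=> a _ h; rewrite (psi_out hchi)// mul0r real_mul0l.
  rewrite (bigD1 i)//= (bigD1 j)//= -!addrA ler_wpDr//.
    rewrite addr_ge0//; first by do 2!(apply: sumr_ge0 => ? _); rewrite !mulr_ge0 ?cab_ge0.
    by do 3!(apply: sumr_ge0 => ? _); rewrite !mulr_ge0 ?cab_ge0.
  rewrite (le_trans (cab_sum _ _ _))//; apply: ler_sum => a _.
  by rewrite cab_real_mul normrM.
apply: (@le_lt_trans _ _ (\esum_(kl in [set: nat * nat]) (Q * B kl.1 kl.2)%:E)%E).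
  by apply: le_esum => kl h; exact: step.
pose Z : R := Q * (d%:R ^+ 2 * (X ^+ 2 * C4) * 5 ^+ d).
apply: (@le_lt_trans _ _ Z%:E); last exact: ltry.
have B0 k l : 0 <= B k l by apply: sumr_ge0.
apply: esum_le_fin => [kl|s us _]; first by rewrite mulr_ge0.
pose n := (\max_(kl <- s) maxn kl.1 kl.2).+1.
pose t2 := [seq (k, l) | k <- index_iota 0 n, l <- index_iota 0 n].
have ut2 : uniq t2 by apply: allpairs_uniq; rewrite ?iota_uniq// => -[? ?] [? ?].
have st2 : {subset s <= t2}.
  move=> [k l] h; have le : (maxn k l < n)%N by rewrite /n ltnS (big_rem _ h)/= leq_maxl.
  apply/allpairsP; exists (k, l); rewrite !mem_index_iota/=.
  by rewrite (leq_ltn_trans (leq_maxl k l))// (leq_ltn_trans (leq_maxr k l)).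
rewrite (le_trans (ler_sum_sub us ut2 st2 (fun kl => mulr_ge0 Q0 (B0 kl.1 kl.2))))//.
rewrite -mulr_sumr ler_wpM2l// big_allpairs/=.
pose K := (d * 2 ^ n + d * 2 ^ n)%N.
apply: (@le_trans _ _ (\sum_(k < n) \sum_(l < n) \sum_(m <- box K) D k l m * wt m)).
  rewrite big_mkord; apply: ler_sum => k _; rewrite big_mkord; apply: ler_sum => l _.
  apply: ler_sum_sub; rewrite ?box_uniq//; apply: box_mono.
  by rewrite /K leq_add// leq_mul// leq_exp2l// ltnW.
under eq_bigr => k _ do rewrite exchange_big/=.
rewrite exchange_big/=.
apply: (@le_trans _ _ (\sum_(m <- box K) d%:R ^+ 2 * (X ^+ 2 * C4) * wt m)); last first.
  rewrite -mulr_sumr; apply: ler_wpM2l; last exact: wt_sum5 (box_uniq _).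
  by have X0' := ltW X0; nonneg.
apply: ler_sum => m _; under eq_bigr => k _ do rewrite -mulr_suml.
rewrite -mulr_suml ler_wpM2r ?wt_ge0//.
rewrite /D; case: eqVneq => [_|m0].
  rewrite big1 => [|k _]; last by rewrite big1.
  by rewrite !mulr_ge0 ?exprn_ge0//; exact: ltW.
under eq_bigr => k _ do rewrite -mulr_sumr.
rewrite -mulr_sumr mulrC ler_pdivrMr ?exprn_gt0 ?jap_gt0//.
have -> : \sum_(k < n) \sum_(l < n) \sum_i \sum_j \sum_(a <- box (2 ^ k))
    `|psi k a| * `|psi l (m - a)| * cab (c a i t * c (m - a) j t) =
    \sum_i \sum_j \sum_(a <- box (2 ^ n)) (\sum_(k < n) `|psi k a|) * (\sum_(l < n) `|psi l (m - a)|) *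
      cab (c a i t * c (m - a) j t).
  under eq_bigr => k _ do rewrite exchange_big/=.
  rewrite exchange_big/=; apply: eq_bigr => i _.
  under eq_bigr => k _ do rewrite exchange_big/=.
  rewrite exchange_big/=; apply: eq_bigr => j _.
  transitivity (\sum_(k < n) \sum_(l < n) \sum_(a <- box (2 ^ n))
      `|psi k a| * `|psi l (m - a)| * cab (c a i t * c (m - a) j t)).
    apply: eq_bigr => k _; apply: eq_bigr => l _; apply/esym/sum_widen; rewrite ?box_uniq//.
      by apply: box_mono; rewrite leq_exp2l// ltnW.
    by move=> a _ h; rewrite (psi_out hchi)// normr0 !mul0r.
  rewrite pair_bigA exchange_big/=; apply: eq_bigr => a _.
  rewrite -(pair_bigA _ (fun k l : 'I_n => `|psi k a| * `|psi l (m - a)| * cab (c a i t * c (m - a) j t)))/=.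
  by rewrite !mulr_suml; apply: eq_bigr => k _; rewrite mulr_sumr mulr_suml.
have cs (x : R) : \sum_(l < d) x = d%:R * x by rewrite sumr_const card_ord mulr_natl.
have -> : d%:R ^+ 2 * (X ^+ 2 * C4) * jap m ^+ N = \sum_(i < d) \sum_(j < d) X ^+ 2 * (C4 * jap m ^+ N).
  by under [RHS]eq_bigr do rewrite cs; rewrite cs; ring.
apply: ler_sum => i _; apply: ler_sum => j _.
apply: (@le_trans _ _ (\sum_(a <- box (2 ^ n)) X ^+ 2 * cab (c a i t * c (m - a) j t))).
  apply: ler_sum => a _; rewrite ler_wpM2r ?cab_ge0// expr2 ler_pM ?hX// sumr_ge0//.
by rewrite -mulr_sumr ler_wpM2l ?cc_sum_le// exprn_ge0// ltW.
Qed.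

Let SK K a : R := \sum_(k < K) psi k a.

(** The truncations of the paraproduct multiply each interaction by a cutoff. *)
Lemma fcoef_remainder K K' i j m : (K <= K')%N -> m != 0 -> (kap m <= 2 ^ K')%N ->
  fcoef ((flow_F t - \sum_(k < K) \sum_(l < K) lp_tensor chi k l (flow_u t)) i j) m =
  \sum_(a <- box (2 ^ K')) real_mul (1 - SK K a * SK K (m - a)) (c a i t * c (m - a) j t).
Proof.
move=> KK m0 kK.
rewrite (_ : fcoef _ m = fcoef (flow_F t i j) m -
  fcoef ((\sum_(k < K) \sum_(l < K) lp_tensor chi k l (flow_u t)) i j) m); last exact: fcoefB.
rewrite fcoef_flow_F -(conv_boxE _ _ _ m0 kK) fcoef_sum.
under eq_bigr => k _ do rewrite fcoef_sum.
transitivity (\sum_(a <- box (2 ^ K')) c a i t * c (m - a) j t -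
  \sum_(k < K) \sum_(l < K) \sum_(a <- box (2 ^ K'))
    real_mul (psi k a * psi l (m - a)) (c a i t * c (m - a) j t)).
  congr (_ - _); apply: eq_bigr => k _; apply: eq_bigr => l _.
  by apply: fcoef_lp_tensor; apply: leq_trans KK; exact: ltnW.
under [X in _ - X]eq_bigr => k _ do rewrite exchange_big/=.
rewrite exchange_big/= -sumrB; apply: eq_bigr => a _.
rewrite /SK mulr_suml; set z := _ * c (m - a) j t.
rewrite [RHS](_ : _ = z - real_mul (\sum_(k < K) psi k a * \sum_(l < K) psi l (m - a)) z); last first.
  by rewrite /real_mul rmorphB rmorph1 mulrBl mul1r.
congr (_ - _); rewrite /real_mul rmorph_sum mulr_suml; apply: eq_bigr => k _.
by rewrite mulr_sumr rmorph_sum mulr_suml.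
Qed.

(** At a given frequency m the truncated product is exact as soon as all the
   interacting frequencies are below the cutoff. Outside a box of size L, one more
   negative derivative makes the remainder O(1/L). *)
Lemma flow_tensor_cvg :
  (fun K : nat => sobolev_norm (- (N.+1 + d.*2)%:R)
     (flow_F t - \sum_(k < K) \sum_(l < K) lp_tensor chi k l (flow_u t))%R) @ \oo --> 0%E.
Proof.
have [X X0 hX] := sum_psi_bounded hchi.
pose Y : R := (1 + X ^+ 2) * C4.
have Y0 : 0 <= Y by rewrite mulr_ge0// addr_ge0// exprn_ge0// ltW.
pose Q : R := d%:R ^+ 2 * (1 + d%:R) ^+ (N.+1 + d.*2).
have Q0 : 0 <= Q by rewrite mulr_ge0 ?exprn_ge0// addr_ge0.
(* bounds the frequencies whose interactions reach the box of size L *)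
pose k0 L := (\max_(m <- box L) kap m)%N.
have bound L K : (k0 L + d * L + 3 <= K)%N ->
    (sobolev_norm (- (N.+1 + d.*2)%:R)
      (flow_F t - \sum_(k < K) \sum_(l < K) lp_tensor chi k l (flow_u t))%R <=
     (Q * (Y * 5 ^+ d / L.+1%:R))%:E)%E.
  move=> LK; pose D m : R := if (m == 0) || (m \in box L) then 0 else Y / jap m.
  apply: (@sobolev_norm_le _ _ D); first last.
  - move=> K'; apply: (@le_trans _ _ (\sum_(m <- box K') Y / L.+1%:R * wt m)); last first.
      rewrite -mulr_sumr mulrAC; apply: ler_wpM2r; first by rewrite invr_ge0.
      by apply: ler_wpM2l => //; exact: wt_sum5 (box_uniq _).
    apply: ler_sum => m _; rewrite ler_wpM2r ?wt_ge0// /D.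
    case: ifPn => [_|]; first by rewrite divr_ge0.
    rewrite negb_or => /andP[_ hm]; rewrite ler_wpM2l// lef_pV2 ?posrE ?jap_gt0 ?ltr0n//.
    by rewrite /jap ler_nat add1n ltnS leqNgt; apply: contra hm => h; apply: nrm_box; exact: ltnW.
  - by move=> m; rewrite /D; case: ifP => // _; rewrite divr_ge0 ?jap_ge0.
  move=> m i j m0; pose K' := (K + kap m)%N.
  have kK : (kap m <= 2 ^ K')%N.
    by rewrite (leq_trans (ltnW (ltn_expl _ (isT : (1 < 2)%N))))// leq_exp2l// leq_addl.
  rewrite (fcoef_remainder _ _ (leq_addr _ _) m0 kK).
  have [mL|mL] := boolP (m \in box L).
    rewrite big1 => [|a _]; first by rewrite cab0 /D mL orbT mul0r.
    have [->|ca] := eqVneq (c a i t) 0; first by rewrite mul0r /real_mul mulr0.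
    have [->|cb] := eqVneq (c (m - a) j t) 0; first by rewrite mulr0 /real_mul mulr0.
    have [h _] := hkap m0; have ak := h _ _ _ _ _ ca cb.
    have kk : (kap m <= k0 L)%N by rewrite /k0 (big_rem m)//= leq_maxl.
    have mn := box_nrm mL.
    rewrite /SK !(@psi_sum_eq1 chi hchi (k0 L + d * L))//.
    - by rewrite mulr1 subrr real_mul0l.
    - have : (nrm (m - a) <= nrm m + nrm a)%N by rewrite -(nrmN a) nrmD.
      by move=> h'; rewrite (leq_trans h')// addnC leq_add// (leq_trans ak)// (leq_trans kk)//.
    by rewrite (leq_trans ak)// (leq_trans kk)// (leq_trans _ (leq_addr _ _))//.
  rewrite /D (negPf m0) (negPf mL)/= exprS mulrA divfK ?gt_eqF ?jap_gt0//.
  rewrite (le_trans (cab_sum _ _ _))//.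
  apply: (@le_trans _ _ (\sum_(a <- box (2 ^ K')) (1 + X ^+ 2) * cab (c a i t * c (m - a) j t))).
    apply: ler_sum => a _; rewrite cab_real_mul ler_wpM2r ?cab_ge0//.
    rewrite (le_trans (ler_normB _ _))// normr1 lerD2l normrM expr2.
    by apply: ler_pM => //; rewrite (le_trans (ler_norm_sum _ _ _)).
  rewrite -mulr_sumr /Y -mulrA ler_wpM2l ?cc_sum_le//.
  by rewrite addr_ge0// exprn_ge0// ltW.
have s0 K : (0 <= sobolev_norm (- (N.+1 + d.*2)%:R)
      (flow_F t - \sum_(k < K) \sum_(l < K) lp_tensor chi k l (flow_u t))%R)%E.
  exact: poweR_ge0.
apply/fine_cvgP; split.
  near=> K; rewrite ge0_fin_numE//; apply: le_lt_trans (bound 0%N K _) (ltry _).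
  by near: K; exact: nbhs_infty_ge.
apply/cvgrPdist_le => e e0.
pose L := Num.trunc (Q * (Y * 5 ^+ d) / e).
near=> K; rewrite sub0r normrN ger0_norm ?fine_ge0// -lee_fin fineK; last first.
  rewrite ge0_fin_numE//; apply: le_lt_trans (bound 0%N K _) (ltry _).
  by near: K; exact: nbhs_infty_ge.
apply: (@le_trans _ _ (Q * (Y * 5 ^+ d / L.+1%:R))%:E).
  by apply: bound; near: K; exact: nbhs_infty_ge.
have -> : Q * (Y * 5 ^+ d / L.+1%:R) = (Q * (Y * 5 ^+ d)) / L.+1%:R by rewrite !mulrA.
rewrite lee_fin ler_pdivrMr ?ltr0n// [leRHS]mulrC -ler_pdivrMr//.
by rewrite ltW// truncnS_gt.
Unshelve. all: by end_near. Qed.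

End FlowTensor.
End Paraproduct.

(** * Curves of synthesized distributions *)

Section SpaceTime.
Context {R : realType} {d : nat}.
Local Notation mode := 'rV[int]_d.
Local Notation C := R[i].
Local Notation V := 'rV[R]_d.
Local Notation mu := (@lebesgue_measure R).
Implicit Types (m a b : mode) (t s : R).

Lemma cube_representative (x : V) : exists m : mode, forall i, 0 <= (x + freq m) ord0 i <= 1.
Proof.
exists (- \row_i Num.floor (x ord0 i)) => i; rewrite !mxE intrN.
have := floor_le_tmp (x ord0 i); have := lt_succ_floor (x ord0 i); rewrite intrD => h1 h2.
by rewrite subr_ge0 h2 lerBlDr addrC ltW.
Qed.

Definition cube : set V := [set v : V | forall i, `[0, 1]%classic (v ord0 i)].

Lemma cube_compact : compact cube.
Proof. by apply: (@rV_compact R d (fun=> `[0, 1]%classic)) => i; exact: segment_compact. Qed.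

Section Periodic.
Variable H : R * V -> R.
Hypotheses (cH : continuous H) (pH : forall t, Zperiodic (fun x => H (t, x))).

(** Compactness of a period cell makes the continuity in time uniform in space. *)
Lemma st_uniform t (e : R) : 0 < e -> \forall t' \near t, forall x, `|H (t', x) - H (t, x)| < e.
Proof.
move=> e0; have e20 : 0 < e / 2 by rewrite divr_gt0.
have /compact_near_coveringP cc := cube_compact.
have := cc R (nbhs t) (fun t' x => `|H (t', x) - H (t, x)| < e) _ _.
have near_ok x : cube x -> \forall x' \near x & t' \near t, `|H (t', x') - H (t, x')| < e.
  move=> _; have c1 := @cH (t, x); move/cvgrPdist_lt : c1 => /(_ _ e20) [[A B]] /= [nA nB] hAB.
  have At : A t by exact: nbhs_singleton.
  exists (B, A) => //= -[x' t'] /= [Bx At'].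
  have h1 := hAB (t', x') (conj At' Bx); have h2 := hAB (t, x') (conj At Bx).
  rewrite /= in h1 h2.
  have -> : H (t', x') - H (t, x') = (H (t, x) - H (t, x')) - (H (t, x) - H (t', x')) by lra.
  by rewrite (le_lt_trans (ler_normB _ _))// [ltRHS](splitr e) ltrD.
move=> /(_ _ near_ok); apply: filterS => t' ht' x.
have [m hm] := cube_representative x.
by rewrite -(pH t' m x) -(pH t m x); apply: ht' => i /=; rewrite in_itv/=; exact: hm.
Qed.

Lemma st_bounded T : exists2 B : R, 0 <= B & forall s x, 0 <= s <= T -> `|H (s, x)| <= B.
Proof.
have [T0|T0] := ltP T 0.
  by exists 0 => // s x /andP[s0 sT]; have := lt_le_trans T0 (le_trans s0 sT); rewrite ltxx.
have cA : compact (`[0, T]%classic `*` cube).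
  by apply: compact_setX; [exact: segment_compact|exact: cube_compact].
have A0 : (`[0, T]%classic `*` cube) !=set0.
  exists (0, 0); split; rewrite /= ?in_itv/= ?lexx ?T0// => i.
  by rewrite /= mxE in_itv/= lexx ler01.
have cn : continuous (fun p => `|H p|).
  by move=> p; apply: (@continuous_comp _ _ _ H (fun y => `|y|)); [exact: cH|exact: norm_continuous].
have [p _ hp] := @compact_EVT_max _ R (fun x => `|H x|) _ A0 cA (continuous_subspaceT cn).
exists `|H p| => // s x sT; have [m hm] := cube_representative x.
rewrite -(pH s m x); apply: hp; rewrite inE; split => /=; first by rewrite in_itv.
by move=> i /=; rewrite in_itv/=; exact: hm.
Qed.

End Periodic.

Variable Phi : R -> test_fun R d.
Hypothesis sPhi : smooth (fun p : R * V => Phi p.1 p.2).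
Local Notation H := (fun p : R * V => Phi p.1 p.2 : R).

(** Pure space derivatives of a function of space-time are those of its time slices;
   space-time bounds thus control the slices. *)
Lemma derives_joint k (v : V) t x :
  derives (nseq k (0, v)) H (t, x) = derives (nseq k v) (Phi t) x.
Proof.
elim: k t x => [|k IH] t x //=; rewrite /derive; set g1 := fun h => h^-1 *: _; set g2 := fun h => h^-1 *: _.
suff -> : g1 = g2 by [].
apply: funext => h; rewrite /g1 /g2 /= IH; congr (_ *: (_ - _)).
have -> : (h *: ((0 : R), v)).1 + (t, x).1 = t by change (h * 0 + t = t); rewrite mulr0 add0r.
  by [].
exact: IH.
Qed.

Lemma norm_time_zero (v : V) : `|((0 : R), v)| = `|v|.
Proof. by rewrite prod_normE /= normr0 max_r. Qed.

Lemma st_cont k (v : V) : continuous (fun p : R * V => derives (nseq k v) (Phi p.1) p.2).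
Proof.
rewrite (_ : (fun p => _) = derives (nseq k (0, v)) H); first by have [] := sPhi (nseq k (0, v)).
by apply: funext => -[t x] /=; rewrite derives_joint.
Qed.

Lemma st_periodic k (v : V) t : Zperiodic (fun x => derives (nseq k v) (Phi t) x).
Proof. by elim: k => [|k IH] /=; [exact: tf_periodic|exact: periodic_derive]. Qed.

Lemma st_test_bounds T N : exists B : R, 0 <= B /\ forall t, 0 <= t <= T ->
  (forall x, `|Phi t x| <= B) /\ (forall i x, `|iter N.*2 (tderive i) (Phi t) x| <= B).
Proof.
have [B B0 hB] := st_bounded (@st_cont 0 0) (st_periodic 0 0) T.
have /choice[f hf] : forall i : 'I_d, exists B : R, 0 <= B /\ forall t x, 0 <= t <= T ->
    `|iter N.*2 (tderive i) (Phi t) x| <= B.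
  move=> i; have [B' B0' hB'] := st_bounded (@st_cont N.*2 (delta_mx 0 i)) (st_periodic N.*2 (delta_mx 0 i)) T.
  by exists B'; split => // t x tT; rewrite iter_tderive; exact: hB'.
exists (B + \sum_i f i); split; first by rewrite addr_ge0// sumr_ge0// => i _; have [] := hf i.
have S0 : 0 <= \sum_i f i by apply: sumr_ge0 => i _; have [] := hf i.
move=> t tT; split => [x|i x]; first by rewrite (le_trans (hB t x tT))// lerDl.
have [_ hi] := hf i; rewrite (le_trans (hi t x tT))// (bigD1 i)//= addrCA lerDl addr_ge0//.
by apply: sumr_ge0 => j _; have [] := hf j.
Qed.

Lemma Cn_bound_slice n B t : Cn_bound n H B -> (forall x, `|Phi t x| <= B) /\
  forall N i x, (N.*2 <= n)%N -> `|iter N.*2 (tderive i) (Phi t) x| <= B.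
Proof.
move=> h; split => [x|N i x Nn]; first exact: (h [::] _ _ (t, x)).
rewrite iter_tderive -derives_joint; apply: h; first by rewrite size_nseq.
by apply/allP => v /nseqP[-> _]; rewrite norm_time_zero delta_norm_le1.
Qed.

Lemma st_ft_continuous m : continuous (fun t => complex.Re (ft (Phi t) m)) /\
  continuous (fun t => complex.Im (ft (Phi t) m)).
Proof.
have key t (e : R) : 0 < e -> \forall t' \near t, cab (ft (Phi t) m - ft (Phi t') m) <= e.
  move=> e0; have e20 : 0 < e / 2 by rewrite divr_gt0.
  have := st_uniform (@st_cont 0 0) (st_periodic 0 0) t e20.
  apply: filterS => t' ht'.
  have -> : ft (Phi t) m - ft (Phi t') m = ft (fun x => Phi t x + - 1 * Phi t' x) m.
    rewrite ftD; [|exact: cper_test|by apply: cperZ; exact: cper_test].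
    rewrite ftZ; last exact: cper_test.
    by rewrite real_mulE; apply: complex_ext; rewrite ?ReB ?ImB ?ReD ?ImD /= mulN1r.
  have -> : e = 2 * (e / 2) by rewrite mulrC divfK.
  apply: ft_le; first by apply: cperD; [exact: cper_test|apply: cperZ; exact: cper_test].
  by move=> x; rewrite mulN1r distrC ltW// ht'.
split=> t; apply/cvgrPdist_le => e e0; have := key t e e0; apply: filterS => t'; apply: le_trans.
  by rewrite -ReB Re_le_cab.
by rewrite -ImB Im_le_cab.
Qed.

End SpaceTime.

Section SynthCurve.
Context {R : realType} {d : nat}.
Local Notation mode := 'rV[int]_d.
Local Notation C := R[i].
Local Notation mu := (@lebesgue_measure R).
Local Notation TR := (measurableTypeR R).
Implicit Types (m : mode) (t s : R) (D : set R).

Definition ccont (f : R -> C) :=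
  continuous (fun t => complex.Re (f t)) /\ continuous (fun t => complex.Im (f t)).

Lemma cont_measurable (f : R -> R) D : measurable D -> continuous f ->
  measurable_fun D (f : TR -> TR).
Proof.
by move=> mD cf; apply: measurable_funTS; exact: continuous_measurable_fun.
Qed.

Lemma itv_oo_finite (T : R) : (mu `]0%R, T[%classic < +oo)%E.
Proof. by rewrite lebesgue_measure_itv /=; case: ifP => _; rewrite ?oppr0 ltry. Qed.

Lemma bounded_integrable (T B : R) (f : R -> R) : measurable_fun `]0, T[%classic (f : TR -> TR) ->
  (forall t, 0 < t < T -> `|f t| <= B) -> mu.-integrable `]0, T[%classic (fun t => (f t)%:E).
Proof.
move=> mf fB; apply: measurable_bounded_integrable => //; first exact: itv_oo_finite.
exists B; split; first exact: num_real.
by move=> y By x /= xT; rewrite (le_trans (fB x _)) ?(ltW By)//; move: xT; rewrite in_itv.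
Qed.

Lemma bounded_Rintegral_le (T B : R) (f : R -> R) : 0 <= T -> 0 <= B ->
  measurable_fun `]0, T[%classic (f : TR -> TR) ->
  (forall t, 0 < t < T -> `|f t| <= B) -> `|\int[mu]_(t in `]0%R, T[) f t| <= T * B.
Proof.
move=> T0 B0 mf fB; have If := bounded_integrable mf fB.
apply: le_trans (le_normr_Rintegral _ If) _ => //.
have mB : measurable_fun `]0, T[%classic (cst B : TR -> TR) by exact: measurable_cst.
have IB : mu.-integrable `]0, T[%classic (fun t => (cst B t)%:E).
  by apply: (@bounded_integrable _ B) => // t _; rewrite /= ger0_norm.
apply: (@le_trans _ _ (\int[mu]_(t in `]0%R, T[) cst B t)).
  apply: le_Rintegral => //; first exact: integrable_norm If.
have muT : fine (mu `]0%R, T[%classic) = T.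
  rewrite lebesgue_measure_itv /= lte_fin; case: ifPn => [_|]; first by rewrite /= oppr0 addr0.
  by rewrite -leNgt /= => Tle; apply/eqP; rewrite eq_le T0 Tle.
by rewrite Rintegral_cst// muT mulrC.
Qed.

Variables (A : R) (N : nat) (g : mode -> R -> C) (T : R).
Hypothesis T0 : 0 < T.
Hypothesis hg : forall t, 0 < t < T -> pbd A N (fun m => g m t).
Hypothesis cg : forall m, ccont (g m).

Lemma sterm_curve_continuous (f : R -> C) m : ccont f ->
  continuous (fun t => complex.Re (g m t * conjc (f t))).
Proof.
move=> [rf if_] t; have [rg ig] := cg m.
rewrite (_ : (fun t => _) = fun t => complex.Re (g m t) * complex.Re (f t) + complex.Im (g m t) * complex.Im (f t)).
  apply: (@continuousD R R R (fun t => complex.Re (g m t) * complex.Re (f t))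
     (fun t => complex.Im (g m t) * complex.Im (f t))); apply: continuousM; [exact: rg|exact: rf|exact: ig|exact: if_].
by apply: funext => u; rewrite ReM; case: (f u) => a b /=; rewrite mulrN opprK.
Qed.

Lemma synth_curve_measurable (Phi : R -> test_fun R d) D : measurable D -> D `<=` `]0, T[%classic ->
  (forall m, ccont (fun t => ft (Phi t) m)) ->
  measurable_fun D ((fun t => synth (fun m => g m t) (Phi t)) : TR -> TR).
Proof.
move=> mD DT cP.
pose h (K : nat) t := \sum_(m <- box K) sterm (fun m => g m t) (Phi t) m.
apply: (@measurable_fun_cvg _ _ _ _ h) => //.
  move=> K; apply: cont_measurable => // t.
  by apply: (@cvg_fsum R R (nbhs t) _ _ (box K) (fun m t => sterm (fun m => g m t) (Phi t) m)) => m; exact: sterm_curve_continuous.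
move=> t /DT; rewrite /= in_itv => /hg ht; exact: synth_cvg ht.
Qed.

(** The Parseval series is dominated uniformly in time, which gives measurability in time
   and the bound of finite order. *)
Lemma st_dist_synth (w : R -> @dist R d) :
  (forall t, 0 < t < T -> w t = synth (fun m => g m t)) -> st_dist T w.
Proof.
move=> wE a b a0 bT.
have wI Phi : {in `]0, T[%classic, (fun t => w t (Phi t)) =1 (fun t => synth (fun m => g m t) (Phi t))}.
  by move=> t; rewrite inE /= in_itv => tT; rewrite wE.
have A0 : 0 <= A by apply: (pbd_ge0 (hg (t := T / 2) _)); rewrite divr_gt0//= ltr_pdivrMr// ltr_pMr// ltr1n.
have S0 : 0 <= @synth_const R d N by rewrite mulr_ge0 ?exprn_ge0 ?decay_const_ge0.
have mS (Phi : R -> test_fun R d) : smooth (fun p : R * 'rV[R]_d => Phi p.1 p.2) ->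
    measurable_fun `]0, T[%classic ((fun t => synth (fun m => g m t) (Phi t)) : TR -> TR).
  by move=> sP; apply: synth_curve_measurable => // m; exact: st_ft_continuous.
split.
  move=> Phi [sP _].
  apply: (@eq_integrable _ _ _ mu _ _ (fun t => (synth (fun m => g m t) (Phi t))%:E)) => //.
    by move=> t tT; rewrite wI.
  have [B [B0 hB]] := st_test_bounds sP T (N + d).
  apply: (@bounded_integrable T (A * @synth_const R d N * B)); first exact: mS.
  move=> t /[dup] tT /andP[t0 tT']; have tT2 : 0 <= t <= T by rewrite !ltW.
  have [h1 h2] := hB t tT2.
  exact: synth_le (hg tT) h1 h2.
exists (N + d).*2, (T * (A * @synth_const R d N)) => Phi B [sP _] hB.
rewrite /st_pairing (_ : Rintegral _ _ _ = \int[mu]_(t in `]0%R, T[) synth (fun m => g m t) (Phi t)); last first.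
  by apply: eq_Rintegral => t tT; rewrite wI.
have h1 t : forall x, `|Phi t x| <= B by have [] := Cn_bound_slice t hB.
have h2 t := (Cn_bound_slice t hB).2.
have B0 : 0 <= B by exact: le_trans (h1 0 0).
rewrite -mulrA; apply: bounded_Rintegral_le; rewrite ?(ltW T0) ?mulr_ge0//; first exact: mS.
move=> t tT; apply: synth_le (hg tT) (h1 t) _ => i x; exact: h2.
Qed.

End SynthCurve.

(** * Mild solutions *)

Section MildSolution.
Context {R : realType} {d : nat}.
Local Notation mode := 'rV[int]_d.
Local Notation C := R[i].
Local Notation mu := (@lebesgue_measure R).
Local Notation TR := (measurableTypeR R).
Implicit Types (m a b : mode) (t s : R).

Lemma ctf_ccont (u : R -> C) (tau : R) : ctf u -> ccont (fun t => u (t + tau)).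
Proof.
move=> [/tfun_continuous ru /tfun_continuous iu].
have sh : continuous (fun t : R => t + tau).
  by move=> t; apply: (@continuousD R R R id (cst tau)); [exact: cvg_id|exact: cst_continuous].
split=> t; [apply: (@continuous_comp _ _ _ (fun t => t + tau) (fun t => complex.Re (u t)))|
  apply: (@continuous_comp _ _ _ (fun t => t + tau) (fun t => complex.Im (u t)))];
  [exact: sh|exact: ru|exact: sh|exact: iu].
Qed.

Lemma ccontD (u v : R -> C) : ccont u -> ccont v -> ccont (fun t => u t + v t).
Proof.
move=> [ru iu] [rv iv]; split.
  by under eq_fun do rewrite ReD; move=> t; exact: continuousD (ru t) (rv t).
by under eq_fun do rewrite ImD; move=> t; exact: continuousD (iu t) (iv t).
Qed.

Lemma ccontM (u v : R -> C) : ccont u -> ccont v -> ccont (fun t => u t * v t).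
Proof.
move=> [ru iu] [rv iv]; split.
  under eq_fun do rewrite ReM.
  by move=> t; exact: continuousB (continuousM (ru t) (rv t)) (continuousM (iu t) (iv t)).
under eq_fun do rewrite ImM.
by move=> t; exact: continuousD (continuousM (ru t) (iv t)) (continuousM (iu t) (rv t)).
Qed.

Lemma ccont_cst (a : C) : ccont (fun=> a).
Proof. by split; exact: cst_continuous. Qed.

Lemma ccont_real (f : R -> R) : continuous f -> ccont (fun t => (f t)%:C%C).
Proof. by move=> cf; split => //=; exact: cst_continuous. Qed.

Lemma exp_lin_derive (k t s : R) :
  is_derive s (1 : R) (fun s => expR (- (k * (t - s)))) (k * expR (- (k * (t - s)))).
Proof.
have -> : (fun s => expR (- (k * (t - s)))) = expR \o (k *: id + cst (- (k * t)) : R -> R).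
  by apply: funext => u /=; congr expR; rewrite /GRing.scale/= mulrBr opprB.
apply: is_derive_eq; rewrite /GRing.scale/= subr0 mulr1 mulrC; congr (_ * expR _).
by rewrite /= mulrBr opprB.
Qed.

Lemma exp_lin_continuous (k t : R) : continuous (fun s => expR (- (k * (t - s)))).
Proof.
move=> s; apply: differentiable_continuous; apply/derivable1_diffP.
exact: (@ex_derive _ _ _ _ _ _ _ (exp_lin_derive k t s)).
Qed.

Lemma FTC_oo (F f : R -> R) t : 0 < t -> (forall s, is_derive s (1 : R) F (f s)) -> continuous f ->
  \int[mu]_(s in `]0%R, t[) f s = F t - F 0.
Proof.
move=> t0 dF cf.
have cF : continuous F.
  by move=> s; apply: differentiable_continuous; apply/derivable1_diffP; exact: (@ex_derive _ _ _ _ _ _ _ (dF s)).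
have h := @continuous_FTC2 R f F 0 t t0 (continuous_subspaceT cf) _ _.
rewrite /Rintegral -(@integral_itv_bndoo _ _ _ _ true false); last first.
  by apply/measurable_EFinP; exact: cont_measurable.
rewrite h//.
- split; [by move=> s _; exact: (@ex_derive _ _ _ _ _ _ _ (dF s))| |].
    exact: cvg_at_right_filter (cF 0).
  exact: cvg_at_left_filter (cF t).
by move=> s _; rewrite derive1E (@derive_val _ _ _ _ _ _ _ (dF s)).
Qed.

Section FlowMild.
Variables (theta eps : R) (rho0 : nat) (c : mode -> 'I_d -> R -> C) (M : mode -> R).
Hypothesis hfl : flow theta eps rho0 c M.
Variable kap : mode -> nat.
Hypothesis hkap : forall m, m != 0 ->
    (forall a i j t t', c a i t != 0 -> c (m - a) j t' != 0 -> (nrm a <= kap m)%N) /\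
    forall K i t, (kap m <= K)%N -> err K c m i t = 0.
Variables (C1 C4 : R) (N : nat).
Hypothesis hC1 : forall a, M a <= C1 * jap a.
Hypothesis C40 : 0 <= C4.
Hypothesis hC4 : forall m, m != 0 -> forall K, exists om : mode -> R,
    [/\ forall a, 0 <= om a, \sum_(a <- box K) om a <= C4 &
     forall a i j t, a \in box K -> -1 <= t <= 1 ->
       cab (c a i t * c (m - a) j t) <= jap m ^+ N * om a].

Local Notation conv := (conv c kap).

(** The Fourier coefficients of the projected divergence of the tensor product. *)
Definition forcing i m s : C := \sum_k (proj m i k)%:C%C * (\sum_l dsym l m * conv k l m s).

(** The vanishing of the error; at the mode 0 all terms vanish. *)
Lemma flow_ode i m s : cder (c m i) s + (lap m)%:C%C * c m i s + forcing i m s = 0.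
Proof.
have [->|m0] := eqVneq m 0.
  have -> : c 0 i = fun=> 0 by apply: funext => u; exact: fl_zero hfl _ _.
  rewrite cder_cst mulr0 !add0r /forcing big1// => k _; rewrite big1 ?mulr0// => l _.
  by rewrite /conv eqxx mulr0.
have [_ /(_ (kap m) i s (leqnn _)) <-] := hkap m0; rewrite /err /forcing; congr (_ + _).
apply: eq_bigr => k _; congr (_ * _); apply: eq_bigr => l _.
by rewrite /conv (negPf m0).
Qed.

Lemma dsym_cab l m : cab (dsym l m : C) <= 2 * pi * jap m.
Proof.
rewrite dsymE (le_trans (cabM _ _))// ler_pM ?cab_ge0//.
  rewrite (le_trans (cabM _ _))// cabr ger0_norm ?mulr_ge0 ?pi_ge0//.
  by rewrite /cab/= normr0 normr1 add0r mulr1.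
by rewrite /zc cab_int /jap ler_nat (leq_trans (coord_nrm m l))// leq_addl.
Qed.

Definition forcing_const : R := d%:R * (2 * (d%:R * (2 * pi * C4))).

Lemma forcing_pbd i s : -1 <= s <= 1 -> pbd forcing_const N.+1 (fun m => forcing i m s).
Proof.
move=> hs m; have cs (x : R) : \sum_(l < d) x = d%:R * x by rewrite sumr_const card_ord mulr_natl.
rewrite (le_trans (cab_sum _ _ _))// /forcing_const -mulrA -cs; apply: ler_sum => k _.
rewrite (le_trans (cabM _ _))// -[leRHS]mulrA ler_pM ?cab_ge0//; first by rewrite cabr proj_le.
rewrite (le_trans (cab_sum _ _ _))// -mulrA -cs; apply: ler_sum => l _.
rewrite (le_trans (cabM _ _))// [leRHS](_ : _ = (2 * pi * jap m) * (C4 * jap m ^+ N)); last by rewrite exprS; ring.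
by apply: ler_pM; rewrite ?cab_ge0 ?dsym_cab//; exact: (conv_le kap C40 hC4 k l m hs).
Qed.

Lemma forcing_herm i s : herm (fun m => forcing i m s).
Proof.
move=> m; rewrite /forcing cj_sum; apply: eq_bigr => k _; rewrite cjM conjc_real projN cj_sum.
congr (_ * _); apply: eq_bigr => l _; rewrite cjM (conv_herm hfl hkap) !dsymE zcN; congr (_ * _).
by rewrite !cjM conjc_real cj_i /zc cj_int; ring.
Qed.

Variable tau : R.
Hypothesis htau : -1 <= tau <= 0.

Local Notation u := (fun t => flow_u c (t + tau)).
Local Notation F := (fun t => flow_F c kap (t + tau)).

Let shift_ok t : 0 <= t <= 1 -> -1 <= t + tau <= 1.
Proof. by move: htau => /andP[? ?] /andP[? ?]; apply/andP; split; lra. Qed.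

Lemma mdiv_coef s i m : -1 <= s <= 1 ->
  fcoef (mdiv (flow_F c kap s) i) m = \sum_l dsym l m * conv i l m s.
Proof.
move=> hs; rewrite fcoef_mdiv => [|j]; last exact: synth_is_dist (conv_pbd kap C40 hC4 i j hs).
by apply: eq_bigr => l _; rewrite (fcoef_flow_F hfl hkap C40 hC4 hs).
Qed.

Lemma leray_coef s i : -1 <= s <= 1 ->
  fcoef (leray (mdiv (flow_F c kap s)) i) = fun m => forcing i m s.
Proof.
move=> hs; rewrite /leray.
have -> : (fun m => \sum_j real_mul ((i == j)%:R - freq m ord0 i * freq m ord0 j / enorm (freq m) ^+ 2)
    (fcoef (mdiv (flow_F c kap s) j) m)) = fun m => forcing i m s.
  by apply: funext => m; apply: eq_bigr => k _; rewrite mdiv_coef.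
exact: fcoef_synth (forcing_pbd i hs) (forcing_herm i s).
Qed.

Definition duhamel_coef t s i m : C := real_mul (expR (- (lap m * (t - s)))) (forcing i m (s + tau)).

Lemma duhamel_integrandE t s i : 0 <= s <= 1 ->
  duhamel_integrand F t s i = synth (duhamel_coef t s i).
Proof.
move=> hs; rewrite /duhamel_integrand /heat leray_coef; last exact: shift_ok.
by [].
Qed.

Lemma exp_le1 m t s : s <= t -> `|expR (- (lap m * (t - s)))| <= 1 :> R.
Proof.
move=> st; rewrite ger0_norm ?expR_ge0// -expR0 ler_expR oppr_le0 mulr_ge0 ?subr_ge0//.
by rewrite /lap; nonneg.
Qed.

Lemma duhamel_coef_pbd t s i : 0 <= s -> s <= t -> t <= 1 ->
  pbd forcing_const N.+1 (duhamel_coef t s i).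
Proof.
move=> s0 st t1; apply: pbd_real_mul => [|m]; last exact: exp_le1.
by apply: forcing_pbd; apply: shift_ok; rewrite s0 (le_trans st).
Qed.

Lemma forcing_ccont i m : ccont (fun s => forcing i m (s + tau)).
Proof.
have E s : forcing i m (s + tau) = - (cder (c m i) (s + tau) + (lap m)%:C%C * c m i (s + tau)).
  by apply/eqP; rewrite -addr_eq0 addrC flow_ode.
rewrite (_ : (fun s => _) = fun s => -1 * (cder (c m i) (s + tau) + (lap m)%:C%C * c m i (s + tau))); last first.
  by apply: funext => s; rewrite E mulN1r.
apply: ccontM; first exact: ccont_cst.
apply: ccontD; first exact: (ctf_ccont tau (ctf_cder (fl_ctf hfl m i))).
by apply: ccontM; [exact: ccont_cst|exact: ctf_ccont (fl_ctf hfl m i)].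
Qed.

Lemma duhamel_coef_ccont t i m : ccont (fun s => duhamel_coef t s i m).
Proof. by apply: ccontM; [apply: ccont_real; exact: exp_lin_continuous|exact: forcing_ccont]. Qed.

(** The value of the Duhamel integral: by the equation, its integrand is minus the
   derivative in s of exp(- lap (t - s)) c(s). *)
Definition duhamel_sum t i m : C :=
  real_mul (expR (- (lap m * t))) (c m i tau) - c m i (t + tau).

Lemma mode_integral t i m (z : C) : 0 < t ->
  \int[mu]_(s in `]0%R, t[) complex.Re (duhamel_coef t s i m * z) = complex.Re (duhamel_sum t i m * z).
Proof.
move=> t0; pose p s : R := expR (- (lap m * (t - s))).
pose al s := complex.Re z * complex.Re (c m i (s + tau)) + - complex.Im z * complex.Im (c m i (s + tau)).
pose dal s := complex.Re z * complex.Re (cder (c m i) (s + tau)) + - complex.Im z * complex.Im (cder (c m i) (s + tau)).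
have [tr ti] := fl_ctf hfl m i.
have dsh s : is_derive s (1 : R) (fun s : R => s + tau) 1.
  by rewrite -[X in is_derive _ _ _ X]addr0; apply: is_deriveD.
have dre s : is_derive s (1 : R) (fun s => complex.Re (c m i (s + tau))) (complex.Re (cder (c m i) (s + tau))).
  have h := @is_derive1_comp R (fun s => complex.Re (c m i s)) (fun s => s + tau) s _ _
     (tfun_is_derive tr (s + tau)) (dsh s).
  by rewrite mulr1 in h.
have dim s : is_derive s (1 : R) (fun s => complex.Im (c m i (s + tau))) (complex.Im (cder (c m i) (s + tau))).
  have h := @is_derive1_comp R (fun s => complex.Im (c m i s)) (fun s => s + tau) s _ _
     (tfun_is_derive ti (s + tau)) (dsh s).
  by rewrite mulr1 in h.
have dalP s : is_derive s (1 : R) al (dal s).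
  by apply: is_deriveD; apply: is_deriveZ.
have dpP s : is_derive s (1 : R) p (lap m * p s) by exact: exp_lin_derive.
have dF s : is_derive s (1 : R) (fun s => -1 * (p s * al s)) (complex.Re (duhamel_coef t s i m * z)).
  have h : is_derive s (1 : R) (p * al)%R (p s *: dal s + al s *: (lap m * p s)) by exact: is_deriveM.
  apply: (@is_derive_eq _ _ _ _ _ _ _ _ (@is_deriveZ R R R (p * al)%R (-1) s 1 _ h)).
  have E : forcing i m (s + tau) = - (cder (c m i) (s + tau) + (lap m)%:C%C * c m i (s + tau)).
    by apply/eqP; rewrite -addr_eq0 addrC flow_ode.
  rewrite /duhamel_coef E -/(p s) /al /dal !real_mulE !ReM !ReN !ImN !ReD !ImD !ReM !ImM /GRing.scale/=.
  by ring.
rewrite (FTC_oo t0 dF); last first.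
  have [cr _] := ccontM (duhamel_coef_ccont t i m) (ccont_cst z); exact: cr.
rewrite /duhamel_sum /p /al subr0 subrr mulr0 oppr0 expR0 add0r.
by rewrite !real_mulE !ReM !ReB !ImB /=; ring.
Qed.

Lemma duhamel_sum_pbd t i : 0 <= t <= 1 -> pbd (C1 + C1) (1 + 1) (duhamel_sum t i).
Proof.
move=> ht; have [t0 t1] := andP ht.
have h1 : pbd C1 1 (fun m => real_mul (expR (- (lap m * t))) (c m i tau)).
  apply: (@pbd_real_mul _ _ _ _ (fun m => c m i tau)).
    by apply: (flow_pbd hfl hC1); move: htau => /andP[? ?]; apply/andP; split; lra.
  by move=> m; have := @exp_le1 m t 0 t0; rewrite subr0.
have h2 : pbd C1 1 (fun m => - c m i (t + tau)).
  by move=> m; rewrite cabN; exact: (flow_pbd hfl hC1 i (shift_ok ht)).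
exact: pbdD h1 h2.
Qed.

Lemma itv_subset t : 0 < t < 1 -> forall s, s \in `]0, t[ -> 0 <= s <= 1.
Proof.
by move=> /andP[t0 t1] s; rewrite in_itv/= => /andP[s0 st]; rewrite ltW//= ltW// (lt_trans st).
Qed.

Lemma duhamel_integrable t i phi : 0 < t < 1 ->
  mu.-integrable `]0, t[%classic (fun s => (duhamel_integrand F t s i phi)%:E).
Proof.
move=> ht; have /andP[t0 t1] := ht.
apply: (@eq_integrable _ _ _ mu _ _ (fun s => (synth (duhamel_coef t s i) phi)%:E)) => //.
  by move=> s; rewrite inE => hs; rewrite duhamel_integrandE//; exact: itv_subset hs.
have hb s : 0 < s < t -> pbd forcing_const N.+1 (duhamel_coef t s i).
  by move=> /andP[s0 st]; apply: duhamel_coef_pbd; rewrite ltW.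
have [B [b0 b1]] := test_bounds phi (N.+1 + d).
apply: (@bounded_integrable _ t (forcing_const * @synth_const R d N.+1 * B)).
  apply: (@synth_curve_measurable _ _ _ _ (fun m s => duhamel_coef t s i m) t hb _ (fun=> phi)) => // m.
    exact: duhamel_coef_ccont.
  exact: ccont_cst.
by move=> s /hb hs; exact: synth_le hs b0 b1.
Qed.

(** The Parseval series can be integrated in time term by term, by dominated
   convergence. *)
Lemma duhamelE t i : 0 < t < 1 -> duhamel F t i = synth (duhamel_sum t i).
Proof.
move=> ht; have /andP[t0 t1] := ht; apply: funext => phi; rewrite /duhamel.
have hb s : 0 < s < t -> pbd forcing_const N.+1 (duhamel_coef t s i).
  by move=> /andP[s0 st]; apply: duhamel_coef_pbd; rewrite ltW.
rewrite (_ : Rintegral _ _ _ = \int[mu]_(s in `]0%R, t[) synth (duhamel_coef t s i) phi); last first.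
  by apply: eq_Rintegral => s; rewrite inE => hs; rewrite duhamel_integrandE//; exact: itv_subset hs.
have [B [b0 b1]] := test_bounds phi (N.+1 + d).
pose f K s : R := \sum_(m <- box K) sterm (duhamel_coef t s i) phi m.
have cf K : continuous (f K).
  move=> s; apply: (@cvg_fsum R R (nbhs s) _ _ (box K) (fun m s => sterm (duhamel_coef t s i) phi m)) => m.
  have [cr _] := ccontM (duhamel_coef_ccont t i m) (ccont_cst (conjc (ft phi m))); exact: cr.
have cstep K : \int[mu]_(s in `]0%R, t[) f K s = \sum_(m <- box K) sterm (duhamel_sum t i) phi m.
  rewrite /f; elim: (box K) => [|m l IH].
    under eq_Rintegral do rewrite big_nil; rewrite big_nil.
    by rewrite Rintegral_cst// mul0r.
  under eq_Rintegral do rewrite big_cons; rewrite big_cons.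
  have c1 m' : continuous (fun s => sterm (duhamel_coef t s i) phi m').
    have [cr _] := ccontM (duhamel_coef_ccont t i m') (ccont_cst (conjc (ft phi m'))); exact: cr.
  have ci (h : R -> R) : continuous h -> mu.-integrable `]0, t[%classic (fun s => (h s)%:E).
    move=> ch; apply: (@integrableS _ _ _ mu `[0, t]%classic) => //; first exact: subset_itv_oo_cc.
    apply: continuous_compact_integrable; first exact: segment_compact.
    exact: continuous_subspaceT.
  have csum : continuous (fun s => \sum_(j <- l) sterm (duhamel_coef t s i) phi j).
    by move=> s; apply: (@cvg_fsum R R (nbhs s) _ _ l (fun m s => sterm (duhamel_coef t s i) phi m)) => m'; exact: c1.
  rewrite RintegralD//; [|exact: ci|exact: ci].
  by rewrite IH; congr (_ + _); exact: mode_integral.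
have lim1 : (\int[mu]_(s in `]0%R, t[) (f K s)%:E @[K --> \oo] -->
    \int[mu]_(s in `]0%R, t[) (synth (duhamel_coef t s i) phi)%:E)%E.
  apply: (@dominated_cvg _ _ _ mu _ _ _ _ (cst (forcing_const * @synth_const R d N.+1 * B)%:E)) => //.
  - by move=> K; apply/measurable_EFinP; exact: cont_measurable.
  - move=> s; rewrite /= in_itv => /hb hs; apply/fine_cvgP; split; first exact: nearW.
    exact: synth_cvg hs.
  - apply/integrableP; split; first exact: measurable_cst.
    by rewrite /= integral_cst// lte_mul_pinfty// itv_oo_finite.
  - move=> K s; rewrite /= in_itv => /hb hs; rewrite lee_fin; exact: synth_bound hs b0 b1 K.
have hs := duhamel_sum_pbd i (t := t).
have tt : 0 <= t <= 1 by rewrite !ltW.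
have lim2 := @synth_cvg _ _ _ _ _ phi (hs tt).
apply/esym; apply: (cvg_unique (@Rhausdorff R) lim2).
have fin : (\int[mu]_(s in `]0%R, t[) (synth (duhamel_coef t s i) phi)%:E)%E \is a fin_num.
  apply: integrable_fin_num => //.
  apply: (@eq_integrable _ _ _ mu _ _ (fun s => (duhamel_integrand F t s i phi)%:E)) => //.
    by move=> s; rewrite inE => hs'; rewrite duhamel_integrandE//; exact: itv_subset hs'.
  exact: duhamel_integrable.
rewrite -(fineK fin) in lim1; have := @fine_cvg _ _ _ eventually_filter _ _ lim1.
by rewrite (_ : fine \o _ = fun K => \sum_(m <- box K) sterm (duhamel_sum t i) phi m)//; apply: funext => K; exact: cstep.
Qed.

Local Notation u_in := (flow_u c tau).

Lemma tau_ok : -1 <= tau <= 1.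
Proof. by move: htau => /andP[? ?]; apply/andP; split; lra. Qed.

Lemma heat_flowE t i : heat t (u_in i) = synth (fun m => real_mul (expR (- (lap m * t))) (c m i tau)).
Proof. by rewrite /heat (fcoef_flow_u hfl hC1 tau_ok). Qed.

Lemma heat_pbd t i : 0 <= t -> pbd C1 1 (fun m => real_mul (expR (- (lap m * t))) (c m i tau)).
Proof.
move=> t0; apply: (@pbd_real_mul _ _ _ _ (fun m => c m i tau)).
  exact: (flow_pbd hfl hC1 i tau_ok).
by move=> m; have := @exp_le1 m t 0 t0; rewrite subr0.
Qed.

Lemma exp_ccont (k : R) (z : C) : ccont (fun t => real_mul (expR (- (k * t))) z).
Proof.
apply: ccontM; last exact: ccont_cst.
apply: ccont_real => t; rewrite (_ : (fun t => _) = fun t => expR (- (- k * (0 - t)))).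
  exact: exp_lin_continuous.
by apply: funext => s; rewrite sub0r mulrNN.
Qed.

Lemma duhamel_eq t i phi : 0 < t < 1 -> duhamel F t i phi = heat t (u_in i) phi - u t i phi.
Proof.
move=> ht; have /andP[t0 t1] := ht; have tt : 0 <= t <= 1 by rewrite !ltW.
rewrite duhamelE// heat_flowE -(synthB _ (heat_pbd i (ltW t0)) (flow_pbd hfl hC1 i (shift_ok tt)))//.
Qed.

(** With sigma = N + 1 + 2 d, where the paraproduct converges, the Duhamel formula
   holds at each time. *)
Lemma flow_mild (chi : 'rV[R]_d -> R) : lp_bump chi -> mild_solution chi 1 u_in u.
Proof.
move=> hchi; exists (N.+1 + d.*2)%:R, F.
have okw t : 0 < t < 1 -> 0 <= t <= 1 by move=> /andP[? ?]; rewrite !ltW.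
(* weaken the exponent by one, to have summability and convergence in the same space *)
have hC4' m : m != 0 -> forall K, exists om : mode -> R,
    [/\ forall a, 0 <= om a, \sum_(a <- box K) om a <= C4 &
     forall a i j t, a \in box K -> -1 <= t <= 1 ->
       cab (c a i t * c (m - a) j t) <= jap m ^+ N.+1 * om a].
  move=> m0 K; have [om [h1 h2 h3]] := hC4 m0 K; exists om; split => // a i j t aK ht.
  by rewrite (le_trans (h3 a i j t aK ht))// ler_wpM2r// ler_weXn2l// jap_ge1.
have stu i : st_dist 1 (fun t => u t i).
  apply: (@st_dist_synth _ _ C1 1 (fun m t => c m i (t + tau))) => //.
    by move=> t /okw ht; exact: (flow_pbd hfl hC1 i (shift_ok ht)).
  by move=> m; exact: ctf_ccont (fl_ctf hfl m i).
have sth i : st_dist 1 (fun t => heat t (u_in i)).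
  apply: (@st_dist_synth _ _ C1 1 (fun m t => real_mul (expR (- (lap m * t))) (c m i tau))) => //.
  - by move=> t /andP[t0 _]; exact: heat_pbd (ltW t0).
  - by move=> m; exact: exp_ccont.
  by move=> t _; exact: heat_flowE.
have std i : st_dist 1 (fun t => duhamel F t i).
  apply: (@st_dist_synth _ _ (C1 + C1) (1 + 1) (fun m t => duhamel_sum t i m)) => //.
  - by move=> t /okw ht; exact: duhamel_sum_pbd.
  - move=> m; rewrite /duhamel_sum.
    rewrite (_ : (fun t => _) = fun t => real_mul (expR (- (lap m * t))) (c m i tau) + (-1) * c m i (t + tau)).
      apply: ccontD; first exact: exp_ccont.
      by apply: ccontM; [exact: ccont_cst|exact: ctf_ccont (fl_ctf hfl m i)].
    by apply: funext => t; rewrite mulN1r.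
  by move=> t ht; exact: duhamelE.
split => //.
- apply: aeW => s /okw ht; have hs := shift_ok ht; split.
  + exact: (flow_tensor_summable hfl hC1 C40 hC4' hs hchi).
  + move=> i j; split; first exact: synth_is_dist (conv_pbd kap C40 hC4 i j hs).
    by rewrite (fcoef_flow_F hfl hkap C40 hC4 hs) /conv eqxx.
  exact: (flow_tensor_cvg hfl hkap hC1 C40 hC4 hs hchi).
- move=> t i ht; split => [phi|]; first exact: duhamel_integrable.
  by rewrite duhamelE//; apply: synth_is_dist; apply: duhamel_sum_pbd; exact: okw.
move=> i a b Phi a0 b1 hPhi.
have [I1 _] := sth i a b a0 b1; have [I2 _] := std i a b a0 b1.
rewrite /st_pairing -RintegralB; [|by []|exact: I1|exact: I2].
apply: eq_Rintegral => t; rewrite inE /= in_itv => ht.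
by rewrite duhamel_eq// subKr.
Qed.

End FlowMild.
End MildSolution.

(** * Two solutions with the same initial datum *)

Section Nonuniqueness.
Context {R : realType} {d : nat}.
Local Notation mode := 'rV[int]_d.
Local Notation C := R[i].
Implicit Types (m a b : mode) (t s : R).

(** The tail beyond a box that nearly attains the supremum of the partial sums. *)
Lemma box_tail (f : mode -> R) (S e : R) : (forall m, 0 <= f m) ->
  (forall K, \sum_(m <- box K) f m <= S) -> 0 < e ->
  exists L, forall K, \sum_(m <- box K | m \notin box L) f m <= e.
Proof.
move=> f0 hS e0; pose A := range (fun K => \sum_(m <- box K) f m).
have hA : has_sup A by split; [exists (\sum_(m <- box 0) f m); exists 0%N|exists S => _ [K _ <-]].
have [_ [L _ <-] hL] := sup_adherent e0 hA; exists L => K.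
pose K' := (K + L)%N.
have LK := box_mono (d := d) (leq_addl K L).
have KK := box_mono (d := d) (leq_addr L K).
have E := big_uniq_sub f (box_uniq L) (box_uniq K') LK.
have h : \sum_(m <- box K') f m <= sup A by apply: ub_le_sup; [exact: hA.2|exists K'].
rewrite (bigID (fun m => m \in box L))/= E in h.
rewrite big_mkcond/= (le_trans (ler_sum_sub (box_uniq K) (box_uniq K') KK _))//.
  by move=> m; case: ifP.
by rewrite -big_mkcond; lra.
Qed.

Variables (theta eps : R) (rho0 : nat) (c : mode -> 'I_d -> R -> C) (M : mode -> R).
Hypothesis hfl : flow theta eps rho0 c M.
Hypothesis theta0 : 0 < theta.
Variable chi : 'rV[R]_d -> R.
Hypothesis hchi : lp_bump chi.
Variables q r : \bar R.
Hypotheses (q1 : (1 <= q)%E) (r1 : (1 <= r)%E).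

Lemma flow_weighted : exists S : R, forall K, \sum_(m <- box K) jap m `^ (- theta) * M m <= S.
Proof.
have w0 m : 0 <= jap m `^ (- theta) * M m by rewrite mulr_ge0 ?powR_ge0 ?(fl_M0 hfl).
exists (eps + \sum_(m <- box rho0) jap m `^ (- theta) * M m) => K.
rewrite (bigID (fun m : mode => (rho0 < nrm m)%N))/=; apply: lerD; first exact: fl_sum hfl K.
rewrite -(big_uniq_sub _ (box_uniq rho0) (box_uniq (K + rho0))); last by apply: box_mono; exact: leq_addl.
rewrite big_mkcond [leRHS]big_mkcond/=.
apply: (@le_trans _ _ (\sum_(m <- box (K + rho0)) if ~~ (rho0 < nrm m)%N then jap m `^ (- theta) * M m else 0)).
  apply: ler_sum_sub; rewrite ?box_uniq//; first by apply: box_mono; exact: leq_addr.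
  by move=> m; case: ifP.
apply: ler_sum => m _; case: ifP => [|_]; last by case: ifP.
by rewrite -leqNgt => h; rewrite nrm_box.
Qed.

Lemma flow_coef t i : -1 <= t <= 1 -> fcoef (flow_u c t i) = fun m => c m i t.
Proof. by move=> ht; have [C1 hC1] := fl_poly hfl; exact: (fcoef_flow_u hfl hC1 ht i). Qed.

Lemma flow_besov t : -1 <= t <= 1 -> besov chi (- theta) q r (flow_u c t).
Proof.
move=> ht; have [C1 hC1] := fl_poly hfl; split.
  by move=> i; exact: (synth_is_dist (flow_pbd hfl hC1 i ht)).
have [B B0 hB] := besov_norm_l1 hchi; have [S hS] := flow_weighted.
apply: le_lt_trans (hB theta q r (flow_u c t) M S (ltW theta0) q1 r1 (fl_M0 hfl) _ hS) (ltry _).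
by move=> i m; rewrite flow_coef// (fl_M hfl).
Qed.

Lemma flow_pbesov t : -1 <= t <= 1 -> pbesov chi (- theta) q r (flow_u c t).
Proof.
move=> ht; have [C1 hC1] := fl_poly hfl; split; first exact: flow_besov.
split; last by move=> i; rewrite flow_coef// (fl_zero hfl).
apply: (@div_synth _ _ C1 1 (fun i m => c m i t)) => [i|m]; first exact: (flow_pbd hfl hC1 i ht).
exact: fl_div hfl m t.
Qed.

Lemma flow_curve tau : -1 <= tau <= 0 -> besov_curve chi (- theta) q r 1 (fun t => flow_u c (t + tau)).
Proof.
move=> /andP[tau1 tau0].
have ok t : 0 <= t <= 1 -> -1 <= t + tau <= 1 by move=> /andP[? ?]; apply/andP; split; lra.
split => [t /ok|t ht e e0]; first exact: flow_besov.
have [B B0 hB] := besov_norm_l1 hchi; have [S hS] := flow_weighted.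
pose Q : R := B * (1 + d%:R) `^ theta.
have Q0 : 0 < Q by rewrite mulr_gt0// powR_gt0// ltr_wpDr.
pose e' := e / 4 / Q.
have e'0 : 0 < e' by rewrite !divr_gt0.
pose f m := jap m `^ (- theta) * M m * (d%:R * 2).
have f0 m : 0 <= f m by rewrite !mulr_ge0 ?powR_ge0 ?(fl_M0 hfl).
have fS K : \sum_(m <- box K) f m <= S * (d%:R * 2) by rewrite -mulr_suml ler_wpM2r ?mulr_ge0.
have [L hL] := box_tail f0 fS e'0.
pose D t' m : R := \sum_i cab (c m i (t' + tau) - c m i (t + tau)).
have D0 t' m : 0 <= D t' m by apply: sumr_ge0 => i _; exact: cab_ge0.
pose G t' : R := \sum_(m <- box L) D t' m.
(* finitely many low modes move continuously, the others are uniformly small *)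
have cG : {for t, continuous G}.
  apply: (@cvg_fsum R R (nbhs t) _ _ (box L) (fun m t' => D t' m)) => m.
  apply: (@cvg_fsum R R (nbhs t) _ _ (index_enum 'I_d) (fun i t' => cab (c m i (t' + tau) - c m i (t + tau)))) => i.
  have [cr ci] := ccontD (ctf_ccont tau (fl_ctf hfl m i)) (ccont_cst (- c m i (t + tau))).
  by apply: cvgD; apply: cvg_norm; [exact: cr|exact: ci].
have G0 : G t = 0.
  by rewrite /G big1// => m _; rewrite /D big1// => i _; rewrite subrr cab0.
have := cG; move/cvgrPdist_lt => /(_ _ e'0); rewrite G0 => /nbhs_ballP[dl /= dl0 hdl].
exists dl => // t' ht' tt'.
have small : G t' <= e'.
  have := hdl t'; rewrite /ball/= distrC => /(_ tt'); rewrite sub0r normrN => h.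
  by rewrite (le_trans (ler_norm _))// ltW.
have DM m : D t' m <= M m * (d%:R * 2).
  apply: (@le_trans _ _ (\sum_(i < d) (M m + M m))); last first.
    by rewrite sumr_const card_ord -mulr_natl le_eqVlt; apply/orP; left; apply/eqP; ring.
  apply: ler_sum => i _; rewrite (le_trans (cabD _ _))// cabN.
  by rewrite lerD// (fl_M hfl)// ok.
have sumD K : \sum_(m <- box K) jap m `^ (- theta) * D t' m <= e' + e'.
  rewrite (bigID (fun m => m \in box L))/=; apply: lerD; last first.
    rewrite (le_trans _ (hL K))//; apply: ler_sum => m _.
    by rewrite /f -mulrA ler_wpM2l ?powR_ge0.
  rewrite (le_trans _ small)// /G -(big_uniq_sub _ (box_uniq L) (box_uniq (K + L))); last by apply: box_mono; exact: leq_addl.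
  rewrite big_mkcond [leRHS]big_mkcond/=.
  apply: (@le_trans _ _ (\sum_(m <- box K) if m \in box L then D t' m else 0)).
    apply: ler_sum => m _; case: ifP => // _; rewrite ler_piMl//.
    rewrite powRN invf_le1 ?powR_gt0 ?jap_gt0//.
    have <- : 1 `^ theta = 1 :> R by rewrite powR1.
    by rewrite ge0_ler_powR ?nnegrE ?jap_ge1 ?jap_ge0// ltW.
  apply: ler_sum_sub; rewrite ?box_uniq//; first by apply: box_mono; exact: leq_addr.
  by move=> m; case: ifP.
have hc i m : cab (fcoef ((flow_u c (t' + tau) - flow_u c (t + tau))%R i) m) <= D t' m.
  rewrite (_ : fcoef _ m = fcoef (flow_u c (t' + tau) i) m - fcoef (flow_u c (t + tau) i) m); last exact: fcoefB.
  rewrite !flow_coef ?ok// /D (bigD1 i)//= lerDl sumr_ge0// => j _; exact: cab_ge0.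
apply: le_lt_trans (hB theta q r _ (D t') (e' + e') (ltW theta0) q1 r1 (D0 t') hc sumD) _.
rewrite lte_fin -/Q /e'; have -> : Q * (e / 4 / Q + e / 4 / Q) = e / 2 by field; rewrite gt_eqF.
by rewrite ltr_pdivrMr// ltr_pMr// ltr1n.
Qed.

(** The flow does not move before time 0: started at time -1 or at time 0 it has the
   same datum, but at time 1 the first solution is still at this datum. *)
Lemma flow_nonunique m i : c m i 1 != c m i 0 -> nonunique_data chi (- theta) q r (flow_u c 0).
Proof.
move=> ne; have zok : -1 <= (0 : R) <= 1 by rewrite oppr_le0 ler01.
split; first exact: flow_pbesov.
have /choice[kap hk] : forall m, exists k : nat, m != 0 ->
    (forall a i j t t', c a i t != 0 -> c (m - a) j t' != 0 -> (nrm a <= k)%N) /\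
    forall K i t, (k <= K)%N -> err K c m i t = 0.
  move=> x; have [x0|x0] := eqVneq x 0; first by exists 0%N.
  by have [k hk] := fl_conv hfl x0; exists k.
have [C1 hC1] := fl_poly hfl; have [C4 [N [C40 hC4]]] := fl_weight hfl.
have mild tau (htau : -1 <= tau <= 0) := flow_mild hfl hk hC1 C40 hC4 htau hchi.
have E1 : flow_u c (-1) = flow_u c 0.
  apply: funext => j; rewrite /flow_u; congr synth; apply: funext => x.
  by rewrite (ctf_const (fl_ctf hfl x j)) ?oppr_le0.
have t1 : -1 <= (-1 : R) <= 0 by rewrite lexx oppr_le0 ler01.
have t0 : -1 <= (0 : R) <= 0 by rewrite lexx oppr_le0 ler01.
exists 1, (fun t => flow_u c (t + -1)), (fun t => flow_u c (t + 0)); split.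
- exact: ltr01.
- by split; exact: flow_curve.
- by split; [rewrite -E1; exact: mild|exact: mild].
exists 1; first by rewrite lexx ler01.
rewrite subrr addr0 => E; have := congr1 (fun v : @Defs.vdist R d => fcoef (v i) m) E.
rewrite !flow_coef//; last by rewrite lexx (le_trans _ ler01)// oppr_le0.
by move=> h; rewrite h eqxx in ne.
Qed.

End Nonuniqueness.

(** * Integral norms of continuous functions on the torus *)

Section TorusNormTheory.
Context {R : realType} {d : nat}.
Local Notation V := 'rV[R]_d.
Local Notation TR := (measurableTypeR R).
Local Notation P := (@cube_prob R d).
Implicit Types (q : \bar R) (f g h : V -> R).

Lemma torus_Lnorm_mono q f g : (1 <= q)%E -> cper f -> cper g -> (forall x, `|f x| <= g x) ->
  (torus_Lnorm q f <= torus_Lnorm q g)%E.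
Proof.
move=> q1 cf cg fg; rewrite /torus_Lnorm unlock.
have gg x : g x <= `|g x| by exact: ler_norm.
case: q q1 => [p p1| _|//].
- have p1' : (1 <= p)%R by rewrite -lee_fin.
  have pp : (0 < p)%R by rewrite (lt_le_trans ltr01).
  have pV : 0 <= p^-1 by rewrite invr_ge0 ltW.
  apply: (gt0_ler_poweR pV); rewrite ?in_itv/= ?leey ?andbT.
  + by apply: integral_ge0 => x _; rewrite lee_fin powR_ge0.
  + by apply: integral_ge0 => x _; rewrite lee_fin powR_ge0.
  have mp h : cper h -> measurable_fun [set: d.-tuple TR] (fun x => `|(h (\row_i tnth x i))%:E|%E `^ p)%E.
    move=> ch; rewrite (_ : (fun x => _) = EFin \o (fun x => `|h (rowt x)| `^ p))//.
    apply/measurable_EFinP; apply: (@measurableT_comp _ _ _ _ _ _ (fun y : R => y `^ p)).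
      exact: measurable_powR.
    exact: (measurable_cont (proj1 (cper_norm ch))).
  apply: ge0_le_integral => //; [exact: mp|exact: mp|].
  move=> x _; rewrite lee_fin; apply: ge0_ler_powR; rewrite ?nnegrE//; first exact: ltW.
  exact: le_trans (gg _).
case: ifPn => // _; apply: le_ess_sup; apply: nearW => x; rewrite /= lee_fin.
exact: le_trans (gg _).
Qed.

Lemma torus_LnormD q f g : (1 <= q)%E -> cper f -> cper g ->
  (torus_Lnorm q (fun x => f x + g x)%R <= torus_Lnorm q f + torus_Lnorm q g)%E.
Proof.
move=> q1 cf cg; exact: (@eminkowski _ _ _ P _ _ _ (measurable_cont (proj1 cf)) (measurable_cont (proj1 cg)) q1).
Qed.

(** For the supremum norm, through the measures of the superlevel sets. *)
Lemma torus_Lnorm_shift q h v : (1 <= q)%E -> cper h ->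
  torus_Lnorm q (fun x => h (x + v)%R) = torus_Lnorm q h.
Proof.
move=> q1 ch; have [c1 ph] := ch; rewrite /torus_Lnorm unlock.
case: q q1 => [p p1| _|//].
  apply: (congr1 (fun z => z `^ p^-1)%E).
  apply: (@ge0_integral_shift_row R d (fun x => (`|h x| `^ p)%:E) v) => [|x|m x].
  - apply/measurable_EFinP; apply: (@measurableT_comp _ _ _ _ _ _ (fun y : R => y `^ p)).
      exact: measurable_powR.
    exact: (measurable_cont (proj1 (cper_norm ch))).
  - by rewrite lee_fin powR_ge0.
  by rewrite ph.
case: ifPn => // _.
have mabs u : measurable_fun [set: d.-tuple TR] (fun x => `|(h (\row_i tnth x i + u))%:E|%E).
  rewrite (_ : (fun x => _) = EFin \o (fun x => `|h (rowt x + u)|))//.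
  by apply/measurable_EFinP; apply: (measurable_cont (proj1 (cper_norm (cper_shift u ch)))).
have m0 : measurable_fun [set: d.-tuple TR] (fun x => `|(h (\row_i tnth x i))%:E|%E).
  by have := mabs 0; under eq_fun do rewrite addr0.
rewrite !ess_supEmu0//; last exact: mabs.
congr ereal_inf; apply: eq_set => y; congr (_ = _).
pose F (x : V) : \bar R := ((y < `|h x|%:E)%E%:R)%:E.
pose A (u : V) := (fun x : d.-tuple TR => `|(h (\row_i tnth x i + u))%:E|%E) @^-1` `]y, +oo[.
have mA u : measurable (A u).
  by rewrite -[A u]setTI; apply: mabs => //; exact: emeasurable_itv.
have AE u x : (\1_(A u) x)%:E = F (rowt x + u)%R.
  rewrite /F indicE; congr (_%:R%:E); congr nat_of_bool.
  by apply/idP/idP; rewrite inE /A /= in_itv/= andbT.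
have FE u : (P (A u) = \int[P]_x F (rowt x + u)%R)%E.
  by rewrite -[A u]setIT -integral_indic//; apply: eq_integral => x _; rewrite AE.
have FE0 : P (A 0) = (\int[P]_x F (rowt x))%E.
  by rewrite FE; apply: eq_integral => x _; rewrite addr0.
have A0E : A 0 = (fun x : d.-tuple TR => `|(h (\row_i tnth x i))%:E|%E) @^-1` `]y, +oo[.
  by rewrite /A; under eq_fun do rewrite addr0.
rewrite -[LHS]/(P (A v)) FE.
rewrite -[X in _ = P X]A0E FE0.
apply: ge0_integral_shift_row.
- rewrite (_ : (fun x => _) = EFin \o \1_(A 0)); last by apply: funext => x; rewrite /= AE addr0.
  by apply/measurable_EFinP; exact: measurable_indic.
- by move=> x; rewrite /F lee_fin.
by move=> m x; rewrite /F ph.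
Qed.

Lemma torus_Lnorm_fin q h : (1 <= q)%E -> cper h -> torus_Lnorm q h \is a fin_num.
Proof.
move=> q1 ch; have [B B0 hB] := cper_bounded ch.
rewrite ge0_fin_numE; last exact: Lnorm_ge0.
exact: le_lt_trans (torus_Lnorm_le q1 B0 ch hB) (ltry _).
Qed.

(** The norm of a continuous periodic function is finite; a real value spares the
   extended arithmetic. *)
Definition tnorm q h : R := fine (torus_Lnorm q h).

Lemma tnormE q h : (1 <= q)%E -> cper h -> torus_Lnorm q h = (tnorm q h)%:E.
Proof. by move=> q1 ch; rewrite /tnorm fineK// torus_Lnorm_fin. Qed.

Lemma tnorm_ge0 q h : 0 <= tnorm q h.
Proof. by rewrite /tnorm fine_ge0//; exact: Lnorm_ge0. Qed.

Lemma tnorm_mono q f g : (1 <= q)%E -> cper f -> cper g -> (forall x, `|f x| <= g x) ->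
  tnorm q f <= tnorm q g.
Proof. by move=> q1 cf cg fg; rewrite -lee_fin -!tnormE// torus_Lnorm_mono. Qed.

Lemma tnormD q f g : (1 <= q)%E -> cper f -> cper g ->
  tnorm q (fun x => f x + g x) <= tnorm q f + tnorm q g.
Proof.
move=> q1 cf cg; rewrite -lee_fin EFinD -!tnormE//; last exact: cperD.
exact: torus_LnormD.
Qed.

Lemma tnorm_shift q h v : (1 <= q)%E -> cper h -> tnorm q (fun x => h (x + v)) = tnorm q h.
Proof. by move=> q1 ch; rewrite /tnorm torus_Lnorm_shift. Qed.

Lemma tnorm_le q h (B : R) : (1 <= q)%E -> 0 <= B -> cper h -> (forall x, `|h x| <= B) ->
  tnorm q h <= B.
Proof. by move=> q1 B0 ch hB; rewrite -lee_fin -tnormE// torus_Lnorm_le. Qed.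

Lemma tnormZ q h (a : R) : (1 <= q)%E -> 0 <= a -> cper h ->
  tnorm q (fun x => a * h x) = a * tnorm q h.
Proof.
move=> q1 a0 ch; suff E : torus_Lnorm q (fun x => a * h x) = (a%:E * torus_Lnorm q h)%E.
  by rewrite /tnorm E fineM// torus_Lnorm_fin.
have mh : measurable_fun [set: d.-tuple TR] (fun x => `|h (rowt x)|).
  exact: (measurable_cont (proj1 (cper_norm ch))).
rewrite /torus_Lnorm unlock; case: q q1 => [p p1| _|//].
  have p1' : (1 <= p)%R by rewrite -lee_fin.
  have pp : (0 < p)%R by rewrite (lt_le_trans ltr01).
  have I0 : (0 <= \int[P]_x (`|h (rowt x)| `^ p)%:E)%E.
    by apply: integral_ge0 => x _; rewrite lee_fin powR_ge0.
  transitivity (((a `^ p)%:E * \int[P]_x (`|h (rowt x)| `^ p)%:E) `^ p^-1)%E.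
    apply: (congr1 (fun z => z `^ p^-1)%E).
    rewrite -ge0_integralZl_EFin//; last 2 first.
    - apply/measurable_EFinP; apply: (@measurableT_comp _ _ _ _ _ _ (fun y : R => y `^ p)) => //.
    - exact: powR_ge0.
    - apply: eq_integral => x _ /=.
      by rewrite normrM (ger0_norm a0) powRM.
  rewrite poweRM ?lee_fin ?powR_ge0//; congr (_ * _)%E.
  by rewrite poweR_EFin -powRrM mulfV ?gt_eqF// powRr1.
have PT : (0 < P [set: d.-tuple TR])%E by rewrite probability_setT.
rewrite PT; rewrite -ess_supZl//; congr ess_sup; apply: funext => x /=.
by rewrite normrM (ger0_norm a0) EFinM.
Qed.

Lemma tnorm_sum_shift q h (I : Type) (s : seq I) (w : I -> R) (v : I -> V) :
  (1 <= q)%E -> cper h -> (forall i, 0 <= w i) ->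
  tnorm q (fun x => \sum_(i <- s) w i * h (x + v i)) <= (\sum_(i <- s) w i) * tnorm q h.
Proof.
move=> q1 ch w0; have cs l : cper (fun x => \sum_(i <- l) w i * h (x + v i)).
  by apply: (@cper_sum R d _ l xpredT (fun i x => w i * h (x + v i))) => i; apply: cperZ; exact: cper_shift.
elim: s => [|i s IH].
  rewrite big_nil mul0r; apply: tnorm_le => //.
  by move=> x; rewrite big_nil normr0.
under eq_fun do rewrite big_cons; rewrite big_cons mulrDl.
rewrite (le_trans (tnormD q1 _ (cs s)))//; first by apply: cperZ; exact: cper_shift.
rewrite lerD// tnormZ// ?tnorm_shift//; exact: cper_shift.
Qed.

(** The endpoint exponents follow from the almost everywhere bound by the essential
   supremum. *)
Lemma torus_hoelder q f g : (1 <= q)%E -> cper f -> cper g -> 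
  torus_int (fun x => `|f x * g x|) <= tnorm q f * tnorm (hoelder_conjugate q) g.
Proof.
move=> q1; have q1' := hoelder_conj_ge1 q1.
have end1 F G : cper F -> cper G -> torus_int (fun x => `|F x * G x|) <= tnorm +oo%E F * tnorm 1%E G.
  move=> cF cG; have y1 : (1 <= +oo :> \bar R)%E by rewrite leey.
  have PT : (0 < P [set: d.-tuple TR])%E by rewrite probability_setT.
  have := tnormE y1 cF; rewrite /torus_Lnorm unlock PT => esF.
  have Fae : {ae P, forall x, `|F (rowt x)| <= tnorm +oo%E F}.
    have := ess_sup_ge P (abse \o (fun x => (F (\row_i tnth x i))%:E)).
    by rewrite esF; apply: filterS => x /=; rewrite lee_fin.
  have E1 : tnorm 1%E G = torus_int (fun x => `|G x|).
    by rewrite /tnorm /torus_Lnorm Lnorm1.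
  rewrite E1 -torus_intZ; last exact: cper_norm.
  have c1 : cper (fun x => `|F x * G x|) by apply: cper_norm; exact: cperM.
  have c2 : cper (fun x => tnorm +oo%E F * `|G x|) by apply: cperZ; exact: cper_norm.
  rewrite /torus_int /Rintegral fine_le//.
  - exact: integrable_fin_num (cper_integrable c1).
  - exact: integrable_fin_num (cper_integrable c2).
  apply: ae_ge0_le_integral => //.
  - by apply/measurable_EFinP; exact: (measurable_cont (proj1 c1)).
  - by move=> x _; rewrite lee_fin mulr_ge0// tnorm_ge0.
  - by apply/measurable_EFinP; exact: (measurable_cont (proj1 c2)).
  by apply: filterS Fae => x h _; rewrite lee_fin normrM ler_wpM2r.
move=> cf cg; case: q q1 q1' => [p p1 p1'|_ _|//]; last by rewrite hoelder_conjugatey; exact: end1.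
have [p_1|p_1] := eqVneq p 1.
  rewrite p_1 hoelder_conjugate1 mulrC.
  by under eq_fun do rewrite mulrC; exact: end1.
have p1'' : (1 < p)%R by rewrite lt_neqAle eq_sym p_1 -lee_fin.
have p0 : (0 < p)%R by exact: lt_trans p1''.
have pc : hoelder_conjugate p%:E = (p / (p - 1))%:E.
  rewrite /hoelder_conjugate/= eqe (gt_eqF p0) -EFinB inver subr_eq0 (negPf p_1).
  by rewrite EFinM.
have c1 : cper (fun x => f x * g x) by exact: cperM.
have pm1 : 0 < p - 1 by rewrite subr_gt0.
have := @hoelder _ _ _ P (fun x => f (rowt x)) (fun x => g (rowt x)) p (p / (p - 1))
  (measurable_cont (proj1 cf)) (measurable_cont (proj1 cg)) p0 (divr_gt0 p0 pm1).
have -> : p^-1 + (p / (p - 1))^-1 = 1 by field; rewrite (gt_eqF p0) (gt_eqF pm1).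
move=> /(_ erefl); rewrite Lnorm1.
rewrite -[X in (_ <= X * _)%E]/(torus_Lnorm p%:E f) -[X in (_ <= _ * X)%E]/(torus_Lnorm (p / (p - 1))%:E g).
rewrite -pc !tnormE// -EFinM => h; rewrite -lee_fin; apply: le_trans h.
rewrite /torus_int /Rintegral fineK//; exact: integrable_fin_num (cper_integrable (cper_norm c1)).
Qed.

End TorusNormTheory.

(** * Fejer means *)

Section Fejer.
Context {R : realType}.
Local Notation C := R[i].

(** The number of ways to write l as a difference of elements of [0, n[, over n: the
   triangular multiplier (1 - |l| / n)^+, in a form that shows why its kernel is
   nonnegative. *)
Definition fej (n : nat) (l : int) : R :=
  n%:R^-1 * \sum_(a < n) \sum_(b < n) ((a%:Z - b%:Z == l)%:R : R).

Let row_le1 n (a : 'I_n) l : \sum_(b < n) ((a%:Z - b%:Z == l)%:R : R) <= 1.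
Proof.
have [b0 hb|h] := pickP (fun b : 'I_n => a%:Z - b%:Z == l); last first.
  by rewrite big1 ?ler01// => b _; rewrite h.
rewrite (bigD1 b0)//= hb big1 ?addr0// => b bb0; case: eqP => // e; case/eqP: bb0.
by apply/val_inj => /=; move: hb e => /eqP; lia.
Qed.

Lemma fej_ge0 n l : 0 <= fej n l.
Proof. by rewrite mulr_ge0 ?invr_ge0//; do 2!(apply: sumr_ge0 => ? _). Qed.

Lemma fej_le1 n l : fej n l <= 1.
Proof.
case: n => [|n]; first by rewrite /fej invr0 mul0r.
rewrite /fej mulrC ler_pdivrMr ?ltr0n// mul1r.
by rewrite (le_trans (ler_sum _ (fun a _ => row_le1 a l)))// sumr_const card_ord.
Qed.

Lemma fejN n l : fej n (- l) = fej n l.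
Proof.
rewrite /fej exchange_big/=; congr (_ * _); apply: eq_bigr => a _; apply: eq_bigr => b _.
by rewrite -eqr_oppLR opprB.
Qed.

Lemma fej0 n : (0 < n)%N -> fej n 0 = 1.
Proof.
move=> n0; rewrite /fej (eq_bigr (fun=> 1)) => [|a _].
  by rewrite sumr_const card_ord mulVf// pnatr_eq0 -lt0n.
rewrite (bigD1 a)//= subrr eqxx big1 ?addr0// => b ba; case: eqP => // e; case/eqP: ba.
by apply/val_inj => /=; move: e; lia.
Qed.

Lemma fej_out n l : (n <= `|l|)%N -> fej n l = 0.
Proof.
move=> nl; rewrite /fej big1 ?mulr0// => a _; rewrite big1// => b _.
case: eqP => // e; have := ltn_ord a; have := ltn_ord b; move: nl; rewrite -e; lia.
Qed.

Lemma fej_cvg n l : (0 < n)%N -> 1 - fej n l <= (`|l|%N)%:R / n%:R.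
Proof.
move=> n0; have pos k : 1 - fej n k%:Z <= k%:R / n%:R.
  have nR : 0 < n%:R :> R by rewrite ltr0n.
  have h : n%:R - k%:R <= \sum_(a < n) \sum_(b < n) ((a%:Z - b%:Z == k%:Z)%:R : R).
    apply: (@le_trans _ _ (\sum_(a < n) (((k <= a)%N)%:R : R))).
      rewrite -natr_sum -(big_mkord xpredT (fun a => nat_of_bool (k <= a)%N)).
      have e : (\sum_(0 <= a < n) (k <= a) = n - k)%N.
        elim: n {n0 nR} => [|n IH]; first by rewrite big_geq.
        by rewrite big_nat_recr//= IH; case: leqP; lia.
      rewrite e; have [nk|nk] := ltnP n k; first by rewrite (eqP (ltnW nk : n - k == 0)%N) subr_le0 ler_nat ltnW.
      by rewrite natrB.
    apply: ler_sum => a _; case: leqP => [ka|]; last by move=> _; apply: sumr_ge0.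
    have kb : (a - k < n)%N by rewrite (leq_ltn_trans (leq_subr _ _)).
    rewrite (bigD1 (Ordinal kb))//= (_ : _ == _) ?lerDl ?sumr_ge0//; lia.
  rewrite /fej lerBlDr [n%:R^-1 * _]mulrC -mulrDl ler_pdivlMr// mul1r; lra.
have [l0|l0] := leP 0 l.
  by have := pos `|l|%N; rewrite gez0_abs.
by have := pos `|l|%N; rewrite ltz0_abs// fejN.
Qed.

(** The character of R / Z, in terms of which phases factor over the coordinates. *)
Definition ee (y : R) : C := Complex (cos (2 * pi * y)) (sin (2 * pi * y)).

Lemma eeD x y : ee (x + y) = ee x * ee y.
Proof. by rewrite /ee mulrDr cosD sinD; apply: complex_ext; rewrite ?ReM ?ImM//= addrC. Qed.

Lemma ee0 : ee 0 = 1.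
Proof. by rewrite /ee mulr0 cos0 sin0. Qed.

Lemma ee_sum (I : Type) (s : seq I) (f : I -> R) : ee (\sum_(i <- s) f i) = \prod_(i <- s) ee (f i).
Proof. by elim: s => [|i s IH]; rewrite ?big_nil ?ee0// !big_cons eeD IH. Qed.

Lemma eeN y : ee (- y) = conjc (ee y).
Proof. by rewrite /ee mulrN cosN sinN. Qed.

Lemma eeX y n : ee (y * n%:R) = ee y ^+ n.
Proof. by elim: n => [|n IH]; rewrite ?mulr0 ?ee0// -natr1 mulrDr mulr1 eeD IH exprSr. Qed.

Lemma ee_int (k : int) : ee k%:~R = 1.
Proof.
have e1 : ee 1 = 1 by rewrite /ee mulr1 [2 * pi]mulrC mulr_natr cos2pi sin2pi.
have en (n : nat) : ee n%:R = 1 by rewrite -[n%:R]mul1r eeX e1 expr1n.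
by case: k => n; rewrite ?NegzE ?rmorphN ?eeN en ?conjc1.
Qed.

Lemma ee_neq1 (k : int) (M : nat) : k != 0 -> (`|k| < M)%N -> ee (k%:~R / M%:R) != 1.
Proof.
move=> k0 kM; have M0 : (0 < M)%N by exact: leq_ltn_trans kM.
have MR : 0 < M%:R :> R by rewrite ltr0n.
apply/eqP => /(congr1 (@complex.Re R)) /=.
pose y : R := pi * ((`|k|%N)%:R / M%:R).
have -> : cos (2 * pi * (k%:~R / M%:R)) = cos (y + y).
  have -> : y + y = 2 * pi * ((`|k|%N)%:R / M%:R) by rewrite /y; ring.
  rewrite natr_absz; have [kp|kn] := leP 0 k; first by rewrite ger0_norm.
  by rewrite ltr0_norm// intrN mulNr mulrN cosN.
have sy : 0 < sin y.
  apply: sin_gt0_pi; rewrite /y mulr_gt0 ?pi_gt0 ?divr_gt0 ?ltr0n ?absz_gt0//=.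
  by rewrite gtr_pMr ?pi_gt0// ltr_pdivrMr// mul1r ltr_nat.
rewrite cosD => h; have := cos2Dsin2 y; rewrite !expr2.
by have := mulr_gt0 sy sy; lra.
Qed.

(** A geometric sum over the M-th roots of unity. *)
Lemma dirichlet_sum (k : int) (M : nat) : (`|k| < M)%N ->
  \sum_(j < M) ee (k%:~R / M%:R * j%:R) = M%:R * (k == 0)%:R.
Proof.
move=> kM; have M0 : (0 < M)%N by exact: leq_ltn_trans kM.
case: eqVneq => [->|k0].
  under eq_bigr do rewrite mul0r mul0r ee0.
  by rewrite sumr_const card_ord mulr1.
rewrite mulr0; under eq_bigr do rewrite eeX.
have z1 := ee_neq1 k0 kM.
have e : (ee (k%:~R / M%:R) - 1) * (\sum_(i < M) ee (k%:~R / M%:R) ^+ i) = 0.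
  rewrite -subrX1 -eeX divfK ?ee_int ?subrr//.
  by rewrite pnatr_eq0 -lt0n.
by move/eqP: e; rewrite mulf_eq0 subr_eq0 (negPf z1)/= => /eqP.
Qed.

(** The discrete Fejer kernel on the M-th roots of unity. *)
Definition fweight (n M : nat) (j : nat) : R :=
  (n%:R * M%:R)^-1 * ((\sum_(a < n) complex.Re (ee (j%:R / M%:R * a%:R))) ^+ 2 +
                      (\sum_(a < n) complex.Im (ee (j%:R / M%:R * a%:R))) ^+ 2).

Lemma fweight_ge0 n M j : 0 <= fweight n M j.
Proof. by rewrite mulr_ge0 ?invr_ge0 ?mulr_ge0// addr_ge0 ?sqr_ge0. Qed.

Lemma fweightE n M j : (fweight n M j)%:C%C =
  ((n%:R * M%:R)^-1)%:C%C * \sum_(a < n) \sum_(b < n) ee (j%:R / M%:R * (a%:Z - b%:Z)%:~R).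
Proof.
rewrite /fweight rmorphM; congr (_ * _).
pose S : C := \sum_(a < n) ee (j%:R / M%:R * a%:R).
rewrite -!Re_sum -!Im_sum -/S.
transitivity (S * conjc S).
  by case: S => x y; apply: complex_ext; rewrite ?ReM ?ImM /=; ring.
rewrite /S cj_sum mulr_suml; apply: eq_bigr => a _; rewrite mulr_sumr; apply: eq_bigr => b _.
by rewrite -eeN -eeD; congr ee; rewrite rmorphB /=; ring.
Qed.

(** Quadrature on the M-th roots of unity is exact for frequencies below M, so that
   the discrete kernel reproduces the triangular multiplier. *)
Lemma fweight_sum n M (l : int) : (0 < n)%N -> (n + `|l| <= M)%N ->
  \sum_(j < M) (fweight n M j)%:C%C * ee (- (l%:~R * (j%:R / M%:R))) = (fej n l)%:C%C.
Proof.
move=> n0 nM; have M0 : (0 < M)%N by rewrite (leq_trans n0)// (leq_trans (leq_addr _ _) nM).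
have MR : M%:R != 0 :> R by rewrite pnatr_eq0 -lt0n.
have nR : n%:R != 0 :> R by rewrite pnatr_eq0 -lt0n.
under eq_bigr => j _ do rewrite fweightE -mulrA mulr_suml.
rewrite -mulr_sumr exchange_big/=.
have E (a b : 'I_n) : \sum_(j < M) ee (j%:R / M%:R * (a%:Z - b%:Z)%:~R) * ee (- (l%:~R * (j%:R / M%:R))) =
    M%:R * (a%:Z - b%:Z == l)%:R.
  rewrite -subr_eq0 -dirichlet_sum; last by have := ltn_ord a; have := ltn_ord b; move: nM; lia.
  by apply: eq_bigr => j _; rewrite -eeD; congr ee; rewrite !rmorphB /=; ring.
under eq_bigr => a _.
  under eq_bigr => j _ do rewrite mulr_suml.
  rewrite exchange_big/=; under eq_bigr => b _ do rewrite E.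
  rewrite -mulr_sumr; over.
rewrite -mulr_sumr mulrA /fej rmorphM; congr (_ * _).
  rewrite -(rmorph_nat (real_complex R)) -rmorphM; congr (_%:C%C).
  by field; rewrite MR nR.
rewrite rmorph_sum; apply: eq_bigr => a _; rewrite rmorph_sum; apply: eq_bigr => b _.
by rewrite rmorph_nat.
Qed.

End Fejer.

Section FejerTorus.
Context {R : realType} {d : nat}.
Local Notation mode := 'rV[int]_d.
Local Notation C := R[i].
Local Notation V := 'rV[R]_d.
Implicit Types (m a b : mode) (n M : nat).

(** The product multiplier, which makes Fejer means positive averages of translates in
   any dimension. *)
Definition fejd n m : R := \prod_i fej n (m ord0 i).

Lemma fejd_le1 n m : fejd n m <= 1.
Proof. by apply: prodr_ile1 => i _; rewrite fej_ge0 fej_le1. Qed.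

Lemma fejdN n m : fejd n (- m) = fejd n m.
Proof. by apply: eq_bigr => i _; rewrite mxE fejN. Qed.

Lemma fejd0 n : (0 < n)%N -> fejd n 0 = 1.
Proof. by move=> n0; rewrite /fejd big1// => i _; rewrite mxE fej0. Qed.

Lemma fejd_out n m : m \notin box n -> fejd n m = 0.
Proof.
rewrite mem_box => /forallPn[j]; rewrite -ltnNge => h.
by rewrite /fejd (bigD1 j)//= fej_out ?mul0r// ltnW.
Qed.

Lemma fejd_cvg n m : (0 < n)%N -> 1 - fejd n m <= (nrm m)%:R / n%:R.
Proof.
move=> n0; rewrite /fejd /nrm natr_sum mulr_suml.
have gen (l : seq 'I_d) : 1 - \prod_(i <- l) fej n (m ord0 i) <= \sum_(i <- l) (`|m ord0 i|%N)%:R / n%:R :> R.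
  elim: l => [|i l IH]; first by rewrite !big_nil subrr.
  rewrite !big_cons; have p1 : \prod_(i <- l) fej n (m ord0 i) <= 1 :> R.
    by apply: prodr_ile1 => j _; rewrite fej_ge0 fej_le1.
  have p0 : 0 <= \prod_(i <- l) fej n (m ord0 i) :> R by apply: prodr_ge0 => j _; exact: fej_ge0.
  have f1 := fej_le1 (R := R) n (m ord0 i); have f0 := fej_ge0 (R := R) n (m ord0 i).
  have fc := fej_cvg (R := R) (m ord0 i) n0.
  move: p1 p0 f1 f0 fc IH; set x := \prod_(i <- l) _; set y := fej n _; set u := _ / _; set S := \sum_(j <- l) _.
  move=> p1 p0 f1 f0 fc IH.
  have h : 1 - y * x = (1 - y) + y * (1 - x) by ring.
  rewrite h lerD//; apply: le_trans IH; rewrite ler_piMl// subr_ge0//.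
exact: gen.
Qed.

Section Average.
Variables (n M : nat).
Hypothesis n0 : (0 < n)%N.

Definition favg_weight (J : {ffun 'I_d -> 'I_M}) : R := \prod_i fweight n M (J i).
Definition favg_shift (J : {ffun 'I_d -> 'I_M}) : V := \row_i - ((J i)%:R / M%:R).

Lemma favg_weight_ge0 J : 0 <= favg_weight J.
Proof. by apply: prodr_ge0 => i _; exact: fweight_ge0. Qed.

Lemma expi_ee m (x : V) : expi m x = ee (\sum_i (m ord0 i)%:~R * x ord0 i).
Proof. by rewrite /expi /ee /phase; congr (Complex (cos (_ * _)) (sin (_ * _))); apply: eq_bigr => i _; rewrite mxE. Qed.

Lemma expi_shift m (x v : V) : expi m (x + v) = expi m v * expi m x.
Proof.
rewrite !expi_ee -eeD -big_split; congr ee; apply: eq_bigr => i _ /=.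
by rewrite mxE mulrDr addrC.
Qed.

Lemma favg_multiplier m : (forall i, (n + `|m ord0 i| <= M)%N) ->
  \sum_J (favg_weight J)%:C%C * expi m (favg_shift J) = (fejd n m)%:C%C.
Proof.
move=> hM; rewrite /fejd rmorph_prod.
transitivity (\prod_i \sum_(j < M) (fweight n M j : R)%:C%C * (ee (- ((m ord0 i)%:~R * (j%:R / M%:R))) : C)); last first.
  by apply: eq_bigr => i _; exact: fweight_sum n0 (hM i).
rewrite bigA_distr_bigA/=; apply: eq_bigr => J _.
rewrite expi_ee ee_sum /favg_weight rmorph_prod -big_split; apply: eq_bigr => i _ /=.
by rewrite /favg_shift mxE mulrN.
Qed.

Lemma favg_weight_sum : (n <= M)%N -> \sum_J favg_weight J = 1.
Proof.
move=> nM; have := @favg_multiplier 0; rewrite fejd0// => h.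
have /(congr1 (@complex.Re R)) : \sum_J (favg_weight J)%:C%C = 1 :> C.
  rewrite -[1]/((1 : R)%:C%C) -h => [|i]; last by rewrite mxE addn0.
  by apply: eq_bigr => J _; rewrite expi0 mulr1.
by rewrite Re_sum.
Qed.

(** On trigonometric polynomials of degree K a finite average of translates replaces
   the convolution with the Fejer kernel. *)
Lemma favg_tpoly K p x : (n + K <= M)%N ->
  \sum_J favg_weight J * tpoly (box K) p (x + favg_shift J) =
  tpoly (box K) (fun m => real_mul (fejd n m) (p m)) x.
Proof.
move=> hM; rewrite /tpoly.
transitivity (complex.Re (\sum_J (favg_weight J)%:C%C * \sum_(m <- box K) p m * expi m (x + favg_shift J))).
  by rewrite Re_sum; apply: eq_bigr => J _; rewrite ReM /= mul0r subr0.
congr complex.Re; under eq_bigr => J _ do rewrite mulr_sumr.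
rewrite exchange_big/= big_seq [RHS]big_seq; apply: eq_bigr => m mK.
rewrite /real_mul -favg_multiplier; last first.
  move=> i; rewrite (leq_trans _ hM)// leq_add2l; move: mK; rewrite mem_box => /forallP; exact.
rewrite !mulr_suml; apply: eq_bigr => J _; rewrite expi_shift; ring.
Qed.

End Average.
End FejerTorus.

(** * Approximation of Besov distributions by Fejer means *)

Section BlockNorm.
Context {R : realType} {d : nat}.
Local Notation mode := 'rV[int]_d.
Local Notation C := R[i].
Local Notation V := 'rV[R]_d.
Implicit Types (m a b : mode) (n k K : nat) (f g u : @Defs.vdist R d).

Variable chi : V -> R.
Hypothesis hchi : lp_bump chi.
Local Notation psi := (psi chi).

Lemma enorm_sum (I : Type) (s : seq I) (v : I -> V) :
  enorm (\sum_(i <- s) v i) <= \sum_(i <- s) enorm (v i).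
Proof.
elim: s => [|i s IH]; first by rewrite !big_nil enorm0.
by rewrite !big_cons (le_trans (enormD _ _))// lerD2l.
Qed.

Lemma lpB k f g i x : lp chi k ((f - g) i) x = lp chi k (f i) x - lp chi k (g i) x.
Proof.
rewrite !(lpE hchi) -tpolyB; congr (tpoly _ _ x); apply: funext => m.
by rewrite -[(f - g) i]/(f i - g i) fcoefB /real_mul mulrBr.
Qed.

Section Exponent.
Variable q : \bar R.
Hypothesis q1 : (1 <= q)%E.

Definition bnorm k f : R := tnorm q (fun x => enorm (\row_i lp chi k (f i) x)).

Lemma bnormE k f : lp_Lnorm chi q k f = (bnorm k f)%:E.
Proof. by rewrite /lp_Lnorm tnormE//; exact: cper_lp_enorm. Qed.

Lemma bnorm_ge0 k f : 0 <= bnorm k f.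
Proof. exact: tnorm_ge0. Qed.

Lemma bnorm_tri k f g u : bnorm k (f - u) <= bnorm k (f - g) + bnorm k (g - u).
Proof.
have c1 (w : @Defs.vdist R d) : cper (fun x => enorm (\row_i lp chi k (w i) x)) by exact: cper_lp_enorm.
rewrite (le_trans _ (tnormD q1 (c1 _) (c1 _)))//.
apply: tnorm_mono => //; first exact: cperD.
move=> x; rewrite ger0_norm ?enorm_ge0//.
rewrite (_ : \row_i lp chi k ((f - u) i) x =
  \row_i lp chi k ((f - g) i) x + \row_i lp chi k ((g - u) i) x) ?enormD//.
by apply/rowP => i; rewrite !mxE !lpB; ring.
Qed.

Lemma bnormB k f g : bnorm k (f - g) <= bnorm k f + bnorm k g.
Proof.
have c1 (w : @Defs.vdist R d) : cper (fun x => enorm (\row_i lp chi k (w i) x)) by exact: cper_lp_enorm.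
rewrite (le_trans _ (tnormD q1 (c1 _) (c1 _)))//.
apply: tnorm_mono => //; first exact: cperD.
move=> x; rewrite ger0_norm ?enorm_ge0//.
rewrite (_ : \row_i lp chi k ((f - g) i) x =
  \row_i lp chi k (f i) x + (-1) *: \row_i lp chi k (g i) x).
  by rewrite (le_trans (enormD _ _))// enormZ normrN1 mul1r.
by apply/rowP => i; rewrite !mxE lpB; ring.
Qed.

Section Means.
Variable f : @Defs.vdist R d.
Hypothesis hf : forall i, is_dist (f i).

Definition fejer_coef n i m : C := real_mul (fejd n m) (fcoef (f i) m).
Definition fejer n : @Defs.vdist R d := fun i => synth (fejer_coef n i).

Lemma fejer_coef_herm n i : herm (fejer_coef n i).
Proof. by move=> m; rewrite /fejer_coef fejdN fcoefN// conjc_real_mul. Qed.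

Lemma fejer_coef_pbd n i : exists A, pbd A 0 (fejer_coef n i).
Proof.
exists (\sum_(m <- box n) cab (fejer_coef n i m)) => m; rewrite expr0 mulr1.
have [mn|mn] := boolP (m \in box n).
  by rewrite (bigD1_seq m) ?box_uniq//= lerDl sumr_ge0// => x _; exact: cab_ge0.
rewrite [leLHS](_ : _ = 0); first by apply: sumr_ge0 => x _; exact: cab_ge0.
by rewrite /fejer_coef fejd_out// real_mul0l cab0.
Qed.

Lemma fcoef_fejer n i : fcoef (fejer n i) = fejer_coef n i.
Proof. by have [A hA] := fejer_coef_pbd n i; exact: fcoef_synth hA (fejer_coef_herm n i). Qed.

(** On a block, the Fejer mean is an average of translates with weights of total
   mass 1, hence contracts every translation invariant norm. *)
Lemma bnorm_fejer n k : (0 < n)%N -> bnorm k (fejer n) <= bnorm k f.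
Proof.
move=> n0; pose M := (n + 2 ^ k)%N.
pose h x := enorm (\row_i lp chi k (f i) x).
have ch : cper h by exact: cper_lp_enorm.
pose W := favg_weight n (M := M) (d := d) (R := R).
pose sh := favg_shift (M := M) (d := d) (R := R).
have E i x : lp chi k (fejer n i) x = \sum_J W J * lp chi k (f i) (x + sh J).
  rewrite (lpE hchi); under [RHS]eq_bigr => J _ do rewrite (lpE hchi).
  rewrite favg_tpoly//; congr (tpoly _ _ x); apply: funext => m.
  by rewrite fcoef_fejer /fejer_coef !real_mulA mulrC.
have W1 : \sum_J W J = 1 by apply: favg_weight_sum => //; exact: leq_addr.
have := tnorm_sum_shift (index_enum _) sh q1 ch (@favg_weight_ge0 R d n M).
rewrite -/W W1 mul1r; apply: le_trans; apply: tnorm_mono => //.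
- exact: cper_lp_enorm.
- apply: (@cper_sum R d _ _ xpredT (fun J x => W J * h (x + sh J))) => J.
  by apply: cperZ; exact: cper_shift.
move=> x; rewrite ger0_norm ?enorm_ge0//.
rewrite (_ : \row_i lp chi k (fejer n i) x = \sum_J W J *: \row_i lp chi k (f i) (x + sh J)).
  rewrite (le_trans (enorm_sum _ _))//; apply: ler_sum => J _.
  by rewrite enormZ ger0_norm//; exact: favg_weight_ge0.
by apply/rowP => i; rewrite !mxE summxE E; apply: eq_bigr => J _; rewrite !mxE.
Qed.

(** A block has finitely many frequencies, at each of which the multiplier tends to 1. *)
Lemma bnorm_fejer_small k (e : R) : 0 < e -> exists n1, forall n, (n1 < n)%N ->
  bnorm k (fejer n - f) <= e.
Proof.
move=> e0; pose Z : R := \sum_i (2 * \sum_(m <- box (2 ^ k)) `|psi k m| * ((nrm m)%:R * cab (fcoef (f i) m))).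
have Z0 : 0 <= Z.
  by apply: sumr_ge0 => i _; rewrite mulr_ge0// sumr_ge0// => m _; rewrite !mulr_ge0 ?cab_ge0.
exists (Num.trunc (Z / e)) => n nn; have n0 : (0 < n)%N by exact: leq_ltn_trans nn.
have nR : 0 < n%:R :> R by rewrite ltr0n.
have Zn : Z / n%:R <= e.
  rewrite ler_pdivrMr// mulrC -ler_pdivrMr// (le_trans (ltW (truncnS_gt _)))//.
  by rewrite ler_nat.
rewrite (le_trans _ Zn)//; apply: tnorm_le => //; [by rewrite divr_ge0|exact: cper_lp_enorm|].
move=> x; rewrite ger0_norm ?enorm_ge0// (le_trans (enorm_le_sum _))//.
rewrite /Z mulr_suml; apply: ler_sum => i _; rewrite mxE.
have hM m : cab (fcoef ((fejer n - f) i) m) <= (nrm m)%:R * cab (fcoef (f i) m) / n%:R.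
  rewrite -[(fejer n - f) i]/(fejer n i - f i) fcoefB fcoef_fejer /fejer_coef.
  rewrite (_ : _ - _ = real_mul (fejd n m - 1) (fcoef (f i) m)); last first.
    by rewrite /real_mul rmorphB rmorph1 mulrBl mul1r.
  rewrite cab_real_mul distrC ger0_norm ?subr_ge0 ?fejd_le1// mulrAC ler_wpM2r ?cab_ge0//.
  exact: fejd_cvg.
rewrite (le_trans (lp_abs_le hchi _ _ hM))// -mulrA ler_wpM2l// mulr_suml.
by apply: ler_sum => m _; rewrite -!mulrA.
Qed.

End Means.

Lemma nat_tail (T : nat -> R) (S e : R) : (forall k, 0 <= T k) ->
  (forall N, \sum_(k < N) T k <= S) -> 0 < e ->
  exists K, forall N, \sum_(k < N | (K <= k)%N) T k <= e.
Proof.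
move=> T0 hS e0; pose A := range (fun N => \sum_(k < N) T k).
have hA : has_sup A by split; [exists (\sum_(k < 0) T k); exists 0%N|exists S => _ [N _ <-]].
have [_ [K _ <-] hK] := sup_adherent e0 hA; exists K => N.
have h : \sum_(k < N + K) T k <= sup A by apply: ub_le_sup; [exact: hA.2|exists (N + K)%N].
have E : \sum_(k < N + K) T k = \sum_(k < K) T k + \sum_(k < N + K | (K <= k)%N) T k.
  rewrite (bigID (fun k : 'I_(N + K) => (k < K)%N))/=; congr (_ + _).
    by rewrite (big_ord_widen_cond _ xpredT T (leq_addl N K)).
  by apply: eq_bigl => k; rewrite -leqNgt.
have le : \sum_(k < N | (K <= k)%N) T k <= \sum_(k < N + K | (K <= k)%N) T k.
  rewrite (big_ord_widen_cond _ (fun k => (K <= k)%N) T (leq_addr K N)).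
  rewrite big_mkcond [leRHS]big_mkcond; apply: ler_sum => k _.
  by case: (K <= k)%N => //=; case: (k < N)%N.
by rewrite (le_trans le)//; move: h hK; rewrite E; lra.
Qed.

Section FiniteExponent.
Variables (s r : R).
Hypothesis r1 : 1 <= r.
Let r0 : 0 < r. Proof. exact: lt_le_trans ltr01 r1. Qed.

Let term k f : R := (2 ^+ k) `^ (s * r) * bnorm k f `^ r.

Let term_ge0 k f : 0 <= term k f. Proof. by rewrite mulr_ge0 ?powR_ge0. Qed.

Let termE k f : (((2 ^+ k) `^ (s * r))%:E * lp_Lnorm chi q k f `^ r)%E = (term k f)%:E.
Proof. by rewrite bnormE poweR_EFin. Qed.

Lemma besov_norm_partial f (A : R) : 0 <= A -> (forall N, \sum_(k < N) term k f <= A `^ r) ->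
  (besov_norm chi s q r%:E f <= A%:E)%E.
Proof.
move=> A0 h; rewrite /besov_norm; under eq_eseriesr do rewrite termE.
have -> : A%:E = ((A `^ r)%:E `^ r^-1)%E by rewrite poweR_EFin -powRrM mulfV ?gt_eqF// powRr1.
apply: gt0_ler_poweR; rewrite ?in_itv/= ?leey ?andbT ?invr_ge0 ?(ltW r0)//.
- by apply: nneseries_ge0 => k _ _; rewrite lee_fin.
- by rewrite lee_fin powR_ge0.
apply: lime_le; first by apply: is_cvg_nneseries => k _ _; rewrite lee_fin.
by apply: nearW => N; rewrite big_mkord sumEFin lee_fin.
Qed.

Lemma besov_partial_norm f (A : R) : 0 <= A -> (besov_norm chi s q r%:E f <= A%:E)%E ->
  forall N, \sum_(k < N) term k f <= A `^ r.
Proof.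
move=> A0 h N; rewrite -lee_fin -sumEFin.
set X := (\sum_(0 <= k <oo) (((2 ^+ k) `^ (s * r))%:E * lp_Lnorm chi q k f `^ r))%E.
have X0 : (0 <= X)%E.
  by apply: nneseries_ge0 => k _ _; rewrite termE lee_fin.
apply: (@le_trans _ _ X).
  rewrite /X; under eq_eseriesr do rewrite termE.
  have := @nneseries_lim_ge R (fun k => (term k f)%:E) xpredT 0%N N.
  by rewrite big_mkord; apply => k _; rewrite lee_fin.
have -> : X = ((X `^ r^-1) `^ r)%E by rewrite -poweRrM mulVf ?gt_eqF// poweRe1.
rewrite -poweR_EFin; apply: gt0_ler_poweR; rewrite ?in_itv/= ?leey ?andbT ?(ltW r0)//.
- exact: poweR_ge0.
Qed.

Lemma besov_norm_finite f : (besov_norm chi s q r%:E f < +oo)%E ->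
  exists2 A : R, 0 <= A & (besov_norm chi s q r%:E f <= A%:E)%E.
Proof.
move=> h; have b0 : (0 <= besov_norm chi s q r%:E f)%E by exact: poweR_ge0.
exists (fine (besov_norm chi s q r%:E f)); first exact: fine_ge0.
by rewrite fineK// ge0_fin_numE.
Qed.

(** A substitute for the triangle inequality that costs a constant. *)
Lemma powRD_le (x y : R) : 0 <= x -> 0 <= y -> (x + y) `^ r <= 2 `^ r * (x `^ r + y `^ r).
Proof.
move=> x0 y0; pose z := Num.max x y.
have z0 : 0 <= z by rewrite le_max x0.
have hz : x + y <= 2 * z.
  have : x <= z by rewrite le_max lexx.
  have : y <= z by rewrite le_max lexx orbT.
  by lra.
apply: (@le_trans _ _ ((2 * z) `^ r)).
  by rewrite ge0_ler_powR ?nnegrE ?(ltW r0) ?addr_ge0// mulr_ge0.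
rewrite powRM// ler_wpM2l ?powR_ge0// /z; case: (leP x y) => _.
  by rewrite lerDr powR_ge0.
by rewrite lerDl powR_ge0.
Qed.

Lemma termD k f g u : term k (f - u) <= 2 `^ r * (term k (f - g) + term k (g - u)).
Proof.
rewrite /term -mulrDr mulrCA ler_wpM2l ?powR_ge0//.
apply: le_trans (powRD_le (bnorm_ge0 _ _) (bnorm_ge0 _ _)).
by rewrite ge0_ler_powR ?nnegrE ?(ltW r0) ?addr_ge0 ?bnorm_ge0 ?bnorm_tri.
Qed.

(** Beyond a block K the tail of the norm of f controls the remainder, by contraction;
   the blocks before K are treated one by one. *)
Lemma fejer_dense f (e : R) : (forall i, is_dist (f i)) -> (besov_norm chi s q r%:E f < +oo)%E ->
  0 < e -> exists n, (0 < n)%N /\ forall N, \sum_(k < N) term k (fejer f n - f) <= e.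
Proof.
move=> hf /besov_norm_finite[A A0 /(besov_partial_norm A0) hA] e0.
have e20 : 0 < e / 2 by rewrite divr_gt0.
have p0 : 0 < 4 `^ r by rewrite powR_gt0.
have [K hK] := nat_tail (fun k => term_ge0 k f) hA (divr_gt0 e20 p0).
pose w : R := \sum_(k < K) (2 ^+ k) `^ (s * r).
have w0 : 0 <= w by apply: sumr_ge0 => k _; exact: powR_ge0.
pose e1 : R := (e / 2 / (1 + w)) `^ r^-1.
have w1 : 0 < 1 + w by rewrite ltr_wpDr.
have e10 : 0 < e1 by rewrite powR_gt0// divr_gt0.
have e1r : e1 `^ r = e / 2 / (1 + w) by rewrite -powRrM mulVf ?gt_eqF// powRr1// ltW// divr_gt0.
have /choice[nk hnk] : forall k, exists n1, forall n, (n1 < n)%N -> bnorm k (fejer f n - f) <= e1.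
  by move=> k; exact: bnorm_fejer_small.
pose n0 := (\max_(k < K) nk k)%N.
have hn0 (k : 'I_K) : (nk k <= n0)%N by exact: (leq_bigmax_cond (F := fun k : 'I_K => nk k)).
move: n0 hn0 => n0 hn0; pose n := n0.+1.
exists n; split => [|N]; first exact: ltn0Sn.
have small k : term k (fejer f n - f) <= 4 `^ r * term k f.
  rewrite /term mulrCA ler_wpM2l ?powR_ge0//.
  have -> : 4 `^ r = 2 `^ r * 2 `^ r :> R by rewrite -powRM//; congr (_ `^ _); ring.
  rewrite -mulrA; apply: (@le_trans _ _ ((bnorm k f + bnorm k f) `^ r)).
    rewrite ge0_ler_powR ?nnegrE ?(ltW r0) ?addr_ge0 ?bnorm_ge0//.
    by rewrite (le_trans (bnormB _ _ _))// lerD2r bnorm_fejer.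
  have -> : (bnorm k f + bnorm k f) `^ r = 2 `^ r * bnorm k f `^ r.
    by rewrite -powRM ?bnorm_ge0//; congr (_ `^ _); ring.
  apply: ler_wpM2l; first exact: powR_ge0.
  rewrite ler_peMl ?powR_ge0//.
  apply: (@le_trans _ _ (1 `^ r)); first by rewrite powR1.
  by rewrite ge0_ler_powR ?nnegrE ?(ltW r0)// ler1n.
rewrite [e]splitr (bigID (fun k : 'I_N => (k < K)%N))/=; apply: lerD; last first.
  apply: (@le_trans _ _ (\sum_(k < N | (K <= k)%N) 4 `^ r * term k f)).
    by under eq_bigl do rewrite -leqNgt; apply: ler_sum => k _; exact: small.
  by rewrite -mulr_sumr mulrC -ler_pdivlMr//.
apply: (@le_trans _ _ (\sum_(k < K) (2 ^+ k) `^ (s * r) * e1 `^ r)); last first.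
  rewrite -mulr_suml e1r -/w mulrA ler_pdivrMr// mulrC ler_wpM2l ?(ltW e20)//; lra.
apply: (@le_trans _ _ (\sum_(k < N + K | (k < K)%N) term k (fejer f n - f))).
  rewrite (big_ord_widen_cond _ (fun k => (k < K)%N) (fun k => term k (fejer f n - f)) (leq_addr K N)).
  rewrite big_mkcond [leRHS]big_mkcond; apply: ler_sum => k _.
  by case: (k < K)%N => //=; case: (k < N)%N.
rewrite -(big_ord_widen_cond _ xpredT (fun k => term k (fejer f n - f)) (leq_addl N K)).
apply: ler_sum => k _; rewrite /term ler_wpM2l ?powR_ge0//.
rewrite ge0_ler_powR ?nnegrE ?(ltW r0) ?bnorm_ge0 ?(ltW e10)// hnk//.
by rewrite /n ltnS hn0.
Qed.

Lemma besov_near f (e : R) : (forall i, is_dist (f i)) -> (besov_norm chi s q r%:E f < +oo)%E ->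
  0 < e -> exists n, (0 < n)%N /\ exists2 de : R, 0 < de & forall g,
    (besov_norm chi s q r%:E (g - fejer f n)%R <= de%:E)%E -> (besov_norm chi s q r%:E (g - f)%R < e%:E)%E.
Proof.
move=> hf fin e0; pose de : R := e / 8.
have de0 : 0 < de by rewrite divr_gt0.
have [n [n0 hn]] := fejer_dense hf fin (powR_gt0 r de0).
exists n; split => //; exists de => // g hg.
have hg' := besov_partial_norm (ltW de0) hg.
apply: (@le_lt_trans _ _ (4 * de)%:E); last by rewrite lte_fin /de; lra.
apply: besov_norm_partial => [|N]; first by rewrite mulr_ge0// ltW.
apply: (@le_trans _ _ (\sum_(k < N) 2 `^ r * (term k (g - fejer f n) + term k (fejer f n - f)))).
  by apply: ler_sum => k _; exact: termD.
rewrite -mulr_sumr big_split/=.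
have -> : (4 * de) `^ r = 2 `^ r * (2 * de) `^ r.
  rewrite (_ : 4 * de = 2 * (2 * de)); last by ring.
  by rewrite powRM// mulr_ge0// ltW.
apply: ler_wpM2l; first exact: powR_ge0.
apply: (@le_trans _ _ (2 * de `^ r)); first by rewrite mulr_natl mulr2n; apply: lerD; [exact: hg'|exact: hn].
have -> : (2 * de) `^ r = 2 `^ r * de `^ r by rewrite powRM// ltW.
apply: ler_wpM2r; first exact: powR_ge0.
by rewrite -[leLHS]powRr1// ler_powR// ler1n.
Qed.

End FiniteExponent.
End Exponent.
End BlockNorm.

(** * Weak-star approximation *)

Section Pairing.
Context {R : realType} {d : nat}.
Local Notation mode := 'rV[int]_d.
Local Notation C := R[i].
Local Notation V := 'rV[R]_d.
Implicit Types (m : mode) (k N K a b : nat) (f g h : @Defs.vdist R d).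

Variable chi : V -> R.
Hypothesis hchi : lp_bump chi.
Local Notation psi := (psi chi).

Lemma double_series (c : nat -> nat -> R) (A : R) :
  (forall N, \sum_(a < N) \sum_(b < N) `|c a b| <= A) ->
  `|lim (\sum_(a < N.+1) \sum_(b < N.+1) c a b @[N --> \oo])| <= A.
Proof.
move=> hA.
have mono (u : nat -> nat -> R) (B : R) : (forall a b, 0 <= u a b) ->
    (forall N, \sum_(a < N) \sum_(b < N) u a b <= B) -> cvgn (fun N => \sum_(a < N) \sum_(b < N) u a b).
  move=> u0 hB; apply: nondecreasing_is_cvgn.
    apply/nondecreasing_seqP => N; rewrite [leRHS]big_ord_recr/=.
    rewrite ler_wpDr ?sumr_ge0//; apply: ler_sum => a _.
    by rewrite [leRHS]big_ord_recr/= lerDl.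
  by exists B => _ [N _ <-].
have cv : cvgn (fun N => \sum_(a < N) \sum_(b < N) c a b).
  have -> : (fun N => \sum_(a < N) \sum_(b < N) c a b) =
      (fun N => \sum_(a < N) \sum_(b < N) (`|c a b| + c a b)) - (fun N => \sum_(a < N) \sum_(b < N) `|c a b|).
    apply: funext => N; rewrite fctE -sumrB; apply: eq_bigr => a _; rewrite -sumrB.
    by apply: eq_bigr => b _; rewrite addrAC subrr add0r.
  apply: is_cvgB; last exact: (mono (fun a b => `|c a b|) A (fun a b => normr_ge0 _) hA).
  apply: (mono (fun a b => `|c a b| + c a b) (A + A)) => [a b|N].
    by rewrite -lerBlDl sub0r lerNnormlW// ler_norm.
  apply: (@le_trans _ _ (\sum_(a < N) \sum_(b < N) (`|c a b| + `|c a b|))).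
    by apply: ler_sum => a _; apply: ler_sum => b _; rewrite lerD2l ler_norm.
  under eq_bigr => a _ do rewrite big_split/=.
  by rewrite big_split/=; exact: lerD (hA N) (hA N).
pose S N := \sum_(a < N) \sum_(b < N) c a b.
have cS : (fun N => S N.+1) @ \oo --> lim (S @ \oo) by rewrite (cvg_shiftS S).
have cn : `|S N.+1| @[N --> \oo] --> `|lim (S @ \oo)| by exact: cvg_norm cS.
rewrite (cvg_lim (@Rhausdorff R) cS) -(cvg_lim (@Rhausdorff R) cn).
apply: limr_le; first by apply/cvg_ex; eexists; exact: cn.
apply: nearW => N; rewrite (le_trans (ler_norm_sum _ _ _))// (le_trans _ (hA N.+1))//.
by apply: ler_sum => a _; exact: ler_norm_sum.
Qed.

Lemma lp_le_sum k (f : @dist R d) x : lp_le chi k f x = \sum_(a < k.+1) lp chi a f x.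
Proof.
elim: k => [|k IH]; first by rewrite big_ord_recr/= big_ord0 add0r.
by rewrite big_ord_recr/= -IH addrC subrK.
Qed.

Section TwoFields.
Variables f h : @Defs.vdist R d.
Hypotheses (hf : forall i, herm (fcoef (f i))) (hh : forall i, herm (fcoef (h i))).

Definition block_pairing a b : R := \sum_i torus_int (fun x => lp chi a (f i) x * lp chi b (h i) x).

(** The product of two blocks without common frequencies has mean zero. *)
Lemma block_pairing_far a b : (a + 3 <= b)%N || (b + 3 <= a)%N -> block_pairing a b = 0.
Proof.
move=> far; rewrite /block_pairing big1// => i _.
pose K := (2 ^ (a + b))%N; pose P k (e : @dist R d) m : C := real_mul (psi k m) (fcoef e m).
have P0 k e m : (k <= a + b)%N -> m \notin box K -> P k e m = 0.
  move=> kab hm; rewrite /P psi_out ?real_mul0l//; apply: contra hm; apply: box_mono.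
  by rewrite /K leq_exp2l.
have lpK k e : (k <= a + b)%N -> lp chi k e = tpoly (box K) (P k e).
  move=> kab; apply: funext => x; rewrite (lpE hchi); congr (_ x); apply/esym/tpoly_widen; rewrite ?box_uniq//.
    by apply: box_mono; rewrite /K leq_exp2l.
  by move=> m _ hm; rewrite /P psi_out ?real_mul0l.
have Ph k e : herm (fcoef e) -> herm (P k e).
  by move=> de m; rewrite /P (psiN hchi) de conjc_real_mul.
have E : torus_int (fun x => lp chi a (f i) x * lp chi b (h i) x) =
    complex.Re (ft (fun x => tpoly (box K) (P a (f i)) x * tpoly (box K) (P b (h i)) x) 0).
  rewrite /ft /cint/=; congr torus_int; apply: funext => x.
  by rewrite oppr0 phase0 cos0 sin0 mulr1 mulr0 subr0 !lpK ?leq_addr ?leq_addl.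
rewrite E ft_tpoly_mul; [|exact: Ph|exact: Ph|by move=> m; apply: P0; exact: leq_addl].
rewrite big1// => m _; rewrite sub0r /P (psiN hchi).
have [->|pa] := eqVneq (psi a m) 0; first by rewrite real_mul0l mul0r.
have [->|pb] := eqVneq (psi b m) 0; first by rewrite real_mul0l mulr0.
have [a1 a2] := psi_neq0 hchi pa; have [b1 b2] := psi_neq0 hchi pb.
suff absurd x y : enorm (freq m : V) < 2 ^+ x -> 2 ^+ y <= 4 * Num.max 1 (enorm (freq m : V)) ->
    (x + 3 <= y)%N -> False.
  by case/orP: far => /absurd; [case/(_ a1 b2)|case/(_ b1 a2)].
move=> hx hy xy; have m1 : Num.max 1 (enorm (freq m : V)) <= 2 ^+ x.
  by rewrite ge_max (ltW hx) andbT exprn_ege1// ler1n.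
have : 2 ^+ (x + 3) <= 4 * 2 ^+ x :> R.
  apply: (@le_trans _ _ (2 ^+ y)); first by rewrite ler_weXn2l// ler1n.
  by rewrite (le_trans hy)// ler_wpM2l.
have x0 : 0 < 2 ^+ x :> R by rewrite exprn_gt0.
by rewrite exprD; move: x0; set z := 2 ^+ x; rewrite -[2 ^+ 3]/(2 * (2 * 2)); lra.
Qed.

Variable q : \bar R.
Hypothesis q1 : (1 <= q)%E.
Local Notation q' := (hoelder_conjugate q).

(** The Cauchy-Schwarz inequality in the components, then the Hoelder inequality. *)
Lemma block_pairing_le a b :
  `|block_pairing a b| <= bnorm chi q a f * bnorm chi q' b h.
Proof.
have q1' := hoelder_conj_ge1 q1.
have c1 i : cper (fun x => lp chi a (f i) x * lp chi b (h i) x) by apply: cperM; exact: cper_lp.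
have ca := cper_lp_enorm hchi a f; have cb := cper_lp_enorm hchi b h.
rewrite /block_pairing -torus_int_sum//.
set G := fun x => \sum_i _; have cG : cper G.
  by apply: (@cper_sum R d _ _ xpredT (fun i x => lp chi a (f i) x * lp chi b (h i) x)).
apply: (@le_trans _ _ (torus_int (fun x => `|enorm (\row_i lp chi a (f i) x) * enorm (\row_i lp chi b (h i) x)|))); last first.
  exact: torus_hoelder.
have cP : cper (fun x => `|enorm (\row_i lp chi a (f i) x) * enorm (\row_i lp chi b (h i) x)|).
  by apply: cper_norm; exact: cperM.
have GP x : `|G x| <= `|enorm (\row_i lp chi a (f i) x) * enorm (\row_i lp chi b (h i) x)|.
  rewrite [leRHS]ger0_norm ?mulr_ge0 ?enorm_ge0// ler_norml; apply/andP; split.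
    rewrite lerNl /G -sumrN.
    have := cauchy_schwarz (-1 *: \row_i lp chi a (f i) x) (\row_i lp chi b (h i) x).
    rewrite enormZ normrN1 mul1r; apply: le_trans; rewrite le_eqVlt; apply/orP; left; apply/eqP.
    by apply: eq_bigr => i _; rewrite !mxE mulN1r mulNr.
  have := cauchy_schwarz (\row_i lp chi a (f i) x) (\row_i lp chi b (h i) x).
  apply: le_trans; rewrite le_eqVlt; apply/orP; left; apply/eqP.
  by apply: eq_bigr => i _; rewrite !mxE.
rewrite /torus_int; apply: le_trans (le_normr_Rintegral _ _) _ => //; first exact: cper_integrable.
apply: le_Rintegral => //; first by exact: (cper_integrable (cper_norm cG)).
exact: (cper_integrable cP).
Qed.

(** Only neighbouring blocks interact, by orthogonality, so that the double series of
   block pairings is absolutely convergent. *)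
Lemma besov_pairing_le (X Y : nat -> R) (A : R) :
  (forall a, bnorm chi q a f <= X a) -> (forall b, bnorm chi q' b h <= Y b) ->
  (forall N, \sum_(b < N) Y b * \sum_(a < N | (a < b + 3)%N && (b < a + 3)%N) X a <= A) ->
  `|besov_pairing chi f h| <= A.
Proof.
move=> hX hY hA.
have cl a b i : cper (fun x => lp chi a (f i) x * lp chi b (h i) x) by apply: cperM; exact: cper_lp.
have E k : \sum_i torus_int (fun x => lp_le chi k (f i) x * lp_le chi k (h i) x) =
    \sum_(a < k.+1) \sum_(b < k.+1) block_pairing a b.
  transitivity (\sum_i \sum_(a < k.+1) \sum_(b < k.+1) torus_int (fun x => lp chi a (f i) x * lp chi b (h i) x)).
    apply: eq_bigr => i _; transitivity (torus_int (fun x => \sum_(a < k.+1) \sum_(b < k.+1) lp chi a (f i) x * lp chi b (h i) x)).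
      congr torus_int; apply: funext => x; rewrite !lp_le_sum mulr_suml.
      by apply: eq_bigr => a _; rewrite mulr_sumr.
    rewrite torus_int_sum => [|a]; last by apply: cper_sum => b.
    by apply: eq_bigr => a _; rewrite torus_int_sum.
  rewrite exchange_big/=; apply: eq_bigr => a _.
  by rewrite exchange_big.
rewrite /besov_pairing (funext E); apply: double_series => N; rewrite exchange_big/=.
apply: le_trans (hA N); apply: ler_sum => b _; rewrite mulr_sumr [leRHS]big_mkcond/=.
apply: ler_sum => a _; case: ifPn => [_|].
  rewrite mulrC (le_trans (block_pairing_le a b))// ler_pM ?bnorm_ge0//.
by rewrite negb_and -!leqNgt => hfar; rewrite block_pairing_far ?normr0// orbC.
Qed.

End TwoFields.

(** Five blocks are at distance at most 2 from b. *)
Lemma sum_near (N b : nat) (v : R) : 0 <= v ->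
  \sum_(a < N | (a < b + 3)%N && (b < a + 3)%N) v <= 5 * v.
Proof.
move=> v0; rewrite -(big_mkord (fun a => (a < b + 3)%N && (b < a + 3)%N) (fun=> v)).
rewrite big_const_seq iter_addr_0.
set c := count _ _; rewrite -[v *+ c]mulr_natl ler_wpM2r// ler_nat /c -size_filter.
rewrite -[leqRHS](size_iota (b - 2) 5); apply: uniq_leq_size; first by rewrite filter_uniq// iota_uniq.
by move=> a; rewrite mem_filter mem_iota; lia.
Qed.

Section Density.
Variables (theta : R) (q : \bar R).
Hypotheses (theta0 : 0 < theta) (q1 : (1 <= q)%E).
Local Notation q' := (hoelder_conjugate q).
Let w k : R := (2 ^+ k) `^ theta.

Lemma besov_sup_le f (A : R) : (besov_norm chi (- theta) q +oo f <= A%:E)%E ->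
  forall k, bnorm chi q k f <= w k * A.
Proof.
move=> h k; have : (((2 ^+ k) `^ (- theta))%:E * lp_Lnorm chi q k f <= A%:E)%E.
  by apply: le_trans h; apply: ereal_sup_ubound; exists k.
rewrite (bnormE hchi q1) lee_fin powRN mulrC ler_pdivrMr ?powR_gt0 ?exprn_gt0//.
by rewrite [w k * A]mulrC.
Qed.

(** Fejer means are bounded in the norm with exponent r = oo and converge on each
   block; against the summable sequence of the blocks of h this is enough. The
   test fields are treated at once by adding their block norms. *)
Lemma besov_near_weakstar f (p : nat) (h : 'I_p -> @Defs.vdist R d) (e : R) :
  (forall i, is_dist (f i)) -> (besov_norm chi (- theta) q +oo f < +oo)%E ->
  (forall j, besov chi theta q' 1%E (h j)) -> 0 < e ->
  exists n, (0 < n)%N /\ exists2 de : R, 0 < de & forall g, (forall i, is_dist (g i)) ->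
    (besov_norm chi (- theta) q +oo (g - fejer f n)%R <= de%:E)%E ->
    forall j, `|besov_pairing chi (g - f) (h j)| < e.
Proof.
move=> hf ffin hh e0; have q1' := hoelder_conj_ge1 q1.
have w1 k : 1 <= w k.
  have <- : 1 `^ theta = 1 :> R by rewrite powR1.
  by rewrite ge0_ler_powR ?nnegrE ?exprn_ge0 ?exprn_ege1 ?ler1n// ltW.
have w0 k : 0 <= w k by exact: powR_ge0.
have [B B0 hB] : exists2 B : R, 0 <= B & forall k, bnorm chi q k f <= w k * B.
  have b0 : (0 <= besov_norm chi (- theta) q +oo f)%E.
    apply: (@le_trans _ _ (((2 ^+ 0) `^ (- theta))%:E * lp_Lnorm chi q 0 f)%E).
      by rewrite (bnormE hchi q1) lee_fin mulr_ge0 ?powR_ge0 ?bnorm_ge0.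
    by apply: ereal_sup_ubound; exists 0%N.
  exists (fine (besov_norm chi (- theta) q +oo f)); first exact: fine_ge0.
  by apply: besov_sup_le; rewrite fineK// ge0_fin_numE.
pose Y b : R := \sum_j bnorm chi q' b (h j).
have Y0 b : 0 <= Y b by apply: sumr_ge0 => j _; exact: bnorm_ge0.
have wY0 b : 0 <= w b * Y b by exact: mulr_ge0.
have [S S0 hS] : exists2 S : R, 0 <= S & forall N, \sum_(b < N) w b * Y b <= S.
  have /choice[A hA] : forall j, exists A : R, 0 <= A /\ forall N, \sum_(b < N) w b * bnorm chi q' b (h j) <= A.
    move=> j; have [A A0 hA] := besov_norm_finite (hh j).2.
    exists A; split=> // N; have := besov_partial_norm hchi q1' (lexx 1) A0 hA N.
    rewrite powRr1//; apply: le_trans; rewrite le_eqVlt; apply/orP; left; apply/eqP.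
    by apply: eq_bigr => b _; rewrite mulr1 powRr1// bnorm_ge0.
  exists (\sum_j A j) => [|N]; first by apply: sumr_ge0 => j _; exact: (hA j).1.
  under eq_bigr => b _ do rewrite /Y mulr_sumr.
  by rewrite exchange_big/=; apply: ler_sum => j _; exact: (hA j).2.
pose G : R := 5 * 4 `^ theta.
have G0 : 0 < G by rewrite mulr_gt0// powR_gt0.
pose de : R := e / (8 * G * (S + 1)).
have de0 : 0 < de by rewrite divr_gt0// !mulr_gt0// ltr_wpDl.
have t0 : 0 < e / (8 * G * (B + 1)) by rewrite divr_gt0// !mulr_gt0// ltr_wpDl.
have [K hK] := nat_tail wY0 hS t0.
have /choice[nk hnk] : forall k, exists n1, forall n, (n1 < n)%N -> bnorm chi q k (fejer f n - f) <= de.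
  by move=> k; exact: (bnorm_fejer_small hchi q1 hf).
pose n0 := (\max_(k < K + 3) nk k)%N.
have hn0 (k : 'I_(K + 3)) : (nk k <= n0)%N by exact: (leq_bigmax_cond (F := fun k : 'I_(K + 3) => nk k)).
move: n0 hn0 => n0 hn0; pose n := n0.+1.
exists n; split; first exact: ltn0Sn.
exists de => // g hg hgn j.
(* one de for g - fejer f n, the other one for the low blocks of fejer f n - f; the
   high blocks are merely bounded *)
pose x (b : bool) : R := de + de + (if b then 2 * B else 0).
have x0 (b : bool) : 0 <= x b by rewrite /x addr_ge0 ?addr_ge0 ?(ltW de0)//; case: b => //; rewrite mulr_ge0.
pose X a : R := w a * x (K + 3 <= a)%N.
have hX a : bnorm chi q a (g - f) <= X a.
  rewrite (le_trans (bnorm_tri hchi q1 a g (fejer f n) f))// /X /x -addrA mulrDr lerD//.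
    exact: besov_sup_le.
  case: leqP => aK.
    rewrite (@le_trans _ _ (w a * (2 * B)))//; last by rewrite ler_wpM2l// lerDr ltW.
    rewrite (le_trans (bnormB hchi q1 _ _ _))// mulrCA mulr_natl mulr2n lerD//.
    by rewrite (le_trans (bnorm_fejer hchi q1 hf _ _)).
  rewrite addr0 (@le_trans _ _ de)//; last by rewrite ler_peMl// ltW.
  by apply: hnk; rewrite /n ltnS; exact: (hn0 (Ordinal aK)).
have hY b : bnorm chi q' b (h j) <= Y b.
  by rewrite /Y (bigD1 j)//= lerDl sumr_ge0// => ? _; exact: bnorm_ge0.
have hgf i : herm (fcoef ((g - f) i)).
  by move=> m; rewrite -[(g - f) i]/(g i - f i) !fcoefB !fcoefN// -rmorphB.
have hhj i : herm (fcoef (h j i)) by move=> m; apply: fcoefN; exact: (hh j).1.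
suff H N : \sum_(b < N) Y b * \sum_(a < N | (a < b + 3)%N && (b < a + 3)%N) X a <= e / 2.
  have := besov_pairing_le hgf hhj q1 hX hY H.
  by move=> /le_lt_trans; apply; lra.
have near (b : 'I_N) : Y b * \sum_(a < N | (a < b + 3)%N && (b < a + 3)%N) X a <= G * x (K <= b)%N * (w b * Y b).
  rewrite [leRHS](_ : _ = Y b * (G * x (K <= b)%N * w b)); last by ring.
  rewrite ler_wpM2l//.
  apply: (@le_trans _ _ (\sum_(a < N | (a < b + 3)%N && (b < a + 3)%N) 4 `^ theta * w b * x (K <= b)%N)).
    apply: ler_sum => a /andP[ab _]; rewrite /X ler_pM//.
      rewrite /w -powRM ?exprn_ge0// ge0_ler_powR ?nnegrE ?mulr_ge0 ?exprn_ge0 ?(ltW theta0)//.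
      have -> : 4 = 2 ^+ 2 :> R by ring.
      by rewrite -exprD ler_weXn2l ?ler1n// addnC -ltnS -addnS.
    rewrite /x lerD2l; case: (leqP (K + 3) a) => aK; first by rewrite (_ : (K <= b)%N)// -(leq_add2r 3) ltnW// (leq_ltn_trans aK).
    by case: (K <= b)%N => //; rewrite mulr_ge0.
  rewrite (le_trans (sum_near _ _ _))//; first by rewrite !mulr_ge0// powR_ge0.
  by rewrite /G le_eqVlt; apply/orP; left; apply/eqP; ring.
apply: (@le_trans _ _ (\sum_(b < N) G * x (K <= b)%N * (w b * Y b))).
  by apply: ler_sum => b _; exact: near.
have -> : \sum_(b < N) G * x (K <= b)%N * (w b * Y b) =
    G * (2 * de) * (\sum_(b < N) w b * Y b) + G * (2 * B) * (\sum_(b < N | (K <= b)%N) w b * Y b).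
  rewrite !mulr_sumr [X in _ = _ + X]big_mkcond -big_split/=; apply: eq_bigr => b _.
  by rewrite /x; case: (K <= b)%N; ring.
have hSN := hS N; have hKN := hK N.
have E1 : G * (2 * de) * (\sum_(b < N) w b * Y b) <= e / 4.
  apply: (@le_trans _ _ (G * (2 * de) * (S + 1))).
    apply: ler_wpM2l; first by apply: mulr_ge0; [exact: ltW|rewrite mulr_ge0// ltW].
    by rewrite (le_trans hSN)// lerDl.
  rewrite /de le_eqVlt; apply/orP; left; apply/eqP; field.
  by rewrite !gt_eqF// ltr_wpDl.
have E2 : G * (2 * B) * (\sum_(b < N | (K <= b)%N) w b * Y b) <= e / 4.
  apply: (@le_trans _ _ (G * (2 * (B + 1)) * (e / (8 * G * (B + 1))))).
    apply: ler_pM => //; first by apply: mulr_ge0; [exact: ltW|rewrite mulr_ge0].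
      by apply: sumr_ge0 => b _; exact: wY0.
    by rewrite ler_wpM2l ?(ltW G0)// ler_wpM2l// lerDl.
  rewrite le_eqVlt; apply/orP; left; apply/eqP; field.
  by rewrite !gt_eqF// ltr_wpDl.
lra.
Qed.

End Density.
End Pairing.

(** * Non-unique data near every Fejer mean *)

Section NearData.
Context {R : realType} {d : nat}.
Local Notation mode := 'rV[int]_d.
Local Notation C := R[i].
Variable chi : 'rV[R]_d -> R.
Hypothesis hchi : lp_bump chi.
Variables (theta : R) (q r : \bar R).
Hypotheses (d2 : (2 <= d)%N) (theta0 : 0 < theta) (q1 : (1 <= q)%E) (r1 : (1 <= r)%E).
Variable f : @Defs.vdist R d.
Hypotheses (hf : forall i, is_dist (f i)) (divf : div f = cst 0) (f0 : forall i, fcoef (f i) 0 = 0).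

Section Seed.
Variables (m : mode) (i1 : 'I_d).

(** A shear wave that is switched on smoothly after time 0. *)
Definition pulse (a : mode) (i : 'I_d) (t : R) : C :=
  if (i == i1) && ((a == m) || (a == - m)) then (flatk 0 t)%:C%C else 0.

Definition seed n (a : mode) i (t : R) : C := fejer_coef f n i a + pulse a i t.

Lemma seed_admissible n : m != 0 -> m ord0 i1 = 0 -> admissible (d * n + nrm m) (seed n).
Proof.
move=> m0 mi1; split.
- move=> a i t an; rewrite /seed /fejer_coef fejd_out ?real_mul0l ?add0r.
    rewrite /pulse; case: ifP => // /andP[_ /orP[]/eqP ea]; move: an;
    by rewrite ea ?nrmN ltnNge leq_addl.
  by apply: contraL an => /box_nrm an; rewrite -leqNgt (leq_trans an)// leq_addr.
- move=> i t; rewrite /seed /fejer_coef f0 /real_mul mulr0 add0r /pulse.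
  by rewrite ![0 == _]eq_sym oppr_eq0 orbb (negbTE m0) andbF.
- move=> a i t; rewrite /seed fejer_coef_herm// rmorphD; congr (_ + _).
  rewrite /pulse eqr_oppLR eqr_opp orbC; case: ifP => _; last by rewrite rmorph0.
  by rewrite -[RHS]/(conjc _) conjc_real.
- move=> a t; rewrite /seed; under eq_bigr do rewrite mulrDr.
  rewrite big_split/= [X in X + _](_ : _ = 0) ?add0r.
    rewrite big1// => i _; rewrite /pulse; case: ifP => [/andP[/eqP-> /orP[]/eqP->]|_]; rewrite ?mulr0//.
      by rewrite /zc mi1 mul0r.
    by rewrite /zc mxE mi1 oppr0 mul0r.
  rewrite /fejer_coef /real_mul; under eq_bigr => i _ do rewrite mulrCA.
  by rewrite -mulr_sumr div_fcoef// mulr0.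
- move=> a i; apply: ctfD; first exact: ctf_cst.
  case E : ((i == i1) && ((a == m) || (a == - m))); last first.
    by rewrite (_ : pulse a i = fun=> 0); [exact: ctf_cst|apply: funext => t; rewrite /pulse E].
  rewrite (_ : pulse a i = fun t => (flatk 0 t)%:C%C); last by apply: funext => t; rewrite /pulse E.
  by split; [exact: tfun_flat|exact: tfun_cst].
Qed.

End Seed.

(** Below the radius of the seed the datum of the flow is the Fejer mean, since the
   pulse vanishes at time 0; above it, it is small in the weighted l^1 space. *)
Lemma nonunique_near n (de : R) : 0 < de -> exists2 g, nonunique_data chi (- theta) q r g &
  (besov_norm chi (- theta) q r (g - fejer f n)%R <= de%:E)%E.
Proof.
move=> de0; pose i0 : 'I_d := Ordinal (leq_trans (isT : 0 < 2) d2)%N; pose i1 : 'I_d := Ordinal d2.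
pose m : mode := delta_mx ord0 i0.
have mi1 : m ord0 i1 = 0 by rewrite mxE.
have m0 : m != 0 by apply/eqP => /rowP/(_ i0); rewrite !mxE eqxx.
have [B B0 hB] := besov_norm_l1 hchi.
pose Q : R := B * (1 + d%:R) `^ theta.
have Q0 : 0 < Q by rewrite mulr_gt0// powR_gt0// ltr_wpDr.
have e0 : 0 < de / Q by exact: divr_gt0.
have [c [M [hfl hc]]] := flow_exists d2 theta0 e0 (seed_admissible n m0 mi1).
set rho := (d * n + nrm m)%N in hfl hc.
exists (flow_u c 0).
  apply: (flow_nonunique hfl theta0 hchi q1 r1 (m := m) (i := i1)).
  rewrite hc; last exact: leq_addl.
  rewrite /seed (inj_eq (addrI _)) /pulse !eqxx/= eq_complex/= eqxx andbT.
  by rewrite {2}/flatk lexx flat1_neq0.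
pose M' a : R := if (rho < nrm a)%N then M a else 0.
have M'0 a : 0 <= M' a by rewrite /M'; case: ifP => // _; exact: fl_M0 hfl a.
rewrite (_ : de = Q * (de / Q)); last by field; rewrite gt_eqF.
apply: (hB theta q r _ M' (de / Q) (ltW theta0) q1 r1 M'0) => [i a|K].
  rewrite -[(flow_u c 0 - fejer f n) i]/(flow_u c 0 i - fejer f n i) fcoefB fcoef_fejer//.
  have z01 : -1 <= (0 : R) <= 1 by rewrite oppr_le0 ler01.
  rewrite (flow_coef hfl)// /M'; case: ltnP => ha.
    rewrite /fejer_coef fejd_out ?real_mul0l ?subr0 ?(fl_M hfl)//.
    by apply: contraL ha => /box_nrm an; rewrite -leqNgt (leq_trans an)// leq_addr.
  rewrite hc// /seed addrAC subrr add0r /pulse; case: ifP => _; last by rewrite cab0.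
  by rewrite /flatk lexx cab0.
rewrite (le_trans _ (fl_sum hfl K))// [leRHS]big_mkcond/=; apply: ler_sum => a _.
by rewrite /M'; case: ifP => _//; rewrite mulr0.
Qed.

End NearData.

Theorem theorem1p1 (R : realType) (d : nat) (chi : 'rV[R]_d -> R)
    (theta : R) (q r : \bar R) :
  (2 <= d)%N -> 0 < theta -> (1 <= q)%E -> (1 <= r)%E -> lp_bump chi ->
  ((r < +oo)%E ->
     besov_dense chi (- theta) q r (nonunique_data chi (- theta) q r)) /\
  (r = +oo%E ->
     besov_weakstar_dense chi (- theta) q (nonunique_data chi (- theta) q r)).
Proof.
move=> d2 theta0 q1 r1 hchi; split.
  case: r r1 => [r'|//|//] r1 _ f [[hf fin] [divf f0]] e e0.
  have [n [n0 [de de0 hn]]] := besov_near hchi q1 r1 hf fin e0.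
  have [g ng hg] := nonunique_near hchi d2 theta0 q1 r1 hf divf f0 n de0.
  by exists g => //; exact: hn.
move=> roo f [[hf fin] [divf f0]] p h hh e e0; rewrite roo.
rewrite opprK in hh.
have [n [n0 [de de0 hn]]] := besov_near_weakstar hchi theta0 q1 hf fin hh e0.
have [g ng hg] := nonunique_near hchi d2 theta0 q1 (leey 1) hf divf f0 n de0.
exists g => // j; apply: hn => //; exact: ng.1.1.1.
Qed.
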